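(* There exist Synchronous Strict PIP algorithms for parallel list contraction (of a list stored in random order), for parallel tree contraction (of a complete binary tree with randomly ordered leaves), and for computing a random permutation, where the span condition in the definition of Synchronous Strict PIP is understood to hold with high probability.
   Context: PRAM model: synchronous processors with a shared memory, each processor also having its own private memory, measured in words. The list and tree contraction algorithms are for the EREW PRAM (no two processors may read or write the same shared location concurrently), and the random permutation algorithm is for the priority-write CRCW PRAM (concurrent reads and writes are allowed and, among values written concurrently to one location, the largest is kept). Span is the maximum number of operations performed by a single processor. An event holds with high probability in $n$ if it holds with probability greater than $1-1/n^{k}$ for some constant $k\ge1$. Synchronous Strict PIP (parallel in-place): let $1\le p\le n$ be the number of processors available, where $n$ is the input size. A PRAM algorithm is Synchronous Strict PIP if it (1) allocates no shared memory aside from the input, (2) uses $\Theta(1)$ private memory per processor, (3) has $O((n/p)\,\mathrm{polylog}(n))$ span, and (4) uses at most $\Theta(1)$ additional space, i.e. is strictly in-place, when run sequentially. List contraction: the input is an array $L$ of $n$ nodes of a doubly linked list, each node $i$ having fields $L[i].\mathrm{prev}$ and $L[i].\mathrm{next}$ (indices of its predecessor and successor, or null). Splicing out node $i$ means setting $L[L[i].\mathrm{prev}].\mathrm{next}\leftarrow L[i].\mathrm{next}$ if $L[i].\mathrm{prev}\ne$ null, and $L[L[i].\mathrm{next}].\mathrm{prev}\leftarrow L[i].\mathrm{prev}$ if $L[i].\mathrm{next}\neq$ null. The task is to splice out all nodes, with effect equal to that of splicing them out one at a time in some order. ''Random order'' means that the assignment of list nodes to array positions is a uniformly random permutation. Tree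 contraction: the input is a rooted binary tree in which every internal node has exactly two children, stored with parent/child pointers, with $n$ leaves. Raking a leaf removes the leaf and its parent and makes the leaf's sibling take the parent's place as child of the grandparent (if any). The task is to contract the tree to a single node by rakes of leaves, with effect equal to that of performing them one at a time in some order. ''Randomly ordered leaves'' means that the leaves are stored in uniformly random order. Random permutation: given an array of $n$ values, rearrange it in place into a uniformly random permutation of its entries. A processor may draw a uniformly random integer in a given range $\{0,\dots,i\}$ in constant time. *)

(* Defs.v *)
From HB Require Import structures.
From mathcomp Require Import all_boot all_order all_fingroup all_algebra.

Set Implicit Arguments.
Unset Strict Implicit.
Unset Printing Implicit Defensive.

(** * The PRAM *)

Definition memory := nat -> nat.

Definition upd (M : memory) (a v : nat) : memory :=
  fun b => if b == a then v else M b.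

Definition eq_upto (N : nat) (M M' : memory) : Prop :=
  forall a, a < N -> M a = M' a.

(* [Sub] is truncated; [Div] and [Mod] by 0 return 0 and the dividend. *)
Inductive binop := Add | Sub | Mul | Div | Mod.

Definition eval_binop (o : binop) (x y : nat) : nat :=
  match o with
  | Add => x + y | Sub => x - y | Mul => x * y | Div => x %/ y | Mod => x %% y
  end.

(* [r], [s], [t] are cells of the private memory of the executing processor,
   [l] is a position in the program.  [Read]/[Write] address the shared memory
   through a private cell, [PRead]/[PWrite] do the same in private memory. *)
Inductive instr :=
  | Const  (r v : nat)                (* r <- v *)
  | Op     (o : binop) (r s t : nat)  (* r <- s o t *)
  | JumpEq (s t l : nat)              (* if s = t then goto l *)
  | JumpLt (s t l : nat)              (* if s < t then goto l *)
  | PRead  (r s : nat)                (* r <- private[s] *)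
  | PWrite (s r : nat)                (* private[s] <- r *)
  | Read   (r s : nat)                (* r <- shared[s] *)
  | Write  (s r : nat)                (* shared[s] <- r *)
  | Draw   (r s : nat).               (* r <- uniform in {0, ..., s} *)

Definition is_draw (i : instr) : bool := if i is Draw _ _ then true else false.

(* One finite program, run by every processor, for all values of n and p. *)
Definition program := seq instr.

Definition deterministic (P : program) : bool := ~~ has is_draw P.

(* [nops] only counts the executed operations; no instruction can read it. *)
Record proc := Proc { pc : nat; priv : memory; nops : nat }.

Record config (p : nat) := Config { procs : 'I_p -> proc; shared : memory }.

Section Semantics.
Variables (P : program) (p : nat).
Implicit Types (c : config p) (q : 'I_p).

(* [None] means that the processor has halted. *)
Definition current c q : option instr := onth P (pc (procs c q)).

Definition finished c : bool := [forall q, ~~ current c q].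

Definition draw_bound c q : nat :=
  if current c q is Some (Draw _ s) then priv (procs c q) s else 0.

(* The joint outcomes of the draws of one step.  A processor that does not draw
   has exactly one outcome, so the uniform distribution on this type makes the
   draws of distinct processors independent and uniform. *)
Definition draws c := {dffun forall q : 'I_p, 'I_(draw_bound c q).+1}.

Definition exec_instr (i : instr) (M : memory) (v : nat) (s : proc) : proc :=
  let R := priv s in
  let set r x := Proc (pc s).+1 (upd R r x) (nops s).+1 in
  let goto l := Proc l R (nops s).+1 in
  match i with
  | Const r x => set r x
  | Op o r a b => set r (eval_binop o (R a) (R b))
  | JumpEq a b l => goto (if R a == R b then l else (pc s).+1)
  | JumpLt a b l => goto (if R a < R b then l else (pc s).+1)
  | PRead r a => set r (R (R a))
  | PWrite a r => set (R a) (R r)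
  | Read r a => set r (M (R a))
  | Write _ _ => goto (pc s).+1
  | Draw r _ => set r v
  end.

(* The values written to the shared address [a] during the next step. *)
Definition writes c (a : nat) : seq nat :=
  pmap (fun q => if current c q is Some (Write s r) then
                   let R := priv (procs c q) in
                   if R s == a then Some (R r) else None
                 else None) (enum 'I_p).

(* Reads see the shared memory before the step.  Concurrent writes are resolved
   by priority: the largest value is kept.  This rule is never used in a run
   satisfying [exclusive] below. *)
Definition step c (d : draws c) : config p :=
  Config
    (fun q => if current c q is Some i
              then exec_instr i (shared c) (d q) (procs c q) else procs c q)
    (fun a => if writes c a is [::] then shared c a
              else \max_(v <- writes c a) v).

(* The program starts with the index of the processor, the number of processors
   and the input size in its private cells 0, 1 and 2. *)
Definition init (n : nat) (M : memory) : config p :=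
  Config (fun q => Proc 0 (nth 0 [:: val q; p; n]) 0) M.

Definition execution (c0 : config p) (cs : nat -> config p) : Prop :=
  cs 0 = c0 /\ forall t, exists d : draws (cs t), cs t.+1 = step d.

Definition halts_by (c0 : config p) (T : nat) : Prop :=
  forall cs, execution c0 cs -> finished (cs T).

Definition shared_access c q : option nat :=
  match current c q with
  | Some (Read _ s) | Some (Write s _) => Some (priv (procs c q) s)
  | _ => None
  end.

Definition private_access c q : seq nat :=
  let R := priv (procs c q) in
  match current c q with
  | Some (Const r _) => [:: r]
  | Some (Op _ r s t) => [:: r; s; t]
  | Some (JumpEq s t _) | Some (JumpLt s t _) => [:: s; t]
  | Some (PRead r s) => [:: r; s; R s]
  | Some (PWrite s r) => [:: s; r; R s]
  | Some (Read r s) | Some (Write r s) | Some (Draw r s) => [:: r; s]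
  | None => [::]
  end.

(* EREW: no two processors access the same shared location in the same step. *)
Definition exclusive c : Prop :=
  forall q q' a,
    q != q' -> shared_access c q = Some a -> shared_access c q' <> Some a.

Definition shared_space_within c (N : nat) : Prop :=
  forall q a, shared_access c q = Some a -> a < N.

Definition private_space_within c (K : nat) : Prop :=
  forall q a, a \in private_access c q -> a < K.

Definition words_below c (w : nat) : Prop :=
  (forall q r, priv (procs c q) r < w) /\ (forall a, shared c a < w).

Definition span c : nat := \max_(q < p) nops (procs c q).

(* Probability that [E] holds after [T] steps from [c]. *)
Fixpoint prob (T : nat) (c : config p) (E : config p -> bool) : rat :=
  if T is T'.+1 then
    ((\sum_(d : draws c) prob T' (step d) E) / #|{: draws c}|%:R)%R
  else ((E c)%:R)%R.

End Semantics.

(** * Synchronous Strict PIP *)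

(* For each size n: [arbitrary n] is the part of the input on which the
   guarantee is worst-case, and [random n] the part which is uniformly random.
   The input occupies the shared addresses 0, ..., cells n - 1. *)
Record input_model := InputModel {
  arbitrary : nat -> Type;
  random : nat -> finType;
  cells : nat -> nat;
  input : forall n, arbitrary n -> random n -> memory
}.

Section PIP.
Variables (I : input_model) (P : program).

Definition start n p (x : arbitrary I n) (r : random I n) : config p :=
  init p n (input x r).

(* [Q n p c] holds of all configurations [c] in all executions on p processors
   from inputs of size n. *)
Definition always (Q : forall n p : nat, config p -> Prop) : Prop :=
  forall n p, 0 < p <= n ->
  forall (x : arbitrary I n) (r : random I n) (cs : nat -> config p),
  execution P (start p x r) cs -> forall t, Q n p (cs t).

Definition erew : Prop := always (fun _ _ c => exclusive P c).

Definition no_extra_shared : Prop :=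
  always (fun n _ c => shared_space_within P c (cells I n)).

Definition constant_private : Prop :=
  exists K, always (fun _ _ c => private_space_within P c K).

(* Words have O(log n) bits: once the word range w is at least a fixed
   polynomial in n and contains the input, no cell ever leaves this range. *)
Definition logarithmic_words : Prop :=
  exists e, forall n p w, 0 < p <= n -> n.+2 ^ e <= w ->
  forall (x : arbitrary I n) (r : random I n) (cs : nat -> config p),
  (forall a, input x r a < w) -> execution P (start p x r) cs ->
  forall t, words_below (cs t) w.

Definition sequentially_in_place : Prop :=
  exists K, always (fun n p c => p = 1 ->
    shared_space_within P c (cells I n + K) /\ private_space_within P c K).

(* Probability over the random part of the input and over the draws. *)
Definition prob_input n p (x : arbitrary I n) (T : nat)
    (E : config p -> bool) : rat :=
  ((\sum_(r : random I n) prob P T (start p x r) E) / #|random I n|%:R)%R.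

(* All executions halt, and the span is O((n/p) polylog n) with probability
   greater than 1 - 1/n^k for some constant k >= 1. *)
Definition span_whp : Prop :=
  exists k C e n0 : nat, 0 < k /\
  forall n p, 0 < p <= n -> forall x : arbitrary I n,
  exists T, (forall r : random I n, halts_by P (start p x r) T) /\
    (n0 <= n ->
     (1 - (n%:R ^+ k)^-1 <
      prob_input x T (fun c : config p =>
        span c * p <= C * n * trunc_log 2 n ^ e)%N :> rat)%R).

Definition sync_strict_pip_whp : Prop :=
  [/\ no_extra_shared, constant_private /\ logarithmic_words, span_whp
    & sequentially_in_place].

End PIP.

(** * Contraction by rounds *)

(* [hist] is the history of the shared memory.  Comparing only its final value
   with a sequential result would make contraction void: splicing a list from
   head to tail amounts to setting all prev fields to null.  So the operations
   have to be carried out along the computation.  Those performed between two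
   successive checkpoints are mutually independent: executing them one at a
   time in any order, from the memory at the first checkpoint, gives the memory
   at the second one. *)
Fixpoint in_rounds (op : nat -> memory -> memory) (N : nat)
    (hist : nat -> memory) (t : nat) (rounds : seq (nat * seq nat)) : Prop :=
  match rounds with
  | [::] => forall u, t <= u -> eq_upto N (hist u) (hist t)
  | (u, batch) :: rounds' =>
      [/\ t <= u,
          forall s, perm_eq s batch ->
            eq_upto N (hist u) (foldl (fun M i => op i M) (hist t) s)
        & in_rounds op N hist u rounds']
  end.

Definition batches (rounds : seq (nat * seq nat)) : seq nat :=
  flatten (unzip2 rounds).

(** * List contraction *)

(* The nodes are 0, ..., n-1 and null is n. *)
Definition prev_ (i : nat) := i.*2.
Definition next_ (i : nat) := i.*2.+1.

(* The k-th node of the list, from the head, is at position [pi k]. *)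
Definition list_order n (pi : {perm 'I_n}) : seq nat :=
  [seq val (pi k) | k <- enum 'I_n].

(* Both [nth] default to null: past the tail, and in front of the head. *)
Definition list_memory n (pi : {perm 'I_n}) : memory := fun a =>
  let s := list_order pi in
  let k := index a./2 s in
  if a < n.*2 then (if odd a then nth n s k.+1 else nth n (n :: s) k) else 0.

Definition random_list : input_model :=
  @InputModel (fun _ => unit) (fun n => {perm 'I_n}) (fun n => n.*2)
    (fun n _ pi => list_memory pi).

Definition splice (n i : nat) (L : memory) : memory :=
  let a := L (prev_ i) in
  let b := L (next_ i) in
  let L1 := if a != n then upd L (next_ a) b else L in
  if b != n then upd L1 (prev_ b) a else L1.

Definition contracts_lists (P : program) : Prop :=
  forall n p, 0 < p <= n -> forall (pi : {perm 'I_n}) cs,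
  execution P (start (I := random_list) p tt pi) cs ->
  exists rounds,
    perm_eq (batches rounds) (iota 0 n) /\
    in_rounds (splice n) n.*2 (fun t => shared (cs t)) 0 rounds.

(** * Tree contraction *)

Inductive btree := Leaf (i : nat) | Node (x : nat) (l r : btree).

Fixpoint leaves (t : btree) : seq nat :=
  match t with Leaf i => [:: i] | Node _ l r => leaves l ++ leaves r end.

Fixpoint internals (t : btree) : seq nat :=
  match t with
  | Leaf _ => [::] | Node x l r => x :: internals l ++ internals r
  end.

Definition root_of (t : btree) : nat :=
  match t with Leaf i => i | Node x _ _ => x end.

(* The leaves are stored at positions 0, ..., n-1 and the internal nodes at
   positions n, ..., 2n-2; null is 2n-1. *)
Definition stored_tree (n : nat) :=
  {t : btree | perm_eq (leaves t) (iota 0 n)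
             & perm_eq (internals t) (iota n n.-1)}.

Definition tnull (n : nat) := n.*2.-1.

Definition parent_ (i : nat) := 3 * i.
Definition left_ (i : nat) := 3 * i + 1.
Definition right_ (i : nat) := 3 * i + 2.

Fixpoint relabel_leaves (f : nat -> nat) (t : btree) : btree :=
  match t with
  | Leaf i => Leaf (f i)
  | Node x l r => Node x (relabel_leaves f l) (relabel_leaves f r)
  end.

Definition perm_nat n (pi : {perm 'I_n}) (i : nat) : nat :=
  if insub i is Some j then val (pi j) else i.

Fixpoint links (null par : nat) (t : btree) (M : memory) : memory :=
  match t with
  | Leaf i => upd (upd (upd M (parent_ i) par) (left_ i) null) (right_ i) null
  | Node x l r =>
      links null x r (links null x l
        (upd (upd (upd M (parent_ x) par)
           (left_ x) (root_of l)) (right_ x) (root_of r)))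
  end.

Definition tree_memory n (t : stored_tree n) (pi : {perm 'I_n}) : memory :=
  links (tnull n) (tnull n) (relabel_leaves (perm_nat pi) (s2val t))
    (fun _ => 0).

Definition random_leaves : input_model :=
  @InputModel stored_tree (fun n => {perm 'I_n}) (fun n => 3 * n.*2.-1)
    tree_memory.

(* As for [splice], the fields of the removed nodes are left unchanged. *)
Definition rake (n l : nat) (M : memory) : memory :=
  let x := M (parent_ l) in
  let g := M (parent_ x) in
  let s := if M (left_ x) == l then M (right_ x) else M (left_ x) in
  let M1 := upd M (parent_ s) g in
  if x == tnull n then M
  else if g == tnull n then M1
  else if M (left_ g) == x then upd M1 (left_ g) s else upd M1 (right_ g) s.

(* Each rake removes one leaf, and the leaves of the remaining tree are always
   original leaves: a single node remains after raking n-1 distinct leaves. *)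
Definition contracts_trees (P : program) : Prop :=
  forall n p, 0 < p <= n -> forall (t : stored_tree n) (pi : {perm 'I_n}) cs,
  execution P (start (I := random_leaves) p t pi) cs ->
  exists rounds,
    [/\ uniq (batches rounds), all (fun l => l < n) (batches rounds),
        size (batches rounds) = n.-1
      & in_rounds (rake n) (3 * n.*2.-1) (fun u => shared (cs u)) 0 rounds].

(** * Random permutation *)

Definition array_memory n (A : 'I_n -> nat) : memory := fun a =>
  if insub a is Some i then A i else 0.

Definition arrays : input_model :=
  @InputModel (fun n => 'I_n -> nat) (fun _ => unit) id
    (fun n A _ => array_memory A).

(* The final array is distributed as [A \o sigma], for sigma uniform. *)
Definition permutes_uniformly (P : program) : Prop :=
  forall n p, 0 < p <= n -> forall A : 'I_n -> nat,
  exists T, halts_by P (start (I := arrays) p A tt) T /\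
  forall B : 'I_n -> nat,
    (prob P T (start (I := arrays) p A tt)
       (fun c => [forall i : 'I_n, shared c i == B i]) =
     #|[set sigma : {perm 'I_n} | [forall i, A (sigma i) == B i]]|%:R
       / (n`!)%:R :> rat)%R.

(* Main.v *)
(* The input is processed by chunks of p elements, one per processor, each in
   polylogarithmic time in the worst case, so that the span bounds even hold with
   probability 1.  No memory is allocated: the cells of the elements of a chunk
   whose content is dead, or can be kept in private memory, serve as scratch.

   Lists.  For a bit k and a value b, the nodes of the chunk whose index has k-th
   bit b and whose successor has another k-th bit are pairwise non-adjacent and
   are spliced out at once.  A node surviving all (k, b) had its initial successor
   spliced out, so every such pass removes half of the remaining nodes.

   Trees.  Rakes conflict only if they share a parent or a grandparent, or if the
   parent of one is the grandparent of the other.  One leaf is elected per parent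
   and then one per grandparent, and the last conflict is broken by the bits of
   the indices as for lists.  The elections are a radix sort in the null child
   fields of the leaves of the chunk.  A surviving leaf is close to a raked one,
   so every pass removes a constant fraction of the remaining leaves.

   Random permutation.  In the Fisher-Yates shuffle, which swaps i and a uniform
   H i <= i for i = 0, ..., n - 1, a chunk of swaps has a closed form: step x brings
   to x the value of the last previous y with H y = H x if there is one, the value
   of H x if H x is x or lies before the chunk, and otherwise what step H x has
   brought to H x.  The previous y is found by grouping equal targets with
   the same radix sort, and the recursion is resolved by pointer jumping. *)

Require Import Defs.
From mathcomp Require Import all_boot all_order all_fingroup all_algebra.
From mathcomp Require Import zify ring.
From Stdlib Require Import FunctionalExtensionality.

Set Implicit Arguments.
Unset Strict Implicit.
Unset Printing Implicit Defensive.

(** * Runs of the machine *)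

(** The requirements concern every configuration of every execution, while the algorithms are
    understood round by round. The bridge is a structured language in which all processors share one
    program counter; its big-step semantics fixes time and memory, and a log of marks, which costs
    no instruction, supplies the checkpoints of the contraction rounds.

    Word sizes cannot be read off such a run without an invariant for each register. They are
    controlled by a syntactic typing with exponents of [n + 2] instead, checked by computation. A
    register that grows in a loop has no type unless it is capped, so many minima in the programs
    are caps that never take effect.

    Concurrent access shapes the algorithms: whenever several processors could want one cell, a
    leader is found by sorting (source, key) words in cells that the chunk owns. In trees a rake
    accounts for at most five other leaves, whence a factor 5/6 per pass and [4 L] passes. For the
    permutation the probability is carried backwards as an expectation over the swaps still to come,
    and a chunk preserves it. *)

Section Machine.
Variables (P : program) (p : nat).
Implicit Types (c : config p) (q : 'I_p) (cs : nat -> config p).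

Definition nodraw c : Prop :=
  forall q, if current P c q is Some i then ~~ is_draw i else true.

(** On a configuration without draws every joint outcome leads to this successor, so an execution is
    forced there; the value 0 of the draws is arbitrary. *)
Definition dstep c : config p :=
  step (P := P) (c := c) [ffun q => ord0].

Lemma step_nodraw c (d : draws P c) : nodraw c -> step d = dstep c.
Proof.
move=> nd; rewrite /dstep /step; congr Config.
apply: functional_extensionality => q.
by move: (nd q); case: (current P c q) => // -[].
Qed.

Lemma step_finished c (d : draws P c) : finished P c -> step d = c.
Proof.
move=> /forallP fin.
have cur q : current P c q = None by case: (current P c q) (fin q).
case: c d fin cur => pr sh d _ cur; rewrite /step; congr Config.
  by apply: functional_extensionality => q; rewrite cur.
apply: functional_extensionality => a.
by rewrite /writes (eq_pmap (f2 := fun=> None)) => [|q]; [elim: (enum _) | rewrite cur].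
Qed.

Lemma execution_shift c cs t :
  execution P c cs -> execution P (cs t) (fun u => cs (t + u)).
Proof.
by move=> [_ st]; split=> [|u]; rewrite ?addn0 // addnS; exact: st.
Qed.

Lemma execution_finished c cs t u :
  execution P c cs -> finished P (cs t) -> t <= u -> cs u = cs t.
Proof.
move=> [_ st] fin /subnK <-; elim: (u - t) => [//|k IH].
by rewrite addSn; have [d ->] := st (k + t); move: d; rewrite IH => d; rewrite step_finished.
Qed.

Lemma card_draws_gt0 c : 0 < #|{: draws P c}|.
Proof. by apply/card_gt0P; exists [ffun q => ord0]. Qed.

Lemma execution_exists c : exists cs, execution P c cs.
Proof.
by exists (fun t => iter t dstep c); split=> // t; exists [ffun q => ord0].
Qed.

(* [G] holds throughout all executions from [c], which halt within [T] steps
   and satisfy [E] in the end with probability [v]. *)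
Inductive out (G : config p -> Prop) (E : config p -> bool) :
    nat -> config p -> rat -> Prop :=
  | out_fin T c : finished P c -> G c -> out G E T c (E c)%:R%R
  | out_draw T c (f : draws P c -> rat) :
      G c -> (forall d, out G E T (step d) (f d)) ->
      out G E T.+1 c ((\sum_d f d) / #|{: draws P c}|%:R)%R.

Lemma sum_const_draws c (v : rat) :
  ((\sum_(d : draws P c) v) / #|{: draws P c}|%:R)%R = v.
Proof.
rewrite GRing.sumr_const -[(v *+ _)%R]GRing.mulr_natr GRing.mulfK // Num.Theory.pnatr_eq0.
by rewrite -lt0n card_draws_gt0.
Qed.

Lemma out_det G E T c v :
  G c -> nodraw c -> out G E T (dstep c) v -> out G E T.+1 c v.
Proof.
move=> Gc nd o; rewrite -[v](sum_const_draws c).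
by apply: (out_draw (f := fun=> v)) => // d; rewrite step_nodraw.
Qed.

Lemma out_iter G E T k c v :
  (forall u, u < k -> G (iter u dstep c) /\ nodraw (iter u dstep c)) ->
  out G E T (iter k dstep c) v -> out G E (k + T) c v.
Proof.
elim: k c => [//|k IH] c good o; have [Gc nd] := good 0 isT.
apply: out_det => //; apply: IH => [u uk|]; last by rewrite -iterSr.
by rewrite -iterSr; exact: good.
Qed.

(** Running past the bound is harmless: a halted configuration is a fixed point of every step, and
    averaging a constant over the draws returns it. *)
Lemma out_prob G E T c v T' : out G E T c v -> T <= T' -> prob P T' c E = v.
Proof.
move=> o; elim: o T' => {T c v} [T c fin _ T' _|T c f _ _ IH [//|T'] le] /=.
  elim: T' => [//|T' IH] /=; rewrite -[RHS](sum_const_draws c).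
  by congr (_ / _)%R; apply: eq_bigr => d _; rewrite step_finished.
by congr (_ / _)%R; apply: eq_bigr => d _; exact: IH.
Qed.

Lemma out_good G E T c v cs t : out G E T c v -> execution P c cs -> G (cs t).
Proof.
move=> o; elim: o cs t => {T c v} [T c fin Gc cs t ex|T c f Gc _ IH cs [|t] ex].
- by rewrite (execution_finished (t := 0) ex) //; case: ex => ->.
- by case: ex => ->.
- have ex1 := execution_shift 1 ex.
  case: ex => c0 /(_ 0) [d] ; rewrite c0 in d * => cd.
  by apply: (IH d (fun u => cs (1 + u))); rewrite -cd.
Qed.

Lemma out_halts G E T c v : out G E T c v -> halts_by P c T.
Proof.
move=> o; elim: o => {T c v} [T c fin _ cs ex|T c f _ _ IH cs ex].
  by rewrite (execution_finished (t := 0) ex) //; case: ex => ->.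
have ex1 := execution_shift 1 ex.
case: ex => c0 /(_ 0) [d]; rewrite c0 in d * => cd.
by apply: (IH d (fun u => cs (1 + u))); rewrite -cd.
Qed.

(** Used for the span, which is bounded in every execution, so that its probability needs no
    computation. *)
Lemma prob_always (E : config p -> bool) T c :
  (forall cs, execution P c cs -> E (cs T)) -> prob P T c E = 1%R.
Proof.
elim: T c => [|T IH] c H /=.
  by have [cs ex] := execution_exists c; have := H cs ex; case: (ex) => -> _ ->.
rewrite -[RHS](sum_const_draws c); congr (_ / _)%R; apply: eq_bigr => d _.
apply: IH => cs [cs0 st].
apply: (H (fun t => if t is u.+1 then cs u else c)); split=> // -[|t]; last exact: st.
by exists d; rewrite cs0.
Qed.

End Machine.

(** * A structured lockstep language *)

(* [LMin] goes through the private cell [tmp], since min x y = x - (x - y). *)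
Definition tmp := 6.

Inductive linstr :=
  | LConst (r v : nat) | LOp (o : binop) (r s t : nat) | LMin (r s t : nat).

(* Two registers [g], [h] in front of an instruction guard it by [g < h];
   [Mark r f] takes no time and logs the time, the memory and the values of [r]
   on the processors for which [f] is positive. *)
Inductive cmd :=
  | Loc (s : seq linstr)
  | Rd (g h r s : nat)
  | Wr (g h s r : nat)
  | Seq (c1 c2 : cmd)
  | While (s t : nat) (c : cmd)
  | Mark (r f : nat).

(** An idle step: cell 0 compared with itself always jumps, here to the next position. *)
Definition nop (l : nat) := JumpEq 0 0 l.+1.

Definition comp_local (i : linstr) : seq instr :=
  match i with
  | LConst r v => [:: Const r v]
  | LOp o r s t => [:: Op o r s t]
  | LMin r s t => [:: Op Defs.Sub tmp s t; Op Defs.Sub r s tmp]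
  end.

(* The branches of a guard are padded to the same length, so that all
   processors leave it at the same time. *)
Definition guarded (l g h : nat) (i : instr) : seq instr :=
  [:: JumpLt g h (l + 3); nop l.+1; JumpEq 0 0 (l + 5); i; nop (l + 4)].

(** Jump targets are absolute, so the compilation carries the position [l] of the code. A loop is
    laid out as test, exit jump, body, back jump. *)
Fixpoint compile (l : nat) (c : cmd) : seq instr :=
  match c with
  | Loc s => flatten (map comp_local s)
  | Rd g h r s => guarded l g h (Read r s)
  | Wr g h s r => guarded l g h (Write s r)
  | Seq c1 c2 => let s1 := compile l c1 in s1 ++ compile (l + size s1) c2
  | While s t c =>
      let b := compile (l + 2) c in
      [:: JumpLt s t (l + 2); JumpEq 0 0 (l + size b + 3)] ++ b ++ [:: JumpEq 0 0 l]
  | Mark _ _ => [::]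
  end.

Definition local1 (i : linstr) (R : memory) : memory :=
  match i with
  | LConst r v => upd R r v
  | LOp o r s t => upd R r (eval_binop o (R s) (R t))
  | LMin r s t => upd (upd R tmp (R s - R t)) r (minn (R s) (R t))
  end.

Fixpoint locals (s : seq linstr) (R : memory) : memory :=
  if s is i :: s' then locals s' (local1 i R) else R.

(* Symbolic execution of local code; [sym] computes on closed code. *)
Inductive expr := EReg (r : nat) | ECst (v : nat) | EOp (o : binop) (d e : expr) | EMin (d e : expr).

Fixpoint den (e : expr) (R : memory) : nat :=
  match e with
  | EReg r => R r
  | ECst v => v
  | EOp o d e => eval_binop o (den d R) (den e R)
  | EMin d e => minn (den d R) (den e R)
  end.

Definition eupd (E : nat -> expr) (r : nat) (e : expr) : nat -> expr :=
  fun r' => if Nat.eqb r' r then e else E r'.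

Definition sym1 (i : linstr) (E : nat -> expr) : nat -> expr :=
  match i with
  | LConst r v => eupd E r (ECst v)
  | LOp o r s t => eupd E r (EOp o (E s) (E t))
  | LMin r s t => eupd (eupd E tmp (EOp Defs.Sub (E s) (E t))) r (EMin (E s) (E t))
  end.

Fixpoint sym_env (s : seq linstr) (E : nat -> expr) : nat -> expr :=
  if s is i :: s' then sym_env s' (sym1 i E) else E.

Definition sym (s : seq linstr) (r : nat) : expr := sym_env s EReg r.

Lemma symE s R r : locals s R r = den (sym s r) R.
Proof.
rewrite /sym; have : forall r, R r = den (EReg r) R by [].
move: {1 3}R EReg; elim: s R => [|i s IH] R R' E H /=; first exact: H.
have updE S F r1 e x : (forall r, S r = den (F r) R) -> x = den e R ->
    forall r', upd S r1 x r' = den (eupd F r1 e r') R.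
  move=> HS He r'; rewrite /upd /eupd; case: eqP => [->|/eqP/negbTE ne].
    by rewrite PeanoNat.Nat.eqb_refl.
  by case: (PeanoNat.Nat.eqb_spec r' r1) => // E'; rewrite E' eqxx in ne.
apply: IH => r'; case: i => [a v|o a b c|a b c] /=.
- exact: updE.
- by apply: (updE) => //=; rewrite !H.
- by apply: (updE) => /=; rewrite ?H // => r''; apply: (updE) => //=; rewrite !H.
Qed.

Definition cost_local (s : seq linstr) : nat := size (flatten (map comp_local s)).

(* [rg] gives the private memories, [tm] the time and [lg] the log. *)
Record state := St {
  rg : nat -> memory; mm : memory; tm : nat; lg : seq (nat * seq nat * memory) }.

Section Language.
Variables (p N : nat) (excl : bool).
Implicit Types (s : state).

Definition active s (g h q : nat) : bool := rg s q g < rg s q h.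

(** The flag [x] asks for exclusiveness. Writes are always checked with [x = true], so even the
    permutation program never has a write conflict; only its reads may collide. *)
Definition addresses_ok s (x : bool) (g h a : nat) : Prop :=
  (forall q, q < p -> active s g h q -> rg s q a < N) /\
  (x -> forall q q', q < p -> q' < p -> active s g h q -> active s g h q' ->
     rg s q a = rg s q' a -> q = q').

Definition read_regs s (g h r a q : nat) : memory :=
  if active s g h q then upd (rg s q) r (mm s (rg s q a)) else rg s q.

(** The default [p] of [find] stands for a cell that nobody writes. *)
Definition writer s (g h a b : nat) : nat :=
  find (fun q => active s g h q && (rg s q a == b)) (iota 0 p).

Definition write_mem s (g h a r : nat) : memory := fun b =>
  if writer s g h a b < p then rg s (writer s g h a b) r else mm s b.

Definition tick s k := St (rg s) (mm s) (tm s + k) (lg s).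

Definition marked s (r f : nat) : seq nat :=
  [seq rg s q r | q <- iota 0 p & 0 < rg s q f].

(** The times are those of the compiled code: 3 for a padded guard, 1 for a successful test and for
    the jump back, 2 for leaving a loop. A loop test must have the same outcome on all processors,
    which keeps their program counters equal. *)
Inductive ev : cmd -> state -> state -> Prop :=
  | ev_loc ls s :
      ev (Loc ls) s (St (fun q => locals ls (rg s q)) (mm s) (tm s + cost_local ls) (lg s))
  | ev_rd g h r a s : addresses_ok s excl g h a ->
      ev (Rd g h r a) s (St (read_regs s g h r a) (mm s) (tm s + 3) (lg s))
  | ev_wr g h a r s : addresses_ok s true g h a ->
      ev (Wr g h a r) s (St (rg s) (write_mem s g h a r) (tm s + 3) (lg s))
  | ev_seq c1 c2 s1 s2 s3 : ev c1 s1 s2 -> ev c2 s2 s3 -> ev (Seq c1 c2) s1 s3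
  | ev_while_true g h c s1 s2 s3 : (forall q, q < p -> active s1 g h q) ->
      ev c (tick s1 1) s2 -> ev (While g h c) (tick s2 1) s3 ->
      ev (While g h c) s1 s3
  | ev_while_false g h c s : (forall q, q < p -> ~~ active s g h q) ->
      ev (While g h c) s (tick s 2)
  | ev_mark r f s :
      ev (Mark r f) s
        (St (rg s) (mm s) (tm s) (rcons (lg s) (tm s, marked s r f, mm s))).

(** Total correctness: a derivation of [ev] is finite, so termination and the exact time are part of
    the claim. *)
Definition wp (c : cmd) (Q : state -> Prop) s : Prop := exists2 s', ev c s s' & Q s'.

(** ** Frame *)

Definition local_target (i : linstr) : seq nat :=
  match i with LConst r _ | LOp _ r _ _ => [:: r] | LMin r _ _ => [:: tmp; r] end.

Fixpoint mods (c : cmd) : seq nat :=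
  match c with
  | Loc ls => flatten (map local_target ls)
  | Rd _ _ r _ => [:: r]
  | Wr _ _ _ _ | Mark _ _ => [::]
  | Seq c1 c2 => mods c1 ++ mods c2
  | While _ _ c => mods c
  end.

Lemma upd_other M a v b : b != a -> upd M a v b = M b.
Proof. by rewrite /upd => /negbTE ->. Qed.

Lemma upd_same M a v : upd M a v a = v.
Proof. by rewrite /upd eqxx. Qed.

Lemma locals_frame ls R r :
  r \notin flatten (map local_target ls) -> locals ls R r = R r.
Proof.
elim: ls R => [//|i ls IH] R /=; rewrite mem_cat negb_or => /andP[ri ris].
rewrite IH //; case: i ri => [a v|o a b c|a b c] /=; rewrite !inE ?negb_or.
- by move=> ?; rewrite upd_other.
- by move=> ?; rewrite upd_other.
- by move=> /andP[? ?]; rewrite !upd_other.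
Qed.

Lemma ev_frame c s s' q r : ev c s s' -> r \notin mods c -> rg s' q r = rg s q r.
Proof.
elim=> {c s s'} //=.
- by move=> ls s; exact: locals_frame.
- by move=> g h r' a s _; rewrite inE /read_regs => rr; case: ifP => // _; rewrite upd_other.
- by move=> c1 c2 s1 s2 s3 _ IH1 _ IH2; rewrite mem_cat negb_or => /andP[/IH1 <- /IH2 ->].
- by move=> g h c s1 s2 s3 _ _ IH1 _ IH2 rc; rewrite IH2 // IH1.
Qed.

Fixpoint unmarked (c : cmd) : bool :=
  match c with
  | Mark _ _ => false
  | Seq c1 c2 => unmarked c1 && unmarked c2
  | While _ _ c => unmarked c
  | _ => true
  end.

Lemma ev_log c s s' : ev c s s' -> unmarked c -> lg s' = lg s.
Proof.
elim=> {c s s'} //=.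
- by move=> c1 c2 s1 s2 s3 _ IH1 _ IH2 /andP[/IH1 <- /IH2 ->].
- by move=> g h c s1 s2 s3 _ _ IH1 _ IH2 rc; rewrite IH2 // IH1.
Qed.

(** ** Word ranges *)

Section Words.
Variables (n w e0 : nat) (ty : nat -> option nat) (tym : option nat).
Hypothesis w_large : n.+2 ^ e0 <= w.

(* A cell of type [Some e] holds values below (n+2)^e, one of type [None]
   arbitrary words. *)
Definition range (t : option nat) : nat := if t is Some e then n.+2 ^ e else w.

Definition subty (t u : option nat) : bool :=
  match t, u with
  | Some a, Some b => a <= b
  | Some a, None => a <= e0
  | None, None => true
  | None, Some _ => false
  end.

(** The minimum may take its type from either operand, which is how a register increased in a loop
    gets one: it inherits the type of its cap. The condition [s != tmp] is needed since the compiled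
    code reads [s] again after writing [tmp]. *)
Definition wt_local (i : linstr) : bool :=
  match i with
  | LConst r v => if ty r is Some e then v < 2 ^ e else (v < 2) && (0 < e0)
  | LOp Add r s t =>
      match ty s, ty t, ty r with
      | Some a, Some b, Some c => maxn a b < c | _, _, _ => false end
  | LOp Mul r s t =>
      match ty s, ty t, ty r with
      | Some a, Some b, Some c => a + b <= c | _, _, _ => false end
  | LOp _ r s t => subty (ty s) (ty r)
  | LMin r s t => (s != tmp) && subty (ty s) (ty tmp) && (subty (ty s) (ty r) || subty (ty t) (ty r))
  end.

Fixpoint wt (c : cmd) : bool :=
  match c with
  | Loc ls => all wt_local ls
  | Rd _ _ r _ => subty tym (ty r)
  | Wr _ _ _ r => subty (ty r) tym
  | Seq c1 c2 => wt c1 && wt c2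
  | While _ _ c => wt c
  | Mark _ _ => true
  end.

Definition bounded_regs (R : memory) : Prop := forall r, R r < range (ty r).

Definition bounded s : Prop :=
  (forall q, q < p -> bounded_regs (rg s q)) /\ forall a, mm s a < range tym.

Lemma range_subty t u : subty t u -> range t <= range u.
Proof.
case: t u => [a|] [b|] //= h; first exact: leq_pexp2l.
exact: leq_trans (leq_pexp2l _ h) w_large.
Qed.

Lemma lt_subty t u x : subty t u -> x < range t -> x < range u.
Proof. by move=> /range_subty h /leq_trans; apply. Qed.

Lemma bounded_upd R r v : bounded_regs R -> v < range (ty r) -> bounded_regs (upd R r v).
Proof. by move=> bR bv r'; rewrite /upd; case: eqP => [->|]. Qed.

Lemma bounded_local1 i R : wt_local i -> bounded_regs R -> bounded_regs (local1 i R).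
Proof.
case: i => [r v|o r s t|r s t] /=.
- case E: (ty r) => [e|] /=.
    move=> v2 bR; apply: bounded_upd => //; rewrite E /=.
    by apply: leq_trans v2 _; case: (e) => // k; rewrite leq_exp2r.
  move=> /andP[v2 e0p] bR; apply: bounded_upd => //; rewrite E /=.
  apply: leq_trans w_large; apply: leq_trans v2 _.
  by apply: (@leq_trans (n.+2 ^ 1)); [rewrite expn1 | exact: leq_pexp2l].
- move=> h bR; apply: bounded_upd => //.
  have := bR s; have := bR t; case: o h => /=.
  + case: (ty s) (ty t) (ty r) => [a|] // [b|] // [c|] //= abc hb ha.
    apply: (@leq_trans (n.+2 ^ maxn a b + n.+2 ^ maxn a b)).
      have A : n.+2 ^ a <= n.+2 ^ maxn a b by apply: leq_pexp2l => //; exact: leq_maxl.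
      have B : n.+2 ^ b <= n.+2 ^ maxn a b by apply: leq_pexp2l => //; exact: leq_maxr.
      by lia.
    apply: (@leq_trans (n.+2 ^ (maxn a b).+1)); last exact: leq_pexp2l.
    by rewrite expnS; nia.
  + by move=> st _ ss; apply: leq_ltn_trans (leq_subr _ _) (lt_subty st ss).
  + case: (ty s) (ty t) (ty r) => [a|] // [b|] // [c|] //= abc hb ha.
    by apply: (@leq_trans (n.+2 ^ (a + b))); [rewrite expnD; nia | exact: leq_pexp2l].
  + by move=> st _ ss; apply: leq_ltn_trans (leq_div _ _) (lt_subty st ss).
  + by move=> st _ ss; apply: leq_ltn_trans (leq_mod _ _) (lt_subty st ss).
- move=> /andP[/andP[_ h1] h2] bR; apply: bounded_upd.
    apply: bounded_upd => //.
    exact: leq_ltn_trans (leq_subr _ _) (lt_subty h1 (bR s)).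
  case/orP: h2 => h; [have := lt_subty h (bR s)|have := lt_subty h (bR t)];
    apply: leq_ltn_trans; [exact: geq_minl|exact: geq_minr].
Qed.

Lemma bounded_locals ls R :
  all wt_local ls -> bounded_regs R -> bounded_regs (locals ls R).
Proof.
elim: ls R => [//|i ls IH] R /= /andP[wi wis] bR.
by apply: IH => //; exact: bounded_local1.
Qed.

Lemma bounded_read s g h r a q :
  subty tym (ty r) -> bounded s -> q < p -> bounded_regs (read_regs s g h r a q).
Proof.
move=> st [bR bM] qp; rewrite /read_regs; case: ifP => _; last exact: bR.
by apply: bounded_upd; [exact: bR | exact: lt_subty st (bM _)].
Qed.

Lemma bounded_write s g h r a b :
  subty (ty r) tym -> bounded s -> write_mem s g h a r b < range tym.
Proof.
move=> st [bR bM]; rewrite /write_mem; case: ifP => // qp.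
by apply: lt_subty st _; exact: bR.
Qed.

Lemma ev_bounded c s s' : ev c s s' -> wt c -> bounded s -> bounded s'.
Proof.
elim=> {c s s'} //=.
- by move=> ls s wis [bR bM]; split=> // q qp; apply: bounded_locals => //; exact: bR.
- by move=> g h r a s _ st bs; split=> [q|]; [exact: bounded_read | case: bs].
- by move=> g h a r s _ st bs; split=> [|b]; [case: bs | exact: bounded_write].
- by move=> c1 c2 s1 s2 s3 _ IH1 _ IH2 /andP[w1 w2] bs; apply: IH2 => //; exact: IH1.
- by move=> g h c s1 s2 s3 _ _ IH1 _ IH2 wc bs; apply: IH2 => //; exact: IH1.
Qed.

End Words.

(** ** Weakest preconditions *)

Lemma wp_loc ls (Q : state -> Prop) s :
  (forall s', (forall q r, rg s' q r = den (sym ls r) (rg s q)) -> mm s' = mm s ->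
     tm s' = tm s + cost_local ls -> lg s' = lg s -> Q s') ->
  wp (Loc ls) Q s.
Proof.
move=> H; eexists; first by constructor.
by apply: H => //= q r; exact: symE.
Qed.

Lemma wp_rd g h r a (Q : state -> Prop) s : addresses_ok s excl g h a ->
  (forall s', (forall q r', r' != r -> rg s' q r' = rg s q r') ->
     (forall q, rg s' q r = if active s g h q then mm s (rg s q a) else rg s q r) ->
     mm s' = mm s -> tm s' = tm s + 3 -> lg s' = lg s -> Q s') ->
  wp (Rd g h r a) Q s.
Proof.
move=> ad H; eexists; first by constructor.
apply: H => //= q; first by move=> r' r'r; rewrite /read_regs; case: ifP; rewrite ?upd_other.
by rewrite /read_regs; case: ifP; rewrite ?upd_same.
Qed.

Lemma wp_mark r f Q s :
  Q (St (rg s) (mm s) (tm s) (rcons (lg s) (tm s, marked s r f, mm s))) -> wp (Mark r f) Q s.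
Proof. by exists (St (rg s) (mm s) (tm s) (rcons (lg s) (tm s, marked s r f, mm s))) => //; constructor. Qed.

Lemma wp_seq c1 c2 Q s : wp c1 (wp c2 Q) s -> wp (Seq c1 c2) Q s.
Proof. by move=> [s2 e1 [s3 e2 Qs]]; exists s3 => //; exact: ev_seq e1 e2. Qed.

Lemma wp_conseq c (Q1 Q : state -> Prop) s :
  wp c Q1 s -> (forall s', Q1 s' -> Q s') -> wp c Q s.
Proof. by move=> [s' e Q1s] imp; exists s' => //; exact: imp. Qed.

Definition same_regs (rs : seq nat) s s' : Prop :=
  forall q r, r \notin rs -> rg s' q r = rg s q r.

Lemma ev_tm c s s' : ev c s s' -> tm s <= tm s'.
Proof.
elim=> {c s s'} /=; intros; rewrite ?leq_addr //.
- by apply: leq_trans; eassumption.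
- apply: leq_trans (leq_trans _ (leq_addr 1 _)) H3; apply: leq_trans (leq_addr 1 _) H1.
Qed.

Lemma wp_frame c (Q1 Q : state -> Prop) s : wp c Q1 s ->
  (forall s', same_regs (mods c) s s' -> (unmarked c -> lg s' = lg s) /\ tm s <= tm s' ->
     Q1 s' -> Q s') ->
  wp c Q s.
Proof.
move=> [s' e Q1s] imp; exists s' => //; apply: imp Q1s => // [q r|].
  exact: ev_frame.
by split; [exact: ev_log | exact: ev_tm e].
Qed.

(** The index of the invariant must decrease, which yields termination. Registers that the body does
    not modify are known to keep their values from the loop entry, so invariants only mention the
    others. *)
Lemma wp_while g h c (I : nat -> state -> Prop) (Q : state -> Prop) m s :
  I m s ->
  (forall m s', same_regs (mods c) s s' -> I m s' ->
     ((forall q, q < p -> ~~ active s' g h q) /\ Q (tick s' 2)) \/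
     ((forall q, q < p -> active s' g h q) /\
       exists2 k, k < m & wp c (fun s'' => I k (tick s'' 1)) (tick s' 1))) ->
  wp (While g h c) Q s.
Proof.
move=> Is step; have : same_regs (mods c) s s by [].
elim/ltn_ind: m {-2}s Is => m IH s' Is ss.
case: (step _ _ ss Is) => [[a Qs]|[a [k km [s2 e2 I2]]]].
  by exists (tick s' 2) => //; exact: ev_while_false.
have [|s3 e3 Q3] := IH k km (tick s2 1) I2.
  by move=> q r rc; rewrite /= (ev_frame q e2) //= ss.
by exists s3 => //; exact: ev_while_true e2 e3.
Qed.

Lemma writer_act s g h a b : writer s g h a b < p ->
  active s g h (writer s g h a b) /\ rg s (writer s g h a b) a = b.
Proof.
rewrite /writer => lt; have := lt; rewrite -{2}[p](size_iota 0) -has_find => /(nth_find 0).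
by rewrite nth_iota // add0n => /andP[? /eqP].
Qed.

Lemma writer_none s g h a b q : p <= writer s g h a b -> q < p ->
  active s g h q -> rg s q a <> b.
Proof.
rewrite /writer leqNgt -{2}[p](size_iota 0) -has_find => /hasPn H qp aq rq.
by have := H q; rewrite mem_iota qp aq rq eqxx /= => /(_ isT).
Qed.

Lemma write_mem_hit s g h a r b q : addresses_ok s true g h a ->
  q < p -> active s g h q -> rg s q a = b -> write_mem s g h a r b = rg s q r.
Proof.
move=> [_ inj] qp aq rq; rewrite /write_mem; case: ltnP => [lt|ge].
  by have [aw rw] := writer_act lt; rewrite (inj isT (writer s g h a b) q) // rw.
by have := writer_none ge qp aq rq.
Qed.

Lemma write_mem_miss s g h a r b :
  (forall q, q < p -> active s g h q -> rg s q a <> b) -> write_mem s g h a r b = mm s b.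
Proof.
move=> no; rewrite /write_mem; case: ltnP => // lt.
by have [aw /(no _ lt aw)] := writer_act lt.
Qed.

Lemma wp_wr g h a r (Q : state -> Prop) s : addresses_ok s true g h a ->
  (forall s', (forall q r', rg s' q r' = rg s q r') ->
     (forall q, q < p -> active s g h q -> mm s' (rg s q a) = rg s q r) ->
     (forall b, (forall q, q < p -> active s g h q -> b <> rg s q a) -> mm s' b = mm s b) ->
     tm s' = tm s + 3 -> lg s' = lg s -> Q s') ->
  wp (Wr g h a r) Q s.
Proof.
move=> ad H; eexists; first by constructor.
apply: H => //= [q qp aq|b nb]; first exact: (write_mem_hit r ad qp aq).
by apply: write_mem_miss => q qp aq E; apply: (nb q qp aq).
Qed.

End Language.

(** The final value of a register after a block of local code is computed by the virtual machine as
    a closed expression in the initial registers; the block is never stepped through in the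
    logic. *)
Ltac symc :=
  repeat match goal with |- context [den (sym ?l ?r) _] =>
    let e := eval vm_compute in (sym l r) in
    replace (sym l r) with e by (vm_compute; reflexivity)
  end; cbn [den eval_binop].

Tactic Notation "symb" hyp(E) := rewrite E; symc.

(** ** Soundness of the compilation *)

Section Sound.
Variables (P : program) (p N : nat) (excl : bool).
Variables (n w e0 : nat) (ty : nat -> option nat) (tym : option nat).
Hypothesis w_large : n.+2 ^ e0 <= w.
Hypothesis ty_words : forall r, subty e0 (ty r) None.
Hypothesis tym_words : subty e0 tym None.

(** Processors have different program counters only inside a guard; at all command boundaries the
    configuration is a [cfg]. *)
Definition gcfg (pcs : nat -> nat) (R : nat -> memory) (M : memory) (t : nat) : config p :=
  Config (fun q : 'I_p => Proc (pcs q) (R q) t) M.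

Definition cfg (l : nat) (s : state) : config p := gcfg (fun=> l) (rg s) (mm s) (tm s).

Definition good (c : config p) : Prop :=
  [/\ excl -> exclusive P c, shared_space_within P c N & words_below c w].

Definition code_at (l : nat) (s : seq instr) : Prop :=
  forall i x, onth s i = Some x -> onth P (l + i) = Some x.

Definition quiet (i : instr) : bool :=
  match i with Read _ _ | Write _ _ | Draw _ _ => false | _ => true end.

Definition low (R : nat -> memory) (M : memory) : Prop :=
  (forall q, q < p -> forall r, R q r < w) /\ forall a, M a < w.

Lemma bounded_low s : bounded p n w ty tym s -> low (rg s) (mm s).
Proof.
move=> [bR bM]; split=> [q qp r|a]; first exact: lt_subty w_large _ _ _ (ty_words r) (bR q qp r).
exact: lt_subty w_large _ _ _ tym_words (bM a).
Qed.

Lemma onth_cat (T : Type) (s1 s2 : seq T) i :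
  onth (s1 ++ s2) i = if i < size s1 then onth s1 i else onth s2 (i - size s1).
Proof. by elim: s1 i => [|x s1 IH] [|i] //=; rewrite IH. Qed.

Lemma onth_size (T : Type) (s : seq T) i x : onth s i = Some x -> i < size s.
Proof. by elim: s i => [|y s IH] [|i] //= /IH. Qed.

Lemma code_at_cat l s1 s2 :
  code_at l (s1 ++ s2) -> code_at l s1 /\ code_at (l + size s1) s2.
Proof.
move=> H; split=> i x sx; first by apply: H; rewrite onth_cat (onth_size sx).
by rewrite -addnA; apply: H; rewrite onth_cat ltnNge leq_addr /= addKn.
Qed.

Lemma gcfg_current pcs R M t (q : 'I_p) : current P (gcfg pcs R M t) q = onth P (pcs q).
Proof. by []. Qed.

Lemma nowrite_step pcs R M t (ins : nat -> instr) :
  (forall q, q < p -> onth P (pcs q) = Some (ins q)) ->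
  (forall q, q < p -> if ins q is Write _ _ then false else true) ->
  dstep P (gcfg pcs R M t) =
  Config (fun q : 'I_p => exec_instr (ins q) M 0 (Proc (pcs q) (R q) t)) M.
Proof.
move=> cur nw; rewrite /dstep /step; congr Config; apply: functional_extensionality.
  by move=> q; rewrite gcfg_current cur //; case: (ins q) => //= r s; rewrite ffunE.
move=> a; rewrite /writes (eq_pmap (f2 := fun=> None)); first by elim: (enum _).
by move=> q; rewrite gcfg_current cur //; have := nw q (ltn_ord q); case: (ins q).
Qed.

Lemma nodraw_gcfg pcs R M t (ins : nat -> instr) :
  (forall q, q < p -> onth P (pcs q) = Some (ins q)) ->
  (forall q, q < p -> ~~ is_draw (ins q)) -> nodraw P (gcfg pcs R M t).
Proof. by move=> cur nd q; rewrite gcfg_current cur // nd. Qed.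

Lemma gcfg_words pcs R M t : low R M -> words_below (gcfg pcs R M t) w.
Proof. by move=> [lR lM]; split=> //= q r; exact: lR. Qed.

Lemma good_noaccess pcs R M t (ins : nat -> instr) :
  (forall q, q < p -> onth P (pcs q) = Some (ins q)) ->
  (forall q, q < p -> match ins q with Read _ _ | Write _ _ => false | _ => true end) ->
  low R M -> good (gcfg pcs R M t).
Proof.
move=> cur qu lRM.
have no (q : 'I_p) : shared_access P (gcfg pcs R M t) q = None.
  by rewrite /shared_access gcfg_current cur //; have := qu q (ltn_ord q); case: (ins q).
split; [|by move=> q a; rewrite no | exact: gcfg_words].
by move=> _ q q' a _; rewrite no.
Qed.

Variables (traj : nat -> config p) (off : nat).
Hypothesis follows :
  forall t, off <= t -> nodraw P (traj t) -> traj t.+1 = dstep P (traj t).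

(** Stated along an arbitrary trajectory that follows the machine where nothing is drawn, so that
    one soundness proof serves both given executions and the iterates of [dstep]. *)
Definition leads t c t' c' : Prop :=
  off <= t -> traj t = c ->
  [/\ t <= t', traj t' = c' & forall u, t <= u < t' -> good (traj u) /\ nodraw P (traj u)].

Lemma leads_refl t c : leads t c t c.
Proof. by move=> _ ?; split=> // u h; exfalso; lia. Qed.

Lemma leads_trans t1 c1 t2 c2 t3 c3 : leads t1 c1 t2 c2 -> leads t2 c2 t3 c3 -> leads t1 c1 t3 c3.
Proof.
move=> p1 p2 o tr; have [a b c] := p1 o tr; have [a' b' c'] := p2 (leq_trans o a) b.
split=> //; first exact: leq_trans a a'.
move=> u /andP[h1 h2]; case: (ltnP u t2) => h; first by apply: c; rewrite h1.
by apply: c'; rewrite h.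
Qed.

Lemma leads_step t c c' : good c -> nodraw P c -> dstep P c = c' -> leads t c t.+1 c'.
Proof.
move=> gc nd <- o tr; split=> //; first by rewrite follows // tr.
by move=> u h; (have -> : u = t by lia); rewrite tr.
Qed.

Lemma leads_quiet pcs R M t pcs' R' (ins : nat -> instr) :
  (forall q, q < p -> onth P (pcs q) = Some (ins q)) ->
  (forall q, q < p -> quiet (ins q)) -> low R M ->
  (forall q, q < p ->
     exec_instr (ins q) M 0 (Proc (pcs q) (R q) t) = Proc (pcs' q) (R' q) t.+1) ->
  leads t (gcfg pcs R M t) t.+1 (gcfg pcs' R' M t.+1).
Proof.
move=> cur qu lRM ex; apply: leads_step.
- by apply: good_noaccess cur _ lRM => q /qu; case: (ins q).
- by apply: nodraw_gcfg cur _ => q /qu; case: (ins q).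
- rewrite (nowrite_step _ _ _ cur); last by move=> q /qu; case: (ins q).
  by congr Config; apply: functional_extensionality => q; rewrite ex.
Qed.

Section Guarded.
Variables (l g h : nat) (i : instr) (s : state).
Hypothesis code : code_at l (guarded l g h i).
Hypothesis lows : low (rg s) (mm s).
Let a q := active s g h q.

Lemma leads_guard1 :
  leads (tm s) (cfg l s) (tm s).+1
    (gcfg (fun q => if a q then l + 3 else l.+1) (rg s) (mm s) (tm s).+1).
Proof.
apply: (leads_quiet (ins := fun=> JumpLt g h (l + 3))) => // q _.
by have := @code 0 _ erefl; rewrite addn0.
Qed.

Definition guard_ins q := if a q then i else nop l.+1.

Lemma guard_cur q :
  onth P (if a q then l + 3 else l.+1) = Some (guard_ins q).
Proof.
rewrite /guard_ins; case: (a q); first exact: (@code 3 _ erefl).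
by have := @code 1 _ erefl; rewrite addn1.
Qed.

Lemma leads_guard3 R M t : low R M ->
  leads t (gcfg (fun q => if a q then l + 4 else l + 2) R M t) t.+1
    (gcfg (fun=> l + 5) R M t.+1).
Proof.
move=> lRM.
apply: (leads_quiet (ins := fun q => if a q then nop (l + 4) else JumpEq 0 0 (l + 5))) => //.
- by move=> q _ /=; case: (a q); [exact: (@code 4 _ erefl) | exact: (@code 2 (JumpEq 0 0 (l+5)) erefl)].
- by move=> q _ /=; case: (a q).
- by move=> q _ /=; case: (a q); rewrite /= ?eqxx ?addnS.
Qed.

Lemma guard_good x k t : i = Read x k \/ i = Write k x ->
  addresses_ok p N s excl g h k ->
  good (gcfg (fun q => if a q then l + 3 else l.+1) (rg s) (mm s) t).
Proof.
move=> iE [spc ex].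
have acc (q : 'I_p) b :
    shared_access P (gcfg (fun q => if a q then l + 3 else l.+1) (rg s) (mm s) t) q = Some b ->
    a q /\ rg s q k = b.
  rewrite /shared_access gcfg_current guard_cur /guard_ins; case: (a q) => //.
  by case: iE => -> /= [].
split; last exact: gcfg_words.
- move=> el q q' b qq /acc[aq rq] /acc[aq' rq'].
  case/negP: qq; apply/eqP/val_inj; apply: (ex el) => //; first exact: ltn_ord.
    exact: ltn_ord.
  by rewrite rq.
- by move=> q b /acc[aq <-]; apply: spc.
Qed.

End Guarded.

Lemma leads_rd l g h r k s : code_at l (guarded l g h (Read r k)) ->
  low (rg s) (mm s) -> low (read_regs s g h r k) (mm s) ->
  addresses_ok p N s excl g h k ->
  leads (tm s) (cfg l s) (tm s + 3)
    (cfg (l + 5) (St (read_regs s g h r k) (mm s) (tm s + 3) (lg s))).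
Proof.
move=> code lo lo' ad; apply: leads_trans (leads_guard1 code lo) _.
apply: leads_trans _ (_ : leads (tm s).+2 _ (tm s + 3) _); last first.
  by rewrite addn3; exact: (leads_guard3 (s := s) code).
apply: leads_step.
- by apply: (guard_good code lo (x := r) (k := k)) => //; left.
- apply: (@nodraw_gcfg _ _ _ _ (guard_ins l g h (Read r k) s)) => [q _|q _]; first exact: (guard_cur s code q).
  by rewrite /guard_ins; case: ifP.
- rewrite (@nowrite_step _ _ _ _ (guard_ins l g h (Read r k) s)).
  + congr Config; apply: functional_extensionality => q.
    by rewrite /guard_ins /read_regs /=; case: (active s g h q); rewrite /= ?eqxx !addnS !addn0.
  + by move=> q _; exact: (guard_cur s code).
  + by move=> q _; rewrite /guard_ins; case: ifP.
Qed.

Lemma pmap_none (T U : Type) (f : T -> option U) s :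
  (forall x, f x = None) -> pmap f s = [::].
Proof. by move=> H; elim: s => //= x s ->; rewrite H. Qed.

Lemma pmap_unique (T : eqType) (U : Type) (f : T -> option U) s x0 v :
  uniq s -> x0 \in s -> f x0 = Some v -> (forall x, f x <> None -> x = x0) ->
  pmap f s = [:: v].
Proof.
move=> us x0s fx0 un.
have nx x : x != x0 -> f x = None.
  by move=> xx; case E: (f x) => [u|//]; case/eqP: xx; apply: un; rewrite E.
elim: s us x0s => [//|x s IH] /= /andP[xs us]; rewrite inE => /orP[/eqP xx|x0s].
  rewrite -xx fx0 /=; congr (_ :: _).
  have {xs} : x0 \notin s by rewrite xx.
  elim: s {IH us} => [//|y s IH]; rewrite inE negb_or => /andP[yx /IH /= ->].
  by rewrite nx // eq_sym.
rewrite nx /=; first exact: IH.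
by apply: contraNneq xs => ->.
Qed.

Lemma leads_wr l g h r k s : code_at l (guarded l g h (Write k r)) ->
  low (rg s) (mm s) -> low (rg s) (write_mem p s g h k r) ->
  addresses_ok p N s true g h k ->
  leads (tm s) (cfg l s) (tm s + 3)
    (cfg (l + 5) (St (rg s) (write_mem p s g h k r) (tm s + 3) (lg s))).
Proof.
move=> code lo lo' ad; apply: leads_trans (leads_guard1 code lo) _.
apply: leads_trans _ (_ : leads (tm s).+2 _ (tm s + 3) _); last first.
  by rewrite addn3; exact: (leads_guard3 (s := s) code).
apply: leads_step.
- apply: (guard_good code lo (x := r) (k := k)); first by right.
  by case: ad => ad1 ad2; split=> // _; exact: ad2.
- apply: (@nodraw_gcfg _ _ _ _ (guard_ins l g h (Write k r) s)) => [q _|q _]; first exact: (guard_cur s code).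
  by rewrite /guard_ins; case: ifP.
- rewrite /dstep /step; congr Config; apply: functional_extensionality.
    move=> q; rewrite gcfg_current (guard_cur s code) /guard_ins /=.
    by case: (active s g h q); rewrite /= ?eqxx !addnS !addn0.
  move=> b; rewrite /writes.
  set f := fun q : 'I_p => if active s g h q && (rg s q k == b) then Some (rg s q r) else None.
  rewrite (eq_pmap (f2 := f)); last first.
    move=> q; rewrite gcfg_current (guard_cur s code) /guard_ins /f.
    by case: (active s g h q).
  case: (ltnP (writer p s g h k b) p) => [lt|ge].
    have [aw rw] := writer_act lt; rewrite /= /write_mem lt.
    (* Active addresses are pairwise distinct, so the priority maximum is taken over a single
       value. *)
    rewrite (pmap_unique (x0 := Ordinal lt) (v := rg s (writer p s g h k b) r)).
    + by rewrite big_seq1.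
    + exact: enum_uniq.
    + by rewrite mem_enum.
    + by rewrite /f /= aw rw eqxx.
    + move=> q; rewrite /f; case: ifP => // /andP[aq /eqP rq] _; apply: val_inj.
      by case: ad => _ inj; apply: (inj isT q (writer p s g h k b)) => //; rewrite rq rw.
  rewrite pmap_none /= => [|q]; first by rewrite /write_mem ltnNge ge.
  rewrite /f.
  by case: ifP => // /andP[aq /eqP]; case/(writer_none ge (ltn_ord q) aq).
Qed.

Lemma leads_local1 l i s : code_at l (comp_local i) ->
  wt_local e0 ty i -> bounded p n w ty tym s ->
  leads (tm s) (cfg l s) (tm s + size (comp_local i))
    (cfg (l + size (comp_local i))
       (St (fun q => local1 i (rg s q)) (mm s) (tm s + size (comp_local i)) (lg s))).
Proof.
move=> code wi bs; have lo := bounded_low bs.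
case: i code wi => [r v|o r x y|r x y] code wi; rewrite /= ?addn1.
- apply: (leads_quiet (ins := fun=> Const r v)) => // q _.
  by have := @code 0 _ erefl; rewrite addn0.
- apply: (leads_quiet (ins := fun=> Op o r x y)) => // q _.
  by have := @code 0 _ erefl; rewrite addn0.
- have lo1 : low (fun q => upd (rg s q) tmp (rg s q x - rg s q y)) (mm s).
    case: lo => lR lM; split=> // q qp r'; rewrite /upd; case: eqP => _; last exact: lR.
    exact: leq_ltn_trans (leq_subr _ _) (lR q qp x).
  have p1 : leads (tm s) (cfg l s) (tm s).+1 (gcfg (fun=> l.+1)
      (fun q => upd (rg s q) tmp (rg s q x - rg s q y)) (mm s) (tm s).+1).
    apply: (leads_quiet (ins := fun=> Op Defs.Sub tmp x y)) => // q _.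
    by have := code 0 _ erefl; rewrite addn0.
  apply: leads_trans p1 _.
  rewrite addn2; apply: (leads_quiet (ins := fun=> Op Defs.Sub r x tmp)) => //.
    by move=> q _; have := @code 1 _ erefl; rewrite addn1.
  move=> q _; rewrite /= addn2; congr Proc.
  by case/andP: wi => /andP[xt _] _; rewrite upd_same upd_other // minnE.
Qed.

Lemma leads_locals l ls s : code_at l (flatten (map comp_local ls)) ->
  all (wt_local e0 ty) ls -> bounded p n w ty tym s ->
  leads (tm s) (cfg l s) (tm s + cost_local ls)
    (cfg (l + cost_local ls)
       (St (fun q => locals ls (rg s q)) (mm s) (tm s + cost_local ls) (lg s))).
Proof.
rewrite /cost_local; elim: ls l s => [|i ls IH] l s /= code wl bs.
  by rewrite !addn0; case: s bs => *; exact: leads_refl.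
case/andP: wl => wi wls; have [code1 code2] := code_at_cat code.
have bs1 : bounded p n w ty tym
    (St (fun q => local1 i (rg s q)) (mm s) (tm s + size (comp_local i)) (lg s)).
  case: (bs) => bR bM; split=> // q qp.
  by apply: (bounded_local1 w_large) => //; exact: bR.
apply: leads_trans (leads_local1 code1 wi bs) _.
by have := IH _ _ code2 wls bs1; rewrite /= size_cat !addnA.
Qed.

(** Every logged memory is the shared memory of the trajectory at the logged time. [List.In] is used
    because memories, being functions, have no decidable equality. *)
Definition log_ok s : Prop :=
  forall e, List.In e (lg s) -> e.1.1 <= tm s /\ shared (traj e.1.1) = e.2.

Lemma log_ok_later s s' : log_ok s -> lg s' = lg s -> tm s <= tm s' -> log_ok s'.
Proof.
by move=> lo E le e; rewrite E => /lo[h ->]; split=> //; exact: leq_trans h le.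
Qed.

Lemma sound c s s' l : ev p N excl c s s' -> code_at l (compile l c) ->
  wt e0 ty tym c -> bounded p n w ty tym s ->
  leads (tm s) (cfg l s) (tm s') (cfg (l + size (compile l c)) s').
Proof.
move=> e; elim: e l => {c s s'} /=.
- by move=> ls s l code wl bs; exact: leads_locals.
- move=> g h r a s ok l code st bs; apply: leads_rd => //; first exact: bounded_low bs.
  apply: bounded_low (_ : bounded p n w ty tym (St (read_regs s g h r a) (mm s) 0 [::])).
  by split=> [q qp|]; [exact: (bounded_read w_large g h a st bs qp) | case: bs].
- move=> g h a r s ok l code st bs; apply: leads_wr => //; first exact: bounded_low bs.
  apply: bounded_low (_ : bounded p n w ty tym (St (rg s) (write_mem p s g h a r) 0 [::])).
  by split=> [|b]; [case: bs | exact: (bounded_write w_large g h a b st bs)].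
- move=> c1 c2 s1 s2 s3 e1 IH1 e2 IH2 l /code_at_cat[code1 code2] /andP[w1 w2] bs.
  rewrite size_cat addnA; apply: leads_trans (IH1 _ code1 w1 bs) _.
  apply: IH2 => //; exact: (ev_bounded w_large e1 w1 bs).
- move=> g h c s1 s2 s3 gt e1 IH1 e2 IH2 l code wc bs.
  have bs2 : bounded p n w ty tym s2 by exact: (ev_bounded w_large e1 wc bs).
  have [codej codebl] := @code_at_cat l
    [:: JumpLt g h (l + 2); JumpEq 0 0 (l + size (compile (l + 2) c) + 3)] _ code.
  have [codeb codel] := code_at_cat codebl.
  have p1 : leads (tm s1) (cfg l s1) (tm s1 + 1) (cfg (l + 2) (tick s1 1)).
    rewrite /cfg /= addn1; apply: (leads_quiet (ins := fun=> JumpLt g h (l + 2))) => //.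
    + by move=> q _; have := codej 0 _ erefl; rewrite addn0.
    + exact: bounded_low bs.
    + by move=> q qp; have := gt q qp; rewrite /active /= => ->.
  apply: leads_trans p1 _; apply: leads_trans (IH1 _ codeb wc bs) _.
  have p2 : leads (tm s2) (cfg (l + 2 + size (compile (l + 2) c)) s2)
      (tm s2 + 1) (cfg l (tick s2 1)).
    rewrite /cfg /= addn1; apply: (leads_quiet (ins := fun=> JumpEq 0 0 l)) => //.
    + by move=> q _; have := codel 0 _ erefl; rewrite addn0.
    + exact: bounded_low bs2.
    + by move=> q qp; rewrite /= eqxx.
  by apply: leads_trans p2 _; apply: IH2.
- move=> g h c s gf l code wc bs; have lo := bounded_low bs.
  have p1 : leads (tm s) (cfg l s) (tm s + 1) (cfg l.+1 (tick s 1)).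
    rewrite /cfg /= addn1; apply: (leads_quiet (ins := fun=> JumpLt g h (l + 2))) => //.
    + by move=> q _; have := code 0 _ erefl; rewrite addn0.
    + by move=> q qp; have := gf q qp; rewrite /active /= => /negbTE ->.
  apply: leads_trans p1 _; rewrite /cfg /= addn2 addn1.
  apply: (leads_quiet (ins := fun=> JumpEq 0 0 (l + size (compile (l + 2) c) + 3))) => //.
    by move=> q _; have := code 1 _ erefl; rewrite addn1.
  by move=> q _ /=; rewrite eqxx size_cat /= addn1 -addnA addn3.
- by move=> r f s l _ _ _; rewrite addn0; exact: leads_refl.
Qed.

Lemma sound_log c s s' l : ev p N excl c s s' -> code_at l (compile l c) ->
  wt e0 ty tym c -> bounded p n w ty tym s -> off <= tm s -> traj (tm s) = cfg l s ->
  log_ok s -> log_ok s'.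
Proof.
move=> e; elim: e l => {c s s'} /=.
- by move=> ls s l _ _ _ _ _ lo; apply: log_ok_later lo _ _; rewrite //= leq_addr.
- by move=> g h r a s ok l _ _ _ _ _ lo; apply: log_ok_later lo _ _; rewrite //= leq_addr.
- by move=> g h r a s ok l _ _ _ _ _ lo; apply: log_ok_later lo _ _; rewrite //= leq_addr.
- move=> c1 c2 s1 s2 s3 e1 IH1 e2 IH2 l /code_at_cat[code1 code2] /andP[w1 w2] bs o tr lo.
  have [h1 h2 _] := sound e1 code1 w1 bs o tr.
  apply: IH2 code2 w2 (ev_bounded w_large e1 w1 bs) (leq_trans o h1) h2 _.
  exact: IH1 code1 w1 bs o tr lo.
- move=> g h c s1 s2 s3 gt e1 IH1 e2 IH2 l code wc bs o tr lo.
  have bs2 : bounded p n w ty tym s2 by exact: (ev_bounded w_large e1 wc bs).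
  have [codej codebl] := @code_at_cat l
    [:: JumpLt g h (l + 2); JumpEq 0 0 (l + size (compile (l + 2) c) + 3)] _ code.
  have [codeb codel] := code_at_cat codebl.
  have p1 : leads (tm s1) (cfg l s1) (tm s1 + 1) (cfg (l + 2) (tick s1 1)).
    rewrite /cfg /= addn1; apply: (leads_quiet (ins := fun=> JumpLt g h (l + 2))) => //.
    + by move=> q _; have := codej 0 _ erefl; rewrite addn0.
    + exact: bounded_low bs.
    + by move=> q qp; have := gt q qp; rewrite /active /= => ->.
  have p2 : leads (tm s2) (cfg (l + 2 + size (compile (l + 2) c)) s2)
      (tm s2 + 1) (cfg l (tick s2 1)).
    rewrite /cfg /= addn1; apply: (leads_quiet (ins := fun=> JumpEq 0 0 l)) => //.
    + by move=> q _; have := codel 0 _ erefl; rewrite addn0.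
    + exact: bounded_low bs2.
    + by move=> q qp; rewrite /= eqxx.
  have [h1 t1 _] := p1 o tr.
  have o1 := leq_trans o h1.
  have [h2 t2 _] := sound e1 codeb wc bs o1 t1.
  have o2 := leq_trans o1 h2.
  have [h3 t3 _] := p2 o2 t2.
  apply: (IH2 _ code wc bs2 (leq_trans o2 h3) t3).
  apply: log_ok_later (IH1 _ codeb wc bs o1 t1 _) _ _; rewrite //= ?leq_addr //.
  by apply: log_ok_later lo _ _; rewrite //= leq_addr.
- by move=> g h c s _ l _ _ _ _ _ lo; apply: log_ok_later lo _ _; rewrite //= leq_addr.
- move=> r f s l _ _ bs o tr lo e.
  rewrite -cats1 => /List.in_app_iff[|[<-|[]]] /=; first exact: lo.
  by rewrite tr.
Qed.

End Sound.

(** ** From runs to Synchronous Strict PIP *)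

Definition registers_below (K : nat) (i : instr) : bool :=
  match i with
  | Const r _ => r < K
  | Op _ r s t => [&& r < K, s < K & t < K]
  | JumpEq s t _ | JumpLt s t _ => (s < K) && (t < K)
  | Read r s | Write r s | Draw r s => (r < K) && (s < K)
  | PRead _ _ | PWrite _ _ => false
  end.

Lemma onth_all (T : Type) (a : pred T) (s : seq T) i x : all a s -> onth s i = Some x -> a x.
Proof. by elim: s i => [|y s IH] [|i] //= /andP[ay /IH] // as_; [case=> <- | exact: as_]. Qed.

Lemma registers_private P p K (c : config p) :
  all (registers_below K) P -> private_space_within P c K.
Proof.
move=> reg q a; rewrite /private_access /current; case E: onth => [i|//].
have := onth_all reg E; case: i {E} => //= [r _|o r s t|s t _|s t _|r s|r s|r s] h;
  rewrite !inE; repeat case/orP; move=> /eqP ->; lia.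
Qed.

Lemma execution_nops P p (c : config p) cs t q :
  execution P c cs -> (forall q, nops (procs c q) = 0) -> nops (procs (cs t) q) <= t.
Proof.
move=> [c0 st] z; elim: t => [|t IH]; first by rewrite c0 z.
have [d ->] := st t; rewrite /=; case: (current P (cs t) q) => [i|]; last exact: leqW.
by case: i.
Qed.

Lemma span_le P p n M cs t :
  execution P (init p n M) cs -> Defs.span (cs t) <= t.
Proof. by move=> ex; apply/bigmax_leqP => q _; exact: execution_nops ex _. Qed.

Section Assembly.
Variables (I : input_model) (P : program) (excl : bool) (K e0 : nat).
Variable B : nat -> nat -> nat.
Hypothesis regs : all (registers_below K) P.
Hypothesis runs : forall n p w, 0 < p <= n -> n.+2 ^ e0 <= w ->
  forall (x : arbitrary I n) (r : random I n), (forall a, input x r a < w) ->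
  exists E v, out P (good P (cells I n) excl w) E (B n p) (start p x r) v.
Hypothesis inputs : forall n (x : arbitrary I n) (r : random I n),
  exists w, forall a, input x r a < w.

Hypothesis nonempty : forall n, 0 < #|random I n|.

Lemma always_good (Q : forall n p, config p -> Prop) :
  (forall n p w c, good P (cells I n) excl w c -> Q n p c) -> @always I P Q.
Proof.
move=> imp n p np x r cs ex t; have [w wi] := inputs x r.
have [||E [v o]] := runs np (w := maxn w (n.+2 ^ e0)) _ (r := r) (x := x).
- by rewrite leq_maxr.
- by move=> a; apply: leq_trans (wi a) _; rewrite leq_maxl.
- exact: imp (out_good _ o ex).
Qed.

Lemma assemble_erew : excl -> erew I P.
Proof. by move=> el; apply: always_good => n p w c [/(_ el)]. Qed.

Lemma assemble_pip C e : 0 < C ->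
  (forall n p, 1 < n -> 0 < p <= n -> B n p * p <= C * n * trunc_log 2 n ^ e) ->
  sync_strict_pip_whp I P.
Proof.
move=> C0 bound; split.
- by apply: always_good => n p w c [_].
- split; first by exists K => n p _ x r cs _ t; exact: registers_private.
  exists e0 => n p w np wl x r cs iw ex t.
  by have [E [v o]] := runs np wl iw; have [] := out_good t o ex.
(* The span is at most the number of steps, so the event is sure and any [k] would do. The threshold
   2 is there because the logarithm in the bound vanishes at [n = 1]. *)
- exists 1, C, e, 2; split=> // n p np x; exists (B n p).
  have hlt r : halts_by P (start p x r) (B n p).
    have [w wi] := inputs x r.
    have [||E [v o]] := runs np (w := maxn w (n.+2 ^ e0)) _ (r := r) (x := x).
    - by rewrite leq_maxr.
    - by move=> a; apply: leq_trans (wi a) _; rewrite leq_maxl.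
    - exact: out_halts o.
  split=> // n2.
  rewrite /prob_input (eq_bigr (fun=> 1%R)); last first.
    move=> r _; apply: prob_always => cs ex; apply: leq_trans (bound _ _ n2 np).
    by rewrite leq_mul2r (span_le _ ex) orbT.
  have kpos : (0 < (n%:R ^+ 1)^-1 :> rat)%R.
    by rewrite GRing.expr1 Num.Theory.invr_gt0 Num.Theory.ltr0n; lia.
  rewrite GRing.sumr_const -[(1 *+ _)%R]GRing.mulr_natl GRing.mulr1 GRing.divff.
    by rewrite Num.Theory.ltrBlDr Num.Theory.ltrDl.
  by rewrite Num.Theory.pnatr_eq0 -lt0n.
- exists K => n p np x r cs ex t _; split; last exact: registers_private.
  move=> q a /(always_good (Q := fun n p c => shared_space_within P c (cells I n)) _ np ex).
  by move=> H; apply: leq_trans (H _) (leq_addr _ _) => n' p' w c [].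
Qed.

End Assembly.

Section CompiledRun.
Variables (c : cmd) (N : nat) (excl : bool).
Variables (e0 : nat) (tys : seq (option nat)) (tym : option nat).
Let P := compile 0 c.
Let ty r := nth (Some 1) tys r.

(** The last conjunct makes room for the initial contents [q], [p], [n] of the cells 0, 1, 2, all
    below [n + 2]; the other cells start at 0. [Some 1] is the type of cells beyond the list. *)
Definition well_typed : bool :=
  [&& wt e0 ty tym c, all (fun t => subty e0 t None) (tym :: Some 1 :: tys)
    & all (fun r => if ty r is Some e then 0 < e else true) [:: 0; 1; 2]].

Hypothesis wtc : well_typed.

Definition start_state (n p : nat) (M : memory) : state :=
  St (fun q => nth 0 [:: q; p; n]) M 0 [::].

Lemma ty_words_seq r : subty e0 (ty r) None.
Proof.
case/and3P: wtc => _ /= /and3P[_ h1 h] _; rewrite /ty.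
case: (ltnP r (size tys)) => rs; first exact: (all_nthP _ h).
by rewrite nth_default.
Qed.

Lemma tym_words_seq : subty e0 tym None.
Proof. by case/and3P: wtc => _ /= /and3P[]. Qed.

Section Start.
Variables (n p w : nat) (M : memory) (s' : state).
Hypothesis np : 0 < p <= n.
Hypothesis wl : n.+2 ^ e0 <= w.
Hypothesis Mw : forall a, M a < range n w tym.
Hypothesis e : ev p N excl c (start_state n p M) s'.

Lemma start_bounded : bounded p n w ty tym (start_state n p M).
Proof.
split=> // q qp r; have rpos t : 0 < range n w t.
  by case: t => [k|] /=; rewrite ?expn_gt0 //; apply: leq_trans wl; rewrite expn_gt0.
case/and3P: wtc => _ _ /and4P[t0 t1 t2 _].
have small t x : (if t is Some k then 0 < k else true) -> subty e0 t None ->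
    x < n.+2 -> x < range n w t.
  case: t => [k|] /= k0 _ xn.
    by apply: leq_trans xn _; rewrite -{1}[n.+2]expn1 leq_pexp2l.
  apply: leq_trans xn _; apply: leq_trans wl; rewrite -{1}[n.+2]expn1 leq_pexp2l //.
  by case/and3P: wtc => _ /and3P[].
case: r => [|[|[|r]]] /=; rewrite ?nth_nil //;
  apply: small => //; try exact: ty_words_seq; lia.
Qed.

Lemma compiled_code : code_at P 0 (compile 0 c).
Proof. by []. Qed.

Lemma wt_cmd : wt e0 ty tym c.
Proof. by case/and3P: wtc. Qed.

Lemma halted_finished : finished P (cfg p (size P) s').
Proof.
apply/forallP => q; rewrite /current /=; case E: onth => [i|//].
by have := onth_size E; rewrite ltnn.
Qed.

Lemma run_leads (traj : nat -> config p) :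
  traj 0 = init p n M ->
  (forall t, nodraw P (traj t) -> traj t.+1 = dstep P (traj t)) ->
  [/\ traj (tm s') = cfg p (size P) s',
      (forall u, u < tm s' -> good P N excl w (traj u) /\ nodraw P (traj u))
    & log_ok traj s'].
Proof.
move=> t0 fol; have fol' t : 0 <= t -> nodraw P (traj t) -> traj t.+1 = dstep P (traj t).
  by move=> _; exact: fol.
have t0' : traj (tm (start_state n p M)) = cfg p 0 (start_state n p M) by [].
have [_ tt gd] := sound wl ty_words_seq tym_words_seq fol' e compiled_code wt_cmd
  start_bounded (leq0n _) t0'.
split=> //.
by apply: (sound_log wl ty_words_seq tym_words_seq fol' e compiled_code wt_cmd
  start_bounded (leq0n _) t0') => x [].
Qed.

Lemma run_out (E : config p -> bool) T : tm s' <= T ->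
  exists v, out P (good P N excl w) E T (init p n M) v.
Proof.
move=> /subnKC <-.
have [] // := @run_leads (fun t => iter t (dstep P (p := p)) (init p n M)).
move=> fin gd _; eexists; apply: out_iter; first exact: gd.
rewrite fin; apply: out_fin; first exact: halted_finished.
have bs := ev_bounded wl e wt_cmd start_bounded.
have lo := bounded_low wl ty_words_seq tym_words_seq bs.
have no (q : 'I_p) : shared_access P (cfg p (size P) s') q = None.
  by rewrite /shared_access; move: (forallP halted_finished q); case: current.
split; [by move=> _ q q' a _; rewrite no | by move=> q a; rewrite no | exact: gcfg_words].
Qed.

Lemma run_history cs : execution P (init p n M) cs ->
  log_ok cs s' /\ forall u, tm s' <= u -> shared (cs u) = mm s'.
Proof.
move=> ex; have [||fin _ lo] := @run_leads cs.
- by case: ex.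
- by move=> t nd; case: ex => _ /(_ t) [d ->]; rewrite step_nodraw.
split=> // u le; rewrite (execution_finished ex _ le) ?fin //.
exact: halted_finished.
Qed.

End Start.
End CompiledRun.

(** ** Type inference *)

(* An iteration towards types accepted by [well_typed]; nothing is proved about
   it, as its result is checked. *)
Definition raise_type (f : nat -> option nat) (r : nat) (t : option nat) : nat -> option nat :=
  fun r' => if r' == r then
              match f r, t with Some a, Some b => Some (maxn a b) | _, _ => None end
            else f r'.

Definition result_type (f : nat -> option nat) (i : linstr) : nat * option nat :=
  match i with
  | LConst r v => (r, Some (trunc_log 2 v).+1)
  | LOp Add r s t =>
      (r, match f s, f t with Some a, Some b => Some (maxn a b).+1 | _, _ => None end)
  | LOp Mul r s t =>
      (r, match f s, f t with Some a, Some b => Some (a + b) | _, _ => None end)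
  | LOp _ r s t => (r, f s)
  | LMin r s t =>
      (r, match f s, f t with
          | Some a, Some b => Some (minn a b) | Some a, None => Some a | None, u => u end)
  end.

Fixpoint infer_cmd (tym : option nat) (f : nat -> option nat) (c : cmd) : nat -> option nat :=
  match c with
  | Loc ls => foldl (fun f i => let rt := result_type f i in raise_type f rt.1 rt.2) f ls
  | Rd _ _ r _ => raise_type f r tym
  | Wr _ _ _ _ | Mark _ _ => f
  | Seq c1 c2 => infer_cmd tym (infer_cmd tym f c1) c2
  | While _ _ c => infer_cmd tym f c
  end.

(** [tmp] starts without a bound, since it receives differences of arbitrary words; 12 iterations
    are enough for the three programs. *)
Definition infer (K : nat) (tym : option nat) (c : cmd) : seq (option nat) :=
  iter 12 (fun tys => map (infer_cmd tym (nth (Some 1) tys) c) (iota 0 K))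
    (set_nth (Some 1) (nseq K (Some 1)) tmp None).

(** * Grouping equal keys *)

(* One round of a radix sort: the zeros keep their order, the ones are reversed
   behind them, so that a single prefix count determines the destinations. *)
Section Partition.
Variables (b : nat -> bool) (p : nat).

Definition zeros (i : nat) : nat := \sum_(0 <= j < i.+1) ~~ b j.

Definition dest (i : nat) : nat := if b i then p.-1 - (i - zeros i) else (zeros i).-1.

Lemma zerosS i : zeros i.+1 = zeros i + ~~ b i.+1.
Proof. by rewrite /zeros big_nat_recr. Qed.

Lemma zeros0 : zeros 0 = ~~ b 0.
Proof. by rewrite /zeros big_nat1. Qed.

Lemma zeros_le i : zeros i <= i.+1.
Proof. by elim: i => [|i IH]; rewrite ?zeros0 ?zerosS; case: (b _) => /=; lia. Qed.

Lemma zeros_lt i j : i < j -> zeros i + ~~ b j <= zeros j /\ zeros j + b j <= zeros i + (j - i).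
Proof.
move/subnKC <-; elim: (j - i.+1) => [|k IH].
  by rewrite addn0 zerosS; case: (b _) => /=; lia.
by rewrite addnS zerosS; move: IH; case: (b _) => /=; case: (b _) => /=; lia.
Qed.

Lemma zeros_self i : ~~ b i <= zeros i /\ zeros i + b i <= i.+1.
Proof.
case: i => [|i]; first by rewrite zeros0; case: (b _).
by have := zeros_le i; rewrite zerosS; case: (b _) => /=; lia.
Qed.

(** This order is all that the sort needs to know of [dest]: injectivity is read off it, and the
    invariant [grouped_step] compares places only. *)
Lemma dest_lt i j : i < p -> j < p ->
  (dest i < dest j) =
  [|| ~~ b i && b j, [&& ~~ b i, ~~ b j & i < j] | [&& b i, b j & j < i]].
Proof.
move=> ip jp; rewrite /dest.
have := zeros_self i; have := zeros_self j; have := zeros_self p.-1.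
have := @zeros_lt i j; have := @zeros_lt j i; have := @zeros_lt i p.-1; have := @zeros_lt j p.-1.
case: (ltngtP i j) => [ij|ij|<-]; case: (b i); case: (b j) => /=;
  case: (ltngtP i p.-1) => [ip'|ip'|ip']; rewrite ?ip' //;
  case: (ltngtP j p.-1) => [jp'|jp'|jp']; rewrite ?jp' //; lia.
Qed.

Lemma dest_bound i : i < p -> dest i < p.
Proof. by move=> ip; have := zeros_le i; rewrite /dest; case: (b i); lia. Qed.

Lemma dest_inj i j : i < p -> j < p -> dest i = dest j -> i = j.
Proof.
move=> ip jp E; have := dest_lt ip jp; have := dest_lt jp ip; rewrite E ltnn.
by case: (b i); case: (b j) => //=; rewrite ?orbF ?andbT; lia.
Qed.

Lemma dest_surj k : k < p -> exists2 i, i < p & dest i = k.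
Proof.
move=> kp; have u : uniq (map dest (iota 0 p)).
  rewrite map_inj_in_uniq ?iota_uniq // => i j; rewrite !mem_iota => /andP[_ ip] /andP[_ jp].
  exact: dest_inj.
have sub : {subset map dest (iota 0 p) <= iota 0 p}.
  move=> x /mapP[i]; rewrite !mem_iota => /andP[_ ip] ->.
  by rewrite dest_bound.
have [_ E] := uniq_min_size u sub (eq_leq (etrans (size_iota 0 p) (esym (etrans (size_map _ _) (size_iota 0 p))))).
have : k \in iota 0 p by rewrite mem_iota.
by rewrite -E => /mapP[i]; rewrite mem_iota => /andP[_ ip] ->; exists i.
Qed.

End Partition.

(* The words [f] are those of [g], permuted; those with a common value modulo
   [2^k] are adjacent, in increasing or in decreasing order of their source. *)
Definition grouped (p k m : nat) (g f : nat -> nat) : Prop :=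
  [/\ forall i, i < p -> exists2 j, j < p & f i = g j,
      forall j, j < p -> exists2 i, i < p & f i = g j,
      forall i j h, i < j -> j < h -> h < p -> f i = f h %[mod 2 ^ k] -> f j = f i %[mod 2 ^ k]
    & forall i j i' j', i < j -> j < p -> i' < j' -> j' < p ->
        f i = f j %[mod 2 ^ k] -> f i' = f i %[mod 2 ^ k] -> f j' = f i %[mod 2 ^ k] ->
        (f i %/ m < f j %/ m) = (f i' %/ m < f j' %/ m)].

Definition bit (k x : nat) : nat := (x %/ 2 ^ k) %% 2.

Lemma bit_lt2 k x : bit k x < 2.
Proof. by rewrite /bit ltn_mod. Qed.

Lemma modn_expS x k : x %% 2 ^ k.+1 = bit k x * 2 ^ k + x %% 2 ^ k.
Proof.
have d0 : 0 < 2 ^ k by rewrite expn_gt0.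
have E : x = x %/ 2 ^ k %/ 2 * 2 ^ k.+1 + (bit k x * 2 ^ k + x %% 2 ^ k).
  by rewrite addnA expnS mulnA -mulnDl -divn_eq -divn_eq.
rewrite {1}E modnMDl modn_small // expnS.
by have := bit_lt2 k x; have := ltn_pmod x d0; nia.
Qed.

Lemma mod_expS x y k :
  x = y %[mod 2 ^ k.+1] <-> bit k x = bit k y /\ x = y %[mod 2 ^ k].
Proof.
rewrite !modn_expS; split=> [E|[-> ->] //].
have d0 : 0 < 2 ^ k by rewrite expn_gt0.
have := congr1 (divn^~ (2 ^ k)) E; have := congr1 (modn^~ (2 ^ k)) E.
by rewrite /= !modnMDl !modn_mod !divnMDl // !(divn_small (ltn_pmod _ d0)) !addn0.
Qed.

Lemma grouped0 p m g : (forall i j, i < j -> j < p -> g i %/ m < g j %/ m) -> grouped p 0 m g g.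
Proof.
move=> inc; split=> [i ip|i ip|i j h _ _ _ _|i j i' j' ij jp ij' jp' _ _ _].
- by exists i. - by exists i. - by rewrite !modn1.
- by rewrite !inc.
Qed.

(** A group of level [k.+1] lies within one value of bit [k]. The round keeps the order of the zeros
    and reverses that of the ones, so each group stays contiguous and is kept or reversed as a
    whole, hence remains monotone. *)
Lemma grouped_step p k m g f f' :
  grouped p k m g f -> (forall x y, x < p -> y < p -> f x %/ m = f y %/ m -> x = y) ->
  (forall i, i < p -> f' (dest (fun q => bit k (f q) == 1) p i) = f i) ->
  grouped p k.+1 m g f'.
Proof.
move=> [G1 G2 G3 G4] inj E; set b := fun q => bit k (f q) == 1 in E.
have src i : i < p -> exists2 j, j < p & f' i = f j /\ dest b p j = i.
  by move=> ip; have [j jp <-] := dest_surj b ip; exists j => //; rewrite E.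
have bE x y : bit k (f x) = bit k (f y) -> b x = b y by rewrite /b => ->.
split.
- by move=> i ip; have [j jp [-> _]] := src i ip; apply: G1.
- move=> j jp; have [i ip <-] := G2 j jp; exists (dest b p i); last exact: E.
  exact: dest_bound.
- move=> i j h ij jh hp.
  have [x xp [-> xi]] := src i (ltn_trans ij (ltn_trans jh hp)).
  have [y yp [-> yj]] := src j (ltn_trans jh hp).
  have [z zp [-> zh]] := src h hp.
  move=> /mod_expS[bxz mxz]; apply/mod_expS.
  move: ij jh; rewrite -xi -yj -zh !dest_lt // -(bE _ _ bxz).
  have bb u v : b u = b v -> bit k (f u) = bit k (f v).
    by have := bit_lt2 k (f u); have := bit_lt2 k (f v); rewrite /b;
       case: (bit k (f u)) => [|[|]] //; case: (bit k (f v)) => [|[|]].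
  case bx: (b x); case by_: (b y); rewrite //= ?orbF ?andbF //= => h1 h2.
    split; first by apply: bb; rewrite bx by_.
    by rewrite (G3 z y x) // -mxz.
  by split; [apply: bb; rewrite bx by_ | apply: (G3 x y z)].
- move=> i j i' j' ij jp ij' jp'.
  have [x xp [-> xi]] := src i (ltn_trans ij jp); have [y yp [-> yj]] := src j jp.
  have [x' xp' [-> xi']] := src i' (ltn_trans ij' jp'); have [y' yp' [-> yj']] := src j' jp'.
  move=> /mod_expS[bxy mxy] /mod_expS[bx'x mx'x] /mod_expS[by'x my'x].
  move: ij ij'; rewrite -xi -yj -xi' -yj' !dest_lt //.
  rewrite -(bE _ _ bxy) (bE _ _ bx'x) (bE _ _ by'x).
  case: (b x); rewrite //= ?orbF => h1 h2; last first.
    by rewrite (G4 x y x' y').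
  have := G4 y x y' x' h1 xp h2 xp'; rewrite -!mxy => /(_ erefl my'x mx'x) H.
  have neq u v : u < v -> v < p -> u < p -> f u %/ m != f v %/ m.
    by move=> uv vp up; apply/eqP => /(inj _ _ up vp) uE; move: uv; rewrite uE ltnn.
  have := neq _ _ h1 xp yp; have := neq _ _ h2 xp' yp'; lia.
Qed.

(** ** The grouping program *)

(** A doubling step of a prefix sum: register 36 is the partial count, 32 the own scratch cell, 37
    the distance [d]. Register 39 is [d - q] truncated, so the guard [39 < 1] lets exactly the
    processors with [d <= q] read. *)
Definition scan_body : cmd :=
  Seq (Wr 3 4 32 36)
  (Seq (Loc [:: LConst 38 0; LOp Defs.Sub 39 37 0; LOp Mul 40 31 37; LOp Defs.Sub 41 32 40])
  (Seq (Rd 39 4 38 41)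
       (Loc [:: LMin 46 38 1; LOp Add 44 36 46; LMin 36 44 1; LOp Mul 42 37 5; LMin 37 42 45]))).

(** Register 33 is the word, 34 and 35 are [k] and [2 ^ k], 43 is the bit, 36 its negation and then
    the prefix count, 51 the destination of the word. *)
Definition group_body : cmd :=
  Seq (Loc [:: LOp Div 42 33 35; LOp Mod 43 42 5; LOp Defs.Sub 36 4 43; LConst 37 1])
  (Seq (While 37 1 scan_body)
  (Seq (Loc [:: LOp Defs.Sub 40 36 4; LOp Defs.Sub 41 4 43; LOp Mul 42 40 41;
                LOp Defs.Sub 46 0 36; LOp Defs.Sub 47 1 4; LOp Defs.Sub 49 47 46;
                LOp Mul 50 49 43; LOp Add 51 42 50; LOp Mul 52 31 51; LOp Add 53 30 52])
  (Seq (Wr 3 4 53 33)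
  (Seq (Rd 3 4 54 32)
       (Loc [:: LMin 33 54 48; LOp Mul 55 35 5; LMin 35 55 7; LOp Add 56 34 4; LMin 34 56 8]))))).

Definition grouping : cmd :=
  Seq (Loc [:: LOp Mul 40 31 0; LOp Add 32 30 40; LOp Mul 45 1 5; LOp Mul 48 7 7;
               LConst 34 0; LConst 35 1])
      (While 34 8 group_body).

Definition reg (s : state) (r v : nat) : Prop := forall q, rg s q r = v.

Section GroupingRun.
Variables (p N L sb st : nat) (excl : bool).
Hypothesis st_gt0 : 0 < st.
Hypothesis p_gt0 : 0 < p.
Hypothesis p_le : p <= 2 ^ L.
Hypothesis scratch_ok : forall q, q < p -> sb + st * q < N.

Definition slot (q : nat) : nat := sb + st * q.

Definition off_scratch (s s' : state) : Prop :=
  forall a, (forall q, q < p -> a <> slot q) -> mm s' a = mm s a.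

Lemma off_scratch_trans s1 s2 s3 : off_scratch s1 s2 -> off_scratch s2 s3 -> off_scratch s1 s3.
Proof. by move=> h1 h2 a na; rewrite h2 // h1. Qed.

Lemma slot_inj q q' : slot q = slot q' -> q = q'.
Proof. by clear -st_gt0; rewrite /slot; nia. Qed.

Definition genv (s : state) : Prop :=
  [/\ forall q, rg s q 0 = q, [/\ reg s 1 p, reg s 3 0, reg s 4 1 & reg s 5 2],
      [/\ reg s 7 (2 ^ L), reg s 8 L, reg s 30 sb & reg s 31 st],
      forall q, rg s q 32 = slot q & reg s 45 (p * 2) /\ reg s 48 (2 ^ L * 2 ^ L)].

Lemma genv_same rs s s' : genv s -> same_regs rs s s' ->
  ~~ has (mem rs) [:: 0; 1; 3; 4; 5; 7; 8; 30; 31; 32; 45; 48] -> genv s'.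
Proof.
move=> [h0 [h1 h3 h4 h5] [h7 h8 h30 h31] h32 [h45 h48]] fr.
move=> /=; rewrite !negb_or => /and5P[r0 r1 r3 r4 /and5P[r5 r7 r8 r30 /and5P[r31 r32 r45 r48 _]]].
by split; [|split|split| |split] => q; rewrite fr.
Qed.

(** What a processor has counted when the distance is [d]: the zeros among the last [d] places up to
    its own. Truncated subtraction cuts the window at the start of the array. *)
Definition window (b : nat -> bool) (d q : nat) : nat := \sum_(q.+1 - d <= j < q.+1) ~~ b j.

Lemma wp_scan b s : genv s -> reg s 37 1 -> (forall q, q < p -> rg s q 36 = ~~ b q) ->
  wp p N excl (While 37 1 scan_body)
    (fun s' => [/\ forall q, q < p -> rg s' q 36 = zeros b q, off_scratch s s'
                 & tm s' <= tm s + 40 * L + 2]) s.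
Proof.
move=> ge r37 r36.
(* The measure counts the doublings that may still be needed: [p <= d * 2 ^ m] excludes a further
   iteration at [m = 0]. *)
apply: (wp_while (m := L) (I := fun m s' => exists2 d, reg s' 37 d &
  [/\ [/\ 0 < d, p <= d * 2 ^ m & d <= p * 2], forall q, q < p -> rg s' q 36 = window b d q,
      off_scratch s s' & tm s' + 40 * m <= tm s + 40 * L])).
  exists 1 => //; split=> //; first by split; lia.
  by move=> q qp; rewrite r36 // /window subn1 /= big_nat1.
move=> m s1 fr [d d1 [[d0 dm d2] z1 os t1]].
have {fr} ge1 := genv_same ge fr isT.
case: (ltnP d p) => dp; [right|left]; last first.
  split; first by move=> q qp; rewrite /active d1; case: ge1 => _ [-> *]; rewrite -leqNgt.
  split=> //=; last by lia.
  move=> q qp; rewrite z1 // /window /zeros; have -> : q.+1 - d = 0 by lia.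
  by [].
split; first by move=> q qp; rewrite /active d1; case: ge1 => _ [-> *].
case: m dm t1 => [|m] dm t1; first by lia.
exists m => //.
case: (ge1) => h0 [h1 h3 h4 h5] [h7 h8 h30 h31] h32 [h45 h48].
apply: wp_seq; apply: wp_wr.
  split=> [q qp _|_ q q' _ _ _ _]; first by rewrite /= h32; exact: scratch_ok.
  by rewrite /= !h32 => /slot_inj.
move=> s2 R2 hit2 miss2 t2 _.
apply: wp_seq; apply: wp_loc => s3 R3 M3 t3 _.
have r39 q : rg s3 q 39 = d - q by symb R3; rewrite !R2 /= d1 h0.
have r41 q : rg s3 q 41 = slot q - st * d by symb R3; rewrite !R2 /= h32 h31 d1.
have r4 q : rg s3 q 4 = 1 by symb R3; rewrite R2; exact: h4.
have act3 q : active s3 39 4 q = (d <= q) by rewrite /active r39 r4; lia.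
have prev q : d <= q -> rg s3 q 41 = slot (q - d) by move=> dq; rewrite r41 /slot mulnBr; nia.
apply: wp_seq; apply: wp_rd.
  split=> [q qp|_ q q' qp qp']; rewrite !act3 => dq.
    by rewrite prev //; apply: scratch_ok; lia.
  by move=> dq'; rewrite !prev // => /slot_inj; lia.
move=> s4 R4 r38 M4 t4 _.
have winle e q' : window b e q' <= q'.+1.
  rewrite /window; apply: (@leq_trans (\sum_(q'.+1 - e <= j < q'.+1) 1)).
    by apply: leq_sum => j _; case: (b j).
  by rewrite sum_nat_const_nat; lia.
apply: wp_loc => s5 R5 M5 t5 _; exists (d * 2).
  move=> q /=; symb R5; rewrite !R4 //; do !symb R3; rewrite !R2 /= d1 h5 h45; lia.
split.
- by rewrite expnS mulnA in dm; split=> //; lia.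
- move=> q qp /=; symb R5; rewrite r38 act3 M3.
  have -> : rg s4 q 36 = window b d q by rewrite R4 //; symb R3; rewrite R2; exact: z1.
  have -> : rg s4 q 1 = p by rewrite R4 //; symb R3; rewrite R2; exact: h1.
  have -> : rg s3 q 38 = 0 by symb R3.
  case: leqP => dq.
    rewrite prev // -h32 hit2; first last.
    + by rewrite /active /= h3 h4.
    + lia.
    have E : window b d q + window b d (q - d) = window b (d * 2) q.
      rewrite /window addnC [RHS](big_cat_nat (n := q.+1 - d)) /=; try lia.
      by congr (_ + _); congr (bigop _ _ _); congr (index_iota _ _); lia.
    by rewrite /= z1; last lia; have := winle d (q - d); have := winle (d * 2) q; lia.
  have -> : window b (d * 2) q = window b d q.
    by rewrite /window; congr (bigop _ _ _); congr (index_iota _ _); lia.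
  by have := winle d q; rewrite min0n addn0; lia.
- apply: off_scratch_trans os _ => a na /=; rewrite M5 M4 M3 miss2 // => q qp _.
  by rewrite /= h32; exact: na.
- by move: t5 t4 t3 t2; rewrite /= /cost_local /=; lia.
Qed.

Variable key : nat -> nat.
Hypothesis key_lt : forall q, q < p -> key q < 2 ^ L.
Hypothesis L_gt0 : 0 < L.

(** The high part remembers the source. It keeps words with equal keys distinct and tells where an
    answer must be sent back. *)
Definition word (j : nat) : nat := j * 2 ^ L + key j.

Lemma word_div j : j < p -> word j %/ 2 ^ L = j.
Proof. by move=> jp; rewrite /word divnMDl ?expn_gt0 // divn_small ?addn0 ?key_lt. Qed.

Lemma word_mod j : j < p -> word j %% 2 ^ L = key j.
Proof. by move=> jp; rewrite /word modnMDl modn_small ?key_lt. Qed.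

(** A pigeonhole argument: [f] takes all the [p] distinct words on only [p] places. *)
Lemma grouped_inj k f x y : grouped p k (2 ^ L) word f -> x < p -> y < p ->
  f x %/ 2 ^ L = f y %/ 2 ^ L -> x = y.
Proof.
move=> [G1 G2 _ _] xp yp E.
have fE : f x = f y.
  have [j jp xj] := G1 x xp; have [j' jp' yj] := G1 y yp.
  by move: E; rewrite xj yj !word_div // => ->.
have uf : uniq (map f (iota 0 p)).
  apply: (@leq_size_uniq _ (map word (iota 0 p))); last by rewrite !size_map.
    rewrite map_inj_in_uniq ?iota_uniq // => i j; rewrite !mem_iota => /andP[_ ip] /andP[_ jp].
    by move/(congr1 (divn^~ (2 ^ L))); rewrite /= !word_div.
  move=> z /mapP[j]; rewrite mem_iota => /andP[_ jp] ->.
  by have [i ip <-] := G2 j jp; apply: map_f; rewrite mem_iota.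
apply/eqP; rewrite -(nth_uniq 0 _ _ uf) ?size_map ?size_iota //.
by rewrite !(nth_map 0) ?size_iota // !nth_iota // !add0n fE.
Qed.

Lemma word_bound k f x : grouped p k (2 ^ L) word f -> x < p -> f x < 2 ^ L * 2 ^ L.
Proof.
by move=> [G1 _ _ _] xp; have [j jp ->] := G1 x xp; have := key_lt jp; rewrite /word; nia.
Qed.

Lemma wp_grouping s :
  [/\ forall q, rg s q 0 = q, [/\ reg s 1 p, reg s 3 0, reg s 4 1 & reg s 5 2]
     & [/\ reg s 7 (2 ^ L), reg s 8 L, reg s 30 sb & reg s 31 st]] ->
  (forall q, q < p -> rg s q 33 = word q) ->
  wp p N excl grouping
    (fun s' => exists2 f, grouped p L (2 ^ L) word f &
       [/\ forall q, q < p -> rg s' q 33 = f q, forall q, q < p -> mm s' (slot q) = f q,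
           forall q, rg s' q 32 = slot q, off_scratch s s'
         & tm s' <= tm s + (40 * L + 100) * L + 20]) s.
Proof.
move=> [h0 [h1 h3 h4 h5] [h7 h8 h30 h31]] h33.
apply: wp_seq; apply: wp_loc => s1 R1 M1 t1 _.
have ge : genv s1.
  split; [|split|split| |split] => q; symb R1;
    by rewrite ?h0 ?h1 ?h3 ?h4 ?h5 ?h7 ?h8 ?h30 ?h31.
apply: (wp_while (m := L) (I := fun m s' => exists2 k, [/\ k <= L, m = L - k, reg s' 34 k & reg s' 35 (2 ^ k)] &
  exists2 f, grouped p k (2 ^ L) word f &
    [/\ forall q, q < p -> rg s' q 33 = f q, 0 < k -> forall q, q < p -> mm s' (slot q) = f q,
        off_scratch s s' & tm s' <= tm s + (40 * L + 100) * k + 10])).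
  exists 0; first by split; rewrite ?subn0 // => q; symb R1.
  exists word; first by apply: grouped0 => i j ij jp; rewrite !word_div //; apply: ltn_trans jp.
  split=> //; first by move=> q qp; symb R1; exact: h33.
    by move=> a _; rewrite M1.
  by move: t1; rewrite /= /cost_local /=; lia.
move=> m s2 fr [k [kL mE k1 pk] [f gf [f33 fm os t2]]].
have {fr ge} ge := genv_same ge fr isT.
case: (ltnP k L) => kl; [right|left]; last first.
  have kE : k = L by lia.
  subst k; split; first by move=> q qp; rewrite /active k1; case: ge => _ _ [_ -> *]; rewrite ltnn.
  exists f => //; split=> //=; first by move=> q qp; apply: fm.
    by case: ge.
  by lia.
split; first by move=> q qp; rewrite /active k1; case: ge => _ _ [_ -> *].
exists (L - k.+1); first by lia.
set b := fun q => bit k (f q) == 1.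
have bE q : ((f q %/ 2 ^ k) %% 2 = b q)%N.
  by rewrite /b /bit; have := ltn_mod (f q %/ 2 ^ k) 2; case: (_ %% 2) => [|[|]].
case: (ge) => g0 [g1 g3 g4 g5] [g7 g8 g30 g31] g32 [g45 g48].
apply: wp_seq; apply: wp_loc => s3 R3 M3 t3 _.
have ge3 : genv s3.
  by split; [|split|split| |split] => q; symb R3; rewrite /= ?g0 ?g1 ?g3 ?g4 ?g5 ?g7 ?g8 ?g30 ?g31 ?g32 ?g45 ?g48.
have s3z q : q < p -> rg s3 q 36 = ~~ b q.
  by move=> qp; symb R3; rewrite /= f33 // pk g5 g4 bE; case: (b q).
have s3b q : q < p -> rg s3 q 43 = b q.
  by move=> qp; symb R3; rewrite /= f33 // pk g5 bE.
have s3w q : q < p -> rg s3 q 33 = f q by move=> qp; symb R3; exact: f33.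
have s3k : reg s3 34 k by move=> q; symb R3; exact: k1.
have s3pk : reg s3 35 (2 ^ k) by move=> q; symb R3; exact: pk.
have s3d : reg s3 37 1 by move=> q; symb R3.
apply: wp_seq; apply: (wp_frame (wp_scan ge3 s3d s3z)) => s4 fr4 _ [z4 os4 t4].
have {ge3} ge4 := genv_same ge3 fr4 isT.
have b4 q : q < p -> rg s4 q 43 = b q by move=> qp; rewrite fr4 // s3b.
have w4 q : q < p -> rg s4 q 33 = f q by move=> qp; rewrite fr4 // s3w.
have k4 : reg s4 34 k by move=> q; rewrite fr4.
have pk4 : reg s4 35 (2 ^ k) by move=> q; rewrite fr4.
case: (ge4) => {}g0 [{}g1 {}g3 {}g4 {}g5] [{}g7 {}g8 {}g30 {}g31] {}g32 [{}g45 {}g48].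
apply: wp_seq; apply: wp_loc => s5 R5 M5 t5 _.
have ad5 q : q < p -> rg s5 q 53 = slot (dest b p q).
  move=> qp; symb R5; rewrite z4 // b4 // g0 g1 g4 g30 g31 /slot /dest.
  by case: (b q) => /=; rewrite ?muln0 ?muln1 ?addn0 ?subn1 ?subn0.
have aw5 : addresses_ok p N s5 true 3 4 53.
  split=> [q qp _|_ q q' qp qp' _ _]; first by rewrite ad5 //; apply: scratch_ok; exact: dest_bound.
  by rewrite !ad5 // => /slot_inj; exact: dest_inj.
have act5 q : active s5 3 4 q by rewrite /active; do !symb R5; rewrite g3 g4.
apply: wp_seq; apply: wp_wr => // s6 R6 hit6 miss6 t6 _.
have mm6 q : q < p -> mm s6 (slot (dest b p q)) = f q.
  by move=> qp; rewrite -ad5 // hit6 //; symb R5; exact: w4.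
have r32 q : rg s6 q 32 = slot q by rewrite R6; symb R5.
apply: wp_seq; apply: wp_rd.
  split=> [q qp _|_ q q' _ _ _ _]; rewrite !r32; first exact: scratch_ok.
  by move/slot_inj.
move=> s7 R7 r54 M7 t7 _.
have r7 r : r \notin [:: 40; 41; 42; 46; 47; 49; 50; 51; 52; 53; 54] -> forall q, rg s7 q r = rg s4 q r.
  move=> rn q; have r5 : r != 54 by apply: contraNneq rn => ->.
  rewrite R7 // R6 R5 -symE locals_frame //; apply: contraNN rn => /=.
  rewrite !inE; do ![case/orP=> [/eqP->|] //]; move/eqP => -> //.
apply: wp_loc => s8 R8 M8 t8 _; exists k.+1.
  split=> // q /=; symb R8; rewrite !r7 //; first by rewrite k4 g4 g8; lia.
  by rewrite pk4 g5 g7 -expnSr; apply/minn_idPl; rewrite leq_pexp2l.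
set f' := fun q => mm s6 (slot q).
have gf' : grouped p k.+1 (2 ^ L) word f'.
  apply: (grouped_step gf) => [x y xp yp|q qp]; first exact: grouped_inj gf xp yp.
  exact: mm6.
exists f' => //; split.
- move=> q qp /=; symb R8; rewrite r54 !r7 // g48 /active !R6.
  do !symb R5; rewrite g3 g4 g32 /=.
  by apply/minn_idPl; apply: ltnW; exact: word_bound gf' qp.
- by move=> _ q qp; rewrite /= M8 M7.
- apply: off_scratch_trans os _ => a na /=.
  rewrite M8 M7 miss6 => [|q qp _]; first by rewrite M5 os4 // M3.
  by rewrite ad5 //; apply: na; exact: dest_bound.
- by move: t8 t7 t6 t5 t4 t3; rewrite /= /cost_local /=; lia.
Qed.
End GroupingRun.

(** * Electing one processor for each key *)

Definition elect : cmd :=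
  Seq (Loc [:: LOp Mul 59 0 7; LMin 60 57 7; LOp Add 33 59 60])
  (Seq grouping
  (Seq (Loc [:: LOp Defs.Sub 61 32 31])
  (Seq (Rd 3 0 62 61)
  (Seq (Loc [:: LOp Mod 63 62 7; LOp Mod 64 33 7; LOp Defs.Sub 65 63 64; LOp Defs.Sub 66 64 63;
                LOp Add 67 65 66; LMin 68 67 4; LOp Defs.Sub 69 4 0; LOp Add 70 68 69;
                LMin 71 70 4; LOp Div 72 33 7; LOp Mul 73 31 72; LOp Add 74 30 73])
  (Seq (Wr 3 4 74 71)
       (Rd 3 4 58 32)))))).

Section Election.
Variables (p N L sb st : nat) (excl : bool).
Hypothesis st_gt0 : 0 < st.
Hypothesis p_gt0 : 0 < p.
Hypothesis p_le : p <= 2 ^ L.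
Hypothesis L_gt0 : 0 < L.
Hypothesis scratch_ok : forall q, q < p -> sb + st * q < N.
Variable key : nat -> nat.
Hypothesis key_lt : forall q, q < p -> key q < 2 ^ L.

Let wd := word L key.

(* The leader of a group is its first member. *)
Definition first (f : nat -> nat) (i : nat) : bool :=
  (i == 0) || (f i.-1 %% 2 ^ L != f i %% 2 ^ L).

(** Were there two first members of one group, contiguity would give the place just before the later
    one the same key. *)
Lemma first_unique f i i' : grouped p L (2 ^ L) wd f -> i < p -> i' < p ->
  first f i -> first f i' -> f i = f i' %[mod 2 ^ L] -> i = i'.
Proof.
move=> [_ _ G3 _].
have lt x y : x < y -> y < p -> f x = f y %[mod 2 ^ L] -> first f y -> False.
  move=> xy yp E /orP[/eqP y0|/eqP]; first by move: xy; rewrite y0.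
  case: (ltngtP x y.-1) => h; last by rewrite -h.
    by rewrite (G3 x y.-1 y) ?E //; lia.
  by move: h; lia.
move=> ip ip' fi fi' E; case: (ltngtP i i') => // h; first by case: (lt _ _ h ip' E fi').
by case: (lt _ _ h ip (esym E) fi).
Qed.

Lemma first_exists f i : i < p ->
  exists2 j, j <= i & first f j /\ f j = f i %[mod 2 ^ L].
Proof.
move=> ip; have ex : exists j, f j %% 2 ^ L == f i %% 2 ^ L by exists i.
case: (ex_minnP ex) => j /eqP E min; exists j; first exact: min.
split=> //; rewrite /first; case: j E min => [//|j] E min /=.
by apply/eqP => E'; have := min j; rewrite E' E eqxx => /(_ isT); rewrite ltnn.
Qed.

Definition elected (lead : nat -> bool) : Prop :=
  (forall q q', q < p -> q' < p -> lead q -> lead q' -> key q = key q' -> q = q') /\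
  (forall q, q < p -> exists2 q', q' < p & lead q' /\ key q' = key q).

(** Once equal keys are adjacent, a word leads its group if its left neighbour has another key or
    does not exist. The flag is written to the slot of the word's source, where that processor finds
    it. *)
Lemma wp_elect s :
  [/\ forall q, rg s q 0 = q, [/\ reg s 1 p, reg s 3 0, reg s 4 1 & reg s 5 2]
     & [/\ reg s 7 (2 ^ L), reg s 8 L, reg s 30 sb & reg s 31 st]] ->
  (forall q, q < p -> rg s q 57 = key q) ->
  wp p N excl elect
    (fun s' => exists2 lead, elected lead &
       [/\ forall q, q < p -> rg s' q 58 = lead q, forall q, rg s' q 32 = slot sb st q,
           off_scratch p sb st s s' & tm s' <= tm s + (40 * L + 100) * L + 60]) s.
Proof.
move=> ge hk; case: (ge) => h0 [h1 h3 h4 h5] [h7 h8 h30 h31].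
apply: wp_seq; apply: wp_loc => s1 R1 M1 t1 _.
have w1 q : q < p -> rg s1 q 33 = wd q.
  move=> qp; symb R1; rewrite h0 h7 hk // /word; congr (_ + _).
  by apply/minn_idPl; rewrite ltnW ?key_lt.
have ge1 : [/\ forall q, rg s1 q 0 = q, [/\ reg s1 1 p, reg s1 3 0, reg s1 4 1 & reg s1 5 2]
     & [/\ reg s1 7 (2 ^ L), reg s1 8 L, reg s1 30 sb & reg s1 31 st]].
  by split; [|split|split] => q; symb R1.
apply: wp_seq; apply: (wp_frame (wp_grouping excl st_gt0 p_gt0 p_le scratch_ok key_lt L_gt0 ge1 w1)).
move=> s2 fr2 _ [f gf [f33 fm a32 os t2]].
have fr r : r \notin [:: 33; 59; 60; 6] -> r \notin mods grouping -> forall q, rg s2 q r = rg s q r.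
  move=> rn rm q; rewrite fr2 // R1 -symE locals_frame //; apply: contraNN rn => /=.
  by rewrite !inE => /or4P[] /eqP->.
have g0 q : rg s2 q 0 = q by rewrite fr.
have g3 : reg s2 3 0 by move=> q; rewrite fr.
have g4 : reg s2 4 1 by move=> q; rewrite fr.
have g7 : reg s2 7 (2 ^ L) by move=> q; rewrite fr.
have g30 : reg s2 30 sb by move=> q; rewrite fr.
have g31 : reg s2 31 st by move=> q; rewrite fr.
apply: wp_seq; apply: wp_loc => s3 R3 M3 t3 _.
have prev q : 0 < q -> rg s3 q 61 = slot sb st q.-1.
  by move=> q0; symb R3; rewrite a32 g31 /slot; nia.
have act3 q : active s3 3 0 q = (0 < q) by rewrite /active; do !symb R3; rewrite g3 g0.
apply: wp_seq; apply: wp_rd.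
  split=> [q qp|_ q q' _ _]; rewrite !act3 => q0.
    by rewrite prev //; apply: scratch_ok; lia.
  move=> q0'; rewrite (prev q) // (prev q') // => /(slot_inj st_gt0) E; lia.
move=> s4 R4 r62 M4 t4 _.
have r4 r : r != 61 -> r != 62 -> forall q, rg s4 q r = rg s2 q r.
  move=> n1 n2 q; rewrite R4 // R3 -symE locals_frame //= !inE //.
apply: wp_seq; apply: wp_loc => s5 R5 M5 t5 _.
have src5 i j : i < p -> j < p -> f i = wd j -> rg s5 i 74 = slot sb st j.
  by move=> ip jp fi; symb R5; rewrite !r4 // f33 // g30 g31 g7 fi (word_div key_lt jp).
have lead5 i : i < p -> rg s5 i 71 = first f i.
  move=> ip; symb R5; rewrite r62 !r4 // f33 // g7 g4 g0 /first act3.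
  case: (posnP i) => [->|i0] /=; first by rewrite subn0; lia.
  rewrite prev // M3 fm; last lia.
  by rewrite neq_ltn; case: (ltngtP (f i.-1 %% 2 ^ L) (f i %% 2 ^ L)) => h /=; lia.
have src i : i < p -> exists2 j, j < p & f i = wd j by case: gf => G1 _ _ _; exact: G1.
have aw5 : addresses_ok p N s5 true 3 4 74.
  split=> [q qp _|_ q q' qp qp' _ _].
    by have [j jp fq] := src q qp; rewrite (src5 q j) //; exact: scratch_ok.
  have [j jp fq] := src q qp; have [j' jp' fq'] := src q' qp'.
  rewrite (src5 q j) // (src5 q' j') // => /(slot_inj st_gt0) jj.
  by apply: (grouped_inj key_lt gf) => //; rewrite fq fq' jj.
have act5 q : active s5 3 4 q by rewrite /active; do !symb R5; rewrite !r4 // g3 g4.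
apply: wp_seq; apply: wp_wr => // s6 R6 hit6 miss6 t6 _.
have g32 q : rg s6 q 32 = slot sb st q by rewrite R6; symb R5; rewrite r4.
apply: wp_rd.
  split=> [q qp _|_ q q' _ _ _ _]; rewrite !g32; first exact: scratch_ok.
  by move/(slot_inj st_gt0).
move=> s7 R7 r58 M7 t7 _.
case: (gf) => _ G2 _ _.
have leadE i j : i < p -> j < p -> f i = wd j -> mm s6 (slot sb st j) = first f i.
  by move=> ip jp fi; rewrite -(src5 i j) // hit6 // lead5.
exists (fun q => mm s6 (slot sb st q) == 1).
  split=> [q q' qp qp'|q qp].
    have [i ip fi] := G2 q qp; have [i' ip' fi'] := G2 q' qp'.
    rewrite (leadE i q) // (leadE i' q') //.
    case fst: (first f i) => //; case fst': (first f i') => // _ _ kk.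
    have ii : i = i'.
      apply: (first_unique gf) => //.
      by rewrite fi fi' (word_mod key_lt qp) (word_mod key_lt qp').
    by have := word_div key_lt qp; rewrite -fi ii fi' (word_div key_lt qp').
  have [i ip fi] := G2 q qp; have [i' ii' [fst fm']] := first_exists f ip.
  have ip' : i' < p by lia.
  have [j jp fj] := src i' ip'; exists j => //; rewrite (leadE i' j) // fst; split=> //.
  by move: fm'; rewrite fj fi (word_mod key_lt jp) (word_mod key_lt qp).
split.
- move=> q qp; rewrite r58 /active R6 R6; do !symb R5; rewrite !r4 // g3 g4 /= g32.
  have [i ip fi] := G2 q qp.
  by rewrite (leadE i q) //; case: (first f i).
- by move=> q; rewrite R7.
- move=> a na; rewrite M7 miss6 => [|q qp _].
    by rewrite M5 M4 M3 os // M1.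
  by have [j jp fq] := src q qp; rewrite (src5 q j) //; exact: na.
- by move: t7 t6 t5 t4 t3 t2 t1; rewrite /= /cost_local /=; lia.
Qed.
End Election.

(** * Rounds of independent operations *)

Definition keys (W : seq (nat * nat)) : seq nat := [seq x.1 | x <- W].

Definition apply_writes (W : seq (nat * nat)) (M : memory) : memory :=
  foldl (fun M x => upd M x.1 x.2) M W.

Lemma apply_writes_miss W M a : a \notin keys W -> apply_writes W M a = M a.
Proof.
elim: W M => [//|x W IH] M /=; rewrite inE negb_or => /andP[ax aW].
by rewrite IH // upd_other.
Qed.

Lemma apply_writes_hit W M x : uniq (keys W) -> x \in W -> apply_writes W M x.1 = x.2.
Proof.
elim: W M => [//|y W IH] M /= /andP[yW uW]; rewrite inE => /orP[/eqP->|xW]; last exact: IH.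
by rewrite apply_writes_miss // upd_same.
Qed.

(** An operation need not be a fixed list of writes in general: this is only asked for memories that
    differ from [M] at cells written by other members of the batch. Disjoint write sets then make
    every order produce the union of the writes. *)
Lemma independent_batch (op : nat -> memory -> memory) (W : nat -> seq (nat * nat))
    (sel : seq nat) (M M' : memory) :
  uniq sel ->
  (forall l, l \in sel -> uniq (keys (W l))) ->
  (forall l l' a, l \in sel -> l' \in sel -> l != l' ->
     a \in keys (W l) -> a \notin keys (W l')) ->
  (forall l M1, l \in sel ->
     (forall a, (forall l', l' \in sel -> l' != l -> a \notin keys (W l')) -> M1 a = M a) ->
     op l M1 = apply_writes (W l) M1) ->
  (forall l x, l \in sel -> x \in W l -> M' x.1 = x.2) ->
  (forall a, (forall l, l \in sel -> a \notin keys (W l)) -> M' a = M a) ->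
  forall s, perm_eq s sel -> foldl (fun M i => op i M) M s = M'.
Proof.
move=> usel uW disj opW hit miss s ps.
have claim r : uniq r -> {subset r <= sel} ->
    (forall l x, l \in r -> x \in W l -> foldl (fun M i => op i M) M r x.1 = x.2) /\
    (forall a, (forall l, l \in r -> a \notin keys (W l)) -> foldl (fun M i => op i M) M r a = M a).
  elim/last_ind: r => [|r l IH] //; rewrite rcons_uniq => /andP[lr ur] sub.
  have [|h1 h2] := IH ur; first by move=> x xr; apply: sub; rewrite mem_rcons inE xr orbT.
  have lsel : l \in sel by apply: sub; rewrite mem_rcons mem_head.
  have rsel x : x \in r -> x \in sel by move=> xr; apply: sub; rewrite mem_rcons inE xr orbT.
  rewrite foldl_rcons opW // => [|a na].
  - split=> [l' x|a na].
      rewrite mem_rcons inE => /orP[/eqP->|l'r] xW.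
        exact: apply_writes_hit (uW _ lsel) xW.
      rewrite apply_writes_miss; first exact: h1 l'r xW.
      apply: (disj l') => //; first exact: rsel.
        by apply: contraNneq lr => <-.
      by apply: map_f.
    rewrite apply_writes_miss; last by apply: na; rewrite mem_rcons mem_head.
    by apply: h2 => l' l'r; apply: na; rewrite mem_rcons inE l'r orbT.
  - apply: h2 => l' l'r; apply: na; first exact: rsel.
    by apply: contraNneq lr => <-.
have us : uniq s by rewrite (perm_uniq ps).
have [|h1 h2] := claim s us; first by move=> x; rewrite (perm_mem ps).
apply: functional_extensionality => a.
case: (boolP (has (fun l => a \in keys (W l)) s)) => [/hasP[l ls /mapP[x xW ->]]|/hasPn no].
  by rewrite (h1 l) // (hit l) // -(perm_mem ps).
by rewrite h2 // miss // => l; rewrite -(perm_mem ps); exact: no.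
Qed.

Section Chain.
Variable op : nat -> memory -> memory.

Fixpoint chain (t : nat) (M : memory) (l : seq (nat * seq nat * memory)) : Prop :=
  match l with
  | [::] => True
  | (u, b, M') :: l' =>
      [/\ t <= u, forall s, perm_eq s b -> foldl (fun M i => op i M) M s = M'
        & chain u M' l']
  end.

Definition last_mark (t : nat) (M : memory) (l : seq (nat * seq nat * memory)) : nat * memory :=
  foldl (fun _ e => (e.1.1, e.2)) (t, M) l.

Lemma chain_rcons t M l u b M' :
  chain t M l -> (last_mark t M l).1 <= u ->
  (forall s, perm_eq s b -> foldl (fun M i => op i M) (last_mark t M l).2 s = M') ->
  chain t M (rcons l (u, b, M')).
Proof.
elim: l t M => [|[[v c] M1] l IH] t M //= [tv h ch] lu st.
by split=> //; apply: IH.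
Qed.

Lemma last_mark_rcons t M l u b M' : last_mark t M (rcons l (u, b, M')) = (u, M').
Proof. by rewrite /last_mark foldl_rcons. Qed.

(** [in_rounds] also asks that nothing changes after the last checkpoint. The programs ensure it by
    marking an empty batch at their very end. *)
Lemma chain_rounds N hist t M l :
  chain t M l -> hist t = M ->
  (forall e, List.In e l -> hist e.1.1 = e.2) ->
  (forall u, (last_mark t M l).1 <= u -> hist u = hist (last_mark t M l).1) ->
  in_rounds op N hist t (map fst l).
Proof.
elim: l t M => [|[[v c] M1] l IH] t M /=; first by move=> _ _ _ h u tu a _; rewrite h.
move=> [tv h ch] ht hl fin; have hv : hist v = M1 := hl _ (or_introl erefl).
split=> //; first by move=> s ps a _; rewrite ht h ?hv.
by apply: IH ch hv _ fin => e el; apply: hl; right.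
Qed.
End Chain.

(** * Processing the input by chunks of p elements *)

(** Finds [2 ^ L] (register 7) and [L] (register 8) by doubling up to [2n + 2]. Registers 3, 4, 5
    hold the constants 0, 1, 2 from here on; 3 is 0 because private memory starts at 0. *)
Definition preamble : cmd :=
  Seq (Loc [:: LConst 4 1; LConst 5 2; LOp Mul 75 5 2; LOp Add 76 75 5; LOp Mul 77 76 5;
               LConst 7 1; LConst 8 0])
      (While 7 76 (Loc [:: LOp Mul 78 7 5; LMin 7 78 77; LOp Add 79 8 4; LMin 8 79 77])).

Definition chunk_head : seq linstr :=
  [:: LOp Defs.Sub 80 2 1; LMin 10 9 80; LOp Add 11 10 0; LOp Defs.Sub 81 9 11; LMin 82 81 4;
      LOp Defs.Sub 12 4 82].

Definition chunk_tail : seq linstr := [:: LOp Add 83 10 1; LMin 9 83 2].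

(* The elements below the value D of register 9 are done.  The next chunk starts
   at min D (n - p), so that all chunks have exactly p elements; register 11 is
   the element of the processor, and register 12 is 0 if it is done already. *)
Definition chunked (body : cmd) : cmd :=
  Seq preamble
  (Seq (While 9 2 (Seq (Loc chunk_head) (Seq body (Loc chunk_tail)))) (Mark 3 3)).

(** The bound [2n + 2] leaves room below [2 ^ L] for everything that is packed into words: keys up
    to [2n] in tree elections, and reports up to [2p + 1] in the permutation. *)
Definition bits (n : nat) : nat := up_log 2 n.*2.+2.

Lemma bits_gt k n : (2 ^ k < n.*2.+2) = (k < bits n).
Proof.
apply/idP/idP => [h|]; first by rewrite ltnNge; apply/negP => /(leq_pexp2l (isT : 0 < 2));
  have := up_logP n.*2.+2 (isT : 1 < 2); rewrite -/(bits n); lia.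
by apply: contraTT; rewrite -!leqNgt => h; apply: up_log_min.
Qed.

Lemma bits_le n : n.*2.+2 <= 2 ^ bits n.
Proof. exact: up_logP. Qed.

Lemma bits_gt0 n : 0 < bits n.
Proof. by rewrite -bits_gt expn0. Qed.

Definition env (n p L : nat) (s : state) : Prop :=
  [/\ forall q, rg s q 0 = q, [/\ reg s 1 p, reg s 2 n, reg s 3 0, reg s 4 1 & reg s 5 2]
    & reg s 7 (2 ^ L) /\ reg s 8 L].

Lemma env_same n p L rs s s' : env n p L s -> same_regs rs s s' ->
  ~~ has (mem rs) [:: 0; 1; 2; 3; 4; 5; 7; 8] -> env n p L s'.
Proof.
move=> [h0 [h1 h2 h3 h4 h5] [h7 h8]] fr /=.
rewrite !negb_or => /and5P[r0 r1 r2 r3 /and5P[r4 r5 r7 r8 _]].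
by split; [|split|split] => q; rewrite fr.
Qed.

Section Chunks.
Variables (n p N : nat) (excl : bool).
Hypothesis np : 0 < p <= n.

Lemma wp_preamble M :
  wp p N excl preamble
    (fun s => [/\ env n p (bits n) s, reg s 9 0, mm s = M, lg s = [::] & tm s <= 10 * bits n + 10])
    (start_state n p M).
Proof.
apply: wp_seq; apply: wp_loc => s R Ms ts ls.
apply: (wp_while (m := bits n) (I := fun m s' => exists2 j, j + m = bits n &
   [/\ env n p j s', reg s' 76 n.*2.+2, reg s' 77 (n.*2.+2 * 2) & [/\ reg s' 9 0, mm s' = M, lg s' = [::]
     & tm s' <= 10 * j + 7]])).
  exists 0 => //; split; [split; [|split|split]| | |] => [q|q|q|q|q|q|q|q|q|q|].
  all: try (by symb R).
  - by symb R => /=; lia.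
  - by symb R => /=; lia.
  by split; [move=> q; symb R | | | rewrite ts].
move=> m s1 _ [j jm [ge h76 h77 [h9 M1 l1 t1]]]; case: (ge) => h0 [h1 h2 h3 h4 h5] [h7 h8].
case: m jm => [|m] jm; [left|right].
  have jE : j = bits n by lia.
  subst j; split; first by move=> q qp; rewrite /active h7 h76 -leqNgt bits_le.
  by split=> //=; lia.
have lt : 2 ^ j < n.*2.+2 by rewrite bits_gt; lia.
split; first by move=> q qp; rewrite /active h7 h76.
exists m => //; apply: wp_loc => s2 R2 M2 t2 l2; exists j.+1; first by lia.
have jle : j < 2 ^ j by apply: ltn_expl.
split; [split; [|split|split]| | |] => [q|q|q|q|q|q|q|q|q|q|].
all: try (by rewrite /= R2; symc; rewrite /= ?h0 ?h1 ?h2 ?h3 ?h4 ?h5 ?h76 ?h77).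
- by symb R2; rewrite /= h7 h5 h77 expnSr; lia.
- by symb R2; rewrite /= h8 h4 h77; lia.
- split=> //=; first by move=> q; symb R2; exact: h9.
  + by rewrite M2.
  + by rewrite l2.
  + by move: t2; rewrite /= /cost_local /=; lia.
Qed.

(** The ceiling of [n / p]. *)
Definition chunks : nat := (n + p.-1) %/ p.

Variables (body : cmd) (J : nat -> memory -> seq (nat * seq nat * memory) -> nat -> Prop).
Variable cost : nat.
Hypothesis J_later : forall D M l t t', t <= t' -> J D M l t -> J D M l t'.
Hypothesis body_mods : ~~ has (mem (mods body)) [:: 0; 1; 2; 3; 4; 5; 7; 8; 9; 10; 11].
Hypothesis body_ok : forall D s, D < n -> env n p (bits n) s -> J D (mm s) (lg s) (tm s) ->
  (forall q, rg s q 11 = minn D (n - p) + q) ->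
  (forall q, rg s q 12 = (D <= minn D (n - p) + q)) ->
  wp p N excl body (fun s' => J (minn (minn D (n - p) + p) n) (mm s') (lg s') (tm s') /\
    tm s' <= tm s + cost) s.

Lemma wp_chunked M : J 0 M [::] 0 ->
  exists s', [/\ ev p N excl (chunked body) (start_state n p M) s',
    tm s' <= 10 * bits n + (cost + 30) * chunks + 20 &
    exists s1, [/\ J n (mm s1) (lg s1) (tm s1), tm s1 <= tm s', mm s' = mm s1
      & lg s' = rcons (lg s1) (tm s', [::], mm s')]].
Proof.
move=> J0; suff [s' e [b1 b2]] : wp p N excl (chunked body)
    (fun s' => tm s' <= 10 * bits n + (cost + 30) * chunks + 20 /\
      exists s1, [/\ J n (mm s1) (lg s1) (tm s1), tm s1 <= tm s', mm s' = mm s1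
      & lg s' = rcons (lg s1) (tm s', [::], mm s')]) (start_state n p M).
  by exists s'.
apply: wp_seq; apply: (wp_conseq (wp_preamble M)) => s [ge h9 Ms ls ts].
have p0 : 0 < p by case/andP: np.
apply: wp_seq; apply: (wp_while (m := chunks) (I := fun m s' => exists2 D, [/\ reg s' 9 D, D <= n & (n - D + p.-1) %/ p <= m] &
   J D (mm s') (lg s') (tm s') /\ tm s' + (cost + 30) * m <= 10 * bits n + (cost + 30) * chunks + 10)).
  exists 0; first by split=> //; rewrite subn0.
  by split; [rewrite Ms ls; exact: J_later J0 | lia].
move=> m s1 fr [D [h9' Dn Dm] [J1 t1]].
have {fr ge} ge : env n p (bits n) s1.
  apply: env_same ge fr _; apply/hasPn => r rin /=.
  have : r \notin mods body.
    by apply: (hasPn body_mods); move: rin; rewrite !inE; do ![case/orP=> [/eqP-> //|]]; move/eqP->.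
  move: rin; rewrite !inE mem_cat !inE => rin /negbTE->.
  by move: rin; do ![case/orP=> [/eqP-> //|]]; move/eqP->.
case: (ge) => h0 [h1 h2 h3 h4 h5] [h7 h8].
case: (ltnP D n) => Dn'; [right|left]; last first.
  split; first by move=> q _; rewrite /active h9' h2 -leqNgt.
  exists (St (rg (tick s1 2)) (mm (tick s1 2)) (tm (tick s1 2))
    (rcons (lg s1) (tm s1 + 2, marked p (tick s1 2) 3 3, mm s1))); first exact: ev_mark.
  split=> /=; first by lia.
  have DE : D = n by lia.
  exists s1; split=> //=; [by rewrite -{1}DE | by lia | ].
  congr (rcons _ (_, _, _)); rewrite /marked /=.
  by rewrite (eq_filter (a2 := pred0)) ?filter_pred0 // => q; rewrite h3.
split; first by move=> q _; rewrite /active h9' h2.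
case: m Dm t1 => [|m] Dm t1.
  have : p %/ p <= (n - D + p.-1) %/ p by apply: leq_div2r; lia.
  by rewrite divnn p0; lia.
exists m => //; apply: wp_seq; apply: wp_loc => s2 R2 M2 t2 l2.
have ge2 : env n p (bits n) s2.
  split; [|split|split] => q; symb R2; [exact: h0|exact: h1|exact: h2|exact: h3|exact: h4|exact: h5|exact: h7|exact: h8].
have h10 q : rg s2 q 10 = minn D (n - p) by symb R2; rewrite /= h9' h2 h1.
have h11 q : rg s2 q 11 = minn D (n - p) + q by symb R2; rewrite /= h9' h2 h1 h0.
have h12 q : rg s2 q 12 = (D <= minn D (n - p) + q).
  by symb R2; rewrite /= h9' h2 h1 h0 h4; case: leqP; lia.
apply: wp_seq; apply: (wp_frame (body_ok Dn' ge2 _ h11 h12)).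
  by rewrite M2 l2 t2 /=; apply: J_later J1; lia.
move=> s3 fr3 _ [J3 t3]; apply: wp_loc => s4 R4 M4 t4 l4.
have fr3' r : r \in [:: 1; 2; 10] -> forall q, rg s3 q r = rg s2 q r.
  move=> ri q; apply: fr3; apply/negP => rm; case/negP: body_mods; apply/hasP; exists r => //.
  by move: ri; rewrite !inE => /or3P[] /eqP->.
exists (minn (minn D (n - p) + p) n).
  split; [|exact: geq_minr|].
    move=> q /=; symb R4; rewrite (fr3' 10) // (fr3' 1) // (fr3' 2) // h10.
    by case: ge2 => _ [-> -> *].
  case: (leqP D (n - p)) => Dp.
    have -> : minn (D + p) n = D + p by lia.
    have E : n - D + p.-1 = 1 * p + (n - (D + p) + p.-1) by lia.
    by move: Dm; rewrite E divnMDl //; lia.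
  have -> : minn (n - p + p) n = n by lia.
  by rewrite subnn divn_small //; lia.
rewrite /= M4 l4; split; first by apply: J_later J3; rewrite t4 /cost_local /=; lia.
by move: t4 t2; rewrite /= /cost_local /=; lia.
Qed.

Lemma chunks_mul : chunks * p <= n * 2.
Proof. by clear -np; rewrite /chunks; have := leq_trunc_div (n + p.-1) p; lia. Qed.

End Chunks.

Definition chunked_time (cst : nat -> nat) (n p : nat) : nat :=
  10 * bits n + (cst n + 30) * chunks n p + 20.

Lemma bits_log n : 1 < n -> bits n <= 3 * trunc_log 2 n.
Proof.
move=> n1; have t0 : 0 < trunc_log 2 n by rewrite trunc_log_gt0.
apply: (@leq_trans (trunc_log 2 n + 2)); last by lia.
apply: up_log_min => //; have := trunc_log_ltn n (isT : 1 < 2).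
by rewrite addnC expnD expnS; lia.
Qed.

(** The constants come from [bits n <= 3 * trunc_log 2 n] and [chunks n p * p <= 2 * n]; 50 is
    [10 * 3] for the preamble plus 20 for the additive term. *)
Lemma chunked_time_le cst A e n p : 0 < e -> cst n + 30 <= A * bits n ^ e ->
  1 < n -> 0 < p <= n ->
  chunked_time cst n p * p <= (50 + 2 * A * 3 ^ e) * n * trunc_log 2 n ^ e.
Proof.
move=> e0 cA n1 np; have t0 : 0 < trunc_log 2 n by rewrite trunc_log_gt0.
have bl := bits_log n1; have ch := chunks_mul np.
have be : bits n ^ e <= 3 ^ e * trunc_log 2 n ^ e.
  by rewrite -expnMn; case: e e0 {cA} => // e _; rewrite leq_exp2r.
have te : trunc_log 2 n <= trunc_log 2 n ^ e.
  by case: e e0 {cA be} => // e _; rewrite expnS leq_pmulr // expn_gt0 t0.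
set t := trunc_log 2 n ^ e in be te *.
have c1 : (cst n + 30) * (chunks n p * p) <= A * (3 ^ e * t) * (n * 2).
  by apply: leq_mul; [apply: leq_trans cA _; rewrite leq_mul2l be orbT | exact: ch].
have c2 : bits n * p <= 3 * t * n.
  by apply: leq_mul; [apply: leq_trans bl _; rewrite leq_mul2l te orbT | case/andP: np].
have c3 : p <= t * n by apply: (@leq_trans (1 * n)); [lia | rewrite leq_mul2r; apply/orP; right; lia].
have -> : chunked_time cst n p * p =
    10 * (bits n * p) + (cst n + 30) * (chunks n p * p) + 20 * p.
  by rewrite /chunked_time; nia.
have -> : (50 + 2 * A * 3 ^ e) * n * t = 50 * (t * n) + A * (3 ^ e * t) * (n * 2) by nia.
move: c1; rewrite -mulnA in c2; lia.
Qed.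

(** * List contraction *)

Lemma prev_neq_next i j : prev_ i <> next_ j.
Proof. by rewrite /prev_ /next_; lia. Qed.

Lemma prev_inj i j : prev_ i = prev_ j -> i = j.
Proof. by rewrite /prev_; lia. Qed.

Lemma next_inj i j : next_ i = next_ j -> i = j.
Proof. by rewrite /next_; lia. Qed.

(** * Simultaneous splicing of pairwise non-adjacent nodes *)

Section Linked.
Variables (n : nat) (rho : nat -> nat).

(* The nodes in [X] form doubly linked lists; [rho] increases along them. *)
Definition linked (X : pred nat) (M : memory) : Prop :=
  (forall v, X v -> v < n) /\
  forall v, X v ->
    (M (next_ v) = n \/
       [/\ X (M (next_ v)), M (prev_ (M (next_ v))) = v & rho v < rho (M (next_ v))]) /\
    (M (prev_ v) = n \/ X (M (prev_ v)) /\ M (next_ (M (prev_ v))) = v).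

(** The joint effect of all splices in [S], every value on the right being read from the old
    memory. *)
Definition spliced (S : pred nat) (M M' : memory) : Prop :=
  [/\ forall v, S v -> M (prev_ v) <> n -> M' (next_ (M (prev_ v))) = M (next_ v),
      forall v, S v -> M (next_ v) <> n -> M' (prev_ (M (next_ v))) = M (prev_ v)
    & forall a, (forall v, S v -> M (prev_ v) <> n -> a <> next_ (M (prev_ v))) ->
        (forall v, S v -> M (next_ v) <> n -> a <> prev_ (M (next_ v))) -> M' a = M a].

Variables (X S : pred nat) (M M' : memory).
Hypothesis lk : linked X M.
Hypothesis SX : forall v, S v -> X v.
Hypothesis indep : forall v, S v -> ~~ S (M (next_ v)).
Hypothesis sp : spliced S M M'.

Lemma Xn : ~~ X n.
Proof. by apply/negP => /lk.1; rewrite ltnn. Qed.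

Lemma Sn : ~~ S n.
Proof. by apply: contraNN Xn; exact: SX. Qed.

Lemma linked_prev v : X v -> M (prev_ v) <> n -> X (M (prev_ v)) /\ M (next_ (M (prev_ v))) = v.
Proof. by move=> /lk.2[_ []]. Qed.

Lemma linked_next v : X v -> M (next_ v) <> n ->
  [/\ X (M (next_ v)), M (prev_ (M (next_ v))) = v & rho v < rho (M (next_ v))].
Proof. by move=> /lk.2[[]]. Qed.

(** No two adjacent nodes are spliced, so a surviving pointer skips at most one node. *)
Lemma spliced_next v : X v -> ~~ S v ->
  M' (next_ v) = if S (M (next_ v)) then M (next_ (M (next_ v))) else M (next_ v).
Proof.
move=> Xv Sv; case: sp => hit1 hit2 miss; case: ifP => Sj.
  have jn : M (next_ v) <> n by move=> E; move: Sj; rewrite E (negbTE Sn).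
  have [_ E _] := linked_next Xv jn.
  have := hit1 _ Sj; rewrite E; apply => vn; move: Xv; rewrite vn (negbTE Xn) //.
apply: miss => u Su un; last by move=> E; apply: (@prev_neq_next _ _ (esym E)).
move=> /next_inj E; have [_ E'] := linked_prev (SX Su) un.
by move: Sj; rewrite E E' Su.
Qed.

Lemma spliced_prev v : X v -> ~~ S v ->
  M' (prev_ v) = if S (M (prev_ v)) then M (prev_ (M (prev_ v))) else M (prev_ v).
Proof.
move=> Xv Sv; case: sp => hit1 hit2 miss; case: ifP => Sj.
  have jn : M (prev_ v) <> n by move=> E; move: Sj; rewrite E (negbTE Sn).
  have [_ E] := linked_prev Xv jn.
  have := hit2 _ Sj; rewrite E; apply => vn; move: Xv; rewrite vn (negbTE Xn) //.
apply: miss => u Su un; first by exact: prev_neq_next.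
move=> /prev_inj E; have [_ E' _] := linked_next (SX Su) un.
by move: Sj; rewrite E E' Su.
Qed.

Lemma spliced_linked : linked (fun v => X v && ~~ S v) M'.
Proof.
split=> [v /andP[Xv _]|v /andP[Xv Sv]]; first exact: lk.1.
split.
  rewrite spliced_next //; case: ifP => Sj.
    have jn : M (next_ v) <> n by move=> E; move: Sj; rewrite E (negbTE Sn).
    have [Xj E r1] := linked_next Xv jn.
    case: (M (next_ (M (next_ v))) =P n) => [->|kn]; [by left | right].
    have [Xk E' r2] := linked_next Xj kn; have Sk := indep Sj.
    by rewrite Xk Sk spliced_prev // E' Sj E; split=> //; exact: ltn_trans r1 r2.
  case: (M (next_ v) =P n) => [->|jn]; [by left | right].
  have [Xj E r1] := linked_next Xv jn.
  by rewrite Xj Sj spliced_prev ?Sj // E (negbTE Sv).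
rewrite spliced_prev //; case: ifP => Sj.
  have jn : M (prev_ v) <> n by move=> E; move: Sj; rewrite E (negbTE Sn).
  have [Xj E] := linked_prev Xv jn.
  case: (M (prev_ (M (prev_ v))) =P n) => [->|kn]; [by left | right].
  have [Xk E'] := linked_prev Xj kn.
  have Sk : ~~ S (M (prev_ (M (prev_ v)))) by apply/negP => /indep; rewrite E' Sj.
  by rewrite Xk Sk spliced_next // E' Sj E.
case: (M (prev_ v) =P n) => [->|jn]; [by left | right].
have [Xj E] := linked_prev Xv jn.
by rewrite Xj Sj spliced_next ?Sj // E (negbTE Sv).
Qed.

Definition splice_writes (v : nat) : seq (nat * nat) :=
  (if M (prev_ v) != n then [:: (next_ (M (prev_ v)), M (next_ v))] else [::]) ++
  (if M (next_ v) != n then [:: (prev_ (M (next_ v)), M (prev_ v))] else [::]).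

Lemma splice_writesP v a : reflect
  ((M (prev_ v) <> n /\ a = next_ (M (prev_ v))) \/ (M (next_ v) <> n /\ a = prev_ (M (next_ v))))
  (a \in keys (splice_writes v)).
Proof.
rewrite /keys map_cat mem_cat; apply: (iffP orP).
  by case=> [|]; case: eqP => //= h; rewrite inE => /eqP ->; [left|right].
by case=> -[h ->]; [left|right]; case: eqP => //= _; rewrite mem_head.
Qed.

Lemma spliced_batch sel : uniq sel -> (forall v, (v \in sel) = S v) ->
  forall s, perm_eq s sel -> foldl (fun M i => splice n i M) M s = M'.
Proof.
move=> us selE; case: (sp) => hit1 hit2 miss.
(* By independence no splice of the batch writes a field of a node that is itself spliced, so each
   one reads its initial fields in any order. *)
have own v a : S v -> (exists2 u, S u & a \in keys (splice_writes u)) ->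
    a <> prev_ v /\ a <> next_ v.
  move=> Sv [u Su /splice_writesP[[h ->]|[h ->]]].
    split=> [/esym/prev_neq_next //|/next_inj E].
    have [_ E'] := linked_prev (SX Su) h; rewrite E in E'.
    by have := indep Sv; rewrite E' Su.
  split=> [/prev_inj E|/prev_neq_next //].
  have [_ E' _] := linked_next (SX Su) h.
  by have := indep Su; rewrite E Sv.
apply: (independent_batch (W := splice_writes)) => //.
- move=> v _; rewrite /keys /splice_writes; case: eqP; case: eqP => //= _ _.
  by rewrite inE andbT; apply/eqP => /esym/prev_neq_next.
- move=> v u a; rewrite !selE => Sv Su vu /splice_writesP[[h E]|[h E]];
    apply/splice_writesP => -[[h' E']|[h' E']]; rewrite E in E'.
  + have [_ F] := linked_prev (SX Sv) h; have [_ F'] := linked_prev (SX Su) h'.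
    by case/eqP: vu; rewrite -F -F' (next_inj E').
  + by case: (prev_neq_next (esym E')).
  + by case: (prev_neq_next E').
  + have [_ F _] := linked_next (SX Sv) h; have [_ F' _] := linked_next (SX Su) h'.
    by case/eqP: vu; rewrite -F -F' (prev_inj E').
- move=> v M1; rewrite selE => Sv H.
  have H' a : a = prev_ v \/ a = next_ v -> M1 a = M a.
    move=> av; apply: H => u; rewrite selE => Su uv; apply/negP => au.
    have [] := own v a Sv; first by exists u.
    by case: av.
  rewrite /splice (H' (prev_ v)); last by left.
  rewrite (H' (next_ v)); last by right.
  by rewrite /splice_writes; case: eqP; case: eqP.
- move=> v x; rewrite selE /splice_writes mem_cat => Sv /orP[]; case: eqP => //= h.
    by rewrite inE => /eqP -> /=; exact: hit1.
  by rewrite inE => /eqP -> /=; exact: hit2.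
- move=> a H; apply: miss => v Sv h E.
    by have := H v; rewrite selE => /(_ Sv)/splice_writesP; apply; left.
  by have := H v; rewrite selE => /(_ Sv)/splice_writesP; apply; right.
Qed.

End Linked.

(* Registers: 12 alive, 13 pass, 15 k, 16 2^k, 17 b, 20 next, 21 prev,
   34 selected. *)
Definition list_round : cmd :=
  Seq (Loc [:: LOp Mul 18 11 5; LOp Add 19 18 4])
  (Seq (Rd 3 12 20 19)
  (Seq (Rd 3 12 21 18)
  (Seq (Loc [:: LOp Div 22 11 16; LOp Mod 23 22 5; LOp Div 24 20 16; LOp Mod 25 24 5;
                LOp Defs.Sub 26 23 17; LOp Defs.Sub 27 17 23; LOp Add 28 26 27; LOp Defs.Sub 29 4 28;
                LOp Defs.Sub 30 25 17; LOp Defs.Sub 31 17 25; LOp Add 32 30 31;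
                LOp Mul 33 12 29; LOp Mul 34 33 32;
                LOp Defs.Sub 35 2 21; LMin 36 35 4; LOp Mul 37 34 36; LOp Mul 38 21 5; LOp Add 39 38 4;
                LOp Defs.Sub 40 2 20; LMin 41 40 4; LOp Mul 42 34 41; LOp Mul 43 20 5;
                LOp Defs.Sub 12 12 34])
  (Seq (Wr 3 37 39 20)
  (Seq (Wr 3 42 43 21)
       (Mark 11 34)))))).

Definition list_bit : cmd :=
  Seq (Loc [:: LConst 17 0]) (Seq list_round
  (Seq (Loc [:: LConst 17 1]) (Seq list_round
       (Loc [:: LOp Mul 85 16 5; LMin 16 85 7; LOp Add 86 15 4; LMin 15 86 8])))).

Definition list_pass : cmd :=
  Seq (Loc [:: LConst 15 0; LConst 16 1])
  (Seq (While 15 8 list_bit) (Loc [:: LOp Add 84 13 4; LMin 13 84 8])).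

Definition list_chunk : cmd := Seq (Loc [:: LConst 13 0]) (While 13 8 list_pass).

Lemma eq_bits L x y : (forall j, j < L -> bit j x = bit j y) -> x = y %[mod 2 ^ L].
Proof.
elim: L => [|L IH] H; first by rewrite !modn1.
by apply/mod_expS; split; [exact: H | apply: IH => j jL; apply: H; exact: ltnW].
Qed.

(** * Contracting one chunk of list nodes on the machine *)

Section ListRun.
Variables (n p : nat) (rho : nat -> nat) (M0 : memory) (D : nat).
Hypothesis np : 0 < p <= n.
Let L := bits n.
Let base := minn D (n - p).

Definition in_chunk (v : nat) : bool := base <= v < base + p.

Definition alive_ok (X : pred nat) (M : memory) (l : seq (nat * seq nat * memory)) (t : nat) : Prop :=
  [/\ linked n rho X M, chain (splice n) 0 M0 l, (last_mark 0 M0 l).1 <= t, (last_mark 0 M0 l).2 = M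
    & perm_eq (flatten [seq e.1.2 | e <- l]) [seq v <- iota 0 n | ~~ X v]].

Definition chunk_env (X : pred nat) (s : state) : Prop :=
  [/\ env n p L s, forall q, rg s q 11 = base + q, forall q, q < p -> rg s q 12 = X (base + q),
      alive_ok X (mm s) (lg s) (tm s) & forall v, ~~ in_chunk v -> X v = (D <= v < n)].

Lemma alive_later X M l t t' : t <= t' -> alive_ok X M l t -> alive_ok X M l t'.
Proof. by move=> tt' [h1 h2 h3 h4 h5]; split=> //; exact: leq_trans h3 tt'. Qed.

Lemma chunk_le : base + p <= n.
Proof. by rewrite /base; lia. Qed.

Lemma bits_small v : v <= n -> v < 2 ^ L.
Proof. by have := bits_le n; rewrite -/L; lia. Qed.

Definition selected (X : pred nat) (M : memory) (k b v : nat) : bool :=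
  [&& in_chunk v, X v, bit k v == b & bit k (M (next_ v)) != b].

Lemma wp_list_round X k b s : b < 2 -> chunk_env X s -> reg s 16 (2 ^ k) -> reg s 17 b ->
  wp p n.*2 true list_round
    (fun s' => [/\ chunk_env (fun v => X v && ~~ selected X (mm s) k b v) s',
        spliced n (selected X (mm s) k b) (mm s) (mm s') & tm s' <= tm s + 50]) s.
Proof.
move=> b2 [ge h11 h12 al Xout] h16 h17.
have [lk ch lt lm bt] := al; case: (ge) => h0 [h1 h2 h3 h4 h5] [h7 h8].
set S := selected X (mm s) k b.
have SX v : S v -> X v by case/and4P.
have SC v : S v -> in_chunk v by case/and4P.
have Xlt v : X v -> v < n by case: lk => h _; exact: h.
have indep v : S v -> ~~ S (mm s (next_ v)).
  by case/and4P => _ _ _ nb; apply/negP => /and4P[_ _ bb _]; rewrite bb in nb.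
apply: wp_seq; apply: wp_loc => s1 R1 M1 t1 l1.
have a18 q : rg s1 q 18 = prev_ (base + q) by symb R1; rewrite h11 h5 muln2.
have a19 q : rg s1 q 19 = next_ (base + q) by symb R1; rewrite h11 h5 h4 muln2 addn1.
have r1 r : r \notin [:: 18; 19] -> forall q, rg s1 q r = rg s q r.
  by move=> rn q; rewrite R1 -symE locals_frame.
have ok x q : q < p -> x = prev_ (base + q) \/ x = next_ (base + q) -> x < n.*2.
  by have := chunk_le; rewrite /prev_ /next_; case; lia.
have act1 q : q < p -> active s1 3 12 q = X (base + q).
  by move=> qp; rewrite /active !r1 // h3 h12 //; case: (X _).
apply: wp_seq; apply: wp_rd.
  split=> [q qp _|_ q q' qp qp' _ _]; first by rewrite a19; apply: (ok _ q) => //; right.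
  by rewrite !a19 => /next_inj; lia.
move=> s2 R2 r20 M2 t2 l2.
apply: wp_seq; apply: wp_rd.
  split=> [q qp _|_ q q' qp qp' _ _]; first by rewrite R2 // a18; apply: (ok _ q) => //; left.
  by rewrite !R2 // !a18 => /prev_inj; lia.
move=> s3 R3 r21 M3 t3 l3.
have r3 r : r \notin [:: 18; 19; 20; 21] -> forall q, rg s3 q r = rg s q r.
  rewrite !inE !negb_or => /and4P[n1 n2 n3 n4] q; rewrite R3 // R2 // r1 // !inE negb_or n1 //.
have c2 q : rg s3 q 2 = n by rewrite r3.
have c4 q : rg s3 q 4 = 1 by rewrite r3.
have c5 q : rg s3 q 5 = 2 by rewrite r3.
have c11 q : rg s3 q 11 = base + q by rewrite r3.
have c12 q : q < p -> rg s3 q 12 = X (base + q) by rewrite r3 //; exact: h12.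
have c16 q : rg s3 q 16 = 2 ^ k by rewrite r3.
have c17 q : rg s3 q 17 = b by rewrite r3.
have v20 q : q < p -> X (base + q) -> rg s3 q 20 = mm s (next_ (base + q)).
  by move=> qp Xq; rewrite R3 // r20 act1 // Xq a19 M1.
have v21 q : q < p -> X (base + q) -> rg s3 q 21 = mm s (prev_ (base + q)).
  move=> qp Xq; rewrite r21 R2 // a18 M2 M1 /active !R2 //.
  by rewrite -[_ < _]/(active s1 3 12 q) act1 // Xq.
apply: wp_seq; apply: wp_loc => s4 R4 M4 t4 l4.
have r4 r : r \in [:: 0; 1; 2; 3; 4; 5; 7; 8; 11] -> forall q, rg s4 q r = rg s q r.
  by rewrite !inE => rin q; rewrite R4; move: rin; do ![case/orP=> [/eqP->|]]; try move/eqP->; symc; rewrite r3.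
have s20 q : rg s4 q 20 = rg s3 q 20 by symb R4.
have s21 q : rg s4 q 21 = rg s3 q 21 by symb R4.
have sel q : q < p -> rg s4 q 34 = S (base + q).
  move=> qp; symb R4; rewrite c12 // c16 c17 c11 c5 c4 /S /selected /in_chunk.
  have -> : base <= base + q < base + p by lia.
  rewrite -/(bit k (base + q)) -/(bit k (rg s3 q 20)).
  case Xq: (X (base + q)) => //=; rewrite v20 // mul1n.
  have := bit_lt2 k (base + q); have := bit_lt2 k (mm s (next_ (base + q))).
  by move: b2; case: (b) => [|[|]] //; case: (bit k (base + q)) => [|[|]] //;
     case: (bit k (mm s _)) => [|[|]].
have nxle v : X v -> mm s (next_ v) <= n.
  by move=> Xv; case: lk => _ /(_ v Xv)[[->|[/Xlt/ltnW]]].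
have pvle v : X v -> mm s (prev_ v) <= n.
  by move=> Xv; case: lk => _ /(_ v Xv)[_ [->|[/Xlt/ltnW]]].
have g1 q : q < p -> active s4 3 37 q = S (base + q) && (mm s (prev_ (base + q)) != n).
  move=> qp; have -> : active s4 3 37 q = (0 < rg s4 q 34 * minn (rg s3 q 2 - rg s3 q 21) (rg s3 q 4)).
    by rewrite /active r4 // h3; do !symb R4.
  rewrite sel // c2 c4; case Sq: (S _) => //; rewrite v21 ?SX // mul1n.
  by have := pvle _ (SX _ Sq); rewrite /=; lia.
have g2 q : q < p -> active s4 3 42 q = S (base + q) && (mm s (next_ (base + q)) != n).
  move=> qp; have -> : active s4 3 42 q = (0 < rg s4 q 34 * minn (rg s3 q 2 - rg s3 q 20) (rg s3 q 4)).
    by rewrite /active r4 // h3; do !symb R4.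
  rewrite sel // c2 c4; case Sq: (S _) => //; rewrite v20 ?SX // mul1n.
  by have := nxle _ (SX _ Sq); rewrite /=; lia.
have a39 q : q < p -> S (base + q) -> rg s4 q 39 = next_ (mm s (prev_ (base + q))).
  by move=> qp Sq; symb R4; rewrite c4 c5 v21 ?SX // muln2 addn1.
have a43 q : q < p -> S (base + q) -> rg s4 q 43 = prev_ (mm s (next_ (base + q))).
  by move=> qp Sq; symb R4; rewrite c5 v20 ?SX // muln2.
apply: wp_seq; apply: wp_wr.
  (* Exclusiveness: each node is the successor of its predecessor, so different nodes have different
     predecessors. *)
  split=> [q qp|_ q q' qp qp']; rewrite g1 // => /andP[Sq /eqP Pq].
    rewrite a39 //; have [/Xlt + _] := linked_prev lk (SX _ Sq) Pq.
    by rewrite /next_; lia.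
  rewrite g1 // => /andP[Sq' /eqP Pq']; rewrite !a39 // => /next_inj E.
  have [_ F] := linked_prev lk (SX _ Sq) Pq; have [_ F'] := linked_prev lk (SX _ Sq') Pq'.
  by move: F'; rewrite -E F; lia.
move=> s5 R5 hit5 miss5 t5 l5.
have act5 q : active s5 3 42 q = active s4 3 42 q by rewrite /active !R5.
apply: wp_seq; apply: wp_wr.
  split=> [q qp|_ q q' qp qp']; rewrite act5 g2 // => /andP[Sq /eqP Pq].
    rewrite R5 a43 //; have [/Xlt + _ _] := linked_next lk (SX _ Sq) Pq.
    by rewrite /prev_; lia.
  rewrite act5 g2 // => /andP[Sq' /eqP Pq']; rewrite !R5 !a43 // => /prev_inj E.
  have [_ F _] := linked_next lk (SX _ Sq) Pq; have [_ F' _] := linked_next lk (SX _ Sq') Pq'.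
  by move: F'; rewrite -E F; lia.
move=> s6 R6 hit6 miss6 t6 l6.
have M4E : mm s4 = mm s by rewrite M4 M3 M2 M1.
have inC v : in_chunk v -> exists2 q, q < p & v = base + q.
  by rewrite /in_chunk => /andP[h h']; exists (v - base); lia.
have sp : spliced n S (mm s) (mm s6).
  split.
  - move=> v Sv Pv; have [q qp vE] := inC v (SC v Sv); subst v.
    rewrite -a39 // miss6 => [|q' qp']; last first.
      rewrite act5 g2 // R5 a39 // => /andP[Sq' _].
      by rewrite a43 // => /esym/prev_neq_next.
    by rewrite hit5 ?s20 ?v20 ?SX // g1 // Sv; apply/eqP.
  - move=> v Sv Pv; have [q qp vE] := inC v (SC v Sv); subst v.
    rewrite -a43 // -(R5 q 43) hit6 ?R5 ?s21 ?v21 ?SX // act5 g2 // Sv; exact/eqP.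
  - move=> a na1 na2; rewrite miss6 => [|q qp]; last first.
      rewrite act5 g2 // => /andP[Sq /eqP Pq]; rewrite R5 a43 //; exact: na2.
    rewrite miss5 ?M4E // => q qp; rewrite g1 // => /andP[Sq /eqP Pq].
    by rewrite a39 //; exact: na1.
apply: wp_mark; split=> //=; last by move: t6 t5 t4 t3 t2 t1; rewrite /cost_local /=; lia.
have lgE : lg s6 = lg s by rewrite l6 l5 l4 l3 l2 l1.
set sl := marked _ _ _ _.
have slE : sl = [seq base + q | q <- iota 0 p & S (base + q)].
  rewrite /sl /marked (eq_in_filter (a2 := fun q => S (base + q))); last first.
    move=> q; rewrite mem_iota => /andP[_ qp]; rewrite R6 R5 sel //; by case: (S _).
  by apply: eq_map => q; rewrite R6 R5 r4 // h11.
have usl : uniq sl.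
  by rewrite slE map_inj_uniq ?filter_uniq ?iota_uniq // => x y; lia.
have msl v : (v \in sl) = S v.
  rewrite slE; apply/mapP/idP => [[q]|Sv].
    by rewrite mem_filter => /andP[Sq _] ->.
  have [q qp vE] := inC v (SC v Sv); exists q => //.
  by rewrite mem_filter -vE Sv mem_iota.
split=> //=.
- split; [|split|split] => q; rewrite /= R6 R5 r4 //.
- by move=> q; rewrite R6 R5 r4.
- move=> q qp; rewrite R6 R5; have -> : rg s4 q 12 = rg s3 q 12 - rg s4 q 34 by do !symb R4.
  rewrite sel // c12 //; case Sq: (S _); last by rewrite andbT subn0.
  by rewrite (SX _ Sq).
- split.
  + exact: spliced_linked lk SX indep sp.
  + rewrite lgE; apply: chain_rcons => //; first by move: t6 t5 t4 t3 t2 t1 lt; lia.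
    by rewrite lm; move=> r pr; exact: (spliced_batch lk SX indep sp usl msl pr).
  + by rewrite last_mark_rcons.
  + by rewrite last_mark_rcons.
  + rewrite lgE map_rcons flatten_rcons /=.
    have uB : uniq (flatten [seq e.1.2 | e <- lg s]).
      by rewrite (perm_uniq bt) filter_uniq ?iota_uniq.
    apply: uniq_perm; rewrite ?filter_uniq ?iota_uniq //.
      rewrite cat_uniq uB usl andbT; apply/hasPn => v; rewrite msl => Sv.
      by rewrite (perm_mem bt) mem_filter (SX _ Sv).
    move=> v; rewrite mem_cat (perm_mem bt) !mem_filter msl mem_iota /= add0n.
    by rewrite negb_and negbK; case Sv: (S v); [have := Xlt _ (SX _ Sv) => -> | rewrite !orbF]; rewrite ?orbT ?andbT.
- move=> v Cv; rewrite Xout //.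
  have -> : S v = false by apply/negP => /SC; rewrite (negbTE Cv).
  by rewrite andbT.
Qed.

Lemma chunk_env_same rs X s s' : chunk_env X s -> same_regs rs s s' ->
  ~~ has (mem rs) [:: 0; 1; 2; 3; 4; 5; 7; 8; 11; 12] ->
  mm s' = mm s -> lg s' = lg s -> tm s <= tm s' -> chunk_env X s'.
Proof.
move=> [ge h11 h12 al out] fr nrs E1 E2 tt.
have n11 : 11 \notin rs by apply: (hasPn nrs).
have n12 : 12 \notin rs by apply: (hasPn nrs).
split=> //; last by rewrite E1 E2; exact: alive_later tt al.
- apply: env_same ge fr _; apply/hasPn => r ri; apply: (hasPn nrs).
  by move: ri; rewrite !inE; do ![case/orP=> [->|]; rewrite ?orbT //]; move->; rewrite ?orbT.
- by move=> q; rewrite fr.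
- by move=> q qp; rewrite fr // h12.
Qed.

Lemma loc_same_regs ls s s' :
  (forall q r, rg s' q r = den (sym ls r) (rg s q)) -> same_regs (flatten (map local_target ls)) s s'.
Proof. by move=> R q r rn; rewrite R -symE locals_frame. Qed.

(** Bookkeeping of a pass that began with nodes [X0] and memory [M1]: a survivor has lost its
    initial successor, or still has it, and then [A] records what the rounds so far revealed about
    the two indices. *)
Definition progress (A : nat -> nat -> Prop) (X0 : pred nat) (M1 : memory) (X : pred nat) (M : memory) :=
  (forall v, X v -> X0 v) /\
  forall v, in_chunk v -> X v -> (X0 (M1 (next_ v)) /\ ~~ X (M1 (next_ v))) \/
    (M (next_ v) = M1 (next_ v) /\ A v (M1 (next_ v))).

(** If a survivor with bit [b] keeps its successor, the only reason why it was not selected is that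
    the successor has bit [b] too. *)
Lemma progress_round A X0 M1 X M M' k b : linked n rho X M -> spliced n (selected X M k b) M M' ->
  progress A X0 M1 X M ->
  progress (fun v j => A v j /\ (bit k v = b -> bit k j = b)) X0 M1
    (fun v => X v && ~~ selected X M k b v) M'.
Proof.
move=> lk sp [sub P].
have SX v : selected X M k b v -> X v by case/and4P.
split=> [v /andP[/sub] //|v Cv /andP[Xv Sv]].
case: (P v Cv Xv) => [[X0j nXj]|[E Avj]]; first by left; rewrite X0j (negbTE nXj).
have := spliced_next lk SX sp Xv Sv; rewrite E.
case: ifP => Sj En; first by left; rewrite (sub _ (SX _ Sj)) andbC.
right; split=> //; split=> // bv; apply/eqP; move: Sv; rewrite /selected Cv Xv bv eqxx E /=.
by rewrite negbK.
Qed.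

Definition agree (k v j : nat) : Prop := forall i, i < k -> bit i v = bit i j.

Lemma progress_weaken (A A' : nat -> nat -> Prop) X0 M1 X M :
  (forall v j, A v j -> A' v j) -> progress A X0 M1 X M -> progress A' X0 M1 X M.
Proof.
move=> imp [sub P]; split=> // v Cv Xv.
by case: (P v Cv Xv) => [h|[h /imp h']]; [left | right].
Qed.

Lemma wp_list_bit X X0 M1 k s : k < L -> chunk_env X s -> reg s 15 k -> reg s 16 (2 ^ k) ->
  progress (agree k) X0 M1 X (mm s) ->
  wp p n.*2 true list_bit
    (fun s' => exists X', [/\ chunk_env X' s', reg s' 15 k.+1, reg s' 16 (2 ^ k.+1),
      progress (agree k.+1) X0 M1 X' (mm s') & tm s' <= tm s + 110]) s.
Proof.
move=> kL ce h15 h16 pr.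
apply: wp_seq; apply: wp_loc => s1 R1 E1 t1 l1.
have ce1 : chunk_env X s1.
  by apply: chunk_env_same ce (loc_same_regs R1) _ E1 l1 _; rewrite ?t1 ?leq_addr.
have r16 : reg s1 16 (2 ^ k) by move=> q; symb R1; exact: h16.
have r17 : reg s1 17 0 by move=> q; symb R1.
rewrite -E1 in pr; have lk1 : linked n rho X (mm s1) by case: ce1 => _ _ _ [].
apply: wp_seq; apply: (wp_frame (wp_list_round (isT : 0 < 2) ce1 r16 r17)) => s2 fr2 _ [ce2 sp2 t2].
have {}pr := progress_round lk1 sp2 pr.
apply: wp_seq; apply: wp_loc => s3 R3 E3 t3 l3.
set X2 := fun v => _ in ce2 pr.
have ce3 : chunk_env X2 s3.
  by apply: chunk_env_same ce2 (loc_same_regs R3) _ E3 l3 _; rewrite ?t3 ?leq_addr.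
have r16' : reg s3 16 (2 ^ k) by move=> q; symb R3; rewrite fr2.
have r17' : reg s3 17 1 by move=> q; symb R3.
rewrite -E3 in pr; have lk3 : linked n rho X2 (mm s3) by case: ce3 => _ _ _ [].
apply: wp_seq; apply: (wp_frame (wp_list_round (isT : 1 < 2) ce3 r16' r17')) => s4 fr4 _ [ce4 sp4 t4].
have {}pr := progress_round lk3 sp4 pr.
set X4 := fun v => _ in ce4 pr.
apply: wp_loc => s5 R5 E5 t5 l5; exists X4; split.
- by apply: chunk_env_same ce4 (loc_same_regs R5) _ E5 l5 _; rewrite ?t5 ?leq_addr.
- move=> q; symb R5; rewrite !fr4 //.
  have -> : rg s3 q 15 = k by symb R3; rewrite fr2 //; symb R1; exact: h15.
  by case: ce3 => -[_ [_ _ _ -> _] [_ ->]] *; lia.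
- move=> q; symb R5; rewrite !fr4 // r16'.
  case: ce3 => -[_ [_ _ _ _ ->] [-> _]] *; rewrite -expnSr.
  by apply/minn_idPl; rewrite leq_pexp2l.
- rewrite E5; apply: progress_weaken pr => v j [[ag h0] h1] i; rewrite ltnS leq_eqVlt.
  case/orP=> [/eqP->|]; last exact: ag.
  have := bit_lt2 k v; have := bit_lt2 k j; move: h0 h1.
  by case: (bit k v) => [|[|]] //; case: (bit k j) => [|[|]] // h0 h1; [have := h0 erefl | have := h1 erefl].
- by move: t5 t4 t3 t2 t1; rewrite /cost_local /=; lia.
Qed.

Definition remaining (X : pred nat) : nat := count X (iota base p).

(** After all bits, a survivor that kept its successor would equal it, against the growth of [rho].
    Null counts as the index [n], so a tail differs from it in some bit as well. Hence each survivor
    is charged to its spliced successor, injectively because prev recovers the survivor; that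
    successor lies in the chunk, since nothing else changes. *)
Lemma progress_halves X X0 M1 M : linked n rho X0 M1 ->
  (forall v, ~~ in_chunk v -> X v = X0 v) ->
  progress (agree L) X0 M1 X M -> remaining X * 2 <= remaining X0.
Proof.
move=> lk out [sub P].
have inI v : (v \in iota base p) = in_chunk v by rewrite mem_iota.
have gone v : in_chunk v -> X v -> X0 (M1 (next_ v)) /\ ~~ X (M1 (next_ v)).
  move=> Cv Xv; case: (P v Cv Xv) => // -[_ ag]; exfalso.
  have X0v := sub _ Xv; have vn : v < n by case: lk => + _; apply.
  have jn : M1 (next_ v) <= n.
    by case: lk => lt /(_ v X0v)[[->|[/lt/ltnW]]].
  have E : v = M1 (next_ v).
    by have := eq_bits ag; rewrite !modn_small //; apply: bits_small => //; exact: ltnW.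
  case: lk => _ /(_ v X0v)[[|[_ _]]]; rewrite -E; last by rewrite ltnn.
  by move=> vE; move: vn; rewrite vE ltnn.
set A := [seq v <- iota base p | X v].
set B := [seq v <- iota base p | X0 v && ~~ X v].
have le : size A <= size B.
  rewrite -(size_map (fun v => M1 (next_ v)) A); apply: uniq_leq_size.
    rewrite map_inj_in_uniq ?filter_uniq ?iota_uniq // => u v.
    rewrite !mem_filter !inI => /andP[Xu Cu] /andP[Xv Cv] E.
    have [/(fun h => proj1 lk _ h) jn _] := gone u Cu Xu.
    have nn w : X0 (M1 (next_ w)) -> M1 (next_ w) <> n.
      by case: lk => lt _ /lt + ?; lia.
    have [_ F _] := linked_next lk (sub _ Xu) (nn _ (proj1 (gone u Cu Xu))).
    have [_ F' _] := linked_next lk (sub _ Xv) (nn _ (proj1 (gone v Cv Xv))).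
    by rewrite -F -F' E.
  move=> j /mapP[v]; rewrite mem_filter inI => /andP[Xv Cv] ->.
  have [X0j nXj] := gone v Cv Xv; rewrite mem_filter X0j nXj inI /=.
  by apply: contraNT nXj => /out ->.
rewrite /remaining -!size_filter -/A muln2 -addnn.
have -> : size [seq v <- iota base p | X0 v] = size A + size B.
  rewrite !size_filter -(count_predUI X); rewrite [X in _ + X](@eq_count _ _ pred0) ?count_pred0 ?addn0.
    by apply: eq_count => v /=; case Xv: (X v); rewrite /= ?andbT ?(sub _ Xv) // andbC.
  by move=> v /=; case: (X v); rewrite ?andbF.
by rewrite leq_add2l.
Qed.

Lemma wp_list_pass X s c : c < L -> chunk_env X s -> reg s 13 c ->
  wp p n.*2 true list_pass
    (fun s' => exists2 X', chunk_env X' s' &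
      [/\ remaining X' * 2 <= remaining X, reg s' 13 c.+1 & tm s' <= tm s + 120 * L + 20]) s.
Proof.
move=> cL ce h13; apply: wp_seq; apply: wp_loc => s1 R1 E1 t1 l1.
have ce1 : chunk_env X s1.
  by apply: chunk_env_same ce (loc_same_regs R1) _ E1 l1 _; rewrite ?t1 ?leq_addr.
apply: wp_seq.
apply: (@wp_frame _ _ _ _ (fun s' => exists2 X', chunk_env X' s' &
    progress (agree L) X (mm s) X' (mm s') /\ tm s' <= tm s + 120 * L + 10)).
  apply: (wp_while (m := L) (I := fun m s' => exists k X', [/\ k + m = L, reg s' 15 k & reg s' 16 (2 ^ k)] /\
     [/\ chunk_env X' s', progress (agree k) X (mm s) X' (mm s') & tm s' + 120 * m <= tm s + 120 * L + 5])).
    exists 0, X; split; [split=> // q; symb R1 | split=> //].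
      by rewrite E1; split=> // v Cv Xv; right.
    by rewrite t1 /cost_local /=; lia.
  move=> m s2 _ [k [X' [[km h15 h16] [ce2 pr t2]]]].
  case: (ce2) => -[_ _ [_ h8]] _ _ _ _.
  case: m km t2 => [|m] km t2; [left|right].
    have kL : k = L by lia.
    subst k; split; first by move=> q _; rewrite /active h15 h8 ltnn.
    exists X'; last by split=> //=; lia.
    by apply: (@chunk_env_same [::]) ce2 _ _ _ _ _ => //=; rewrite leq_addr.
  have kL : k < L by lia.
  split; first by move=> q _; rewrite /active h15 h8.
  exists m => //.
  have ce2' : chunk_env X' (tick s2 1).
    by apply: (@chunk_env_same [::]) ce2 _ _ _ _ _ => //=; rewrite leq_addr.
  apply: (wp_conseq (wp_list_bit kL ce2' h15 h16 pr)) => s3 [X3 [ce3 h15' h16' pr3 t3]].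
  exists k.+1, X3; split; first by split=> //; lia.
  split=> //; last by move: t3 => /=; lia.
  by apply: (@chunk_env_same [::]) ce3 _ _ _ _ _ => //=; rewrite leq_addr.
move=> s2 fr2 _ [X2 ce2 [pr2 t2]].
apply: wp_loc => s3 R3 E3 t3 l3; exists X2.
  by apply: chunk_env_same ce2 (loc_same_regs R3) _ E3 l3 _; rewrite ?t3 ?leq_addr.
have lk : linked n rho X (mm s) by case: ce => _ _ _ [].
split.
- apply: progress_halves lk _ pr2 => v Cv.
  by case: ce2 => _ _ _ _ o2; case: ce => _ _ _ _ o1; rewrite o1 // o2.
- move=> q; symb R3; rewrite fr2 //; have -> : rg s1 q 13 = c by symb R1; exact: h13.
  by case: ce2 => -[_ [_ _ _ -> _] [_ ->]] *; lia.
- by move: t3 t2; rewrite /cost_local /=; lia.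
Qed.

Lemma wp_list_chunk X s : chunk_env X s ->
  wp p n.*2 true list_chunk
    (fun s' => exists2 X', chunk_env X' s' &
      remaining X' = 0 /\ tm s' <= tm s + (120 * L + 30) * L + 10) s.
Proof.
move=> ce; apply: wp_seq; apply: wp_loc => s1 R1 E1 t1 l1.
have ce1 : chunk_env X s1.
  by apply: chunk_env_same ce (loc_same_regs R1) _ E1 l1 _; rewrite ?t1 ?leq_addr.
apply: (wp_while (m := L) (I := fun m s' => exists c X', [/\ c + m = L, reg s' 13 c & chunk_env X' s'] /\
   remaining X' * 2 ^ c <= p /\ tm s' + (120 * L + 30) * m <= tm s + (120 * L + 30) * L + 5)).
  exists 0, X; split; [split=> // q; symb R1 | split].
    by rewrite muln1; apply: leq_trans (count_size _ _) _; rewrite size_iota.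
  by rewrite t1 /cost_local /=; lia.
move=> m s2 _ [c [X' [[cm h13 ce2] [rem t2]]]].
case: (ce2) => -[_ _ [_ h8]] _ _ _ _.
have ce2t k : chunk_env X' (tick s2 k).
  by apply: (@chunk_env_same [::]) ce2 _ _ _ _ _ => //=; rewrite leq_addr.
case: m cm t2 => [|m] cm t2; [left|right].
  have cL : c = L by lia.
  subst c; split; first by move=> q _; rewrite /active h13 h8 ltnn.
  exists X'; first exact: ce2t.
  split; last by move=> /=; lia.
  (* The chunk has fewer than [2 ^ L] nodes, so [L] halvings leave none. *)
  have pL : p < 2 ^ L by apply: bits_small; case/andP: np.
  by case: (remaining X') rem => // r; rewrite mulSn; lia.
have cL : c < L by lia.
split; first by move=> q _; rewrite /active h13 h8.
exists m => //.
apply: (wp_conseq (wp_list_pass cL (ce2t 1) h13)) => s3 [X3 ce3 [rem3 h13' t3]].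
exists c.+1, X3; split; first split=> //; first by lia.
  by apply: (@chunk_env_same [::]) ce3 _ _ _ _ _ => //=; rewrite leq_addr.
split; last by move: t3 => /=; lia.
by rewrite expnS mulnA; apply: leq_trans rem; rewrite leq_mul2r rem3 orbT.
Qed.
End ListRun.

(** * The input list satisfies the invariant, with [rho] the position in the list *)

Section ListMemory.
Variables (n : nat) (pi : {perm 'I_n}).
Let s := list_order pi.
Let M := list_memory pi.

Lemma list_order_uniq : uniq s.
Proof.
rewrite map_inj_uniq ?enum_uniq // => i j.
by move=> /val_inj/perm_inj.
Qed.

Lemma list_order_size : size s = n.
Proof. by rewrite size_map size_enum_ord. Qed.

Lemma mem_list_order v : (v \in s) = (v < n).
Proof.
apply/mapP/idP => [[k _ ->]|vn]; first exact: ltn_ord.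
by exists ((pi^-1)%g (Ordinal vn)); rewrite ?mem_enum // permKV.
Qed.

Lemma list_memory_next v : v < n -> M (next_ v) = nth n s (index v s).+1.
Proof.
move=> vn; rewrite /M /list_memory /next_ -/s.
have -> : (v.*2).+1 < n.*2 by lia.
by rewrite /= odd_double /= uphalf_double.
Qed.

Lemma list_memory_prev v : v < n -> M (prev_ v) = nth n (n :: s) (index v s).
Proof.
move=> vn; rewrite /M /list_memory /prev_ -/s.
have -> : v.*2 < n.*2 by lia.
by rewrite odd_double doubleK.
Qed.

Lemma list_memory_linked : linked n (index^~ s) (fun v => 0 <= v < n) M.
Proof.
split=> [v //|v /= vn].
have vs : v \in s by rewrite mem_list_order.
have iv : index v s < n by rewrite -list_order_size index_mem.
have sz := list_order_size.
have nthn i : i < n -> nth n s i < n by move=> h; rewrite -mem_list_order mem_nth ?sz.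
rewrite (list_memory_next vn) (list_memory_prev vn); split.
  case: (ltnP (index v s).+1 n) => h; [right|left]; last by rewrite nth_default ?sz.
  have jn := nthn _ h.
  rewrite jn (list_memory_prev jn) index_uniq ?sz ?list_order_uniq //= nth_index //.
case E: (index v s) => [|k] /=; [by left | right].
have kn : k < n by lia.
have jn := nthn _ kn.
by rewrite jn (list_memory_next jn) index_uniq ?sz ?list_order_uniq // -E nth_index.
Qed.

Lemma list_memory_le a : M a <= n.
Proof.
rewrite /M /list_memory -/s; case: ifP => // _.
have h i : nth n s i <= n.
  case: (ltnP i (size s)) => h; last by rewrite nth_default.
  by apply: ltnW; rewrite -mem_list_order mem_nth.
by case: ifP => _ //; case: (index _ _) => [|k] /=.
Qed.
End ListMemory.

Definition list_cost (n : nat) : nat := (120 * bits n + 30) * bits n + 10.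

Lemma list_run n p (pi : {perm 'I_n}) : 0 < p <= n ->
  exists s', [/\ ev p n.*2 true (chunked list_chunk) (start_state n p (list_memory pi)) s',
    tm s' <= chunked_time list_cost n p,
    chain (splice n) 0 (list_memory pi) (lg s'), last_mark 0 (list_memory pi) (lg s') = (tm s', mm s')
    & perm_eq (flatten [seq e.1.2 | e <- lg s']) (iota 0 n)].
Proof.
move=> np; set M0 := list_memory pi; set rho := index^~ (list_order pi).
pose J D M l t := alive_ok n rho M0 (fun v => D <= v < n) M l t.
have later D M l t t' : t <= t' -> J D M l t -> J D M l t' by exact: alive_later.
have ok D s : D < n -> env n p (bits n) s -> J D (mm s) (lg s) (tm s) ->
    (forall q, rg s q 11 = minn D (n - p) + q) ->
    (forall q, rg s q 12 = (D <= minn D (n - p) + q)) ->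
    wp p n.*2 true list_chunk (fun s' => J (minn (minn D (n - p) + p) n) (mm s') (lg s') (tm s') /\
      tm s' <= tm s + list_cost n) s.
  move=> Dn ge Js h11 h12.
  have ce : chunk_env n p rho M0 D (fun v => D <= v < n) s.
    split=> // q qp; rewrite h12; have -> : minn D (n - p) + q < n by lia.
    by rewrite andbT.
  apply: (wp_conseq (wp_list_chunk np ce)) => s' [X [_ _ _ al out] [rem t']].
  split; last by rewrite /list_cost addnA.
  suff E : X = (fun v => minn (minn D (n - p) + p) n <= v < n) by rewrite /J -E.
  apply: functional_extensionality => v.
  case Cv: (in_chunk n p D v).
    have -> : X v = false.
      apply/negP => Xv; have : has X (iota (minn D (n - p)) p).
        by apply/hasP; exists v => //; rewrite mem_iota.
      by rewrite has_count; move: rem; rewrite /remaining => ->.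
    by move: Cv; rewrite /in_chunk; lia.
  rewrite out ?Cv //; move: Cv; rewrite /in_chunk; lia.
have J0 : J 0 M0 [::] 0.
  split=> //; first exact: list_memory_linked.
  rewrite /= (eq_in_filter (a2 := pred0)) ?filter_pred0 // => v.
  by rewrite mem_iota => /= ->.
have [s' [e t' [s1 [[_ ch lt lm bt] ts mE lE]]]] :=
  wp_chunked np (body := list_chunk) later isT ok J0.
exists s'; split=> //; rewrite lE.
- apply: chain_rcons => //; first exact: leq_trans lt ts.
  by move=> r /perm_nilP ->; rewrite lm mE.
- exact: last_mark_rcons.
- rewrite map_rcons flatten_rcons cats0; apply: perm_trans bt _.
  rewrite (eq_filter (a2 := predT)) ?filter_predT // => v /=.
  by apply/negP; lia.
Qed.

Definition list_types : seq (option nat) := infer 90 (Some 1) (chunked list_chunk).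

Lemma list_well_typed : well_typed (chunked list_chunk) 20 list_types (Some 1).
Proof. by vm_compute. Qed.

Lemma list_theorem : exists P : program,
  [/\ deterministic P, erew random_list P, contracts_lists P & sync_strict_pip_whp random_list P].
Proof.
exists (compile 0 (chunked list_chunk)).
have det : deterministic (compile 0 (chunked list_chunk)) by vm_compute.
have regs : all (registers_below 90) (compile 0 (chunked list_chunk)) by vm_compute.
have runs n p w : 0 < p <= n -> n.+2 ^ 20 <= w ->
    forall (x : arbitrary random_list n) (r : random random_list n),
    (forall a, input x r a < w) ->
  exists E v, out (compile 0 (chunked list_chunk))
    (good (compile 0 (chunked list_chunk)) (cells random_list n) true w) E
    (chunked_time list_cost n p) (start p x r) v.
  move=> np wl x r _; have [s' [e t' _ _ _]] := list_run r np.
  have Mw a : list_memory r a < range n w (Some 1).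
    by rewrite /= expn1 ltnS; apply: leqW; exact: list_memory_le.
  have [v o] := run_out list_well_typed np wl Mw e (fun=> true) t'.
  by exists (fun=> true), v.
have inputs n (x : arbitrary random_list n) (r : random random_list n) :
    exists w, forall a, input x r a < w.
  by exists n.+1 => a; rewrite ltnS; exact: list_memory_le.
have nonempty n : 0 < #|random random_list n| by apply/card_gt0P; exists 1%g.
split=> //.
- exact: (assemble_erew runs inputs).
- move=> n p np pi cs ex; have [s' [e t' ch lm bt]] := list_run pi np.
  have Mw a : list_memory pi a < range n (n.+2 ^ 20) (Some 1).
    by rewrite /= expn1 ltnS; apply: leqW; exact: list_memory_le.
  have [lo fin] := run_history list_well_typed np (leqnn _) Mw e ex.
  exists (map fst (lg s')); split; first by rewrite /batches /unzip2 -map_comp.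
  apply: (chain_rounds (op := splice n)) ch _ _ _ => /=.
  + by case: ex => ->.
  + by move=> x /lo[].
  + by rewrite lm => u /= tu; rewrite !fin.
(* With [L = bits n], [list_cost n + 30] is [120 L^2 + 30 L + 40], which is below [220 L^2]. *)
- apply: (assemble_pip regs runs inputs nonempty (C := 50 + 2 * 220 * 3 ^ 2) (e := 2)) => // n p n1 np.
  apply: chunked_time_le => //; rewrite /list_cost.
  have := bits_gt0 n; nia.
Qed.

(** * Tree contraction *)

Definition sibling (M : memory) (x v : nat) : nat :=
  if M (left_ x) == v then M (right_ x) else M (left_ x).

(* The other child of the grandparent of [l]: a rake of [l] conflicts only with
   rakes of the sibling of [l], of this node and of its counterparts. *)
Definition uncle (n : nat) (M : memory) (l : nat) : nat :=
  let x := M (parent_ l) in let g := M (parent_ x) in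
  if g == tnull n then tnull n else sibling M g x.

(* The nodes whose uncle may change when [r] is raked. *)
Definition neighbours (n : nat) (M : memory) (r : nat) : seq nat :=
  let s := sibling M (M (parent_ r)) r in let y := uncle n M r in
  [:: s; M (left_ s); M (right_ s); M (left_ y); M (right_ y)].

(** * Simultaneous rakes in a partially contracted tree *)

Section Treed.
Variables (n : nat) (rho : nat -> nat).

(** The remaining leaves are [X], the remaining internal nodes [Y]. The function [rho] increases
    downwards, which excludes cycles, and the last clause excludes a second root. *)
Definition treed (X Y : pred nat) (M : memory) : Prop :=
  [/\ forall v, X v -> v < n, forall v, Y v -> n <= v < tnull n,
      forall v, X v || Y v -> M (parent_ v) = tnull n \/
        [/\ Y (M (parent_ v)), M (left_ (M (parent_ v))) = v \/ M (right_ (M (parent_ v))) = v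
          & rho (M (parent_ v)) < rho v],
      forall x, Y x -> [/\ X (M (left_ x)) || Y (M (left_ x)), X (M (right_ x)) || Y (M (right_ x)),
        M (left_ x) <> M (right_ x), M (parent_ (M (left_ x))) = x & M (parent_ (M (right_ x))) = x]
    & forall v v', X v || Y v -> X v' || Y v' ->
        M (parent_ v) = tnull n -> M (parent_ v') = tnull n -> v = v'].

Definition slot_of (M : memory) (g x : nat) : nat :=
  if M (left_ g) == x then left_ g else right_ g.

(** As for lists, the joint effect of the rakes, read from the old memory: the sibling gets the
    grandparent as parent and takes the place of the removed parent there. *)
Definition raked (S : pred nat) (M M' : memory) : Prop :=
  [/\ forall l, S l -> M' (parent_ (sibling M (M (parent_ l)) l)) = M (parent_ (M (parent_ l))),
      forall l, S l -> M (parent_ (M (parent_ l))) <> tnull n ->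
        M' (slot_of M (M (parent_ (M (parent_ l)))) (M (parent_ l))) = sibling M (M (parent_ l)) l
    & forall a, (forall l, S l -> a <> parent_ (sibling M (M (parent_ l)) l)) ->
        (forall l, S l -> M (parent_ (M (parent_ l))) <> tnull n ->
           a <> slot_of M (M (parent_ (M (parent_ l)))) (M (parent_ l))) -> M' a = M a].

Definition independent_rakes (S : pred nat) (M : memory) : Prop :=
  [/\ forall l, S l -> M (parent_ l) <> tnull n,
      forall l l', S l -> S l' -> M (parent_ l) = M (parent_ l') -> l = l',
      forall l l', S l -> S l' -> M (parent_ (M (parent_ l))) = M (parent_ (M (parent_ l'))) -> l = l'
    & forall l l', S l -> S l' -> M (parent_ (M (parent_ l))) <> M (parent_ l')].

Lemma parent_inj u v : parent_ u = parent_ v -> u = v.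
Proof. by rewrite /parent_; lia. Qed.

Lemma left_inj u v : left_ u = left_ v -> u = v.
Proof. by rewrite /left_; lia. Qed.

Lemma right_inj u v : right_ u = right_ v -> u = v.
Proof. by rewrite /right_; lia. Qed.

Lemma left_right u v : left_ u <> right_ v.
Proof. by rewrite /left_ /right_; lia. Qed.

Lemma left_parent u v : left_ u <> parent_ v.
Proof. by rewrite /left_ /parent_; lia. Qed.

Lemma parent_lt m v : v < m -> parent_ v < 3 * m.
Proof. by rewrite /parent_; lia. Qed.

Lemma left_lt m v : v < m -> left_ v < 3 * m.
Proof. by rewrite /left_; lia. Qed.

Lemma right_lt m v : v < m -> right_ v < 3 * m.
Proof. by rewrite /right_; lia. Qed.

Lemma slot_lt M m g x : g < m -> slot_of M g x < 3 * m.
Proof. by rewrite /slot_of; case: ifP => _; [exact: left_lt | exact: right_lt]. Qed.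

Lemma parent_slot M u g x : parent_ u <> slot_of M g x.
Proof. by rewrite /parent_ /slot_of /left_ /right_; case: ifP; lia. Qed.

Lemma left_slot M u g x : left_ u = slot_of M g x -> u = g /\ M (left_ g) = x.
Proof. by rewrite /slot_of; case: eqP => [E /left_inj ->|_ /left_right]. Qed.

Lemma right_slot M u g x : right_ u = slot_of M g x -> u = g /\ M (left_ g) <> x.
Proof. by rewrite /slot_of; case: eqP => [_ /esym/left_right //|E /right_inj ->]. Qed.

Lemma slot_inj_parent M g x g' x' : slot_of M g x = slot_of M g' x' -> g = g'.
Proof.
by rewrite /slot_of; case: eqP => _; case: eqP => _; [move/left_inj|move/left_right|move/esym/left_right|move/right_inj].
Qed.

Section Basics.
Variables (X Y : pred nat) (M : memory).
Hypothesis tr : treed X Y M.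

Lemma treed_parent v : X v || Y v -> M (parent_ v) <> tnull n ->
  [/\ Y (M (parent_ v)), M (left_ (M (parent_ v))) = v \/ M (right_ (M (parent_ v))) = v
    & rho (M (parent_ v)) < rho v].
Proof. by case: tr => _ _ h _ _ /h[]. Qed.

Lemma treed_sibling v : X v || Y v -> M (parent_ v) <> tnull n ->
  let s := sibling M (M (parent_ v)) v in
  [/\ X s || Y s, M (parent_ s) = M (parent_ v), s <> v
    & M (left_ (M (parent_ v))) = s \/ M (right_ (M (parent_ v))) = s].
Proof.
move=> Vv xn /=; have [Yx ch _] := treed_parent Vv xn.
case: tr => _ _ _ /(_ _ Yx)[Vl Vr lr pl pr] _.
rewrite /sibling; case: eqP => E; last first.
  by split=> //; left.
by split=> //; [rewrite -[in RHS]E => h; apply: lr; rewrite h | right].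
Qed.

Lemma child_of x v : Y x -> X v || Y v -> M (parent_ v) = x ->
  M (left_ x) = v \/ M (right_ x) = v.
Proof.
move=> Yx Vv E; have xn : M (parent_ v) <> tnull n.
  by rewrite E => h; case: tr => _ /(_ _ Yx) + _ _ _; rewrite h ltnn andbF.
by have [_ + _] := treed_parent Vv xn; rewrite E.
Qed.

Lemma child_cases x v u : Y x -> X v || Y v -> X u || Y u ->
  M (parent_ v) = x -> M (parent_ u) = x -> u = v \/ u = sibling M x v.
Proof.
move=> Yx Vv Vu pv pu; rewrite /sibling.
case: (child_of Yx Vv pv) => E; case: (child_of Yx Vu pu) => F.
- by left; rewrite -E -F.
- by right; rewrite E eqxx F.
- by right; case: eqP => [h|_ //]; move: E; case: tr => _ _ _ /(_ _ Yx)[_ _ lr _ _] _ rE; case: lr; rewrite h rE.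
- by left; rewrite -E -F.
Qed.

Lemma treed_null : ~~ (X (tnull n) || Y (tnull n)).
Proof.
case: tr => hX hY _ _ _; apply/norP; split; apply/negP.
  by move/hX; rewrite /tnull; lia.
by move/hY; rewrite ltnn andbF.
Qed.

Lemma treed_XY v : X v -> Y v -> False.
Proof. by case: tr => hX hY _ _ _ /hX a /hY b; lia. Qed.

(** An uncle is a child of the grandparent, while [v] is two levels below it. This plays the part of
    the difference between a list node and its successor. *)
Lemma uncle_neq v : X v -> M (parent_ v) <> tnull n -> uncle n M v <> v.
Proof.
move=> Xv xn; have Vv : X v || Y v by rewrite Xv.
have [Yx _ r1] := treed_parent Vv xn; rewrite /uncle.
have Vx : X (M (parent_ v)) || Y (M (parent_ v)) by rewrite Yx orbT.
case: eqP => gn; first by move=> E; move: treed_null; rewrite E Xv.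
have [_ ps _ _] := treed_sibling Vx gn; have [_ _ r2] := treed_parent Vx gn.
by move=> E; move: ps; rewrite E => pv; rewrite -pv ltnn in r2.
Qed.

Lemma root_above v : X v || Y v ->
  exists2 r, X r || Y r & M (parent_ r) = tnull n /\ (r = v \/ Y r).
Proof.
elim/ltn_ind: {v}(rho v) {-2}v (erefl (rho v)) => m IH v mE Vv.
case: (M (parent_ v) =P tnull n) => pn; first by exists v => //; split=> //; left.
have [Yp _ lt] := treed_parent Vv pn.
have Vp : X (M (parent_ v)) || Y (M (parent_ v)) by rewrite Yp orbT.
have [r Vr [rn [rp|Yr]]] := IH _ (leq_trans lt (eq_leq mE)) _ erefl Vp; exists r => //.
  by split=> //; right; rewrite rp.
by split=> //; right.
Qed.

(** A parentless [v] would be the only root, but going up from the other leaf ends at that leaf or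
    at an internal node. Since the leaf [n - 1] is spared, every other remaining leaf can be
    raked. *)
Lemma leaf_parent v u : X v -> X u -> v <> u -> M (parent_ v) <> tnull n.
Proof.
move=> Xv Xu vu pn; have Vu : X u || Y u by rewrite Xu.
have [r Vr [rn ru]] := root_above Vu.
have E : r = v by case: tr => _ _ _ _; apply=> //; rewrite Xv.
case: ru => [ru|]; first by apply: vu; rewrite -E.
by rewrite E; exact: treed_XY.
Qed.

Variables (k b : nat) (P W1 W2 : pred nat).

(** True if the uncle does not compete in the round for bit [k] and value [b]: indices from [n] on
    are internal nodes or null, and a leaf with another bit does not take part. *)
Definition free_uncle (y : nat) : bool := (n <= y) || ((y %/ 2 ^ k) %% 2 != b).

Hypothesis PX : forall l, P l -> X l.
Hypothesis Pn : forall l, P l -> M (parent_ l) <> tnull n.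
Hypothesis Pb : forall l, P l -> (l %/ 2 ^ k) %% 2 = b.
Hypothesis W1P : forall l, W1 l -> P l.
Hypothesis W2W1 : forall l, W2 l -> W1 l.
Hypothesis W1_unique : forall l l', W1 l -> W1 l' -> M (parent_ l) = M (parent_ l') -> l = l'.
Hypothesis W1_exists : forall l, P l -> exists2 l', W1 l' & M (parent_ l') = M (parent_ l).
Hypothesis W2_unique : forall l l', W2 l -> W2 l' ->
  M (parent_ (M (parent_ l))) = M (parent_ (M (parent_ l'))) -> l = l'.
Hypothesis W2_exists : forall l, W1 l ->
  exists2 l', W2 l' & M (parent_ (M (parent_ l'))) = M (parent_ (M (parent_ l))).

Definition winner (l : nat) : bool := W2 l && free_uncle (uncle n M l).

(** The elections settle equal parents and equal grandparents. If the parent of [l'] is the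
    grandparent of [l], then the leaf [l'] is the uncle of [l]; having bit [b], it contradicts that
    this uncle is free. *)
Lemma winner_independent : independent_rakes winner M.
Proof.
split.
- by move=> l /andP[/W2W1/W1P/Pn].
- by move=> l l' /andP[/W2W1 Wl _] /andP[/W2W1 Wl' _]; exact: W1_unique.
- by move=> l l' /andP[Wl _] /andP[Wl' _]; exact: W2_unique.
- move=> l l' /andP[/W2W1/W1P Pl fl] /andP[/W2W1/W1P Pl' _] E.
  have Vl : X l || Y l by rewrite PX.
  have Vl' : X l' || Y l' by rewrite PX.
  have [Yx _ _] := treed_parent Vl (Pn Pl); have [Yx' _ _] := treed_parent Vl' (Pn Pl').
  have Vx : X (M (parent_ l)) || Y (M (parent_ l)) by rewrite Yx orbT.
  have gn : M (parent_ (M (parent_ l))) <> tnull n by rewrite E; exact: Pn.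
  have uE : uncle n M l = l'.
    rewrite /uncle ifN; last exact/eqP.
    rewrite E; case: (child_cases Yx' Vx Vl' E erefl) => // lx.
    by case: (treed_XY (PX Pl')); rewrite lx.
  move: fl; rewrite uE /free_uncle (Pb Pl') eqxx orbF.
  by case: tr => hX _ _ _ _; have := hX _ (PX Pl'); lia.
Qed.

(** The leaf elected for the grandparent of [l] does win: if it shares the parent of [l], it also
    shares the free uncle; otherwise its uncle is the parent of [l], an internal node. So [l] is
    that leaf, its sibling or a child of its uncle. *)
Lemma winner_near l : P l -> free_uncle (uncle n M l) ->
  exists2 r, winner r & l = r \/ l \in neighbours n M r.
Proof.
move=> Pl fl; have [l1 W1l1 x1] := W1_exists Pl; have [l2 W2l2 g2] := W2_exists W1l1.
have P2 := W1P (W2W1 W2l2).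
have Vl : X l || Y l by rewrite PX.
have V2 : X l2 || Y l2 by rewrite PX.
have [Yx cx _] := treed_parent Vl (Pn Pl); have [Yx2 _ _] := treed_parent V2 (Pn P2).
exists l2; last first.
  case: (M (parent_ l2) =P M (parent_ l)) => xx.
    case: (child_cases Yx2 V2 Vl erefl (esym xx)) => E; first by left.
    by right; rewrite /neighbours -E mem_head.
  right; rewrite x1 in g2.
  have Vx : X (M (parent_ l)) || Y (M (parent_ l)) by rewrite Yx orbT.
  have Vx2 : X (M (parent_ l2)) || Y (M (parent_ l2)) by rewrite Yx2 orbT.
  have gn : M (parent_ (M (parent_ l2))) <> tnull n.
    by move=> gn; apply: xx; case: tr => _ _ _ _; apply=> //; rewrite -g2.
  have [Yg _ _] := treed_parent Vx2 gn.
  case: (child_cases Yg Vx2 Vx erefl (esym g2)) => E; first by case: xx; rewrite E.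
  rewrite /neighbours /uncle ifN; last exact/eqP.
  by rewrite -E !inE; case: cx => ->; rewrite eqxx !orbT.
rewrite /winner W2l2 /=; rewrite x1 in g2.
case: (M (parent_ l2) =P M (parent_ l)) => xx; first by rewrite /uncle xx -/(uncle n M l).
have Vx : X (M (parent_ l)) || Y (M (parent_ l)) by rewrite Yx orbT.
have Vx2 : X (M (parent_ l2)) || Y (M (parent_ l2)) by rewrite Yx2 orbT.
have gn : M (parent_ (M (parent_ l2))) <> tnull n.
  by move=> gn; apply: xx; case: tr => _ _ _ _; apply=> //; rewrite -g2.
have [Yg _ _] := treed_parent Vx2 gn.
case: (child_cases Yg Vx2 Vx erefl (esym g2)) => E; first by case: xx; rewrite E.
rewrite /uncle ifN; last exact/eqP.
by rewrite -E /free_uncle; case: tr => _ hY _ _ _; case/andP: (hY _ Yx) => ->.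
Qed.

End Basics.

Section Raked.
Variables (X Y S : pred nat) (M M' : memory).
Hypothesis tr : treed X Y M.
Hypothesis SX : forall l, S l -> X l.
Hypothesis ind : independent_rakes S M.
Hypothesis rk : raked S M M'.

Let x l := M (parent_ l).
Let g l := M (parent_ (x l)).
Let s l := sibling M (x l) l.

Definition removed (v : nat) : bool := has (fun l => S l && (x l == v)) (iota 0 n).

Lemma hasS (a : pred nat) : reflect (exists2 l, S l & a l) (has (fun l => S l && a l) (iota 0 n)).
Proof.
apply: (iffP hasP) => [[l _ /andP[Sl al]]|[l Sl al]]; exists l => //; last by rewrite Sl.
by rewrite mem_iota; case: tr => hX _ _ _ _; rewrite hX // SX.
Qed.

Lemma removedP v : reflect (exists2 l, S l & x l = v) (removed v).
Proof. by apply: (iffP (hasS _)) => -[l Sl /eqP E]; exists l => //; apply/eqP. Qed.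

Lemma raked_parent l : S l -> Y (x l).
Proof.
move=> Sl; have xn : x l <> tnull n by case: ind => h _ _ _; exact: h.
have Vl : X l || Y l by rewrite SX.
by have [] := treed_parent tr Vl xn.
Qed.

(** The sibling shares the parent, so it is not raked itself; nor is it the parent of a raked leaf,
    whose grandparent would then be the parent of [l]. *)
Lemma raked_sibling l : S l ->
  [/\ X (s l) || Y (s l), M (parent_ (s l)) = x l, s l <> l, ~~ S (s l) & ~~ removed (s l)].
Proof.
move=> Sl; have xn : x l <> tnull n by case: ind => h _ _ _; exact: h.
have Vl : X l || Y l by rewrite SX.
have [Vs ps sl _] := treed_sibling tr Vl xn; rewrite -/(x l) -/(s l) in Vs ps sl.
case: ind => _ ix _ cf; split=> //.
  by apply/negP => Ss; apply: sl; apply: ix => //; rewrite ps.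
by apply/removedP => -[l' Sl' E]; apply: (cf l' l) => //; rewrite -/(x l') E ps.
Qed.

Lemma parent_hit l : S l -> M' (parent_ (s l)) = g l.
Proof. by case: rk => h _ _; exact: h. Qed.

Lemma parent_miss v : (forall l, S l -> v <> s l) -> M' (parent_ v) = M (parent_ v).
Proof.
move=> nv; case: rk => _ _; apply=> l Sl; last by move=> _; exact: parent_slot.
by move/parent_inj; exact: nv.
Qed.

Lemma left_hit l : S l -> g l <> tnull n -> M (left_ (g l)) = x l -> M' (left_ (g l)) = s l.
Proof. by case: rk => _ h _ Sl gn E; have := h l Sl gn; rewrite /slot_of -/(x l) -/(g l) E eqxx. Qed.

Lemma right_hit l : S l -> g l <> tnull n -> M (left_ (g l)) <> x l -> M' (right_ (g l)) = s l.
Proof.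
by case: rk => _ h _ Sl gn /eqP/negbTE E; have := h l Sl gn; rewrite /slot_of -/(x l) -/(g l) E.
Qed.

Lemma left_miss z : (forall l, S l -> g l = z -> M (left_ z) <> x l) -> M' (left_ z) = M (left_ z).
Proof.
move=> nz; case: rk => _ _; apply=> l Sl; first by rewrite /left_ /parent_; lia.
by move=> _ /left_slot[E F]; apply: (nz l Sl); rewrite ?E.
Qed.

Lemma right_miss z : (forall l, S l -> g l = z -> M (left_ z) = x l) -> M' (right_ z) = M (right_ z).
Proof.
move=> nz; case: rk => _ _; apply=> l Sl; first by rewrite /right_ /parent_; lia.
by move=> _ /right_slot[E F]; apply: F; rewrite -E; exact: nz Sl (esym E).
Qed.

Let X' v := X v && ~~ S v.
Let Y' v := Y v && ~~ removed v.

Lemma grandparent l : S l -> g l <> tnull n ->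
  [/\ Y (g l), ~~ removed (g l), rho (g l) < rho (x l) & rho (x l) < rho (s l)].
Proof.
move=> Sl gn; have Yx := raked_parent Sl.
have Vx : X (x l) || Y (x l) by rewrite Yx orbT.
have [Yg _ r] := treed_parent tr Vx gn.
have [Vs ps _ _ _] := raked_sibling Sl.
have [|_ _ r'] := treed_parent tr Vs; first by rewrite ps; case: ind => h _ _ _; exact: h.
split=> //; last by rewrite ps in r'.
apply/removedP => -[l' Sl' E]; case: ind => _ _ _ cf; exact: (cf l l').
Qed.

Lemma remaining_child z c : Y' z -> X c || Y c -> M (parent_ c) = z ->
  (forall l, S l -> c <> x l) -> X' c || Y' c.
Proof.
move=> /andP[Yz nz] Vc pc nc; rewrite /X' /Y'.
have nr : ~~ removed c by apply/removedP => -[l Sl E]; apply: (nc l Sl).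
have nS : ~~ S c.
  by apply/negP => Sc; case/negP: nz; apply/removedP; exists c.
by case/orP: Vc => ->; rewrite ?nS ?nr ?orbT.
Qed.

Lemma remaining_parent c : X' c || Y' c -> X c || Y c.
Proof. by case/orP=> /andP[->]; rewrite ?orbT. Qed.

Lemma not_removed_child c l : X' c || Y' c -> S l -> c <> x l /\ c <> l.
Proof.
move=> Vc Sl; split=> E; move: Vc; rewrite E /X' /Y' => /orP[/andP[h1 h2]|/andP[h1 h2]].
- exact: (treed_XY tr h1 (raked_parent Sl)).
- by case/negP: h2; apply/removedP; exists l.
- by rewrite Sl in h2.
- exact: (treed_XY tr (SX Sl) h1).
Qed.

(** Independence makes every surviving cell change at most once: a node is the sibling of at most
    one raked leaf and the grandparent of at most one, and neither siblings nor grandparents are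
    removed. *)
Lemma raked_treed : treed X' Y' M'.
Proof.
case: (tr) => hX hY hP hC hR; case: (ind) => _ ix ig cf.
split.
- by move=> v /andP[/hX].
- by move=> v /andP[/hY].
- move=> v Vv; have V0 := remaining_parent Vv.
  case: (hasP (a := fun l => S l && (s l == v)) (s := iota 0 n)) => [[l _ /andP[Sl /eqP sv]]|no].
    rewrite -sv parent_hit //; case: (g l =P tnull n) => [->|gn]; [by left | right].
    have [Yg ng r1 r2] := grandparent Sl gn.
    split; [by rewrite /Y' Yg | | exact: ltn_trans r1 r2].
    by case: (M (left_ (g l)) =P x l) => E; [left; exact: left_hit | right; exact: right_hit].
  have nv l : S l -> v <> s l.
    move=> Sl E; apply: no; exists l; last by rewrite Sl E eqxx.
    by rewrite mem_iota hX // SX.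
  rewrite parent_miss //.
  case: (M (parent_ v) =P tnull n) => [->|pn]; [by left | right].
  have [Yz ch r] := treed_parent tr V0 pn.
  have nz : ~~ removed (M (parent_ v)).
    apply/removedP => -[l Sl E].
    have Vl : X l || Y l by rewrite SX.
    case: (child_cases tr (raked_parent Sl) Vl V0 erefl (esym E)) => [vl|]; last exact: nv.
    by have [_] := not_removed_child Vv Sl; rewrite vl.
  split=> //; first by rewrite /Y' Yz.
  case: ch => ch; [left|right].
    rewrite left_miss // => l Sl gl; rewrite ch => E.
    by have [] := not_removed_child Vv Sl.
  rewrite right_miss // => l Sl gl.
  have Yx := raked_parent Sl; have Vx : X (x l) || Y (x l) by rewrite Yx orbT.
  case: (child_of tr Yz Vx gl) => // E; exfalso.
  by have [h _] := not_removed_child Vv Sl; apply: h; rewrite -ch E.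
- move=> z Yz'; have /andP[Yz nz] := Yz'; have [Vl Vr lr pl pr] := hC z Yz.
  have gz l : S l -> g l = z -> g l <> tnull n.
    by move=> Sl -> E; have := hY _ Yz; rewrite E ltnn andbF.
  have noS c : M (parent_ c) = z -> forall l, S l -> c <> s l.
    move=> pc l Sl E; case/negP: nz; apply/removedP; exists l => //.
    by have [_ ps _ _ _] := raked_sibling Sl; rewrite -ps -E pc.
  have sV l : S l -> X' (s l) || Y' (s l).
    move=> Sl; have [Vs _ _ nS nr] := raked_sibling Sl.
    by rewrite /X' /Y'; case/orP: Vs => ->; rewrite ?nS ?nr ?orbT.
  have sne l c : S l -> g l = z -> M (parent_ c) = z -> s l <> c.
    move=> Sl gl pc E; have [_ ps _ _ _] := raked_sibling Sl.
    move: ps; rewrite E pc => xz; have := gz l Sl gl => gn.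
    by have [_ _ r _] := grandparent Sl gn; rewrite gl -xz ltnn in r.
  case: (hasP (a := fun l => S l && (g l == z)) (s := iota 0 n)) => [[l _ /andP[Sl /eqP gl]]|no].
    have gn := gz l Sl gl; have Yx := raked_parent Sl.
    have Vx : X (x l) || Y (x l) by rewrite Yx orbT.
    have un l' : S l' -> g l' = z -> l' = l by move=> Sl' gl'; apply: ig => //; rewrite -/(g _) gl' -gl.
    case: (M (left_ z) =P x l) => E.
      have L : M' (left_ z) = s l by rewrite -gl left_hit // gl.
      have R : M' (right_ z) = M (right_ z).
        by apply: right_miss => l' Sl' gl'; rewrite (un l').
      rewrite L R parent_hit // parent_miss; last exact: noS.
      split=> //; [exact: sV | | exact: sne].
      by apply: (remaining_child Yz') => // l' Sl' F; apply: lr; rewrite F E; congr x; rewrite (un l') // /g -F.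
    have R : M' (right_ z) = s l by rewrite -gl right_hit // gl.
    have L : M' (left_ z) = M (left_ z).
      by apply: left_miss => l' Sl' gl'; rewrite (un l').
    rewrite L R parent_hit // parent_miss; last exact: noS.
    split=> //; [ | exact: sV | by move/esym; apply: sne].
    by apply: (remaining_child Yz') => // l' Sl' F; apply: E; rewrite F; congr x; apply: un; rewrite // /g -F.
  have ng l : S l -> g l <> z.
    move=> Sl E; apply: no; exists l; last by rewrite Sl E eqxx.
    by rewrite mem_iota hX // SX.
  rewrite left_miss => [|l /ng //]; rewrite right_miss => [|l /ng //].
  rewrite !parent_miss; try exact: noS.
  split=> //; apply: (remaining_child Yz') => // l Sl E; apply: (ng l Sl); rewrite /g -E //.
- move=> v v' Vv Vv' pv pv'.
  have V0 := remaining_parent Vv; have V0' := remaining_parent Vv'.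
  have cases u : X' u || Y' u -> M' (parent_ u) = tnull n ->
      M (parent_ u) = tnull n \/ exists2 l, S l & u = s l /\ g l = tnull n.
    move=> Vu pu; case: (hasP (a := fun l => S l && (s l == u)) (s := iota 0 n)) => [[l _ /andP[Sl /eqP su]]|no].
      by right; exists l => //; split=> //; rewrite -parent_hit // su.
    left; rewrite -parent_miss // => l Sl E; apply: no; exists l; last by rewrite Sl E eqxx.
    by rewrite mem_iota hX // SX.
  (* If [x l] was the root, any other survivor without old parent would equal it by uniqueness of
     the root, yet [x l] is removed. *)
  have clash u l : X' u || Y' u -> S l -> g l = tnull n -> M (parent_ u) <> tnull n.
    move=> Vu Sl gl E; have Vx : X (x l) || Y (x l) by rewrite raked_parent ?orbT.
    have [h _] := not_removed_child Vu Sl; apply: h.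
    by apply: hR => //; exact: remaining_parent.
  case: (cases v Vv pv) => [h|[l Sl [vl gl]]]; case: (cases v' Vv' pv') => [h'|[l' Sl' [vl' gl']]].
  + exact: hR.
  + by case: (clash v l' Vv Sl' gl').
  + by case: (clash v' l Vv' Sl gl).
  + by rewrite vl vl'; congr s; apply: ig => //; rewrite -/(g l) gl.
Qed.

Definition rake_writes (l : nat) : seq (nat * nat) :=
  (parent_ (s l), g l) ::
  (if g l != tnull n then [:: (slot_of M (g l) (x l), s l)] else [::]).

Lemma rake_writesP l a : reflect
  (a = parent_ (s l) \/ (g l <> tnull n /\ a = slot_of M (g l) (x l)))
  (a \in keys (rake_writes l)).
Proof.
rewrite /rake_writes /= inE; case: eqP => [->|ne] /=; first by constructor; left.
case: eqP => gn /=; first by constructor => -[//|[]].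
rewrite inE; apply: (iffP eqP) => [->|[//|[_ ->]] //]; by right.
Qed.

Lemma raked_batch sel : uniq sel -> (forall l, (l \in sel) = S l) ->
  forall r, perm_eq r sel -> foldl (fun M i => rake n i M) M r = M'.
Proof.
move=> us selE; case: (rk) => hit1 hit2 miss; case: (ind) => xnull ix ig cf.
apply: (independent_batch (W := rake_writes)) => //.
- move=> l _; rewrite /rake_writes; case: eqP => //= _.
  by rewrite inE andbT; apply/eqP; exact: parent_slot.
- move=> l l' a; rewrite !selE => Sl Sl' ll' /rake_writesP[->|[gn ->]];
    apply/rake_writesP => -[E|[gn' E]].
  + move/parent_inj: E => E; have [_ p _ _ _] := raked_sibling Sl.
    have [_ p' _ _ _] := raked_sibling Sl'.
    by case/eqP: ll'; apply: ix => //; rewrite -[M _]/(x l) -p E p'.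
  + exact: parent_slot E.
  + exact: parent_slot (esym E).
  + by case/eqP: ll'; apply: ig => //; exact: slot_inj_parent E.
- move=> l M1; rewrite selE => Sl H.
  have [Vs ps _ _ _] := raked_sibling Sl.
  have own a : (forall l', S l' -> l' <> l -> a <> parent_ (s l')) ->
      (forall l', S l' -> l' <> l -> a <> slot_of M (g l') (x l')) -> M1 a = M a.
    move=> h1 h2; apply: H => l'; rewrite selE => Sl' /eqP ne.
    by apply/rake_writesP => -[E|[_ E]]; [exact: h1 E | exact: h2 E].
  (* The five cells that a rake inspects are written by no other rake of the batch. *)
  have e1 : M1 (parent_ l) = x l.
    apply: own => l' Sl' ne; last exact: parent_slot.
    move/parent_inj => E; have [_ p _ _ _] := raked_sibling Sl'.
    by apply: ne; apply: ix => //; rewrite -[M (parent_ l')]/(x l') -p -E.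
  have e2 : M1 (parent_ (x l)) = g l.
    apply: own => l' Sl' ne; last exact: parent_slot.
    move/parent_inj => E; have [_ p _ _ _] := raked_sibling Sl'.
    by apply: (cf l l') => //; rewrite -/(x l) E p.
  have e3 : M1 (left_ (x l)) = M (left_ (x l)).
    apply: own => l' Sl' ne; first by rewrite /left_ /parent_; lia.
    by move/left_slot => [E _]; apply: (cf l' l) => //; rewrite -E.
  have e4 : M1 (right_ (x l)) = M (right_ (x l)).
    apply: own => l' Sl' ne; first by rewrite /right_ /parent_; lia.
    by move/right_slot => [E _]; apply: (cf l' l) => //; rewrite -E.
  have e5 : M1 (left_ (g l)) = M (left_ (g l)).
    apply: own => l' Sl' ne; first by rewrite /left_ /parent_; lia.
    by move/left_slot => [E _]; apply: ne; apply: ig.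
  rewrite /rake e1 e2 e3 e4 e5 -/(sibling M (x l) l) -/(s l).
  have /eqP/negbTE -> := xnull _ Sl.
  rewrite /rake_writes; case: eqP => //= _.
  by rewrite /slot_of; case: ifP.
- move=> l w; rewrite selE /rake_writes inE => Sl /orP[/eqP->|]; first exact: hit1.
  by case: eqP => //= gn; rewrite inE => /eqP->; exact: hit2.
- move=> a H; apply: miss => l Sl; first by move=> E; have := H l; rewrite selE => /(_ Sl)/rake_writesP; apply; left.
  by move=> gn E; have := H l; rewrite selE => /(_ Sl)/rake_writesP; apply; right.
Qed.

(** The uncle is found through the parent fields of [l] and of its parent and the child fields of
    its grandparent. A rake of [r] alters one of these only if [l] is the sibling of [r], a child of
    that sibling, or a child of the uncle of [r]: five nodes at most. *)
Lemma uncle_change l : X' l -> M (parent_ l) <> tnull n -> uncle n M' l <> uncle n M l ->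
  exists2 r, S r & l \in neighbours n M r.
Proof.
move=> X'l xn ch; have Vl' : X' l || Y' l by rewrite X'l.
have Vl := remaining_parent Vl'; have [Yx cx _] := treed_parent tr Vl xn.
have Vx : X (x l) || Y (x l) by rewrite /x Yx orbT.
case: (hasP (a := fun r => S r && (l \in neighbours n M r)) (s := iota 0 n)) => [[r _ /andP[Sr lr]]|no].
  by exists r.
exfalso; apply: ch.
have no' r : S r -> l \notin neighbours n M r.
  move=> Sr; apply/negP => lr; apply: no; exists r; last by rewrite Sr.
  by case: tr => hX _ _ _ _; rewrite mem_iota hX // SX.
have ns r : S r -> l <> s r.
  by move=> Sr E; have := no' r Sr; rewrite /neighbours -/(s r) -E mem_head.
have nx r : S r -> x l <> s r.
  move=> Sr E; have := no' r Sr; rewrite /neighbours -/(s r) -E !inE.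
  by case: cx => F; rewrite /x F eqxx !orbT.
rewrite /uncle parent_miss // -/(x l) parent_miss //.
case: eqP => // /= gn; rewrite -/(g l).
have [Yg _ _] := treed_parent tr Vx gn.
have ng r : S r -> g r <> g l.
  move=> Sr gr; have Vxr : X (x r) || Y (x r) by rewrite raked_parent ?orbT.
  have gn' : g r <> tnull n by rewrite gr.
  case: (child_cases tr Yg Vxr Vx gr erefl) => E.
    have Vr : X r || Y r by rewrite SX.
    case: (child_cases tr (raked_parent Sr) Vr Vl erefl E) => F; last exact: ns F.
    by have [_] := not_removed_child Vl' Sr.
  have := no' r Sr; rewrite /neighbours /uncle -/(x r) -/(g r) gr ifN; last exact/eqP.
  by rewrite -E !inE; case: cx => F; rewrite /x F eqxx !orbT.
rewrite /sibling left_miss => [|r /ng //]; rewrite right_miss // => r /ng //.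
Qed.

End Raked.
End Treed.

(* Registers: 11 the leaf l, 12 alive, 15 k, 16 2^k, 17 b, 88 the parent x of l,
   90 the grandparent g, 94 null, 95 the key 2n of non-participants, 129 the uncle,
   141 selected, 149 the sibling. *)
Definition participate : seq linstr :=
  [:: LOp Div 96 11 16; LOp Mod 97 96 5; LOp Defs.Sub 98 97 17; LOp Defs.Sub 99 17 97;
      LOp Add 100 98 99; LOp Defs.Sub 101 4 100; LOp Mul 87 12 101;
      LOp Add 103 5 4; LOp Mul 104 103 11; LOp Mul 95 5 2; LOp Defs.Sub 94 95 4;
      LOp Mul 105 103 157; LOp Add 30 105 4; LOp Add 31 5 4].

(* Register 57 becomes the value of [v] on the processors with [f = 1] and 2n
   elsewhere. *)
Definition set_key (f v : nat) : seq linstr :=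
  [:: LOp Mul 106 f v; LOp Defs.Sub 107 4 f; LOp Mul 108 107 95; LOp Add 57 106 108].

(** Register 125 tells whether [x] is the left child of [g], so that [119 - 125] is the address of
    its slot, the right field being the cell after the left one. Register 139 marks an uncle in
    competition; without a grandparent, 116 is 0 and the leaf is selected. Register 145 tells
    whether [l] is a left child. *)
Definition select_rake : seq linstr :=
  [:: LOp Defs.Sub 122 120 88; LOp Defs.Sub 123 88 120; LOp Add 124 122 123; LOp Defs.Sub 125 4 124;
      LOp Mul 126 125 121; LOp Defs.Sub 127 4 125; LOp Mul 128 127 120; LOp Add 129 126 128;
      LOp Defs.Sub 130 2 129; LMin 131 130 4; LOp Div 132 129 16; LOp Mod 133 132 5;
      LOp Defs.Sub 134 133 17; LOp Defs.Sub 135 17 133; LOp Add 136 134 135; LOp Defs.Sub 137 4 136;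
      LOp Mul 138 131 137; LOp Mul 139 138 116; LOp Defs.Sub 140 4 139; LOp Mul 141 113 140;
      LOp Defs.Sub 142 91 11; LOp Defs.Sub 143 11 91; LOp Add 144 142 143; LOp Defs.Sub 145 4 144;
      LOp Mul 146 145 92; LOp Defs.Sub 147 4 145; LOp Mul 148 147 91; LOp Add 153 146 148;
      LMin 149 153 95;
      LOp Mul 150 103 149; LOp Defs.Sub 151 119 125; LOp Mul 152 141 115;
      LOp Defs.Sub 12 12 141].

Definition election (f v : nat) : cmd := Seq (Loc (set_key f v)) elect.

(** The elections use the left child fields of the chunk's leaves as scratch, with base
    [3 * base + 1] and stride 3; those of raked leaves stay null too. [Wr 3 4 32 94] puts null back
    before the rakes, so that the checkpoint shows the tree alone. *)
Definition tree_round : cmd :=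
  Seq (Loc participate)
  (Seq (Rd 3 87 88 104)
  (Seq (election 87 88)
  (Seq (Loc [:: LOp Mul 109 87 58; LOp Mul 110 103 88; LOp Add 111 110 4; LOp Add 112 110 5])
  (Seq (Rd 3 109 90 110)
  (Seq (Rd 3 109 91 111)
  (Seq (Rd 3 109 92 112)
  (Seq (election 109 90)
  (Seq (Loc [:: LOp Mul 113 109 58; LOp Defs.Sub 114 94 90; LMin 115 114 4; LOp Mul 116 113 115;
                LOp Mul 117 103 90; LOp Add 118 117 4; LOp Add 119 117 5])
  (Seq (Rd 3 116 120 118)
  (Seq (Rd 3 116 121 119)
  (Seq (Loc select_rake)
  (Seq (Wr 3 4 32 94)
  (Seq (Wr 3 141 150 90)
  (Seq (Wr 3 152 151 149)
       (Mark 11 141))))))))))))))).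

Lemma eq_flag a b : 1 - (a - b + (b - a)) = (a == b).
Proof. by case: eqP => h; lia. Qed.

(** * One round of rakes on the machine *)

Section TreeRun.
Variables (n p : nat) (rho : nat -> nat) (M0 : memory) (D : nat).
Hypothesis np : 0 < p <= n.
Let L := bits n.
Let base := minn D (n - p).

Let chunk := in_chunk n p D.

Definition tree_ok (X Y : pred nat) (M : memory) (l : seq (nat * seq nat * memory)) (t : nat) : Prop :=
  [/\ treed n rho X Y M, forall v, v < n -> M (left_ v) = tnull n,
      chain (rake n) 0 M0 l, (last_mark 0 M0 l).1 <= t /\ (last_mark 0 M0 l).2 = M
    & perm_eq (flatten [seq e.1.2 | e <- l]) [seq v <- iota 0 n | ~~ X v]].

(** The leaf [n - 1] counts as remaining whatever has been done, as it is never raked. *)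
Definition leaves_from (D : nat) (v : nat) : bool := (v < n) && ((D <= v) || (v == n.-1)).

Definition tree_env (X Y : pred nat) (s : state) : Prop :=
  [/\ env n p L s /\ reg s 157 base, forall q, rg s q 11 = base + q,
      forall q, q < p -> rg s q 12 = X (base + q) && (base + q < n.-1),
      tree_ok X Y (mm s) (lg s) (tm s)
    & X n.-1 /\ forall v, ~~ chunk v -> X v = leaves_from D v].

Lemma tree_later X Y M l t t' : t <= t' -> tree_ok X Y M l t -> tree_ok X Y M l t'.
Proof. by move=> tt' [h1 h2 h3 [h4 h5] h6]; split=> //; split=> //; exact: leq_trans h4 tt'. Qed.

Lemma leaf_bound q : q < p -> base + q < n.
Proof. by rewrite /base; lia. Qed.

Lemma tree_bits_small v : v <= n.*2 -> v < 2 ^ L.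
Proof. by have := bits_le n; rewrite -/L; lia. Qed.

Lemma in_chunkP v : chunk v -> exists2 q, q < p & v = base + q.
Proof. by rewrite /chunk /in_chunk -/base => /andP[h h']; exists (v - base); lia. Qed.

Lemma chunk_index q : q < p -> chunk (base + q).
Proof. by rewrite /chunk /in_chunk -/base; lia. Qed.

Lemma inner_cell v c : n <= v -> c = parent_ v \/ c = left_ v \/ c = right_ v ->
  forall q, q < p -> c <> left_ (base + q).
Proof.
move=> nv cE q qp; have := leaf_bound qp; clear -nv cE.
by case: cE => [->|[->|->]]; rewrite /parent_ /left_ /right_; lia.
Qed.

Lemma chunk_cell q : q < p -> base + q < n.*2.-1.
Proof. by move=> qp; have := leaf_bound qp; lia. Qed.

Lemma n_le : n <= n.*2.-1.
Proof. by lia. Qed.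

Lemma null_flag y : y <= n.*2.-1 -> minn (tnull n - y) 1 = (y != tnull n).
Proof. by rewrite /tnull => h; case: eqP => E /=; lia. Qed.

Lemma free_flag (y bb b0 : nat) : 1 - minn (n - y) 1 * (bb == b0) = ((n <= y) || (bb != b0)).
Proof. by case: eqP => E /=; case: leqP => h /=; lia. Qed.

Definition election_time : nat := (40 * L + 100) * L + 60.

Lemma p_bits : p <= 2 ^ L.
Proof. by apply: ltnW; apply: tree_bits_small; lia. Qed.

Lemma slot_left q : slot (3 * base + 1) 3 q = left_ (base + q).
Proof. by rewrite /slot /left_; lia. Qed.

Lemma left_bound q : q < p -> 3 * base + 1 + 3 * q < 3 * n.*2.-1.
Proof. by move=> qp; have := leaf_bound qp; lia. Qed.

(** Non-participants share the key [2n], above every competing value, so they form a group of their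
    own and no participant can lose to them. *)
Lemma wp_election (f : pred nat) (v : nat -> nat) fr vr s : env n p L s ->
  reg s 30 (3 * base + 1) -> reg s 31 3 -> reg s 95 (n.*2) ->
  (forall q, q < p -> rg s q fr = f q) -> (forall q, q < p -> f q -> rg s q vr = v q) ->
  (forall q, q < p -> f q -> v q < n.*2) ->
  vr \notin [:: 57; 106; 107; 108; 6] -> fr \notin [:: 57; 106; 107; 108; 6] ->
  95 \notin [:: 57; 106; 107; 108; 6] ->
  den (sym (set_key fr vr) 57) =1 (fun R => R fr * R vr + (R 4 - R fr) * R 95) ->
  wp p (3 * n.*2.-1) true (election fr vr)
    (fun s' => exists2 lead : nat -> bool,
      [/\ forall q q', q < p -> q' < p -> f q -> f q' -> lead q -> lead q' -> v q = v q' -> q = q',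
          forall q, q < p -> f q -> exists2 q', q' < p & [/\ f q', lead q' & v q' = v q]
        & forall q, q < p -> rg s' q 58 = lead q] &
      [/\ forall q, rg s' q 32 = left_ (base + q),
          forall a, (forall q, q < p -> a <> left_ (base + q)) -> mm s' a = mm s a
        & tm s' <= tm s + election_time + 10]) s.
Proof.
move=> ge h30 h31 h95 hf hv vlt nv nf n95 symk.
case: (ge) => h0 [h1 h2 h3 h4 h5] [h7 h8].
pose key q := if f q then v q else n.*2.
apply: wp_seq; apply: wp_loc => s1 R1 M1 t1 _.
have r1 r : r \notin [:: 57; 106; 107; 108; 6] -> forall q, rg s1 q r = rg s q r.
  move=> rn q; rewrite R1 -symE locals_frame //; apply: contraNN rn => /=.
  by rewrite !inE => /or4P[] /eqP->.
have k1 q : q < p -> rg s1 q 57 = key q.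
  move=> qp; rewrite R1 symk hf // h95 h4 /key; case fq: (f q).
    by rewrite hv // subnn mul0n addn0 mul1n.
  by rewrite mul0n subn0 mul1n.
have key_lt q : q < p -> key q < 2 ^ L.
  by move=> qp; apply: tree_bits_small; rewrite /key; case: ifP => // fq; exact: ltnW (vlt q qp fq).
have ge1 : [/\ forall q, rg s1 q 0 = q, [/\ reg s1 1 p, reg s1 3 0, reg s1 4 1 & reg s1 5 2]
     & [/\ reg s1 7 (2 ^ L), reg s1 8 L, reg s1 30 (3 * base + 1) & reg s1 31 3]].
  by split; [|split|split] => q; rewrite r1.
have p0 : 0 < p by case/andP: np.
have := @wp_elect p (3 * n.*2.-1) L (3 * base + 1) 3 true isT p0 p_bits (bits_gt0 n) left_bound key key_lt s1 ge1 k1.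
move/wp_conseq; apply=> s2 [lead [uq ex] [r58 r32 os t2]]; exists lead.
  split=> //.
  - by move=> q q' qp qp' fq fq' lq lq' E; apply: uq => //; rewrite /key fq fq'.
  - move=> q qp fq; have [q' qp' [lq' E]] := ex q qp; exists q' => //.
    move: E; rewrite /key fq; case fq': (f q') => // E; have := vlt q qp fq; lia.
split.
- by move=> q; rewrite r32 slot_left.
- by move=> a na; rewrite os ?M1 // => q qp; rewrite slot_left; exact: na.
- by move: t1 t2; rewrite /election_time /cost_local /=; lia.
Qed.

Definition alive_leaf (X : pred nat) (v : nat) : bool := [&& chunk v, X v & v < n.-1].

Lemma alive_parent X Y M v : treed n rho X Y M -> X n.-1 -> alive_leaf X v -> M (parent_ v) <> tnull n.
Proof. by move=> tr Xn /and3P[_ Xv lt]; apply: (leaf_parent tr Xv Xn); lia. Qed.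

Definition round_result (X Y : pred nat) (k b : nat) (M M' : memory) (S : pred nat) : Prop :=
  [/\ forall l, S l -> alive_leaf X l, independent_rakes n S M, raked n S M M'
    & forall l, alive_leaf X l -> bit k l = b -> free_uncle n k b (uncle n M l) ->
        exists2 r, S r & l = r \/ l \in neighbours n M r].

Lemma wp_tree_round X Y k b s : b < 2 -> tree_env X Y s -> reg s 16 (2 ^ k) -> reg s 17 b ->
  wp p (3 * n.*2.-1) true tree_round
    (fun s' => exists2 S, round_result X Y k b (mm s) (mm s') S &
       tree_env (fun v => X v && ~~ S v) (fun v => Y v && ~~ removed n S (mm s) v) s' /\
       tm s' <= tm s + 2 * election_time + 120) s.
Proof.
move=> b2 te h16 h17; have [[ge h10] h11 h12 [tr lnull ch [lt lm] bt] [Xlast Xout]] := te.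
case: (ge) => h0 [h1 h2 h3 h4 h5] [h7 h8].
set M := mm s in tr lnull lm *.
case: (tr) => hX hY hP hC hR.
have xn q : q < p -> X (base + q) -> base + q < n.-1 -> M (parent_ (base + q)) <> tnull n.
  by move=> qp Xq lq; apply: (alive_parent tr Xlast); rewrite /alive_leaf chunk_index ?Xq.
pose P v := alive_leaf X v && (bit k v == b).
have PE q : q < p -> P (base + q) = X (base + q) && (base + q < n.-1) && (bit k (base + q) == b).
  by move=> qp; rewrite /P /alive_leaf chunk_index.
have PX v : P v -> X v by case/andP=> /and3P[].
have Pn v : P v -> M (parent_ v) <> tnull n by case/andP=> + _; exact: (alive_parent tr).
have Pb v : P v -> bit k v = b by case/andP=> _ /eqP.
have Pin v : P v -> exists2 q, q < p & v = base + q by case/andP=> /and3P[/in_chunkP].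
have VP v : P v -> X v || Y v by move/PX => ->.
pose x v := M (parent_ v); pose g v := M (parent_ (x v)).
have Yx v : P v -> Y (x v) by move=> Pv; have [] := treed_parent tr (VP v Pv) (Pn v Pv).
have Vx v : P v -> X (x v) || Y (x v) by move/Yx => ->; rewrite orbT.
have xlt v : P v -> n <= x v < n.*2.-1 by move/Yx/hY.
have gle v : P v -> g v <= n.*2.-1.
  move=> Pv; case: (g v =P tnull n) => [-> //|gn].
  by have [/hY + _ _] := treed_parent tr (Vx v Pv) gn; rewrite /g /tnull; lia.
apply: wp_seq; apply: wp_loc => s1 R1 M1 t1 l1.
have r1 r : r \in [:: 0; 1; 2; 3; 4; 5; 7; 8; 157; 11; 12; 16; 17] -> forall q, rg s1 q r = rg s q r.
  by rewrite !inE => rin q; rewrite R1; move: rin; do ![case/orP=> [/eqP->|]]; try move/eqP->; symc.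
have ge1 : env n p L s1 by split; [|split|split] => q; rewrite r1.
have c30 : reg s1 30 (3 * base + 1) by move=> q; symb R1; rewrite h4 h5 h10.
have c31 : reg s1 31 3 by move=> q; symb R1; rewrite h4 h5.
have c103 : reg s1 103 3 by move=> q; symb R1; rewrite h4 h5.
have c94 : reg s1 94 (tnull n) by move=> q; symb R1; rewrite h4 h5 h2 mul2n subn1.
have c95 : reg s1 95 n.*2 by move=> q; symb R1; rewrite h5 h2 mul2n.
have c87 q : q < p -> rg s1 q 87 = P (base + q).
  move=> qp; symb R1; rewrite h12 // h11 h16 h17 h5 h4 eq_flag PE // -/(bit k (base + q)).
  by case: (_ && _); case: (_ == _).
have c104 q : rg s1 q 104 = parent_ (base + q) by symb R1; rewrite h11 h4 h5.
have a1 q : q < p -> active s1 3 87 q = P (base + q).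
  by move=> qp; rewrite /active c87 // r1 // h3; case: (P _).
apply: wp_seq; apply: wp_rd.
  split=> [q qp _|_ q q' qp qp' _ _]; rewrite !c104; last by move/parent_inj/addnI.
  exact: parent_lt (chunk_cell qp).
move=> s2 R2 r88 M2 t2 l2.
have M2E : mm s2 = M by rewrite M2 M1.
have c88 q : q < p -> P (base + q) -> rg s2 q 88 = x (base + q).
  by move=> qp Pq; rewrite r88 a1 // Pq c104 M1.
have ge2 : env n p L s2 by split; [|split|split] => q; rewrite R2 // r1.
have e1 := @wp_election (fun q => P (base + q)) (fun q => x (base + q)) 87 88 s2 ge2
  (fun q => etrans (R2 q 30 isT) (c30 q)) (fun q => etrans (R2 q 31 isT) (c31 q))
  (fun q => etrans (R2 q 95 isT) (c95 q)).
apply: wp_seq; apply: (wp_frame (e1 _ c88 _ isT isT isT _)) => {e1}.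
- by move=> q qp; rewrite R2 // c87.
- by move=> q qp /xlt; lia.
- by move=> R; symc.
move=> s3 fr3 lg3 [lead1 [u1 ex1 r58] [r32 off3 t3]].
pose W1 v := P v && lead1 (v - base).
have W1E q : W1 (base + q) = P (base + q) && lead1 q by rewrite /W1 addKn.
have W1P v : W1 v -> P v by case/andP.
have W1_unique v v' : W1 v -> W1 v' -> x v = x v' -> v = v'.
  move=> Wv Wv'; have [q qp vE] := Pin v (W1P v Wv); have [q' qp' vE'] := Pin v' (W1P v' Wv').
  subst v v'; move: Wv Wv'; rewrite !W1E => /andP[Pq lq] /andP[Pq' lq'] E.
  by rewrite (u1 q q').
have W1_exists v : P v -> exists2 v', W1 v' & x v' = x v.
  move=> Pv; have [q qp vE] := Pin v Pv; subst v.
  by have [q' qp' [Pq' lq' E]] := ex1 q qp Pv; exists (base + q'); rewrite ?W1E ?Pq'.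
have f3 r : r \notin 88 :: mods (election 87 88) -> forall q, rg s3 q r = rg s1 q r.
  by rewrite inE negb_or => /andP[n88 rn] q; rewrite fr3 // R2.
have off3' a : (forall q, q < p -> a <> left_ (base + q)) -> mm s3 a = M a.
  by move=> na; rewrite off3 // M2E.
have rdM c v : n <= v -> c = parent_ v \/ c = left_ v \/ c = right_ v -> mm s3 c = M c.
  by move=> nv cE; apply: off3'; exact: inner_cell nv cE.
apply: wp_seq; apply: wp_loc => s4 R4 M4 t4 l4.
have r4 r : r \notin [:: 109; 110; 111; 112] -> forall q, rg s4 q r = rg s3 q r.
  by move=> rn q; rewrite R4 -symE locals_frame.
have c88' q : q < p -> P (base + q) -> rg s3 q 88 = x (base + q).
  by move=> qp Pq; rewrite fr3 // c88.
have c109 q : q < p -> rg s4 q 109 = W1 (base + q).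
  move=> qp; symb R4; rewrite r58 // f3 // c87 // W1E.
  by case: (P _); case: (lead1 q).
have a4 q : q < p -> active s4 3 109 q = W1 (base + q).
  by move=> qp; rewrite /active c109 // r4 // f3 // r1 // h3; case: (W1 _).
have c110 q : q < p -> W1 (base + q) -> rg s4 q 110 = parent_ (x (base + q)).
  by move=> qp /W1P Pq; symb R4; rewrite c88' // f3 // c103.
have c111 q : q < p -> W1 (base + q) -> rg s4 q 111 = left_ (x (base + q)).
  by move=> qp /W1P Pq; symb R4; rewrite c88' // !f3 // c103 r1 // h4.
have c112 q : q < p -> W1 (base + q) -> rg s4 q 112 = right_ (x (base + q)).
  by move=> qp /W1P Pq; symb R4; rewrite c88' // !f3 // c103 r1 // h5.
have uniqW q q' : q < p -> q' < p -> W1 (base + q) -> W1 (base + q') -> x (base + q) = x (base + q') -> q = q'.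
  by move=> qp qp' Wq Wq' /(W1_unique _ _ Wq Wq')/addnI.
have bnd q : q < p -> W1 (base + q) -> n <= x (base + q) < n.*2.-1 by move=> _ /W1P/xlt.
apply: wp_seq; apply: wp_rd.
  split=> [q qp|_ q q' qp qp']; rewrite a4 // => Wq.
    by rewrite c110 //; apply: parent_lt; case/andP: (bnd q qp Wq).
  by rewrite a4 // => Wq'; rewrite !c110 // => /parent_inj; exact: uniqW.
move=> s5 R5 r90 M5 t5 l5.
have a5 q : active s5 3 109 q = active s4 3 109 q by rewrite /active !R5.
apply: wp_seq; apply: wp_rd.
  split=> [q qp|_ q q' qp qp']; rewrite a5 a4 // => Wq; rewrite !R5 //.
    by rewrite c111 //; apply: left_lt; case/andP: (bnd q qp Wq).
  by rewrite a5 a4 // => Wq'; rewrite !c111 // => /left_inj; exact: uniqW.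
move=> s6 R6 r91 M6 t6 l6.
have a6 q : active s6 3 109 q = active s4 3 109 q by rewrite /active !R6 // !R5.
apply: wp_seq; apply: wp_rd.
  split=> [q qp|_ q q' qp qp']; rewrite a6 a4 // => Wq; rewrite !R6 // !R5 //.
    by rewrite c112 //; apply: right_lt; case/andP: (bnd q qp Wq).
  by rewrite a6 a4 // => Wq'; rewrite !c112 // => /right_inj; exact: uniqW.
move=> s7 R7 r92 M7 t7 l7.
have f7 r : r \notin [:: 90; 91; 92] -> forall q, rg s7 q r = rg s4 q r.
  by rewrite !inE !negb_or => /and3P[n1 n2 n3] q; rewrite R7 // R6 // R5.
have c90 q : q < p -> W1 (base + q) -> rg s7 q 90 = g (base + q).
  move=> qp Wq; rewrite R7 // R6 // r90 a4 // Wq c110 // M4.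
  by apply: (rdM _ (x (base + q))); [case/andP: (bnd q qp Wq) | by left].
have c91 q : q < p -> W1 (base + q) -> rg s7 q 91 = M (left_ (x (base + q))).
  move=> qp Wq; rewrite R7 // r91 a5 a4 // Wq R5 // c111 // M5 M4.
  by apply: (rdM _ (x (base + q))); [case/andP: (bnd q qp Wq) | by right; left].
have c92 q : q < p -> W1 (base + q) -> rg s7 q 92 = M (right_ (x (base + q))).
  move=> qp Wq; rewrite r92 a6 a4 // Wq R6 // R5 // c112 // M6 M5 M4.
  by apply: (rdM _ (x (base + q))); [case/andP: (bnd q qp Wq) | by right; right].
have g1 r : r \in [:: 0; 1; 2; 3; 4; 5; 7; 8; 157; 11; 12; 16; 17] -> forall q, rg s7 q r = rg s q r.
  by move=> rin q; rewrite -r1 //; move: rin; rewrite !inE; do ![case/orP=> [/eqP->|]]; try move/eqP->; rewrite f7 // r4 // f3.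
have ge7 : env n p L s7 by split; [|split|split] => q; rewrite g1.
have d30 : reg s7 30 (3 * base + 1) by move=> q; rewrite f7 // r4 // f3 // c30.
have d31 : reg s7 31 3 by move=> q; rewrite f7 // r4 // f3 // c31.
have d95 : reg s7 95 n.*2 by move=> q; rewrite f7 // r4 // f3 // c95.
have d94 : reg s7 94 (tnull n) by move=> q; rewrite f7 // r4 // f3 // c94.
have d103 : reg s7 103 3 by move=> q; rewrite f7 // r4 // f3 // c103.
have d88 q : q < p -> W1 (base + q) -> rg s7 q 88 = x (base + q).
  by move=> qp /W1P Wq; rewrite f7 // r4 // c88'.
have e2 := @wp_election (fun q => W1 (base + q)) (fun q => g (base + q)) 109 90 s7 ge7 d30 d31 d95.
apply: wp_seq; apply: (wp_frame (e2 _ c90 _ isT isT isT _)) => {e2}.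
- by move=> q qp; rewrite f7 // c109.
- by move=> q qp /W1P/gle; lia.
- by move=> R; symc.
move=> s8 fr8 lg8 [lead2 [u2 ex2 r58'] [r32' off8 t8]].
pose W2 v := W1 v && lead2 (v - base).
have W2E q : W2 (base + q) = W1 (base + q) && lead2 q by rewrite /W2 addKn.
have W2W1 v : W2 v -> W1 v by case/andP.
have W2_unique v v' : W2 v -> W2 v' -> g v = g v' -> v = v'.
  move=> Wv Wv'; have [q qp vE] := Pin v (W1P v (W2W1 v Wv)); have [q' qp' vE'] := Pin v' (W1P v' (W2W1 v' Wv')).
  subst v v'; move: Wv Wv'; rewrite !W2E => /andP[Pq lq] /andP[Pq' lq'] E.
  by rewrite (u2 q q').
have W2_exists v : W1 v -> exists2 v', W2 v' & g v' = g v.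
  move=> Wv; have [q qp vE] := Pin v (W1P v Wv); subst v.
  by have [q' qp' [Wq' lq' E]] := ex2 q qp Wv; exists (base + q'); rewrite ?W2E ?Wq'.
have off8' a : (forall q, q < p -> a <> left_ (base + q)) -> mm s8 a = M a.
  by move=> na; rewrite off8 // M7 M6 M5 M4 off3'.
have rdM8 c v : n <= v -> c = parent_ v \/ c = left_ v \/ c = right_ v -> mm s8 c = M c.
  by move=> nv cE; apply: off8'; exact: inner_cell nv cE.
have e8 r : r \notin mods (election 109 90) -> forall q, rg s8 q r = rg s7 q r.
  by move=> rn q; rewrite fr8.
apply: wp_seq; apply: wp_loc => s9 R9 M9 t9 l9.
have r9 r : r \notin [:: 113; 114; 6; 115; 116; 117; 118; 119] -> forall q, rg s9 q r = rg s8 q r.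
  by move=> rn q; rewrite R9 -symE locals_frame.
have c113 q : q < p -> rg s9 q 113 = W2 (base + q).
  move=> qp; symb R9; rewrite r58' // e8 // f7 // c109 // W2E.
  by case: (W1 _); case: (lead2 q).
have c115 q : q < p -> W2 (base + q) -> rg s9 q 115 = (g (base + q) != tnull n).
  move=> qp /W2W1 Wq; symb R9; rewrite !e8 // c90 // (g1 4) // h4 d94.
  exact: null_flag (gle _ (W1P _ Wq)).
have c116 q : q < p -> rg s9 q 116 = W2 (base + q) && (g (base + q) != tnull n).
  move=> qp; have -> : rg s9 q 116 = rg s9 q 113 * rg s9 q 115 by do !symb R9.
  rewrite c113 //; case Wq: (W2 _) => //; by rewrite c115 // mul1n.
have a9 q : q < p -> active s9 3 116 q = W2 (base + q) && (g (base + q) != tnull n).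
  by move=> qp; rewrite /active c116 // r9 // e8 // g1 // h3; case: (_ && _).
have c118 q : q < p -> W2 (base + q) -> rg s9 q 118 = left_ (g (base + q)).
  by move=> qp /W2W1 Wq; symb R9; rewrite !e8 // c90 // d103 g1 // h4.
have c119 q : q < p -> W2 (base + q) -> rg s9 q 119 = right_ (g (base + q)).
  by move=> qp /W2W1 Wq; symb R9; rewrite !e8 // c90 // d103 g1 // h5.
have gY v : W2 v -> g v != tnull n -> n <= g v < n.*2.-1.
  by move=> /W2W1/W1P Pv /eqP gn; have [/hY + _ _] := treed_parent tr (Vx v Pv) gn.
have uniqG q q' : q < p -> q' < p -> W2 (base + q) -> W2 (base + q') -> g (base + q) = g (base + q') -> q = q'.
  by move=> qp qp' Wq Wq' /(W2_unique _ _ Wq Wq')/addnI.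
apply: wp_seq; apply: wp_rd.
  split=> [q qp|_ q q' qp qp']; rewrite a9 // => /andP[Wq gq].
    by rewrite c118 //; apply: left_lt; case/andP: (gY _ Wq gq).
  by rewrite a9 // => /andP[Wq' gq']; rewrite !c118 // => /left_inj; exact: uniqG.
move=> s10 R10 r120 M10 t10 l10.
have a10 q : active s10 3 116 q = active s9 3 116 q by rewrite /active !R10.
apply: wp_seq; apply: wp_rd.
  split=> [q qp|_ q q' qp qp']; rewrite a10 a9 // => /andP[Wq gq]; rewrite !R10 //.
    by rewrite c119 //; apply: right_lt; case/andP: (gY _ Wq gq).
  by rewrite a10 a9 // => /andP[Wq' gq']; rewrite !c119 // => /right_inj; exact: uniqG.
move=> s11 R11 r121 M11 t11 l11.
have f11 r : r \notin [:: 120; 121] -> forall q, rg s11 q r = rg s9 q r.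
  by rewrite !inE !negb_or => /andP[n1 n2] q; rewrite R11 // R10.
have c120 q : q < p -> W2 (base + q) -> g (base + q) != tnull n -> rg s11 q 120 = M (left_ (g (base + q))).
  move=> qp Wq gq; rewrite R11 // r120 a9 // Wq gq c118 // M9.
  by apply: (rdM8 _ (g (base + q))); [case/andP: (gY _ Wq gq) | by right; left].
have c121 q : q < p -> W2 (base + q) -> g (base + q) != tnull n -> rg s11 q 121 = M (right_ (g (base + q))).
  move=> qp Wq gq; rewrite r121 a10 a9 // Wq gq R10 // c119 // M10 M9.
  by apply: (rdM8 _ (g (base + q))); [case/andP: (gY _ Wq gq) | by right; right].
set S := winner n M k b W2.
have ind : independent_rakes n S M := winner_independent tr PX Pn Pb W1P W2W1 W1_unique W2_unique.
have near := winner_near tr (k := k) (b := b) PX Pn W1P W2W1 W1_exists W2_exists.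
have SW v : S v -> W2 v by case/andP.
have SX v : S v -> X v by move/SW/W2W1/W1P/PX.
have SA v : S v -> alive_leaf X v by move/SW/W2W1/W1P/andP; case.
pose sb v := sibling M (x v) v.
have sbP v : S v -> [/\ n <= x v, sb v < n.*2.-1 & M (parent_ (sb v)) = x v].
  move=> Sv; have [Vs ps _ _ _] := raked_sibling tr SX ind Sv; split=> //.
    by case/andP: (xlt _ (W1P _ (W2W1 _ (SW _ Sv)))).
  by case/orP: Vs => [/hX|/hY/andP[_]//]; rewrite -/(sb v) => h; apply: leq_trans h _; exact: n_le.
apply: wp_seq; apply: wp_loc => s12 R12 M12 t12 l12.
have r12 r : r \notin flatten (map local_target select_rake) -> forall q, rg s12 q r = rg s11 q r.
  by move=> rn q; rewrite R12 -symE locals_frame.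
have h113 q : q < p -> rg s11 q 113 = W2 (base + q) by move=> qp; rewrite f11 // c113.
have h116 q : q < p -> rg s11 q 116 = W2 (base + q) && (g (base + q) != tnull n).
  by move=> qp; rewrite f11 // c116.
have hr r : r \in [:: 0; 1; 2; 3; 4; 5; 7; 8; 157; 11; 12; 16; 17] -> forall q, rg s11 q r = rg s q r.
  by move=> rin q; rewrite -g1 //; move: rin; rewrite !inE; do ![case/orP=> [/eqP->|]]; try move/eqP->; rewrite f11 // r9 // e8.
have h88 q : q < p -> W2 (base + q) -> rg s11 q 88 = x (base + q).
  by move=> qp /W2W1 Wq; rewrite f11 // r9 // e8 // d88.
have h91 q : q < p -> W2 (base + q) -> rg s11 q 91 = M (left_ (x (base + q))).
  by move=> qp /W2W1 Wq; rewrite f11 // r9 // e8 // c91.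
have h92 q : q < p -> W2 (base + q) -> rg s11 q 92 = M (right_ (x (base + q))).
  by move=> qp /W2W1 Wq; rewrite f11 // r9 // e8 // c92.
have h90 q : q < p -> W2 (base + q) -> rg s11 q 90 = g (base + q).
  by move=> qp /W2W1 Wq; rewrite f11 // r9 // e8 // c90.
have h103 q : rg s11 q 103 = 3 by rewrite f11 // r9 // e8.
have h119 q : q < p -> W2 (base + q) -> rg s11 q 119 = right_ (g (base + q)).
  by move=> qp Wq; rewrite f11 // c119.
have h115 q : q < p -> W2 (base + q) -> rg s11 q 115 = (g (base + q) != tnull n).
  by move=> qp Wq; rewrite f11 // c115.
have k125 q : q < p -> W2 (base + q) -> g (base + q) != tnull n ->
    rg s12 q 125 = (M (left_ (g (base + q))) == x (base + q)).
  by move=> qp Wq gq; symb R12; rewrite (hr 4) // h4 eq_flag c120 // h88.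
have k129 q : q < p -> W2 (base + q) -> g (base + q) != tnull n -> rg s12 q 129 = uncle n M (base + q).
  move=> qp Wq gq; have -> : rg s12 q 129 = rg s12 q 125 * rg s11 q 121 + (rg s11 q 4 - rg s12 q 125) * rg s11 q 120.
    by do !symb R12.
  rewrite k125 // c120 // c121 // (hr 4) // h4 /uncle -/(x (base + q)) -/(g (base + q)) (negbTE gq) /sibling.
  by case: eqP => _ /=; rewrite ?subnn ?subn0 !mul0n !mul1n ?addn0.
have k141 q : q < p -> rg s12 q 141 = S (base + q).
  move=> qp; have -> : rg s12 q 141 = rg s11 q 113 * (rg s11 q 4 -
      minn (rg s11 q 2 - rg s12 q 129) (rg s11 q 4) *
      (rg s11 q 4 - (rg s12 q 129 %/ rg s11 q 16 %% rg s11 q 5 - rg s11 q 17 +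
         (rg s11 q 17 - rg s12 q 129 %/ rg s11 q 16 %% rg s11 q 5))) * rg s11 q 116).
    by do !symb R12.
  rewrite h113 // h116 // (hr 2) // (hr 4) // (hr 5) // (hr 16) // (hr 17) // h2 h4 h5 h16 h17 eq_flag.
  rewrite /S /winner; case Wq: (W2 _) => //=; case gq: (g _ == tnull n) => /=.
    by rewrite /free_uncle /uncle -/(x (base + q)) -/(g (base + q)) gq muln0 subn0; have -> : n <= tnull n by exact: n_le.
  rewrite k129 ?gq // /free_uncle -/(uncle n M (base + q)) muln1.
  by rewrite free_flag mul1n.
have k149 q : q < p -> S (base + q) -> rg s12 q 149 = sb (base + q).
  move=> qp Sq; have Wq := SW _ Sq; have -> : rg s12 q 149 =
      minn ((rg s11 q 4 - (rg s11 q 91 - rg s11 q 11 + (rg s11 q 11 - rg s11 q 91))) * rg s11 q 92 +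
      (rg s11 q 4 - (rg s11 q 4 - (rg s11 q 91 - rg s11 q 11 + (rg s11 q 11 - rg s11 q 91)))) * rg s11 q 91) (rg s11 q 95).
    by do !symb R12.
  have -> : rg s11 q 95 = n.*2 by rewrite f11 // r9 // e8 // d95.
  rewrite (hr 4) // (hr 11) // h4 h11 h91 // h92 // eq_flag.
  have -> : forall c : bool, c * M (right_ (x (base + q))) + (1 - c) * M (left_ (x (base + q))) =
      if c then M (right_ (x (base + q))) else M (left_ (x (base + q))).
    by case; rewrite ?subnn ?subn0 !mul0n !mul1n ?addn0.
  by apply/minn_idPl; case: (sbP _ Sq) => _ + _; rewrite /sb /sibling; lia.
have k150 q : q < p -> S (base + q) -> rg s12 q 150 = parent_ (sb (base + q)).
  move=> qp Sq; rewrite -k149 //; have -> : rg s12 q 150 = rg s11 q 103 * rg s12 q 149 by do !symb R12.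
  by rewrite h103.
have k152 q : q < p -> rg s12 q 152 = S (base + q) && (g (base + q) != tnull n).
  move=> qp; have -> : rg s12 q 152 = rg s12 q 141 * rg s11 q 115 by do !symb R12.
  rewrite k141 //; case Sq: (S _) => //; by rewrite h115 ?SW // mul1n.
have k151 q : q < p -> S (base + q) -> g (base + q) != tnull n ->
    rg s12 q 151 = slot_of M (g (base + q)) (x (base + q)).
  move=> qp Sq gq; have -> : rg s12 q 151 = rg s11 q 119 - rg s12 q 125 by do !symb R12.
  rewrite h119 ?SW // k125 ?SW // /slot_of.
  by case: eqP => _ /=; rewrite ?subn0 // /left_ /right_ addn2 subn1 addn1.
have k32 q : rg s12 q 32 = left_ (base + q) by rewrite r12 // f11 // r9 // r32'.
have k94 q : rg s12 q 94 = tnull n by rewrite r12 // f11 // r9 // e8.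
have k3 q : rg s12 q 3 = 0 by rewrite r12 // (hr 3).
have k4 q : rg s12 q 4 = 1 by rewrite r12 // (hr 4).
apply: wp_seq; apply: wp_wr.
  split=> [q qp _|_ q q' qp qp' _ _]; rewrite !k32; last by move/left_inj/addnI.
  exact: left_lt (chunk_cell qp).
move=> s13 R13 hit13 miss13 t13 l13.
(* Both elections disturbed only fields that were null, so after writing null the memory is exactly
   that of the beginning of the round. *)
have M13 : mm s13 = M.
  apply: functional_extensionality => a.
  case: (boolP (has (fun q => a == left_ (base + q)) (iota 0 p))) => [/hasP[q]|/hasPn no].
    rewrite mem_iota => /andP[_ qp] /eqP ->; rewrite lnull ?leaf_bound // -k32 hit13 ?k94 //.
    by rewrite /active k3 k4.
  have na q : q < p -> a <> left_ (base + q).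
    by move=> qp E; have := no q; rewrite mem_iota qp E eqxx => /(_ isT).
  rewrite miss13; last by move=> q qp _; rewrite k32; exact: na.
  by rewrite M12 M11 M10 M9 off8'.
have a13 q : q < p -> active s13 3 141 q = S (base + q).
  by move=> qp; rewrite /active !R13 k141 // k3; case: (S _).
apply: wp_seq; apply: wp_wr.
  split=> [q qp|_ q q' qp qp']; rewrite a13 // => Sq.
    by rewrite R13 k150 //; apply: parent_lt; have [_ h _] := sbP _ Sq.
  rewrite a13 // => Sq'; rewrite !R13 !k150 // => /parent_inj E.
  have [_ _ p1] := sbP _ Sq; have [_ _ p2] := sbP _ Sq'.
  by apply: uniqW => //; [apply: W2W1; exact: SW | apply: W2W1; exact: SW | rewrite -p1 E p2].
move=> s14 R14 hit14 miss14 t14 l14.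
have a14 q : q < p -> active s14 3 152 q = S (base + q) && (g (base + q) != tnull n).
  by move=> qp; rewrite /active !R14 !R13 k152 // k3; case: (_ && _).
apply: wp_seq; apply: wp_wr.
  split=> [q qp|_ q q' qp qp']; rewrite a14 // => /andP[Sq gq]; rewrite !R14 !R13 k151 //.
    by apply: slot_lt; case/andP: (gY _ (SW _ Sq) gq).
  rewrite a14 // => /andP[Sq' gq']; rewrite k151 // => /slot_inj_parent.
  by apply: uniqG => //; exact: SW.
move=> s15 R15 hit15 miss15 t15 l15.
have inS v : S v -> exists2 q, q < p & v = base + q by move/SW/W2W1/W1P/Pin.
have rk : raked n S M (mm s15).
  split.
  - move=> v Sv; have [q qp vE] := inS v Sv; subst v.
    rewrite -/(x (base + q)) -/(sb (base + q)) -k150 // miss15 => [|q' qp'].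
      by rewrite -R13 hit14 ?R13 ?a13 // r12 // h90 ?SW.
    rewrite a14 // => /andP[Sq' gq']; rewrite R14 R13 k151 // k150 //.
    exact: parent_slot.
  - move=> v Sv /eqP gv; have [q qp vE] := inS v Sv; subst v.
    rewrite -/(x (base + q)) -/(g (base + q)) -k151 // -(R13 q) -(R14 q) hit15 ?R14 ?R13 ?k149 //.
    by rewrite a14 // Sv.
  - move=> a na1 na2; rewrite miss15 => [|q qp].
      rewrite miss14 ?M13 // => q qp; rewrite a13 // => Sq.
      by rewrite R13 k150 //; exact: na1.
    rewrite a14 // => /andP[Sq gq]; rewrite R14 R13 k151 //; apply: na2 => //; exact/eqP.
apply: wp_mark; exists S; first by split=> //= v Av bv fu; apply: near; rewrite // /P Av bv eqxx.
have lgE : lg s15 = lg s by rewrite l15 l14 l13 l12 l11 l10 l9 lg8.1 // l7 l6 l5 l4 lg3.1 // l2 l1.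
split; last first.
  by move: t15 t14 t13 t12 t11 t10 t9 t8 t7 t6 t5 t4 t3 t2 t1; rewrite /= /cost_local /=; lia.
set sl := marked _ _ _ _.
have tle : tm s <= tm s15.
  rewrite t15 t14 t13 t12 t11 t10 t9; do ![apply: leq_trans _ (leq_addr _ _)].
  apply: leq_trans lg8.2; rewrite t7 t6 t5 t4; do ![apply: leq_trans _ (leq_addr _ _)].
  by apply: leq_trans lg3.2; rewrite t2 t1; do ![apply: leq_trans _ (leq_addr _ _)].
have R15' q r : rg s15 q r = rg s12 q r by rewrite R15 R14 R13.
have slE : sl = [seq base + q | q <- iota 0 p & S (base + q)].
  rewrite /sl /marked (eq_in_filter (a2 := fun q => S (base + q))); last first.
    by move=> q; rewrite mem_iota => /andP[_ qp]; rewrite R15' k141 //; case: (S _).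
  by apply: eq_map => q; rewrite R15' r12 // (hr 11) // h11.
have usl : uniq sl.
  by rewrite slE map_inj_uniq ?filter_uniq ?iota_uniq // => u v; exact: addnI.
have msl v : (v \in sl) = S v.
  rewrite slE; apply/mapP/idP => [[q]|Sv].
    by rewrite mem_filter => /andP[Sq _] ->.
  have [q qp vE] := inS v Sv; exists q => //.
  by rewrite mem_filter -vE Sv mem_iota.
have lastS : S n.-1 = false by apply/negP => /SA/and3P[_ _]; rewrite ltnn.
split=> //=.
- split; [split; [|split|split]|] => q; rewrite /= R15' r12 //.
  + by rewrite (hr 0) // h0.
  + by rewrite (hr 1) // h1.
  + by rewrite (hr 2) // h2.
  + by rewrite (hr 3) // h3.
  + by rewrite (hr 4) // h4.
  + by rewrite (hr 5) // h5.
  + by rewrite (hr 7) // h7.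
  + by rewrite (hr 8) // h8.
  + by rewrite (hr 157) // h10.
- by move=> q; rewrite R15' r12 // (hr 11).
- move=> q qp; rewrite R15'; have -> : rg s12 q 12 = rg s11 q 12 - rg s12 q 141 by do !symb R12.
  rewrite k141 // (hr 12) // h12 //; case Sq: (S _); last by rewrite andbT subn0.
  by have /and3P[_ -> ->] := SA _ Sq; rewrite andbF.
- split.
  + exact: raked_treed tr SX ind rk.
  + move=> v vn; case: rk => _ _ miss; rewrite miss ?lnull // => l Sl.
      exact: left_parent.
    move=> /eqP gn /left_slot[E _]; have := gY _ (SW _ Sl); rewrite /g /x -E => /(_ _)/andP[].
      by rewrite E.
    by rewrite leqNgt vn.
  + rewrite lgE; apply: chain_rcons => //; first by apply: leq_trans lt tle.
    by rewrite lm => r pr; exact: (raked_batch tr SX ind rk usl msl pr).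
  + by rewrite last_mark_rcons.
  + rewrite lgE map_rcons flatten_rcons /=.
    have uB : uniq (flatten [seq e.1.2 | e <- lg s]).
      by rewrite (perm_uniq bt) filter_uniq ?iota_uniq.
    apply: uniq_perm; rewrite ?filter_uniq ?iota_uniq //.
      rewrite cat_uniq uB usl andbT; apply/hasPn => v; rewrite msl => Sv.
      by rewrite (perm_mem bt) mem_filter (SX _ Sv).
    move=> v; rewrite mem_cat (perm_mem bt) !mem_filter msl mem_iota /= add0n.
    by rewrite negb_and negbK; case Sv: (S v); [have := hX _ (SX _ Sv) => -> | rewrite !orbF]; rewrite ?orbT ?andbT.
- split; first by rewrite Xlast lastS.
  move=> v Cv; rewrite Xout //.
  have -> : S v = false by apply/negP => /SA/and3P[]; rewrite (negbTE Cv).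
  by rewrite andbT.
Qed.
End TreeRun.

Definition tree_bit : cmd :=
  Seq (Loc [:: LConst 17 0]) (Seq tree_round
  (Seq (Loc [:: LConst 17 1]) (Seq tree_round
       (Loc [:: LOp Mul 85 16 5; LMin 16 85 7; LOp Add 86 15 4; LMin 15 86 8])))).

Definition tree_pass : cmd :=
  Seq (Loc [:: LConst 15 0; LConst 16 1])
  (Seq (While 15 8 tree_bit) (Loc [:: LOp Add 84 13 4; LMin 13 84 14])).

(* The leaf n - 1 is never raked, so that all other leaves have a parent. *)
Definition tree_chunk : cmd :=
  Seq (Loc [:: LOp Defs.Sub 157 11 0; LOp Defs.Sub 153 2 4; LOp Defs.Sub 154 153 11; LMin 155 154 4;
               LMin 12 12 155; LOp Add 156 5 5; LOp Mul 14 156 8; LConst 13 0])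
      (While 13 14 tree_pass).

(** * Passes over the leaves of a chunk, and their amortised progress *)

Section TreeLoops.
Variables (n p : nat) (rho : nat -> nat) (M0 : memory) (D : nat).
Hypothesis np : 0 < p <= n.
Let L := bits n.
Let base := minn D (n - p).
Let alive := alive_leaf n p D.
Let tenv := tree_env n p rho M0 D.

Lemma tree_env_same rs X Y s s' : tenv X Y s -> same_regs rs s s' ->
  ~~ has (mem rs) [:: 0; 1; 2; 3; 4; 5; 7; 8; 11; 12; 157] ->
  mm s' = mm s -> lg s' = lg s -> tm s <= tm s' -> tenv X Y s'.
Proof.
move=> [[ge h10] h11 h12 al out] fr nrs E1 E2 tt.
have nr r : r \in [:: 0; 1; 2; 3; 4; 5; 7; 8; 11; 12; 157] -> r \notin rs by move/(hasPn nrs).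
split=> //; last by rewrite E1 E2; exact: tree_later tt al.
- split; last by move=> q; rewrite fr // nr.
  apply: env_same ge fr _; apply/hasPn => r ri; apply: nr.
  by move: ri; rewrite !inE; do ![case/orP=> [->|]; rewrite ?orbT //]; move->; rewrite ?orbT.
- by move=> q; rewrite fr // nr.
- by move=> q qp; rewrite fr ?h12 // nr.
Qed.

Definition living (X : pred nat) : nat := count (alive X) (iota base p).

(** Amortisation over a pass that began with [X0] and [M1]: each rake pays for its five
    [neighbours], collected in [U]. A leaf that nobody paid for has kept its initial uncle, and [A]
    records what the rounds revealed about the two. *)
Definition charged (A : nat -> nat -> Prop) (X0 : pred nat) (M1 : memory) (U : seq nat)
    (X : pred nat) (M : memory) : Prop :=
  [/\ forall v, X v -> X0 v, size U + 5 * living X <= 5 * living X0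
    & forall v, alive X v -> v \in U \/ (uncle n M v = uncle n M1 v /\ A v (uncle n M1 v))].

Lemma alive_chunk X v : alive X v -> v \in iota base p.
Proof. by case/and3P; rewrite /in_chunk mem_iota. Qed.

(** A leaf that is still unpaid is near no raked one, so its uncle is unchanged; if it has bit [b],
    then by the choice of the winners its uncle was not free. *)
Lemma charged_round A X0 M1 U X Y M M' S k b :
  treed n rho X Y M -> X n.-1 -> round_result n p D X Y k b M M' S ->
  charged A X0 M1 U X M ->
  exists U', charged (fun v y => A v y /\ (bit k v = b -> ~~ free_uncle n k b y))
    X0 M1 U' (fun v => X v && ~~ S v) M'.
Proof.
move=> tr Xn [SA ind rk near] [sub sz cov].
have SX l : S l -> X l by case/SA/and3P.
exists (U ++ flatten [seq neighbours n M r | r <- iota base p & S r]); split.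
- by move=> v /andP[/sub].
- rewrite size_cat size_flatten /shape -map_comp.
  have -> : sumn [seq (size \o neighbours n M) r | r <- iota base p & S r] = 5 * count S (iota base p).
    by rewrite -size_filter; elim: [seq _ <- _ | _] => //= x l ->; rewrite mulnS.
  have E : living X = living (fun v => X v && ~~ S v) + count S (iota base p).
    rewrite /living -[in RHS](@eq_in_count _ (fun v => alive X v && S v) S); last first.
      by move=> v _ /=; case Sv: (S v); rewrite ?andbF ?andbT //; exact: (SA v Sv).
    elim: (iota base p) => //= v l ->; rewrite addnACA; congr (_ + _).
    rewrite /alive /alive_leaf; case: (in_chunk _ _ _ _); case: (X v); case: (S v); case: (v < _) => //=.
  by move: sz; rewrite E; lia.
- move=> v Av; have Av' : alive X v by move: Av; rewrite /alive /alive_leaf => /and3P[-> /andP[-> _] ->].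
  have nS : ~~ S v by case/and3P: Av => _ /andP[].
  have near' r : S r -> v \in neighbours n M r -> v \in U ++ flatten [seq neighbours n M r | r <- iota base p & S r].
    move=> Sr vr; rewrite mem_cat; apply/orP; right; apply/flattenP; exists (neighbours n M r) => //.
    by apply: map_f; rewrite mem_filter Sr; exact: alive_chunk (SA r Sr).
  case: (cov v Av') => [vU|[uE Av0]]; first by left; rewrite mem_cat vU.
  have Xv : (fun v => X v && ~~ S v) v by case/and3P: Av.
  have pn : M (parent_ v) <> tnull n := alive_parent np tr Xn Av'.
  case: (uncle n M' v =P uncle n M v) => [E|ne]; last first.
    by have [r Sr vr] := uncle_change tr SX ind rk Xv pn ne; left; exact: near' vr.
  case bv: (bit k v == b); last first.
    by right; rewrite E uE; split=> //; split=> // /eqP; rewrite bv.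
  case fu: (free_uncle n k b (uncle n M v)); last first.
    by right; rewrite E uE; split=> //; split=> // _; rewrite -uE fu.
  have [r Sr [vr|vr]] := near v Av' (eqP bv) fu; first by move: nS; rewrite vr Sr.
  by left; exact: near' vr.
Qed.

Definition blocked (k v y : nat) : Prop := forall i, i < k -> ~~ free_uncle n i (bit i v) y.

Lemma charged_weaken (A A' : nat -> nat -> Prop) X0 M1 U X M :
  (forall v y, A v y -> A' v y) -> charged A X0 M1 U X M -> charged A' X0 M1 U X M.
Proof.
move=> imp [sub sz cov]; split=> // v Av.
by case: (cov v Av) => [h|[h /imp h']]; [left | right].
Qed.

(** A survivor outside [U] would have an uncle with all its bits, that is itself, against
    [uncle_neq]. Hence [living X <= size U <= 5 * (living X0 - living X)], which is the factor
    5/6. *)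
Lemma charged_shrinks X0 Y0 M1 U X M : treed n rho X0 Y0 M1 -> X0 n.-1 ->
  charged (blocked L) X0 M1 U X M -> living X * 6 <= living X0 * 5.
Proof.
move=> tr Xn [sub sz cov]; suff le : living X <= size U by lia.
rewrite /living -size_filter; apply: uniq_leq_size; first by rewrite filter_uniq ?iota_uniq.
move=> v; rewrite mem_filter => /andP[Av _].
case: (cov v Av) => [//|[_ bl]]; exfalso.
have Av0 : alive X0 v by case/and3P: Av => c /sub x l; apply/and3P.
have Xv : X0 v by case/and3P: Av0.
have pn := alive_parent np tr Xn Av0.
apply: (uncle_neq tr Xv pn).
have vn : v < n by case: tr => hX _ _ _ _; exact: hX.
have un : uncle n M1 v < n.
  by have := bl 0 (bits_gt0 n); rewrite /free_uncle negb_or -ltnNge => /andP[].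
have := @eq_bits L (uncle n M1 v) v.
rewrite !modn_small; try by apply: (tree_bits_small D np); lia.
apply=> j jL; have := bl j jL; rewrite /free_uncle negb_or negbK => /andP[_ /eqP].
by [].
Qed.

Definition round_cost : nat := 2 * election_time n + 120.

Lemma wp_tree_bit X Y X0 M1 U k s : k < L -> tenv X Y s -> reg s 15 k -> reg s 16 (2 ^ k) ->
  charged (blocked k) X0 M1 U X (mm s) ->
  wp p (3 * n.*2.-1) true tree_bit
    (fun s' => exists X' Y' U', [/\ tenv X' Y' s', reg s' 15 k.+1, reg s' 16 (2 ^ k.+1),
      charged (blocked k.+1) X0 M1 U' X' (mm s') & tm s' <= tm s + 2 * round_cost + 10]) s.
Proof.
move=> kL te h15 h16 pr.
apply: wp_seq; apply: wp_loc => s1 R1 E1 t1 l1.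
have te1 : tenv X Y s1.
  by apply: tree_env_same te (loc_same_regs R1) _ E1 l1 _; rewrite ?t1 ?leq_addr.
have r16 : reg s1 16 (2 ^ k) by move=> q; symb R1; exact: h16.
have r17 : reg s1 17 0 by move=> q; symb R1.
rewrite -E1 in pr.
have tr1 : treed n rho X Y (mm s1) by case: te1 => _ _ _ [].
have Xn1 : X n.-1 by case: te1 => _ _ _ _ [].
apply: wp_seq; apply: (wp_frame (wp_tree_round np (isT : 0 < 2) te1 r16 r17)) => s2 fr2 _ [S rr [te2 t2]].
have [U2 {}pr] := charged_round tr1 Xn1 rr pr.
apply: wp_seq; apply: wp_loc => s3 R3 E3 t3 l3.
set X2 := fun v => _ in te2 pr; set Y2 := fun v => _ && ~~ removed _ _ _ _ in te2.
have te3 : tenv X2 Y2 s3.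
  by apply: tree_env_same te2 (loc_same_regs R3) _ E3 l3 _; rewrite ?t3 ?leq_addr.
have r16' : reg s3 16 (2 ^ k) by move=> q; symb R3; rewrite fr2.
have r17' : reg s3 17 1 by move=> q; symb R3.
rewrite -E3 in pr.
have tr3 : treed n rho X2 Y2 (mm s3) by case: te3 => _ _ _ [].
have Xn3 : X2 n.-1 by case: te3 => _ _ _ _ [].
apply: wp_seq; apply: (wp_frame (wp_tree_round np (isT : 1 < 2) te3 r16' r17')) => s4 fr4 _ [S' rr' [te4 t4]].
have [U4 {}pr] := charged_round tr3 Xn3 rr' pr.
apply: wp_loc => s5 R5 E5 t5 l5; do 3 eexists; split.
- by apply: tree_env_same te4 (loc_same_regs R5) _ E5 l5 _; rewrite ?t5 ?leq_addr.
- move=> q; symb R5; rewrite !fr4 //.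
  have -> : rg s3 q 15 = k by symb R3; rewrite fr2 //; symb R1; exact: h15.
  by case: te3 => -[[_ [_ _ _ -> _] [_ ->]] _] *; rewrite -/L; lia.
- move=> q; symb R5; rewrite !fr4 // r16'.
  case: te3 => -[[_ [_ _ _ _ ->] [-> _]] _] *; rewrite -expnSr.
  by apply/minn_idPl; rewrite leq_pexp2l.
- rewrite E5; apply: charged_weaken pr => v y [[bl b0] b1] i; rewrite ltnS leq_eqVlt.
  case/orP=> [/eqP->|]; last exact: bl.
  have := bit_lt2 k v; move: b0 b1.
  by case: (bit k v) => [|[|]] // b0 b1 _; [exact: b0 | exact: b1].
- by move: t5 t4 t3 t2 t1; rewrite /round_cost /cost_local /=; lia.
Qed.

Definition pass_cost : nat := (2 * round_cost + 12) * L + 20.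

Lemma wp_tree_pass X Y s c : c < 4 * L -> tenv X Y s -> reg s 13 c -> reg s 14 (4 * L) ->
  wp p (3 * n.*2.-1) true tree_pass
    (fun s' => exists X' Y', tenv X' Y' s' /\
      [/\ living X' * 6 <= living X * 5, reg s' 13 c.+1 & tm s' <= tm s + pass_cost]) s.
Proof.
move=> cL te h13 h14; apply: wp_seq; apply: wp_loc => s1 R1 E1 t1 l1.
have te1 : tenv X Y s1.
  by apply: tree_env_same te (loc_same_regs R1) _ E1 l1 _; rewrite ?t1 ?leq_addr.
apply: wp_seq.
apply: (@wp_frame _ _ _ _ (fun s' => exists X' Y' U', [/\ tenv X' Y' s',
    charged (blocked L) X (mm s) U' X' (mm s') & tm s' <= tm s + (2 * round_cost + 12) * L + 10])).
  apply: (wp_while (m := L) (I := fun m s' => exists k X' Y' U', [/\ k + m = L, reg s' 15 k & reg s' 16 (2 ^ k)] /\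
     [/\ tenv X' Y' s', charged (blocked k) X (mm s) U' X' (mm s')
       & tm s' + (2 * round_cost + 12) * m <= tm s + (2 * round_cost + 12) * L + 5])).
    exists 0, X, Y, [::]; split; [split=> // q; symb R1 | split=> //].
      by rewrite E1; split=> // v Cv; right.
    by rewrite t1 /cost_local /=; lia.
  move=> m s2 _ [k [X' [Y' [U' [[km h15 h16] [te2 pr t2]]]]]].
  case: (te2) => -[[_ _ [_ h8]] _] _ _ _ _.
  case: m km t2 => [|m] km t2; [left|right].
    have kL : k = L by lia.
    subst k; split; first by move=> q _; rewrite /active h15 h8 ltnn.
    exists X', Y', U'; split=> //=; last by lia.
    by apply: (@tree_env_same [::]) te2 _ _ _ _ _ => //=; rewrite leq_addr.
  have kL : k < L by lia.
  split; first by move=> q _; rewrite /active h15 h8.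
  exists m => //.
  have te2' : tenv X' Y' (tick s2 1).
    by apply: (@tree_env_same [::]) te2 _ _ _ _ _ => //=; rewrite leq_addr.
  apply: (wp_conseq (wp_tree_bit kL te2' h15 h16 pr)) => s3 [X3 [Y3 [U3 [te3 h15' h16' pr3 t3]]]].
  exists k.+1, X3, Y3, U3; split; first by split=> //; lia.
  split=> //; last by move: t3 t2 => /=; lia.
  by apply: (@tree_env_same [::]) te3 _ _ _ _ _ => //=; rewrite leq_addr.
move=> s2 fr2 _ [X2 [Y2 [U2 [te2 pr2 t2]]]].
apply: wp_loc => s3 R3 E3 t3 l3; exists X2, Y2; split.
  by apply: tree_env_same te2 (loc_same_regs R3) _ E3 l3 _; rewrite ?t3 ?leq_addr.
have tr : treed n rho X Y (mm s) by case: te => _ _ _ [].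
have Xn : X n.-1 by case: te => _ _ _ _ [].
split.
- exact: charged_shrinks tr Xn pr2.
- move=> q; symb R3; rewrite !fr2 //.
  have -> : rg s1 q 13 = c by symb R1; exact: h13.
  have -> : rg s1 q 14 = 4 * L by symb R1; exact: h14.
  by case: te1 => -[[_ [_ _ _ -> _] _] _] *; lia.
- by move: t3 t2; rewrite /pass_cost /cost_local /=; lia.
Qed.

Definition tree_time : nat := (pass_cost + 2) * (4 * L) + 30.

Lemma wp_tree_chunk Y s : env n p L s -> (forall q, rg s q 11 = base + q) ->
  (forall q, rg s q 12 = (D <= base + q)) ->
  tree_ok n rho M0 (leaves_from n D) Y (mm s) (lg s) (tm s) ->
  wp p (3 * n.*2.-1) true tree_chunk
    (fun s' => exists X' Y', tenv X' Y' s' /\ living X' = 0 /\ tm s' <= tm s + tree_time) s.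
Proof.
move=> ge h11 h12 al; case: (ge) => h0 [h1 h2 h3 h4 h5] [h7 h8].
apply: wp_seq; apply: wp_loc => s1 R1 E1 t1 l1.
have te1 : tenv (leaves_from n D) Y s1.
  split.
  - split; first by split; [|split|split] => q; symb R1; [exact: h0|exact: h1|exact: h2|exact: h3|exact: h4|exact: h5|exact: h7|exact: h8].
    by move=> q; symb R1; rewrite h11 h0 addnK.
  - by move=> q; symb R1; exact: h11.
  - move=> q qp; symb R1; rewrite h12 h2 h4 h11 /leaves_from (leaf_bound D np qp) /=.
    case: (leqP D (base + q)) => d /=; case: (ltnP (base + q) n.-1) => e /=; try lia.
    all: rewrite ?andbT ?andbF ?orbF ?ltn_eqF //=; try lia.
  - by rewrite E1 l1; apply: tree_later al; rewrite t1 leq_addr.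
  - by split=> //; rewrite /leaves_from eqxx orbT andbT; lia.
have h13 : reg s1 13 0 by move=> q; symb R1.
have h14 : reg s1 14 (4 * L) by move=> q; symb R1; rewrite h5 h8.
have {h14} h14 q : rg s1 q 14 = 4 * L by rewrite h14.
apply: (wp_while (m := 4 * L) (I := fun m s' => exists c X' Y', [/\ c + m = 4 * L, reg s' 13 c & tenv X' Y' s'] /\
   living X' * 6 ^ c <= p * 5 ^ c /\ tm s' + (pass_cost + 2) * m <= tm s + (pass_cost + 2) * (4 * L) + 20)).
  exists 0, (leaves_from n D), Y; split; [by split | split].
    by rewrite !muln1; apply: leq_trans (count_size _ _) _; rewrite size_iota.
  by rewrite t1 /cost_local /=; lia.
move=> m s2 fr [c [X' [Y' [[cm h13' te2] [rem t2]]]]].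
have h14' : reg s2 14 (4 * L) by move=> q; rewrite fr.
have te2t k : tenv X' Y' (tick s2 k).
  by apply: (@tree_env_same [::]) te2 _ _ _ _ _ => //=; rewrite leq_addr.
case: m cm t2 => [|m] cm t2; [left|right].
  have cL : c = 4 * L by lia.
  subst c; split; first by move=> q _; rewrite /active h13' h14' ltnn.
  exists X', Y'; split; first exact: te2t.
  split; last by rewrite /tree_time /=; lia.
  apply/eqP; rewrite eqn0Ngt; apply/negP => pos.
  have pL : p < 2 ^ L by apply: (tree_bits_small D np); lia.
  (* [4 L] passes suffice since [2 * 5 ^ 4 = 1250] is at most [6 ^ 4 = 1296] and the chunk has fewer
     than [2 ^ L] leaves. *)
  have : 2 ^ L * 5 ^ (4 * L) <= 6 ^ (4 * L).
    by rewrite !expnM -expnMn leq_exp2r ?bits_gt0.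
  have f0 : 0 < 5 ^ (4 * L) by rewrite expn_gt0.
  move: rem; set a := 6 ^ _; set b := 5 ^ _ in f0 *; set d := 2 ^ _ in pL *.
  by clear -pos pL f0; nia.
have cL : c < 4 * L by lia.
split; first by move=> q _; rewrite /active h13' h14'.
exists m => //.
apply: (wp_conseq (wp_tree_pass cL (te2t 1) h13' h14')) => s3 [X3 [Y3 [te3 [rem3 h13'' t3]]]].
exists c.+1, X3, Y3; split; first split=> //; first by lia.
  by apply: (@tree_env_same [::]) te3 _ _ _ _ _ => //=; rewrite leq_addr.
split; last by move: t3 => /=; lia.
rewrite !expnS mulnA; apply: (@leq_trans (living X' * 5 * 6 ^ c)).
  by rewrite leq_mul2r rem3 orbT.
by rewrite mulnAC [5 * _]mulnC mulnA leq_mul2r rem orbT.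
Qed.
End TreeLoops.

(** * The input tree in memory satisfies the invariant *)

Fixpoint preorder (t : btree) : seq nat :=
  match t with Leaf i => [:: i] | Node x l r => x :: preorder l ++ preorder r end.

Fixpoint stored (null par : nat) (t : btree) (M : memory) : Prop :=
  match t with
  | Leaf i => [/\ M (parent_ i) = par, M (left_ i) = null & M (right_ i) = null]
  | Node x l r => [/\ M (parent_ x) = par, M (left_ x) = root_of l, M (right_ x) = root_of r,
                     stored null x l M & stored null x r M]
  end.

Definition cell_of (v c : nat) : Prop := [\/ c = parent_ v, c = left_ v | c = right_ v].

Lemma cell_of_inj u v c : cell_of u c -> cell_of v c -> u = v.
Proof. by rewrite /cell_of /parent_ /left_ /right_ => -[] -> []; lia. Qed.

Lemma upd3_other v M a b d c : ~ cell_of v c ->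
  upd (upd (upd M (parent_ v) a) (left_ v) b) (right_ v) d c = M c.
Proof.
by move=> nc; rewrite !upd_other //; apply/eqP => E; apply: nc; rewrite E;
  [constructor 1 | constructor 2 | constructor 3].
Qed.

Lemma upd3_cells v M a b d :
  let M' := upd (upd (upd M (parent_ v) a) (left_ v) b) (right_ v) d in
  [/\ M' (parent_ v) = a, M' (left_ v) = b & M' (right_ v) = d].
Proof.
by split; rewrite ?upd_same //; repeat (rewrite upd_other ?upd_same //;
  last by rewrite /parent_ /left_ /right_; lia).
Qed.

Lemma links_outside null par t M c :
  (forall v, v \in preorder t -> ~ cell_of v c) -> links null par t M c = M c.
Proof.
elim: t par M => [i|x l IHl r IHr] par M /= out.
  by apply: upd3_other; apply: out; rewrite mem_head.
rewrite IHr => [|v vr]; last by apply: out; rewrite inE mem_cat vr !orbT.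
rewrite IHl => [|v vl]; last by apply: out; rewrite inE mem_cat vl orbT.
by apply: upd3_other; apply: out; rewrite mem_head.
Qed.

Lemma stored_ext null par t M M' :
  (forall v c, v \in preorder t -> cell_of v c -> M' c = M c) ->
  stored null par t M -> stored null par t M'.
Proof.
elim: t par => [i|x l IHl r IHr] par /= ext.
  have e c : cell_of i c -> M' c = M c by apply: ext; rewrite mem_head.
  by move=> [h1 h2 h3]; rewrite !e //; [constructor 3 | constructor 2 | constructor 1].
have e c : cell_of x c -> M' c = M c by apply: ext; rewrite mem_head.
move=> [h1 h2 h3 sl sr]; rewrite !e; try by [constructor 3 | constructor 2 | constructor 1].
by split=> //; [apply: IHl sl | apply: IHr sr] => v c vt; apply: ext;
  rewrite inE mem_cat vt ?orbT.
Qed.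

(** Later writes of [links] concern other nodes, and the cells of distinct nodes are disjoint. *)
Lemma stored_links null par t M : uniq (preorder t) -> stored null par t (links null par t M).
Proof.
elim: t par M => [i|x l IHl r IHr] par M /=.
  by move=> _; have [h1 h2 h3] := upd3_cells i M par null null; split.
rewrite mem_cat negb_or cat_uniq => /and4P[/andP[xl xr] ul /hasPn lr ur].
set M1 := upd _ _ _; have [h1 h2 h3] := upd3_cells x M par (root_of l) (root_of r).
have keep c : cell_of x c -> links null x r (links null x l M1) c = M1 c.
  move=> xc; rewrite links_outside => [|v vr vc]; last by case/negP: xr; rewrite (cell_of_inj xc vc).
  by rewrite links_outside // => v vl vc; case/negP: xl; rewrite (cell_of_inj xc vc).
rewrite !keep; try by [constructor 1 | constructor 2 | constructor 3].
split=> //; last exact: IHr.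
apply: stored_ext (IHl x M1 ul) => v c vl vc.
rewrite links_outside // => u ur' uc; have := lr u ur'.
by rewrite /= -(cell_of_inj vc uc) vl.
Qed.

Lemma root_preorder t : root_of t \in preorder t.
Proof. by case: t => [i|x l r] /=; rewrite mem_head. Qed.

Lemma perm_preorder t : perm_eq (preorder t) (leaves t ++ internals t).
Proof.
elim: t => [i|x l IHl r IHr] //=.
move/seq.permP: IHl => IHl; move/seq.permP: IHr => IHr.
by apply/seq.permP => a; rewrite /= !count_cat /= !count_cat IHl IHr !count_cat; move: (a x : nat) (count a _) (count a _) (count a _) (count a _); lia.
Qed.

Lemma mem_internals x t : x \in internals t -> x \in preorder t.
Proof. by rewrite (perm_mem (perm_preorder t)) mem_cat orbC => ->. Qed.

Lemma stored_root null par t M : stored null par t M -> M (parent_ (root_of t)) = par.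
Proof. by case: t => [i|x l r] /= []. Qed.

(** A parent precedes its children in preorder; this index serves as [rho]. *)
Lemma stored_nonroot null par t M v : stored null par t M -> uniq (preorder t) ->
  v \in preorder t -> v = root_of t \/
  [/\ M (parent_ v) \in internals t, M (left_ (M (parent_ v))) = v \/ M (right_ (M (parent_ v))) = v
    & index (M (parent_ v)) (preorder t) < index v (preorder t)].
Proof.
elim: t par => [i|x l IHl r IHr] par /=; first by move=> _ _; rewrite inE => /eqP; left.
rewrite mem_cat negb_or cat_uniq => -[px lx rx sl sr] /and4P[/andP[xl xr] ul /hasPn lr ur].
rewrite inE => /orP[/eqP|b]; [by left | right].
have vx : v != x.
  by apply: contraTneq b => ->; rewrite mem_cat negb_or xl.
rewrite eq_sym in vx; rewrite (negbTE vx).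
move: b; rewrite mem_cat => /orP[vl|vr].
  case: (IHl x sl ul vl) => [E|[h1 h2 h3]].
    have pv : M (parent_ v) = x by rewrite E; exact: stored_root sl.
    by rewrite pv eqxx mem_head; split=> //; left; rewrite lx.
  have ne : x != M (parent_ v) by apply: contraNneq xl => ->; exact: mem_internals.
  by rewrite (negbTE ne) inE mem_cat h1 orbT !index_cat vl mem_internals.
case: (IHr x sr ur vr) => [E|[h1 h2 h3]].
  have pv : M (parent_ v) = x by rewrite E; exact: stored_root sr.
  by rewrite pv eqxx mem_head; split=> //; right; rewrite rx.
have ne : x != M (parent_ v) by apply: contraNneq xr => ->; exact: mem_internals.
rewrite (negbTE ne) inE mem_cat h1 !orbT !index_cat (negbTE (lr v vr)).
by rewrite (negbTE (lr _ (mem_internals h1))); split=> //; rewrite ltnS ltn_add2l.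
Qed.

Lemma stored_children null par t M x : stored null par t M -> uniq (preorder t) ->
  x \in internals t ->
  [/\ M (left_ x) \in preorder t, M (right_ x) \in preorder t, M (left_ x) <> M (right_ x),
      M (parent_ (M (left_ x))) = x & M (parent_ (M (right_ x))) = x].
Proof.
elim: t par => [i|y l IHl r IHr] par //=.
rewrite mem_cat negb_or cat_uniq => -[py ly ry sl sr] /and4P[/andP[yl yr] ul /hasPn lr ur].
rewrite inE => /orP[/eqP->|].
  rewrite ly ry (stored_root sl) (stored_root sr) !inE !mem_cat !root_preorder !orbT; split=> // E.
  by have := lr _ (root_preorder r); rewrite /= -E root_preorder.
rewrite mem_cat => /orP[xl|xr].
  by have [h1 h2 h3 h4 h5] := IHl y sl ul xl; rewrite !inE !mem_cat h1 h2 !orbT.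
by have [h1 h2 h3 h4 h5] := IHr y sr ur xr; rewrite !inE !mem_cat h1 h2 !orbT.
Qed.

Lemma stored_leaf null par t M v : stored null par t M -> v \in leaves t -> M (left_ v) = null.
Proof.
elim: t par => [i|y l IHl r IHr] par /=; first by case=> _ h _; rewrite inE => /eqP ->.
by case=> _ _ _ sl sr; rewrite mem_cat => /orP[]; [exact: IHl sl | exact: IHr sr].
Qed.

Lemma links_lt B null par t M c : null < B -> par < B -> (forall v, v \in preorder t -> v < B) ->
  (forall a, M a < B) -> links null par t M c < B.
Proof.
move=> nB; elim: t par M c => [i|x l IHl r IHr] par M c pB tB mB /=.
  by rewrite /upd; case: eqP => // _; case: eqP => // _; case: eqP.
have xB : x < B by apply: tB; rewrite mem_head.
have lB v : v \in preorder l -> v < B by move=> vl; apply: tB; rewrite /= inE mem_cat vl orbT.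
have rB v : v \in preorder r -> v < B by move=> vr; apply: tB; rewrite /= inE mem_cat vr !orbT.
apply: IHr => // a; apply: IHl => // a'.
rewrite /upd; case: eqP => // _; first exact: rB (root_preorder r).
by case: eqP => // _; [exact: lB (root_preorder l) | case: eqP].
Qed.

Lemma leaves_relabel f t : leaves (relabel_leaves f t) = map f (leaves t).
Proof. by elim: t => [//|x l IHl r IHr] /=; rewrite IHl IHr map_cat. Qed.

Lemma internals_relabel f t : internals (relabel_leaves f t) = internals t.
Proof. by elim: t => [//|x l IHl r IHr] /=; rewrite IHl IHr. Qed.

Lemma perm_nat_perm n (pi : {perm 'I_n}) s : perm_eq s (iota 0 n) ->
  perm_eq (map (perm_nat pi) s) (iota 0 n).
Proof.
move=> ps; apply: perm_trans (perm_map _ ps) _.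
rewrite -val_enum_ord -map_comp; apply: uniq_perm.
- rewrite map_inj_uniq ?enum_uniq // => i j /=.
  by rewrite /perm_nat !valK => /val_inj/perm_inj.
- by rewrite map_inj_uniq ?enum_uniq //; exact: val_inj.
move=> v; apply/mapP/mapP => -[i _ ->] /=.
  by exists (pi i); rewrite ?mem_enum // /perm_nat valK.
by exists ((pi^-1)%g i); rewrite ?mem_enum // /perm_nat valK permKV.
Qed.

Section TreeMemory.
Variables (n : nat) (t : stored_tree n) (pi : {perm 'I_n}).
Let t' := relabel_leaves (perm_nat pi) (s2val t).
Let M := tree_memory t pi.

Lemma tree_leaves v : (v \in leaves t') = (v < n).
Proof.
rewrite leaves_relabel (perm_mem (perm_nat_perm pi (s2valP t))) mem_iota.
by [].
Qed.

Lemma tree_internals v : (v \in internals t') = (n <= v < tnull n).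
Proof.
rewrite internals_relabel (perm_mem (s2valP' t)) mem_iota /tnull.
by case: n => [|m]; rewrite //=; lia.
Qed.

Lemma tree_preorder_uniq : uniq (preorder t').
Proof.
rewrite (perm_uniq (perm_preorder _)) cat_uniq leaves_relabel internals_relabel.
rewrite (perm_uniq (perm_nat_perm pi (s2valP t))) (perm_uniq (s2valP' t)) !iota_uniq andbT /=.
apply/hasPn => v; rewrite (perm_mem (s2valP' t)) (perm_mem (perm_nat_perm pi (s2valP t))) !mem_iota.
by lia.
Qed.

Lemma tree_preorder v : (v \in preorder t') = (v < n) || (n <= v < tnull n).
Proof. by rewrite (perm_mem (perm_preorder _)) mem_cat tree_leaves tree_internals. Qed.

Lemma tree_memory_stored : stored (tnull n) (tnull n) t' M.
Proof. exact: stored_links tree_preorder_uniq. Qed.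

Lemma tree_memory_lt a : M a < n.*2.+1.
Proof.
apply: links_lt => //; rewrite /tnull; try lia.
by move=> v; rewrite tree_preorder /tnull; lia.
Qed.

Lemma tree_memory_treed : treed n (index^~ (preorder t')) (leaves_from n 0)
  (fun v => n <= v < tnull n) M.
Proof.
have st := tree_memory_stored; have u := tree_preorder_uniq.
have XE v : leaves_from n 0 v = (v < n) by rewrite /leaves_from andbT.
have VE v : leaves_from n 0 v || (n <= v < tnull n) = (v \in preorder t').
  by rewrite XE tree_preorder.
split.
- by move=> v; rewrite XE.
- by [].
- move=> v; rewrite VE => vt; case: (stored_nonroot st u vt) => [->|[h1 h2 h3]].
    by left; exact: stored_root st.
  by right; rewrite -tree_internals.
- by move=> x; rewrite -tree_internals => xt; rewrite !VE; exact: stored_children st u xt.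
- have root v : v \in preorder t' -> M (parent_ v) = tnull n -> v = root_of t'.
    move=> vt pv; case: (stored_nonroot st u vt) => [//|[]].
    by rewrite pv tree_internals ltnn andbF.
  by move=> v v'; rewrite !VE => /root h /root h' /h -> /h' ->.
Qed.

Lemma tree_memory_leaf v : v < n -> M (left_ v) = tnull n.
Proof. by rewrite -tree_leaves; exact: stored_leaf tree_memory_stored. Qed.
End TreeMemory.

Lemma tree_run n p (t : stored_tree n) (pi : {perm 'I_n}) : 0 < p <= n ->
  exists s', [/\ ev p (3 * n.*2.-1) true (chunked tree_chunk)
      (start_state n p (tree_memory t pi)) s',
    tm s' <= chunked_time tree_time n p,
    chain (rake n) 0 (tree_memory t pi) (lg s'),
    last_mark 0 (tree_memory t pi) (lg s') = (tm s', mm s')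
    & perm_eq (flatten [seq e.1.2 | e <- lg s']) (iota 0 n.-1)].
Proof.
move=> np; set M0 := tree_memory t pi.
set rho := index^~ (preorder (relabel_leaves (perm_nat pi) (s2val t))).
pose J D M l t := exists Y, tree_ok n rho M0 (leaves_from n D) Y M l t.
have later D M l t1 t2 : t1 <= t2 -> J D M l t1 -> J D M l t2.
  by move=> le12 [Y h]; exists Y; exact: tree_later h.
have ok D s : D < n -> env n p (bits n) s -> J D (mm s) (lg s) (tm s) ->
    (forall q, rg s q 11 = minn D (n - p) + q) ->
    (forall q, rg s q 12 = (D <= minn D (n - p) + q)) ->
    wp p (3 * n.*2.-1) true tree_chunk
      (fun s' => J (minn (minn D (n - p) + p) n) (mm s') (lg s') (tm s') /\
      tm s' <= tm s + tree_time n) s.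
  move=> Dn ge [Y Js] h11 h12.
  apply: (wp_conseq (wp_tree_chunk np ge h11 h12 Js)) => s' [X [Y' [[_ _ _ al [Xn out]] [rem t']]]].
  split=> //; exists Y'.
  suff E : X = leaves_from n (minn (minn D (n - p) + p) n) by rewrite -E.
  apply: functional_extensionality => v.
  case Cv: (in_chunk n p D v); last first.
    by rewrite out ?Cv //; move: Cv; rewrite /in_chunk /leaves_from; lia.
  have Xlast : v = n.-1 -> X v by move=> ->.
  have : ~~ has (alive_leaf n p D X) (iota (minn D (n - p)) p).
    by rewrite has_count; move: rem; rewrite /living => ->.
  move/hasPn => /(_ v); rewrite mem_iota /alive_leaf.
  move: Cv; rewrite /in_chunk => /[dup] Cv -> /(_ isT).
  rewrite /leaves_from; case: (X v) Xlast => /=; lia.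
have J0 : J 0 M0 [::] 0.
  exists (fun v => n <= v < tnull n); split=> //.
  - exact: tree_memory_treed.
  - exact: tree_memory_leaf.
  rewrite /= (eq_in_filter (a2 := pred0)) ?filter_pred0 // => v.
  by rewrite mem_iota /leaves_from /= => ->.
have [s' [e t' [s1 [[Y [_ _ ch [lt lm] bt]] ts mE lE]]]] :=
  wp_chunked np (body := tree_chunk) later isT ok J0.
exists s'; split=> //; rewrite lE.
- apply: chain_rcons => //; first exact: leq_trans lt ts.
  by move=> r /perm_nilP ->; rewrite lm mE.
- exact: last_mark_rcons.
- rewrite map_rcons flatten_rcons cats0; apply: perm_trans bt _.
  have n0 : 0 < n by lia.
  have -> : iota 0 n = rcons (iota 0 n.-1) n.-1.
    by rewrite -cats1 -[in LHS](prednK n0) -addn1 iotaD.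
  rewrite filter_rcons /leaves_from eqxx orbT andbT prednK // leqnn /=.
  rewrite (eq_in_filter (a2 := predT)) ?filter_predT // => v.
  by rewrite mem_iota /=; lia.
Qed.

(** Shared cells also carry the words of the radix sort, whence a larger exponent than the input
    alone would require; 12 only has to pass the check. *)
Definition tree_types : seq (option nat) := infer 170 (Some 12) (chunked tree_chunk).

Lemma tree_well_typed : well_typed (chunked tree_chunk) 60 tree_types (Some 12).
Proof. by vm_compute. Qed.

Lemma tree_time_poly : exists A, forall n, tree_time n + 30 <= A * bits n ^ 4.
Proof.
(* 4356 is the sum of the coefficients of the expanded polynomial, each power of [L] being at most
   [L ^ 4]. *)
exists 4356 => n; rewrite /tree_time /pass_cost /round_cost /election_time.
have := bits_gt0 n; set L := bits n => L0.
have l2 : L <= L * L by rewrite leq_pmull.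
have l3 : L * L <= L * L * L by rewrite leq_pmulr.
have l4 : L * L * L <= L * L * L * L by rewrite leq_pmulr.
have -> : L ^ 4 = L * L * L * L by rewrite !expnS expn0 muln1 !mulnA.
have -> : ((2 * (2 * ((40 * L + 100) * L + 60) + 120) + 12) * L + 20 + 2) * (4 * L) + 30 + 30 =
   640 * (L * L * L * L) + 1600 * (L * L * L) + 1968 * (L * L) + 88 * L + 60.
  by ring.
by move: (L * L * L * L) (L * L * L) (L * L) l2 l3 l4 => a4 a3 a2 l2 l3 l4; lia.
Qed.

Lemma tree_theorem : exists P : program,
  [/\ deterministic P, erew random_leaves P, contracts_trees P & sync_strict_pip_whp random_leaves P].
Proof.
exists (compile 0 (chunked tree_chunk)).
have det : deterministic (compile 0 (chunked tree_chunk)) by vm_compute.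
have regs : all (registers_below 170) (compile 0 (chunked tree_chunk)) by vm_compute.
have Mw n w (t : stored_tree n) (pi : {perm 'I_n}) a : tree_memory t pi a < range n w (Some 12).
  apply: leq_trans (tree_memory_lt t pi a) _.
  by apply: (@leq_trans (n.+2 ^ 2)); [nia | rewrite /= leq_exp2l].
have runs n p w : 0 < p <= n -> n.+2 ^ 60 <= w ->
    forall (x : arbitrary random_leaves n) (r : random random_leaves n),
    (forall a, input x r a < w) ->
  exists E v, out (compile 0 (chunked tree_chunk))
    (good (compile 0 (chunked tree_chunk)) (cells random_leaves n) true w) E
    (chunked_time tree_time n p) (start p x r) v.
  move=> np wl x r _; have [s' [e t' _ _ _]] := tree_run x r np.
  have [v o] := run_out tree_well_typed np wl (Mw n w x r) e (fun=> true) t'.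
  by exists (fun=> true), v.
have inputs n (x : arbitrary random_leaves n) (r : random random_leaves n) :
    exists w, forall a, input x r a < w.
  by exists n.*2.+1 => a; exact: tree_memory_lt.
have nonempty n : 0 < #|random random_leaves n| by apply/card_gt0P; exists 1%g.
split; [exact: det | exact: (assemble_erew runs inputs) | | ].
- move=> n p np t pi cs ex; have [s' [e t' ch lm bt]] := tree_run t pi np.
  have [w wl] : exists w, n.+2 ^ 60 <= w by exists (n.+2 ^ 60).
  have [lo fin] := run_history tree_well_typed np wl (Mw n w t pi) e ex.
  have bE : batches (map fst (lg s')) = flatten [seq e.1.2 | e <- lg s'].
    by rewrite /batches /unzip2 -map_comp.
  exists (map fst (lg s')); rewrite bE (perm_uniq bt) iota_uniq (perm_size bt) size_iota.
  split; [by [] | | by [] | ].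
    by rewrite (perm_all _ bt); apply/allP => v; rewrite mem_iota => h; clear -h np; lia.
  apply: (chain_rounds (op := rake n)) ch _ _ _ => /=.
  + by case: ex => ->.
  + by move=> x /lo[].
  + by rewrite lm => u /= tu; rewrite !fin.
- have [A AE] : exists A, forall n, tree_time n + 30 <= A * bits n ^ 4 := tree_time_poly.
  apply: (assemble_pip regs runs inputs nonempty (C := 50 + 2 * A * 3 ^ 4) (e := 4)).
    by rewrite addn_gt0.
  by move=> n p n1 np; exact: (chunked_time_le (e := 4) isT (AE n) n1 np).
Qed.

(** * Random permutation *)

Definition swap (i h : nat) (M : memory) : memory :=
  fun y => if y == i then M h else if y == h then M i else M y.

Lemma swap_id i M : swap i i M = M.
Proof. by apply: functional_extensionality => y; rewrite /swap; case: eqP => [->|]. Qed.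

Definition shuffle (H : nat -> nat) (b k : nat) (M : memory) : memory :=
  foldl (fun M i => swap i (H i) M) M (iota b k).

Lemma shuffleS H b k M : shuffle H b k.+1 M = swap (b + k) (H (b + k)) (shuffle H b k M).
Proof. by rewrite /shuffle -addn1 iotaD foldl_cat. Qed.

Lemma eq_shuffle H H' b k M : (forall i, b <= i < b + k -> H i = H' i) ->
  shuffle H b k M = shuffle H' b k M.
Proof.
elim: k => [//|k IH] E; rewrite !shuffleS IH => [|i ik]; last by apply: E; lia.
by rewrite E //; lia.
Qed.

(** ** Closed form of a chunk of swaps *)

Section ClosedForm.
Variables (H : nat -> nat) (b p : nat) (M : memory) (src : nat -> nat).
Hypothesis H_le : forall i, b <= i < b + p -> H i <= i.

Definition sibling_before (j x : nat) : Prop :=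
  [/\ b <= j < x, H j = H x & forall i, j < i < x -> H i <> H x].

Definition first_sibling (x : nat) : Prop := forall i, b <= i < x -> H i <> H x.

(* Before step [x], the cell [x] contains its initial value and the cell [H x]
   the initial value of [src x]. *)
Definition sources : Prop := forall x, b <= x < b + p ->
  [/\ forall j, sibling_before j x -> src x = j,
      first_sibling x -> (H x < b) || (H x == x) -> src x = H x
    & first_sibling x -> b <= H x < x -> src x = src (H x)].

(** Before its step, [j] still holds its initial value, which the step brings to [H j]. So a target
    holds the initial value of the last element aimed at it, and a processed cell that is no target
    keeps what its own step brought there. *)
Definition described (k : nat) (M' : memory) : Prop := forall y,
  (forall j, b <= j < b + k -> H j = y -> (forall i, j < i < b + k -> H i <> y) -> M' y = M j) /\
  ((forall j, b <= j < b + k -> H j <> y) -> M' y = if b <= y < b + k then M (src y) else M y).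

Lemma last_in_group k y : (forall j, b <= j < b + k -> H j <> y) \/
  exists j, [/\ b <= j < b + k, H j = y & forall i, j < i < b + k -> H i <> y].
Proof.
elim: k => [|k IH]; first by left => j; lia.
case: (eqVneq (H (b + k)) y) => [E|ne].
  by right; exists (b + k); split=> // [|i]; lia.
case: IH => [no|[j [jk Hj la]]]; [left => j jk|right].
  by case: (eqVneq j (b + k)) => [->|jn]; [exact/eqP | apply: no; lia].
exists j; split=> //; first by lia.
by move=> i ij; case: (eqVneq i (b + k)) => [->|jn]; [exact/eqP | apply: la; lia].
Qed.

Lemma described_unique k M1 M2 : described k M1 -> described k M2 -> M1 = M2.
Proof.
move=> d1 d2; apply: functional_extensionality => y.
have [h1 h1'] := d1 y; have [h2 h2'] := d2 y.
case: (last_in_group k y) => [no|[j [jk Hj la]]]; first by rewrite h1' // h2'.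
by rewrite (h1 j) // (h2 j).
Qed.

(** By induction the two values swapped at step [i] are known: the cell [i] is untouched, and the
    cell [H i] holds the value of the last sibling, its initial value, or what step [H i] brought
    there. These are the three clauses on [src]. *)
Lemma shuffle_described k : sources -> k <= p -> described k (shuffle H b k M).
Proof.
move=> srcs; elim: k => [|k IH] kp.
  by move=> y; split=> [j|_]; [lia | rewrite addn0; case: ifP => //; lia].
have {}IH : described k (shuffle H b k M) by apply: IH; lia.
rewrite shuffleS; set i := b + k; set M' := shuffle H b k M in IH *.
have ik : b <= i < b + p by rewrite /i; lia.
have [src1 src2 src3] := srcs i ik; have Hi := H_le ik.
(* No earlier step aims at [i], because [H j <= j < i]. *)
have M'i : M' i = M i.
  have [_ ->] := IH i; first by case: ifP => //; rewrite /i; lia.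
  by move=> j jk E; have : H j <= j by [apply: H_le; lia]; rewrite /i in E; lia.
have M'H : H i != i -> M' (H i) = M (src i).
  move=> Hne; have [g1 g2] := IH (H i).
  case: (last_in_group k (H i)) => [no|[j [jk Hj la]]].
    have fs : first_sibling i by move=> j jk; apply: no; rewrite /i in jk; lia.
    rewrite g2 //; case: ifP => Hb; first by rewrite src3 //; lia.
    by rewrite src2 //; move: Hb Hne Hi; rewrite /i; lia.
  by rewrite (g1 j) // (src1 j).
move=> y; rewrite /swap; split.
  move=> j jk Hj la; case: (eqVneq j i) => [ji|ji].
    subst j; case: eqP => [yi|_]; last by rewrite -Hj eqxx M'i.
    by rewrite Hj yi M'i.
  have jk' : b <= j < b + k by rewrite /i in ji; lia.
  have Hiy : H i <> y by apply: la; rewrite /i; lia.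
  case: eqP => [yi|_].
    have Hjj : H j <= j by apply: H_le; lia.
    by exfalso; move: Hjj; rewrite Hj yi /i; lia.
  case: eqP => [/esym //|_]; have [g1 _] := IH y.
  by apply: g1 => // i' ii; apply: la; lia.
move=> no; have Hiy : H i <> y by apply: no; rewrite /i; lia.
case: eqP => [yi|ne].
  subst y; rewrite M'H; last exact/eqP.
  by rewrite (_ : (_ <= _ < _)) // /i; lia.
case: eqP => [/esym //|_]; have [_ ->] := IH y; last by move=> j jk; apply: no; lia.
by have -> : (b <= y < b + k.+1) = (b <= y < b + k) by rewrite /i in ne; lia.
Qed.
End ClosedForm.

(** ** Iterated averages *)

Section Averages.
Import GRing.Theory Num.Theory.
Local Open Scope ring_scope.

Definition mean (m : nat) (f : nat -> rat) : rat := (\sum_(0 <= h < m) f h) / m%:R.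

(** The expectation of [phi] at a function with independent values, uniform in [{0, ..., b q}] for
    [q < k] and 0 from [k] on, taken one coordinate at a time. *)
Fixpoint average (k : nat) (b : nat -> nat) (phi : (nat -> nat) -> rat) : rat :=
  if k is k'.+1 then mean (b k').+1 (fun h => average k' b (fun g => phi (upd g k' h)))
  else phi (fun=> 0%N).

Lemma eq_mean m f f' : (forall h, (h < m)%N -> f h = f' h) -> mean m f = mean m f'.
Proof.
move=> E; rewrite /mean; congr (_ / _); rewrite !big_mkord.
by apply: eq_bigr => h _; exact: E.
Qed.

Lemma eq_average k b phi psi : phi =1 psi -> average k b phi = average k b psi.
Proof.
elim: k phi psi => [|k IH] phi psi E /=; first exact: E.
by apply: eq_mean => h _; apply: IH => g; exact: E.
Qed.

Lemma average_mean k b m (phi : (nat -> nat) -> nat -> rat) :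
  mean m (fun h => average k b (phi^~ h)) = average k b (fun g => mean m (phi g)).
Proof.
elim: k phi => [//|k IH] phi /=.
transitivity (mean (b k).+1 (fun h' => mean m (fun h =>
    average k b (fun g => phi (upd g k h') h)))); last by apply: eq_mean => h _; exact: IH.
by rewrite /mean -!mulr_suml exchange_big /= mulrAC.
Qed.

Lemma mean1 f : mean 1 f = f 0%N.
Proof. by rewrite /mean big_nat1 divr1. Qed.

Definition extend p (b : 'I_p -> nat) (d : {dffun forall q : 'I_p, 'I_(b q).+1}) : nat -> nat :=
  fun k => if insub k is Some q then val (d q) else 0%N.

Lemma extendE p (b : 'I_p -> nat) (d : {dffun forall q : 'I_p, 'I_(b q).+1}) (q : 'I_p) :
  extend d q = d q.
Proof. by rewrite /extend valK. Qed.

Lemma extend_out p (b : 'I_p -> nat) (d : {dffun forall q : 'I_p, 'I_(b q).+1}) k :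
  (p <= k)%N -> extend d k = 0%N.
Proof. by move=> pk; rewrite /extend insubF // ltnNge pk. Qed.

Lemma extend_le p (b : nat -> nat) (d : {dffun forall q : 'I_p, 'I_(b q).+1}) k :
  (extend d k <= b k)%N.
Proof.
case: (ltnP k p) => kp; last by rewrite extend_out.
by rewrite (_ : k = Ordinal kp) // extendE -ltnS ltn_ord.
Qed.

Definition collect p (b : nat -> nat) (g : nat -> nat) : {dffun forall q : 'I_p, 'I_(b q).+1} :=
  [ffun q : 'I_p => inord (g q)].

Lemma extend_inj p (b : 'I_p -> nat) (d d' : {dffun forall q : 'I_p, 'I_(b q).+1}) :
  extend d = extend d' -> d = d'.
Proof. by move=> E; apply/ffunP => q; apply: val_inj; rewrite /= -!extendE E. Qed.

Lemma extend_collect p (b g : nat -> nat) : (forall k, g k <= b k)%N ->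
  (forall k, p <= k -> g k = 0)%N -> extend (collect p b g) = g.
Proof.
move=> gb g0; apply: functional_extensionality => k.
case: (ltnP k p) => kp; last by rewrite extend_out // g0.
by rewrite (_ : k = Ordinal kp) // extendE ffunE inordK // ltnS gb.
Qed.

(** Identifies the uniform law on the joint draws of the machine with the iterated mean. The
    induction splits off the last processor by the bijection [F], and cardinals multiply. *)
Lemma average_draws p (b' : 'I_p -> nat) (b : nat -> nat) phi : (forall q, b' q = b q) ->
  (\sum_(d : {dffun forall q : 'I_p, 'I_(b' q).+1}) phi (extend d))
     / #|{: {dffun forall q : 'I_p, 'I_(b' q).+1}}|%:R = average p b phi.
Proof.
move=> bE; have {bE} -> : b' = fun q : 'I_p => b q by apply: functional_extensionality.
elim: p phi {b'} => [|p IH] phi /=.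
  pose z : {dffun forall q : 'I_0, 'I_(b q).+1} := [ffun q => ord0].
  have one (d : {dffun forall q : 'I_0, 'I_(b q).+1}) : d = z by apply/ffunP => -[].
  have -> : #|{: {dffun forall q : 'I_0, 'I_(b q).+1}}| = 1%N.
    by apply/eqP/fintype1P; exists z.
  rewrite divr1 (bigD1 z) //= big1 ?addr0 => [|d]; last by rewrite [d]one eqxx.
  by congr phi; apply: functional_extensionality => k; rewrite extend_out.
pose F (x : 'I_(b p).+1 * {dffun forall q : 'I_p, 'I_(b q).+1}) :=
  collect p.+1 b (upd (extend x.2) p x.1).
have EF x : extend (F x) = upd (extend x.2) p x.1.
  apply: extend_collect => k.
    by rewrite /upd; case: eqP => [->|_]; [rewrite -ltnS ltn_ord | exact: extend_le].
  by move=> pk; rewrite upd_other ?extend_out //; lia.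
pose F' (d : {dffun forall q : 'I_p.+1, 'I_(b q).+1}) : 'I_(b p).+1 * {dffun forall q : 'I_p, 'I_(b q).+1} :=
  (inord (extend d p), collect p b (fun k => if (k < p)%N then extend d k else 0%N)).
have bij : bijective F.
  exists F' => [[h d]|d]; rewrite /F'; last first.
    apply: extend_inj; rewrite EF /= inordK; last by rewrite ltnS extend_le.
    rewrite extend_collect; first last.
    - by move=> k; rewrite leqNgt => /negbTE ->.
    - by move=> k; case: ifP => // _; exact: extend_le.
    apply: functional_extensionality => k; rewrite /upd; case: eqP => [->//|kp].
    by case: ltnP => // pk; rewrite extend_out //; lia.
  rewrite EF upd_same /=; congr (_, _); first by apply: val_inj; rewrite /= inordK.
  apply: extend_inj; rewrite extend_collect; first last.
  - by move=> k; rewrite leqNgt => /negbTE ->.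
  - by move=> k; case: ifP => // kp; rewrite upd_other ?extend_le //; lia.
  apply: functional_extensionality => k; case: ltnP => kp; last by rewrite extend_out.
  by rewrite upd_other //; lia.
rewrite (reindex F) /=; last exact: onW_bij.
rewrite -(bij_eq_card bij) card_prod card_ord natrM invfM mulrA.
rewrite [RHS]/mean big_mkord -(pair_bigA _ (fun h d => phi (extend (F (h, d))))) /=.
rewrite mulrAC; congr (_ / _).
rewrite mulr_suml; apply: eq_bigr => h _; rewrite -IH; congr (_ / _).
by apply: eq_bigr => d _; rewrite EF.
Qed.

Fixpoint expected (psi : memory -> rat) (k i : nat) (M : memory) : rat :=
  if k is k'.+1 then mean i.+1 (fun h => expected psi k' i.+1 (swap i h M)) else psi M.

(** Elements below [D] were processed by an earlier, overlapping chunk. Being their own targets,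
    they are swapped with themselves. *)
Definition targets (D b : nat) (g : nat -> nat) (x : nat) : nat :=
  if (x < D)%N then x else g (x - b)%N.

(** The last coordinate is the outermost mean, but its swap is the last one of the chunk; exchanging
    the means turns it into the next step of [expected]. An element below [D] draws from the single
    value 0, and its mean disappears. *)
Lemma expected_chunk psi n D b k M : (b <= D)%N -> (b + k <= n)%N ->
  average k (fun q => if (D <= b + q)%N then (b + q)%N else 0%N)
    (fun g => expected psi (n - maxn D (b + k)) (maxn D (b + k)) (shuffle (targets D b g) b k M))
  = expected psi (n - D) D M.
Proof.
move=> bD; elim: k => [|k IH] bk; first by rewrite addn0 (maxn_idPl bD).
have sh g h : shuffle (targets D b (upd g k h)) b k.+1 M =
    swap (b + k) (if (b + k < D)%N then (b + k)%N else h) (shuffle (targets D b g) b k M).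
  rewrite shuffleS {1}/targets addKn upd_same; congr (swap _ _ _).
  apply: eq_shuffle => i ik; rewrite /targets; case: ifP => // _.
  by rewrite upd_other //; lia.
rewrite -IH /=; last by lia.
case: (leqP D (b + k)) => Dk.
  under eq_mean => h _ do under eq_average => g do rewrite sh ltnNge Dk /=.
  rewrite (@average_mean k _ (b + k).+1 (fun g h => expected psi _ _ (swap (b + k) h (shuffle (targets D b g) b k M)))).
  apply: eq_average => g.
  have -> : maxn D (b + k.+1) = (b + k).+1 by lia.
  by have -> : (n - (b + k) = (n - (b + k).+1).+1)%N by lia.
rewrite mean1; apply: eq_average => g; rewrite sh Dk swap_id.
by have -> : maxn D (b + k.+1) = D by lia.
Qed.

Definition insert_max n (x : 'I_n.+1 * {perm 'I_n}) : {perm 'I_n.+1} :=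
  (tperm x.1 ord_max * lift_perm ord_max ord_max x.2)%g.

(** The position [h] is recovered as the preimage of the maximum, which gives injectivity; the
    cardinals agree by [(n + 1) n! = (n + 1)!]. *)
Lemma insert_max_bij n : bijective (@insert_max n).
Proof.
apply: inj_card_bij; last first.
  by rewrite card_prod card_ord !card_Sn factS.
move=> [h s] [h' s'] E.
have im x y : insert_max (x, y) x = ord_max by rewrite permM tpermL lift_perm_id.
have hh : h = h' by apply: (@perm_inj _ (insert_max (h, s))); rewrite im E im.
move: E; rewrite /insert_max hh => /= /mulgI E; congr (_, _).
apply/permP => k; apply: (@lift_inj _ ord_max).
by rewrite -!(lift_perm_lift ord_max) E.
Qed.

Lemma perm_nat_ord n (s : {perm 'I_n}) (i : 'I_n) : perm_nat s i = s i.
Proof. by rewrite /perm_nat valK. Qed.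

Lemma perm_nat_out n (s : {perm 'I_n}) k : (n <= k)%N -> perm_nat s k = k.
Proof. by move=> nk; rewrite /perm_nat insubF // ltnNge nk. Qed.

Lemma perm_nat_insert_max n h (s : {perm 'I_n}) k :
  perm_nat (insert_max (h, s)) k =
  perm_nat s (if k == n then val h else if k == h then n else k).
Proof.
have lift k' : perm_nat (lift_perm ord_max ord_max s) k' = perm_nat s k'.
  case: (ltngtP k' n) => kn.
  - have -> : k' = lift ord_max (Ordinal kn) by rewrite lift_max.
    by rewrite perm_nat_ord lift_perm_lift !lift_max perm_nat_ord.
  - by rewrite !perm_nat_out //; lia.
  - rewrite [RHS]perm_nat_out ?kn // -[n in LHS]/(val (@ord_max n)).
    by rewrite perm_nat_ord lift_perm_id.
rewrite -lift; case: (ltnP k n.+1) => kn; last first.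
  have -> : (k == n) = false by lia.
  have -> : (k == h) = false by apply/negbTE; rewrite neq_ltn (leq_trans (ltn_ord h) kn) orbT.
  by rewrite !perm_nat_out.
rewrite (_ : k = Ordinal kn) // perm_nat_ord permM -perm_nat_ord; congr perm_nat.
rewrite /=; case: tpermP => [kh|kh|kh km].
- by rewrite /= -kh /= eqxx; case: eqP.
- by rewrite -[k]/(val (Ordinal kn)) kh eqxx.
- rewrite (_ : (k == n) = false); last by apply/negP => /eqP kE; apply: km; apply: val_inj.
  by rewrite (_ : (k == h) = false) //; apply/negP => /eqP kE; apply: kh; apply: val_inj.
Qed.

(** Correctness of the sequential Fisher-Yates shuffle: swapping [n] with a uniform [h] after a
    uniform permutation of the first [n] cells is composition with [insert_max], a bijection onto
    the permutations of [n + 1] cells. *)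
Lemma average_shuffle n psi M :
  average n id (fun g => psi (shuffle g 0 n M)) =
  (\sum_(s : {perm 'I_n}) psi (M \o perm_nat s)) / n`!%:R.
Proof.
elim: n psi => [|n IH] psi /=.
  rewrite divr1 (bigD1 (1%g : {perm 'I_0})) //= big1 ?addr0 => [|s]; last first.
    by case/eqP; apply/permP => -[].
  by congr psi; apply: functional_extensionality => k; rewrite /= /perm_nat insubF.
rewrite (reindex (@insert_max n)) /=; last exact: onW_bij (insert_max_bij n).
rewrite -(pair_bigA _ (fun h s => psi (M \o perm_nat (insert_max (h, s))))) /=.
rewrite /mean big_mkord factS natrM invfM mulrA mulrAC; congr (_ / _).
rewrite mulr_suml; apply: eq_bigr => h _.
transitivity (average n id (fun g => psi (swap n h (shuffle g 0 n M)))).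
  apply: eq_average => g; rewrite shuffleS add0n upd_same; congr (psi (swap _ _ _)).
  by apply: eq_shuffle => i ik; rewrite upd_other //; lia.
rewrite (IH (fun M' => psi (swap n h M'))); congr (_ / _); apply: eq_bigr => s _; congr psi.
apply: functional_extensionality => k; rewrite /swap /= perm_nat_insert_max.
by case: ifP => // _; case: ifP.
Qed.

Lemma expected_uniform psi n M :
  expected psi n 0 M = (\sum_(s : {perm 'I_n}) psi (M \o perm_nat s)) / n`!%:R.
Proof.
have := @expected_chunk psi n 0 0 n M isT (leqnn n).
rewrite subn0 => <-; rewrite add0n max0n subnn -average_shuffle; apply: eq_average => g /=.
by congr psi; apply: eq_shuffle => i _; rewrite /targets subn0.
Qed.
End Averages.

(** ** Neighbours among equal keys *)

Section Neighbours.
Variables (p L : nat) (key f : nat -> nat).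
Hypothesis key_lt : forall q, q < p -> key q < 2 ^ L.
Hypothesis gf : grouped p L (2 ^ L) (word L key) f.

Definition source (i : nat) : nat := f i %/ 2 ^ L.

Lemma source_word i : i < p -> source i < p /\ f i = word L key (source i).
Proof.
by case: gf => G1 _ _ _ ip; have [j jp E] := G1 i ip; rewrite /source E (word_div key_lt).
Qed.

Lemma group_key i : i < p -> f i %% 2 ^ L = key (source i).
Proof. by move=> ip; have [sp E] := source_word ip; rewrite {1}E (word_mod key_lt). Qed.

Lemma source_surj x : x < p -> exists2 i, i < p & source i = x.
Proof.
case: gf => _ G2 _ _ xp; have [i ip E] := G2 x xp.
by exists i; rewrite // /source E (word_div key_lt).
Qed.

Lemma source_inj i j : i < p -> j < p -> source i = source j -> i = j.
Proof. exact: (grouped_inj key_lt gf). Qed.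

Lemma group_between i j h : i < j -> j < h -> h < p -> key (source i) = key (source h) ->
  key (source j) = key (source i).
Proof.
case: gf => _ _ G3 _ ij jh hp; rewrite -!group_key //; try lia.
exact: G3.
Qed.

Lemma group_monotone i j i' j' : i < j -> j < p -> i' < j' -> j' < p ->
  key (source i) = key (source j) -> key (source i') = key (source i) ->
  key (source j') = key (source i) ->
  (source i < source j) = (source i' < source j').
Proof.
case: gf => _ _ _ G4 ij jp ij' jp'; rewrite -!group_key //; try lia.
exact: G4.
Qed.

Definition adjacent (i i' : nat) : bool := [&& i' < p & (i'.+1 == i) || (i' == i.+1)].

(** A group is contiguous and monotone, so neighbouring places hold consecutive members: an element
    between the two sources would have its place beyond one of them, against monotonicity. *)
Lemma adjacent_below i i' x : i < p -> adjacent i i' -> key (source i') = key (source i) ->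
  source i' < source i -> source i' < x < source i -> key x <> key (source i).
Proof.
move=> ip /andP[ip' adj] kk lt xi kx; have [sp _] := source_word ip.
have xp : x < p by lia.
have [u up ux] := source_surj xp; subst x.
have ui : u <> i by move=> E; move: xi; rewrite E; lia.
have ui' : u <> i' by move=> E; move: xi; rewrite E; lia.
case/orP: adj => /eqP E.
  case: (ltnP u i') => h.
    have := @group_monotone i' i u i'; rewrite lt kk kx => /(_ _ ip h ip' erefl erefl erefl).
    by lia.
  have iu : i < u by lia.
  have := @group_monotone i' i i u; rewrite lt kk kx => /(_ _ ip iu up erefl erefl erefl).
  by lia.
case: (ltnP u i) => h.
  have := @group_monotone i i' u i; rewrite kk kx => /(_ _ ip' h ip erefl erefl erefl).
  by lia.
have iu : i' < u by lia.
have := @group_monotone i i' i' u; rewrite kk kx => /(_ _ ip' iu up erefl erefl erefl).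
by lia.
Qed.

Lemma adjacent_exists i x (below : bool) : i < p -> x < p -> key x = key (source i) ->
  (if below then x < source i else source i < x) ->
  exists2 i', adjacent i i' &
    key (source i') = key (source i) /\ if below then source i' < source i else source i < source i'.
Proof.
move=> ip xp kx cmp; have [u up ux] := source_surj xp; subst x.
have ui : u <> i by move=> E; move: cmp; rewrite E ltnn; case: below.
case: (ltnP u i) => h.
  have ipred : i.-1.+1 = i by lia.
  have i1 : i.-1 < p by lia.
  have k1 : key (source i.-1) = key (source i).
    case: (eqVneq u i.-1) => [<-//|ne]; rewrite -kx.
    by apply: (@group_between u i.-1 i) => //; lia.
  have ii : i.-1 < i by lia.
  have m := @group_monotone u i i.-1 i h ip ii ip kx (etrans k1 (esym kx)) (esym kx).
  exists i.-1; first by rewrite /adjacent i1 ipred eqxx.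
  split=> //; have ne : source i.-1 <> source i by move/source_inj => /(_ i1 ip); lia.
  have ne' : source u <> source i by move/source_inj => /(_ up ip).
  by case: below cmp; lia.
have h' : i < u by lia.
have i1 : i.+1 < p by lia.
have k1 : key (source i.+1) = key (source i).
  case: (eqVneq u i.+1) => [<-//|ne].
  by apply: (@group_between i i.+1 u) => //; lia.
have m := @group_monotone i u i i.+1 h' up (ltnSn i) i1 (esym kx) erefl k1.
exists i.+1; first by rewrite /adjacent i1 eqxx orbT.
split=> //; have ne : source i.+1 <> source i by move/source_inj => /(_ i1 ip); lia.
have ne' : source u <> source i by move/source_inj => /(_ up ip).
by case: below cmp; lia.
Qed.

Definition left (i : nat) (b : bool) : bool :=
  [&& 0 < i, key (source i.-1) == key (source i)
    & if b then source i.-1 < source i else source i < source i.-1].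

Definition right (i : nat) (b : bool) : bool :=
  [&& i.+1 < p, key (source i.+1) == key (source i)
    & if b then source i.+1 < source i else source i < source i.+1].

(** Packs both answers into one word: twice the previous member plus one, with 0 for none, and in
    the low bit whether there is a next member. As a group may be increasing or decreasing, each can
    be on either side. *)
Definition report (i : nat) : nat :=
  (left i true * (source i.-1).+1 + right i true * (source i.+1).+1) * 2
    + (left i false + right i false).

Lemma left_right_exclusive i b : i < p -> left i b -> right i b -> False.
Proof.
move=> ip /and3P[i0 /eqP k1 c1] /and3P[i1 /eqP k2 c2].
have := @group_monotone i.-1 i i i.+1; rewrite k1 k2 => /(_ _ ip (ltnSn i) i1 erefl erefl erefl).
by move: c1 c2; case: b; lia.
Qed.

Definition has_previous (x v : nat) : Prop :=
  (v = 0 /\ forall j, j < x -> key j <> key x) \/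
  exists j, [/\ v = j.+1, j < x, key j = key x & forall i, j < i < x -> key i <> key x].

Definition has_next (x v : nat) : Prop :=
  (v = 0 /\ forall j, x < j < p -> key j <> key x) \/
  (v = 1 /\ exists2 j, x < j < p & key j = key x).

Lemma reportP i : i < p ->
  [/\ report i <= p.*2.+1, has_previous (source i) (report i %/ 2) & has_next (source i) (report i %% 2)].
Proof.
move=> ip; have [sp _] := source_word ip.
have adjl : 0 < i -> adjacent i i.-1 by rewrite /adjacent; lia.
have adjr : i.+1 < p -> adjacent i i.+1 by rewrite /adjacent eqxx orbT => ->.
have srcl : source i.-1 < p by have [] // := @source_word i.-1; lia.
have prev : has_previous (source i)
    (left i true * (source i.-1).+1 + right i true * (source i.+1).+1).
  case lf: (left i true); case rt: (right i true).
  - by case: (left_right_exclusive ip lf rt).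
  - right; exists (source i.-1); move: lf => /and3P[i0 /eqP k1 c1].
    rewrite mul1n addn0; split=> // j; exact: (adjacent_below ip (adjl i0)).
  - right; exists (source i.+1); move: rt => /and3P[i0 /eqP k1 c1].
    rewrite mul1n; split=> // j; exact: (adjacent_below ip (adjr i0)).
  - left; split=> // j jx kj.
    have [i' /andP[ip' /orP[/eqP E|/eqP E]] [k c]] := @adjacent_exists i j true ip (ltn_trans jx sp) kj jx.
      by case/negP: lf; subst i; rewrite /left /= k eqxx.
    by case/negP: rt; subst i'; rewrite /right ip' k eqxx.
have next : has_next (source i) (left i false + right i false).
  case lf: (left i false); case rt: (right i false).
  - by case: (left_right_exclusive ip lf rt).
  - right; split=> //; exists (source i.-1); move: lf => /and3P[i0 /eqP k1 c1] //.
    by rewrite c1.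
  - right; split=> //; exists (source i.+1); move: rt => /and3P[i0 /eqP k1 c1] //.
    by rewrite c1; have [] := source_word i0.
  - left; split=> // j /andP[xj jp] kj.
    have [i' /andP[ip' /orP[/eqP E|/eqP E]] [k c]] := @adjacent_exists i j false ip jp kj xj.
      by case/negP: lf; subst i; rewrite /left /= k eqxx.
    by case/negP: rt; subst i'; rewrite /right ip' k eqxx.
have n1 : left i false + right i false <= 1 by case: next => [[->]|[->]].
rewrite /report divnMDl // divn_small ?ltnS // addn0 modnMDl modn_small ?ltnS //; split=> //.
suff : left i true * (source i.-1).+1 + right i true * (source i.+1).+1 <= p by lia.
by case: prev => [[-> _]//|[j [-> jx _ _]]]; lia.
Qed.
End Neighbours.

(* The sentinel n of registers 107 and 110 is not a key. *)
Definition look_around : seq linstr :=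
  [:: LOp Mul 112 7 7; LOp Defs.Sub 107 2 3; LOp Defs.Sub 110 2 3; LOp Defs.Sub 108 32 4;
      LOp Add 109 0 4; LOp Add 111 32 4].

(** Registers 124 and 128 test the equality of keys on the left and on the right; 131, 137 add that
    the neighbour's source is smaller, 134, 140 that it is larger. Register 148 is the report, 149
    the cell of the source to which it is sent. *)
Definition compare_keys : seq linstr :=
  [:: LMin 113 107 112; LMin 114 110 112; LOp Div 115 33 7; LOp Mod 116 33 7;
      LOp Div 117 113 7; LOp Mod 118 113 7; LOp Div 119 114 7; LOp Mod 120 114 7;
      LOp Defs.Sub 121 116 118; LOp Defs.Sub 122 118 116; LOp Add 123 121 122; LOp Defs.Sub 124 4 123;
      LOp Defs.Sub 125 116 120; LOp Defs.Sub 126 120 116; LOp Add 127 125 126; LOp Defs.Sub 128 4 127;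
      LOp Defs.Sub 129 115 117; LMin 130 129 4; LOp Mul 131 124 130;
      LOp Defs.Sub 132 117 115; LMin 133 132 4; LOp Mul 134 124 133;
      LOp Defs.Sub 135 115 119; LMin 136 135 4; LOp Mul 137 128 136;
      LOp Defs.Sub 138 119 115; LMin 139 138 4; LOp Mul 140 128 139;
      LOp Add 141 117 4; LOp Mul 142 131 141; LOp Add 143 119 4; LOp Mul 144 137 143;
      LOp Add 145 142 144; LOp Add 146 134 140; LOp Mul 147 145 5; LOp Add 148 147 146;
      LOp Add 149 30 115].

Definition siblings : cmd :=
  Seq grouping
  (Seq (Loc look_around)
  (Seq (Rd 3 0 107 108)
  (Seq (Rd 109 1 110 111)
  (Seq (Loc compare_keys)
  (Seq (Wr 3 4 149 148)
  (Seq (Rd 3 4 150 32)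
       (Loc [:: LMin 151 150 7; LOp Mod 152 151 5; LOp Div 153 151 5]))))))).

Lemma eq_below (a b k k' : nat) :
  (1 - (k - k' + (k' - k))) * minn (a - b) 1 = (k' == k) && (b < a).
Proof. by case: eqP; case: ltnP => /=; lia. Qed.

Section Siblings.
Variables (n p N base L : nat) (key : nat -> nat).
Hypothesis np : 0 < p <= n.
Hypothesis nL : n.*2.+2 <= 2 ^ L.
Hypothesis L_gt0 : 0 < L.
Hypothesis key_lt : forall q, q < p -> key q < n.
Hypothesis space : forall q, q < p -> base + q < N.

Lemma wp_siblings s : env n p L s -> reg s 30 base -> reg s 31 1 ->
  (forall q, q < p -> rg s q 33 = word L key q) ->
  wp p N false siblings
    (fun s' => [/\ forall q, rg s' q 32 = base + q,
        forall q, q < p -> has_previous key q (rg s' q 153) /\ has_next p key q (rg s' q 152),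
        off_scratch p base 1 s s' & tm s' <= tm s + (40 * L + 100) * L + 100]) s.
Proof.
move=> [h0 [h1 h2 h3 h4 h5] [h7 h8]] h30 h31 h33.
have keyL q : q < p -> key q < 2 ^ L by move=> qp; have := key_lt qp; lia.
have sc q : q < p -> base + 1 * q < N by rewrite mul1n; exact: space.
have pL : p <= 2 ^ L by lia.
have [p0 _] := andP np.
have ge : [/\ forall q, rg s q 0 = q, [/\ reg s 1 p, reg s 3 0, reg s 4 1 & reg s 5 2]
     & [/\ reg s 7 (2 ^ L), reg s 8 L, reg s 30 base & reg s 31 1]] by [].
apply: wp_seq; apply: (wp_frame (wp_grouping false (ltn0Sn 0) p0 pL sc keyL L_gt0 ge h33)).
move=> s1 fr1 _ [f gf [f33 fm a32 os t1]].
have {}a32 q : rg s1 q 32 = base + q by rewrite a32 /slot mul1n.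
have {}fm q : q < p -> mm s1 (base + q) = f q by move=> qp; rewrite -fm // /slot mul1n.
have {h0 h1 h2 h3 h4 h5 h7 h8 h30 h31} [h0 [h1 h2 h3 h4 h5] [h7 h30]] :
    [/\ forall q, rg s1 q 0 = q, [/\ reg s1 1 p, reg s1 2 n, reg s1 3 0, reg s1 4 1 & reg s1 5 2]
      & reg s1 7 (2 ^ L) /\ reg s1 30 base].
  by split; [|split|split] => q; rewrite fr1.
apply: wp_seq; apply: wp_loc => s2 R2 M2 t2 _.
have act2 q : active s2 3 0 q = (0 < q) by rewrite /active; do !symb R2; rewrite h3 h0.
have r108 q : 0 < q -> rg s2 q 108 = base + q.-1 by move=> q0; symb R2; rewrite a32 h4; lia.
apply: wp_seq; apply: wp_rd => [|s3 R3 r107 M3 t3 _].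
  by split=> // q qp; rewrite act2 => q0; rewrite r108 //; apply: space; lia.
have e3 r : r \in [:: 0; 1; 2; 3; 4; 5; 7; 30; 32; 33] -> forall q, rg s3 q r = rg s1 q r.
  move=> rin q; rewrite R3; last by apply: contraTneq rin => ->.
  by rewrite R2 -symE locals_frame //; apply: contraTN rin; rewrite /= !inE;
    do ![case/orP=> [/eqP->|] //]; move/eqP->.
have v107 q : q < p -> rg s3 q 107 = if 0 < q then f q.-1 else n.
  move=> qp; rewrite r107 act2; case: ifP => q0; first by rewrite r108 // M2 fm //; lia.
  by symb R2; rewrite h2 h3 subn0.
have act3 q : active s3 109 1 q = (q.+1 < p).
  by rewrite /active !R3 //; do !symb R2; rewrite h0 h1 h4 addn1.
have r111 q : rg s3 q 111 = base + q.+1 by rewrite R3 //; symb R2; rewrite a32 h4; lia.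
apply: wp_seq; apply: wp_rd => [|s4 R4 r110 M4 t4 _].
  by split=> // q qp; rewrite act3 => q1; rewrite r111; exact: space.
have e4 r : r \in [:: 0; 1; 2; 3; 4; 5; 7; 30; 32; 33] -> forall q, rg s4 q r = rg s1 q r.
  by move=> rin q; rewrite R4 ?e3 //; apply: contraTneq rin => ->.
have v110 q : q < p -> rg s4 q 110 = if q.+1 < p then f q.+1 else n.
  move=> qp; rewrite r110 act3; case: ifP => q1; first by rewrite r111 M3 M2 fm.
  by rewrite R3 //; symb R2; rewrite h2 h3 subn0.
have r112 q : rg s4 q 112 = 2 ^ L * 2 ^ L.
  by rewrite R4 // R3 //; symb R2; rewrite h7.
apply: wp_seq; apply: wp_loc => s5 R5 M5 t5 _.
have LL : 2 ^ L <= 2 ^ L * 2 ^ L by apply: leq_pmulr; rewrite expn_gt0.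
have fL q : q < p -> f q <= 2 ^ L * 2 ^ L.
  by move=> qp; apply: ltnW; exact: (word_bound (ltn0Sn 0) p0 pL keyL L_gt0 gf qp).
have src q : q < p -> source L f q < p /\ f q %% 2 ^ L = key (source L f q).
  by move=> qp; have [sp _] := source_word keyL gf qp; split=> //; exact: (group_key keyL gf).
have n_mod : n %% 2 ^ L = n by rewrite modn_small //; lia.
have n_div : n %/ 2 ^ L = 0 by rewrite divn_small //; lia.
set x := source L f; have xE q : f q %/ 2 ^ L = x q by [].
have r113 q : q < p -> rg s5 q 113 = if 0 < q then f q.-1 else n.
  move=> qp; symb R5; rewrite r112 R4 // v107 //; apply/minn_idPl.
  by case: ifP => q0; [apply: fL; lia | lia].
have r114 q : q < p -> rg s5 q 114 = if q.+1 < p then f q.+1 else n.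
  move=> qp; symb R5; rewrite r112 v110 //; apply/minn_idPl.
  by case: ifP => q0; [apply: fL; lia | lia].
have c4 q : rg s4 q 4 = 1 by rewrite e4.
have c5 q : rg s4 q 5 = 2 by rewrite e4.
have c7 q : rg s4 q 7 = 2 ^ L by rewrite e4.
have r115 q : q < p -> rg s5 q 115 = x q by move=> qp; symb R5; rewrite e4 // f33 // c7.
have flag q : q < p -> rg s4 q 33 = f q by move=> qp; rewrite e4 // f33.
have lflag q : q < p -> (n == key (x q)) = false ->
    (if 0 < q then f q.-1 else n) %% 2 ^ L == f q %% 2 ^ L = (0 < q) && (key (x q.-1) == key (x q)).
  move=> qp nk; have [_ ->] := src q qp; case: (posnP q) => [_|q0]; first by rewrite n_mod -/x nk.
  by have [|_ ->] := src q.-1; first by lia.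
have nkey q : q < p -> (n == key (x q)) = false.
  by move=> qp; have [sp _] := src q qp; have := key_lt sp; rewrite -/x; lia.
have rflag q : q < p ->
    (if q.+1 < p then f q.+1 else n) %% 2 ^ L == f q %% 2 ^ L = (q.+1 < p) && (key (x q.+1) == key (x q)).
  move=> qp; have [_ ->] := src q qp; case: (ltnP q.+1 p) => [q1|_]; last by rewrite n_mod -/x nkey.
  by have [_ ->] := src q.+1 q1.
have r148 q : q < p -> rg s5 q 148 = report p L key f q.
  move=> qp; have -> : rg s5 q 148 =
     ((rg s4 q 4 - (rg s4 q 33 %% rg s4 q 7 - rg s5 q 113 %% rg s4 q 7 + (rg s5 q 113 %% rg s4 q 7 - rg s4 q 33 %% rg s4 q 7))) *
        minn (rg s4 q 33 %/ rg s4 q 7 - rg s5 q 113 %/ rg s4 q 7) (rg s4 q 4) * (rg s5 q 113 %/ rg s4 q 7 + rg s4 q 4) +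
      (rg s4 q 4 - (rg s4 q 33 %% rg s4 q 7 - rg s5 q 114 %% rg s4 q 7 + (rg s5 q 114 %% rg s4 q 7 - rg s4 q 33 %% rg s4 q 7))) *
        minn (rg s4 q 33 %/ rg s4 q 7 - rg s5 q 114 %/ rg s4 q 7) (rg s4 q 4) * (rg s5 q 114 %/ rg s4 q 7 + rg s4 q 4)) * rg s4 q 5 +
     ((rg s4 q 4 - (rg s4 q 33 %% rg s4 q 7 - rg s5 q 113 %% rg s4 q 7 + (rg s5 q 113 %% rg s4 q 7 - rg s4 q 33 %% rg s4 q 7))) *
        minn (rg s5 q 113 %/ rg s4 q 7 - rg s4 q 33 %/ rg s4 q 7) (rg s4 q 4) +
      (rg s4 q 4 - (rg s4 q 33 %% rg s4 q 7 - rg s5 q 114 %% rg s4 q 7 + (rg s5 q 114 %% rg s4 q 7 - rg s4 q 33 %% rg s4 q 7))) *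
        minn (rg s5 q 114 %/ rg s4 q 7 - rg s4 q 33 %/ rg s4 q 7) (rg s4 q 4)).
    by do !symb R5.
  rewrite c4 c5 c7 !eq_below r113 // r114 // flag // lflag ?nkey // rflag // /report /left /right -/x xE.
  by case: (0 < q) => /=; case: (q.+1 < p) => /=; rewrite ?xE ?addn1 ?andbF.
have ad5 q : q < p -> rg s5 q 149 = base + x q.
  by move=> qp; symb R5; rewrite e4 // h30 flag // c7.
have act5 q : active s5 3 4 q by rewrite /active; do !symb R5; rewrite !e4 // h3 h4.
have aw5 : addresses_ok p N s5 true 3 4 149.
  split=> [q qp _|_ q q' qp qp' _ _]; first by rewrite ad5 //; apply: space; case: (src q qp).
  by rewrite !ad5 // => /addnI; exact: (source_inj keyL gf).
apply: wp_seq; apply: wp_wr => // s6 R6 hit6 miss6 t6 _.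
have act6 q : active s6 3 4 q by rewrite /active !R6; exact: act5.
have r32 q : rg s6 q 32 = base + q by rewrite R6; symb R5; rewrite e4.
apply: wp_seq; apply: wp_rd => [|s7 R7 r150 M7 t7 _].
  by split=> // q qp _; rewrite r32; exact: space.
apply: wp_loc => s8 R8 M8 t8 _.
have c75 q : rg s7 q 7 = 2 ^ L /\ rg s7 q 5 = 2 by rewrite !R7 // !R6; do !symb R5; rewrite c7 c5.
have rep i : i < p -> rg s8 (x i) 151 = report p L key f i.
  move=> ip; symb R8; have [-> _] := c75 (x i); rewrite r150.
  rewrite act6 r32 -ad5 // hit6 // r148 //.
  by apply/minn_idPl; have [rb _ _] := reportP keyL gf ip; lia.
split.
- by move=> q; symb R8; rewrite R7.
- move=> q qp; have [i ip <-] := source_surj keyL gf qp; have [_ pr nx] := reportP keyL gf ip.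
  have [_ c] := c75 (x i).
  have -> : rg s8 (x i) 153 = rg s8 (x i) 151 %/ rg s7 (x i) 5 by do !symb R8.
  have -> : rg s8 (x i) 152 = rg s8 (x i) 151 %% rg s7 (x i) 5 by do !symb R8.
  by rewrite c rep.
- move=> a na; rewrite M8 M7 miss6 => [|q qp _]; last first.
    by rewrite ad5 // -/(x q) -[x q]mul1n; apply: na; case: (src q qp).
  by rewrite M5 M4 M3 M2 os.
- by move: t8 t7 t6 t5 t4 t3 t2 t1; rewrite /cost_local /=; lia.
Qed.
End Siblings.

(** ** Pointer jumping *)

Section Jumping.
Variables (H tg : nat -> nat) (go : pred nat).

Definition chase (x t : nat) : Prop := exists d,
  [/\ forall j, j < d -> go (iter j H x), ~~ go (iter d H x) & t = tg (iter d H x)].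

Lemma chase_unique x t t' : chase x t -> chase x t' -> t = t'.
Proof.
move=> [d [g ng ->]] [d' [g' ng' ->]]; congr (tg (iter _ H x)).
by case: (ltngtP d d') => // h; [case/negP: ng; exact: g' | case/negP: ng'; exact: g].
Qed.

Lemma chase_stop x t : ~~ go x -> chase x t -> t = tg x.
Proof. by move=> ng c; apply: (chase_unique c); exists 0; split. Qed.

Lemma chase_go x t : go x -> chase x t -> chase (H x) t.
Proof.
move=> gx [[|d] [g ng ->]]; first by rewrite /= gx in ng.
by exists d; split=> [j jd||]; rewrite -?iterSr //; exact: g.
Qed.

(* An odd word [2 t + 1] gives the final target, an even one a pointer. *)
Definition jumped (k x w : nat) : Prop := exists d, (forall j, j < d -> go (iter j H x)) /\
  ((~~ go (iter d H x) /\ w = (tg (iter d H x)).*2.+1) \/ (d = 2 ^ k /\ w = (iter d H x).*2)).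

Lemma jumped0 x : jumped 0 x (if go x then (H x).*2 else (tg x).*2.+1).
Proof.
case gx: (go x); [exists 1 | exists 0]; split=> //; last by left; rewrite /= gx.
  by case=> //=; rewrite gx.
by right.
Qed.

Lemma jumped_odd k x w : odd w -> jumped k x w -> jumped k.+1 x w.
Proof.
by move=> ow [d [g [h|[_ wE]]]]; [exists d; split=> //; left | rewrite wE odd_double in ow].
Qed.

(** Pointer doubling: the word found at the end of [2 ^ k] steps accounts for up to [2 ^ k] more. *)
Lemma jumped_even k x w w' : ~~ odd w -> jumped k x w -> jumped k w./2 w' -> jumped k.+1 x w'.
Proof.
move=> ew [d [g [[_ wE]|[dE ->]]]]; first by rewrite wE /= odd_double in ew.
rewrite doubleK => -[d' [g' c]]; exists (d' + d); split=> [j jd|].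
  case: (ltnP j d) => h; first exact: g.
  by rewrite -(subnK h) iterD; apply: g'; lia.
rewrite iterD; case: c => [h|[-> ->]]; [by left | right; split=> //].
by rewrite dE expnS mul2n -addnn.
Qed.

Lemma jumped_pointer k x w : ~~ odd w -> jumped k x w -> exists2 y, go y & w = (H y).*2.
Proof.
move=> ew [d [g [[_ wE]|[dE ->]]]]; first by rewrite wE /= odd_double in ew.
case: d g dE => [|d] g dE; first by have := expn_gt0 2 k; rewrite -dE.
by exists (iter d H x); first exact: g.
Qed.

(** The path strictly decreases, so from [x < 2 ^ k] it cannot make [2 ^ k] steps; the word must be
    final. *)
Lemma jumped_chase k x w : (forall y, go y -> H y < y) -> x < 2 ^ k -> jumped k x w ->
  chase x w./2.
Proof.
move=> dec xk [d [g [[ng ->]|[dE _]]]]; first by exists d; rewrite /= uphalf_double; split.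
have : iter d H x + d <= x.
  elim: d {dE} g => [|d IH] g /=; first by rewrite addn0.
  have := dec _ (g d (ltnSn d)); have := IH (fun j jd => g j (ltnW jd)); lia.
by lia.
Qed.
End Jumping.

(** A finished element of an overlapping chunk has drawn 0; register 104 adds its own index, which
    makes its swap void. *)
Definition place_key : seq linstr :=
  [:: LOp Defs.Sub 103 4 12; LOp Mul 104 103 11; LOp Add 105 101 104; LOp Defs.Sub 30 10 3;
      LOp Defs.Sub 31 4 3; LOp Mul 59 0 7; LOp Add 33 59 105].

Definition group_flags : seq linstr :=
  [:: LMin 161 153 4; LOp Defs.Sub 162 4 152; LOp Defs.Sub 163 10 105; LMin 164 163 4;
      LOp Defs.Sub 165 4 164; LOp Mul 166 162 165].

(** If there is a previous sibling (register 161), its cell is the final target. Otherwise the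
    target is [H x], encoded as a pointer, without the low bit, when it is an earlier element of the
    chunk (register 174). *)
Definition first_pointer : seq linstr :=
  [:: LMin 168 167 4; LOp Defs.Sub 169 4 168; LOp Defs.Sub 170 4 161; LOp Defs.Sub 171 11 105;
      LMin 172 171 4; LOp Mul 173 165 172; LOp Mul 174 170 173; LOp Add 175 10 153;
      LOp Defs.Sub 176 175 4; LOp Mul 177 161 176; LOp Mul 178 170 105; LOp Add 179 177 178;
      LOp Defs.Sub 180 4 174; LOp Mul 181 5 179; LOp Add 182 181 180; LOp Defs.Sub 183 182 3;
      LConst 184 0].

(** Several elements may point to the same cell, so this read may be concurrent. *)
Definition jump : cmd :=
  Seq (Wr 3 4 11 183)
  (Seq (Loc [:: LOp Mod 185 183 5; LOp Div 186 183 5; LOp Defs.Sub 187 4 185; LOp Defs.Sub 188 183 3])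
  (Seq (Rd 3 187 188 186)
       (Loc [:: LMin 183 188 7; LOp Add 189 184 4; LMin 184 189 8]))).

(* Register 11 holds the element x of the processor, 101 its draw, 105 its
   target H x, 106 its value, 162 whether x is the last element with this
   target, 169 whether x is no target, 183 its word. *)
Definition shuffle_chunk : cmd :=
  Seq (Loc place_key)
  (Seq (Rd 3 4 106 11)
  (Seq siblings
  (Seq (Loc group_flags)
  (Seq (Wr 3 4 11 3)
  (Seq (Wr 3 166 105 4)
  (Seq (Rd 3 4 167 11)
  (Seq (Loc first_pointer)
  (Seq (While 184 8 jump)
  (Seq (Loc [:: LOp Div 190 183 5])
  (Seq (Wr 3 4 11 106)
  (Seq (Rd 3 4 191 190)
  (Seq (Wr 3 169 11 191)
       (Wr 3 162 105 106))))))))))))).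

(** * A chunk of the shuffle on the machine *)

Section ShuffleChunk.
Variables (n p D : nat).
Hypothesis np : 0 < p <= n.
Let L := bits n.
Let base := minn D (n - p).

Lemma wp_jumps (H tg : nat -> nat) (go : pred nat) s : env n p L s ->
  (forall q, rg s q 11 = base + q) -> reg s 184 0 ->
  (forall y, go y -> [&& base <= H y, H y < y & y < base + p]) ->
  (forall x, base <= x < base + p -> tg x < n) ->
  (forall q, q < p -> rg s q 183 =
     if go (base + q) then (H (base + q)).*2 else (tg (base + q)).*2.+1) ->
  wp p n false (While 184 8 jump)
    (fun s' => [/\ forall q, q < p -> chase H tg go (base + q) (rg s' q 183)./2,
       off_scratch p base 1 s s' & tm s' <= tm s + 20 * L + 2]) s.
Proof.
move=> ge h11 h184 goP tgP w0.
have bp : base + p <= n by rewrite /base; lia.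
have nL := bits_le n; rewrite -/L in nL.
have path d x : base <= x < base + p -> (forall j, j < d -> go (iter j H x)) ->
    base <= iter d H x < base + p.
  case: d => [//|d] _ /(_ d (ltnSn d)) /goP /=; lia.
have jb k x w : base <= x < base + p -> jumped H tg go k x w -> w < 2 ^ L.
  move=> xc [d [g h]]; have zc := path d x xc g; have := tgP _ zc.
  by case: h => [[_ ->]|[_ ->]]; move: zc; lia.
apply: (wp_while (m := L) (I := fun m s' => exists k, [/\ k + m = L, reg s' 184 k,
   forall q, q < p -> jumped H tg go k (base + q) (rg s' q 183), off_scratch p base 1 s s'
   & tm s' <= tm s + 20 * k])).
  exists 0; split=> // [q qp|]; last by rewrite muln0 addn0.
  by rewrite w0 //; exact: jumped0.
move=> m s1 fr [k [km h184' jk os t1]].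
have {ge} ge : env n p L s1 by apply: (env_same ge fr).
have {}h11 q : rg s1 q 11 = base + q by rewrite fr.
case: (ge) => h0 [h1 h2 h3 h4 h5] [h7 h8].
case: m km => [|m] km; [left|right].
  have kL : k = L by lia.
  subst k; split; first by move=> q _; rewrite /active h184' h8 ltnn.
  split=> //= [q qp|]; last by lia.
  apply: (jumped_chase _ _ (jk q qp)); first by move=> y /goP/and3P[].
  by lia.
split; first by move=> q _; rewrite /active h184' h8; lia.
exists m => //; apply: wp_seq; apply: wp_wr => [|s2 R2 hit2 miss2 t2 _].
  split=> [q qp _|_ q q' _ _ _ _] /=; rewrite !h11; [lia | exact: addnI].
have hit q : q < p -> mm s2 (base + q) = rg s1 q 183.
  by move=> qp; rewrite -h11 hit2 // /active /= h3 h4.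
apply: wp_seq; apply: wp_loc => s3 R3 M3 t3 _.
have w3 q : rg s3 q 183 = rg s1 q 183 by symb R3; rewrite R2.
have w188 q : rg s3 q 188 = rg s1 q 183 by symb R3; rewrite !R2 /= h3 subn0.
have w186 q : rg s3 q 186 = (rg s1 q 183)./2 by symb R3; rewrite !R2 /= h5 divn2.
have act q : active s3 3 187 q = ~~ odd (rg s1 q 183).
  rewrite /active; do !symb R3; rewrite !R2 /= h3 h4 h5 modn2.
  by case: (odd _).
have ptr q : q < p -> ~~ odd (rg s1 q 183) ->
    exists2 q', q' < p & (rg s1 q 183)./2 = base + q'.
  move=> qp ev; have [y gy wE] := jumped_pointer ev (jk q qp).
  have := goP _ gy; rewrite wE doubleK => h; exists (H y - base); lia.
apply: wp_seq; apply: wp_rd => [|s4 R4 r188 M4 t4 _].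
  by split=> // q qp; rewrite act w186 => /(ptr q qp)[q' qp' ->]; lia.
apply: wp_loc => s5 R5 M5 t5 _; exists k.+1.
have j5 q : q < p -> jumped H tg go k.+1 (base + q) (rg s4 q 188).
  move=> qp; rewrite r188 act w186; case: ifP => ev; last first.
    by rewrite w188; apply: jumped_odd (jk q qp); move: ev => /negbFE.
  have [q' qp' E] := ptr q qp ev.
  by rewrite E M3 hit //; apply: jumped_even (jk q qp) _; rewrite // E; exact: jk.
have e4 r : r \in [:: 4; 7; 8; 184] -> forall q, rg s4 q r = rg s1 q r.
  move=> rin q; rewrite R4; last by apply: contraTneq rin => ->.
  by move: rin; rewrite !inE; do ![case/orP=> [/eqP->|]]; try move/eqP->; symb R3; rewrite R2.
split=> /=.
- by lia.
- by move=> q /=; symb R5; rewrite !e4 // h184' h4 h8; lia.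
- move=> q qp; symb R5; rewrite (e4 7) // h7; have j := j5 q qp.
  by rewrite (minn_idPl _) // ltnW // (jb _ _ _ _ j) //; lia.
- apply: off_scratch_trans os _ => a na /=; rewrite M5 M4 M3 miss2 // => q qp _.
  by rewrite /= h11 -[q]mul1n; exact: na.
- by move: t5 t4 t3 t2 t1; rewrite /= /cost_local /=; lia.
Qed.

Definition shuffle_cost : nat := (40 * L + 100) * L + 20 * L + 250.

Lemma wp_shuffle_chunk g s : env n p L s -> reg s 10 base ->
  (forall q, rg s q 11 = base + q) -> (forall q, rg s q 12 = (D <= base + q)) ->
  (forall q, q < p -> rg s q 101 = g q) ->
  (forall q, q < p -> g q <= if D <= base + q then base + q else 0) ->
  wp p n false shuffle_chunk
    (fun s' => mm s' = shuffle (targets D base g) base p (mm s) /\ tm s' <= tm s + shuffle_cost) s.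
Proof.
move=> ge h10 h11 h12 h101 g_le; set M := mm s; set H := targets D base g.
have bp : base + p <= n by rewrite /base; lia.
have HE q : H (base + q) = if base + q < D then base + q else g q by rewrite /H /targets addKn.
have H_le x : base <= x < base + p -> H x <= x.
  move=> xc; have -> : x = base + (x - base) by lia.
  have xp : x - base < p by lia.
  by have := g_le _ xp; rewrite HE; case: leqP; lia.
pose key q := H (base + q).
have key_lt q : q < p -> key q < n.
  by move=> qp; have := H_le (base + q); rewrite /key; lia.
have nL := bits_le n; rewrite -/L in nL.
case: (ge) => h0 [h1 h2 h3 h4 h5] [h7 h8].
apply: wp_seq; apply: wp_loc => s1 R1 M1 t1 _.
have r105 q : q < p -> rg s1 q 105 = key q.
  move=> qp; symb R1; rewrite h101 // h4 h12 h11 /key HE; have := g_le q qp.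
  by case: (ltnP (base + q) D) => h /=; lia.
have r33 q : q < p -> rg s1 q 33 = word L key q.
  move=> qp; have -> : rg s1 q 33 = rg s q 0 * rg s q 7 + rg s1 q 105 by do !symb R1.
  by rewrite r105 // h0 h7.
have e1 r : r \in [:: 0; 1; 2; 3; 4; 5; 7; 8; 10; 11; 12] -> forall q, rg s1 q r = rg s q r.
  by rewrite !inE => rin q; move: rin; do ![case/orP=> [/eqP->|]]; try move/eqP->; symb R1.
have act1 s' q : reg s' 3 0 -> reg s' 4 1 -> active s' 3 4 q.
  by move=> c3 c4; rewrite /active c3 c4.
have own r s' q : rg s' q r = base + q -> q < p -> rg s' q r < n by move=> -> qp; lia.
apply: wp_seq; apply: wp_rd => [|s2 R2 r106 M2 t2 _].
  by split=> // q qp _; apply: own => //; rewrite e1.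
have {}r106 q : q < p -> rg s2 q 106 = M (base + q).
  by move=> qp; rewrite r106 act1 ?e1 // => [|q'|q']; rewrite ?e1 // h11 M1.
have ge2 : env n p L s2.
  by split; [|split|split] => q; rewrite R2 // e1.
have h30 : reg s2 30 base by move=> q; rewrite R2 //; symb R1; rewrite h10 h3 subn0.
have h31 : reg s2 31 1 by move=> q; rewrite R2 //; symb R1; rewrite h4 h3.
have w2 q : q < p -> rg s2 q 33 = word L key q by move=> qp; rewrite R2 // r33.
have space q : q < p -> base + q < n by lia.
apply: wp_seq; apply: (wp_frame (wp_siblings np nL (bits_gt0 n) key_lt space ge2 h30 h31 w2)).
move=> s3 fr3 _ [_ sib os3 t3].
pose v q := rg s3 q 153; pose nx q := rg s3 q 152.
have e3 r : r \in [:: 0; 1; 2; 3; 4; 5; 7; 8; 10; 11; 12] -> forall q, rg s3 q r = rg s q r.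
  move=> rin q; rewrite fr3; first by rewrite R2 ?e1 //; apply: contraTneq rin => ->.
  by move: rin; rewrite !inE; do ![case/orP=> [/eqP->|//]]; try move/eqP->.
have k105 q : q < p -> rg s3 q 105 = key q by move=> qp; rewrite fr3 // R2 // r105.
have k106 q : q < p -> rg s3 q 106 = M (base + q) by move=> qp; rewrite fr3 // r106.
have nextP q : q < p -> nx q = 0 \/ nx q = 1.
  by move=> qp; rewrite /nx; have [_ [[-> _]|[-> _]]] := sib q qp; [left | right].
have lastP q : q < p -> (nx q == 0) <-> (forall i, base + q < i < base + p -> H i <> key q).
  move=> qp; rewrite /nx; have [_ [[-> no]|[-> [j qj kj]]]] := sib q qp; split=> //.
    move=> _ i iq; have -> : i = base + (i - base) by lia.
    by apply: no; lia.
  by move=> /(_ (base + j)) []; [lia | exact: kj].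
apply: wp_seq; apply: wp_loc => s4 R4 M4 t4 _.
have e4 r : r \in [:: 0; 1; 2; 3; 4; 5; 7; 8; 10; 11; 12; 105; 106; 152; 153] ->
    forall q, rg s4 q r = rg s3 q r.
  by rewrite !inE => rin q; move: rin; do ![case/orP=> [/eqP->|]]; try move/eqP->; symb R4.
have r162 q : q < p -> rg s4 q 162 = (nx q == 0).
  by move=> qp; symb R4; rewrite (e3 4) // h4 -/(nx q); case: (nextP q qp) => ->.
have r165 q : q < p -> rg s4 q 165 = (base <= key q).
  by move=> qp; symb R4; rewrite (e3 4) // (e3 10) // h4 h10 k105 //; lia.
have r166 q : q < p -> rg s4 q 166 = (nx q == 0) && (base <= key q).
  move=> qp; have -> : rg s4 q 166 = rg s4 q 162 * rg s4 q 165 by do !symb R4.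
  by rewrite r162 // r165 // mulnb.
have r161 q : q < p -> rg s4 q 161 = (v q != 0).
  by move=> qp; symb R4; rewrite (e3 4) // h4 -/(v q); case: (v q) => [|m] //=; lia.
apply: wp_seq; apply: wp_wr => [|s5 R5 hit5 miss5 t5 _].
  split=> [q qp _|_ q q' _ _ _ _]; first by apply: own => //; rewrite e4 // e3.
  by rewrite !e4 // !e3 // !h11; exact: addnI.
have z5 q : q < p -> mm s5 (base + q) = 0.
  by move=> qp; rewrite -h11 -e3 // -e4 // hit5 // ?act1 // => [|q'|q']; rewrite e4 // e3.
have act5 q : q < p -> active s5 3 166 q = (nx q == 0) && (base <= key q).
  by move=> qp; rewrite /active !R5 r166 // e4 // e3 // h3; case: andP.
have last_inj q q' : q < p -> q' < p -> nx q == 0 -> nx q' == 0 -> key q = key q' -> q = q'.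
  move=> qp qp' /(lastP _ qp) l /(lastP _ qp') l' kk; case: (ltngtP q q') => // h; exfalso.
    by apply: (l (base + q')); [lia | exact: (esym kk)].
  by apply: (l' (base + q)); [lia | exact: kk].
apply: wp_seq; apply: wp_wr => [|s6 R6 hit6 miss6 t6 _].
  split=> [q qp|_ q q' qp qp']; rewrite ?act5 //.
    by move=> _; rewrite R5 e4 // k105 // key_lt.
  by move=> /andP[l _] /andP[l' _]; rewrite !R5 !e4 // !k105 //; exact: last_inj.
have r6 r q : rg s6 q r = rg s4 q r by rewrite R6 R5.
(* Only the last element of each group writes the mark 1 to its target, so every target is marked by
   a single writer. *)
pose used x := has (fun j => key j == x) (iota 0 p).
have usedP x : used x = false -> forall j, base <= j < base + p -> H j <> x.
  move=> /negbT/hasPn no j jc E; have := no (j - base).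
  by rewrite mem_iota /key subnKC ?E ?eqxx; lia.
have used_last x : used x -> exists q, [/\ q < p, nx q == 0 & key q = x].
  case: (last_in_group H base p x) => [no|[j [jc Hj la]] _].
    by move=> /hasP[q]; rewrite mem_iota => /andP[_ qp] /eqP kq; case: (no (base + q)); first lia.
  have jp : j - base < p by lia.
  have jE : base + (j - base) = j by lia.
  exists (j - base); split=> //; last by rewrite /key jE.
  by apply/(lastP _ jp) => i ic; rewrite /key jE Hj; apply: la; lia.
have u6 q : q < p -> mm s6 (base + q) = used (base + q).
  move=> qp; case uq: (used _).
    have [q' [qp' l kq]] := used_last _ uq.
    have <- : rg s5 q' 105 = base + q by rewrite R5 e4 // k105.
    rewrite hit6 //; first by rewrite R5 e4 // e3 // h4.
    by rewrite act5 // l kq leq_addr.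
  rewrite miss6 ?z5 // => q' qp' _; rewrite R5 e4 // k105 // => /esym E.
  by apply: (usedP _ uq (base + q')) => //; lia.
apply: wp_seq; apply: wp_rd => [|s7 R7 r167 M7 t7 _].
  by split=> // q qp _; apply: own => //; rewrite r6 e4 // e3.
have {}r167 q : q < p -> rg s7 q 167 = used (base + q).
  by move=> qp; rewrite r167 act1 ?r6 ?e4 ?e3 ?h11 ?u6 // => q'; rewrite r6 e4 // e3.
apply: wp_seq; apply: wp_loc => s8 R8 M8 t8 _.
have e7 r : r \in [:: 0; 1; 2; 3; 4; 5; 7; 8; 10; 11; 12; 105; 106; 152; 153] ->
    forall q, rg s7 q r = rg s3 q r.
  by move=> rin q; rewrite R7 ?r6 ?e4 //; apply: contraTneq rin => ->.
have e8 r : r \in [:: 0; 1; 2; 3; 4; 5; 7; 8; 10; 11; 12; 105; 106; 152; 153] ->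
    forall q, rg s8 q r = rg s3 q r.
  move=> rin q; rewrite -(e7 _ rin); move: rin.
  by rewrite !inE; do ![case/orP=> [/eqP->|]]; try move/eqP->; symb R8.
have k169 q : q < p -> rg s8 q 169 = ~~ used (base + q).
  by move=> qp; symb R8; rewrite (e7 4) // e3 // h4 r167 //; case: (used _).
have k162 q : q < p -> rg s8 q 162 = (nx q == 0).
  by move=> qp; symb R8; rewrite R7 // r6 r162.
(* The closed form recurses exactly at elements without previous sibling whose target is an earlier
   element of the chunk. *)
pose go y := [&& base <= y < base + p, v (y - base) == 0, base <= H y & H y < y].
pose tg y := if v (y - base) == 0 then H y else base + v (y - base) - 1.
have goP y : go y -> [&& base <= H y, H y < y & y < base + p].
  by case/and4P=> /andP[_ ->] _ -> ->.
have vP x : base <= x < base + p -> v (x - base) <= x - base.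
  move=> xc; have xp : x - base < p by lia.
  by rewrite /v; have [[[-> _]|[j [-> jx _ _]]] _] := sib _ xp.
have tg_lt x : base <= x < base + p -> tg x < n.
  move=> xc; have := vP _ xc; have := H_le _ xc; rewrite /tg; case: eqP; lia.
have k183 q : q < p -> rg s8 q 183 =
    if go (base + q) then (H (base + q)).*2 else (tg (base + q)).*2.+1.
  move=> qp; have -> : rg s8 q 183 =
     rg s7 q 5 * (rg s7 q 161 * (rg s7 q 10 + rg s7 q 153 - rg s7 q 4) +
        (rg s7 q 4 - rg s7 q 161) * rg s7 q 105) +
     (rg s7 q 4 - (rg s7 q 4 - rg s7 q 161) *
        (rg s7 q 165 * minn (rg s7 q 11 - rg s7 q 105) (rg s7 q 4))) - rg s7 q 3.
    by do !symb R8.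
  rewrite (e7 5) // (e7 10) // (e7 153) // (e7 4) // (e7 105) // (e7 11) // (e7 3) //.
  rewrite (e3 5) // (e3 10) // (e3 4) // (e3 11) // (e3 3) // (R7 _ 161) // (R7 _ 165) // !r6 r161 // r165 // k105 // h3 h4 h5 h10 h11.
  rewrite /go /tg addKn -/(key q) -/(v q).
  have -> : base <= base + q < base + p by lia.
  by case: eqP => vq /=; case: leqP => h /=; case: ltnP => h' /=; lia.
have ge8 : env n p L s8 by split; [|split|split] => q; rewrite e8 // e3.
have h11' q : rg s8 q 11 = base + q by rewrite e8 // e3.
have h184 : reg s8 184 0 by move=> q; symb R8.
apply: wp_seq; apply: (wp_frame (wp_jumps ge8 h11' h184 goP tg_lt k183)).
move=> s9 fr9 _ [ch os9 t9].
have e9 r : r \in [:: 0; 1; 2; 3; 4; 5; 10; 11; 105; 106] -> forall q, rg s9 q r = rg s3 q r.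
  move=> rin q; rewrite fr9 ?e8 //; move: rin; rewrite !inE;
    by do ![case/orP=> [/eqP->|//]]; try move/eqP->.
pose src x := (rg s9 (x - base) 183)./2.
have chs x : base <= x < base + p -> chase H tg go x (src x).
  move=> xc; have -> : x = base + (x - base) by lia.
  by rewrite /src addKn; apply: ch; lia.
have src_lt x : base <= x < base + p -> src x < n.
  move=> xc; have [d [gd _ ->]] := chs x xc; apply: tg_lt.
  by case: d gd => [//|d] /(_ d (ltnSn d)) /goP /=; lia.
have sources_src : sources H base p src.
  move=> x xc; have xE : base + (x - base) = x by lia.
  have xp : x - base < p by lia.
  have [prev _] := sib _ xp; split.
  - move=> j [jx Hj la]; have jE : base + (j - base) = j by lia.
    have [[_ no]|[j' [vE jx' kj' la']]] := prev.
      by case: (no (j - base)); [lia | rewrite /key jE xE].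
    have -> : src x = tg x.
      by apply: chase_stop (chs x xc); rewrite /go /v vE andbF.
    rewrite /tg /v vE /=; case: (ltngtP (base + j') j) => h; try lia.
      case: (la' (j - base)); [lia | by rewrite /key jE xE].
    by case: (la (base + j')); [lia | rewrite -/(key j') kj' /key xE].
  - move=> fs fin; have vE : v (x - base) = 0.
      rewrite /v; case: prev => [[-> _]|[j [-> jx kj _]]] //.
      by case: (fs (base + j)); [lia | rewrite -/(key j) kj /key xE].
    have -> : src x = tg x.
      by apply: chase_stop (chs x xc); rewrite /go vE; lia.
    by rewrite /tg vE.
  - move=> fs Hx; have vE : v (x - base) = 0.
      rewrite /v; case: prev => [[-> _]|[j [-> jx kj _]]] //.
      by case: (fs (base + j)); [lia | rewrite -/(key j) kj /key xE].
    have gx : go x by rewrite /go vE eqxx xc.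
    by apply: (chase_unique (chase_go gx (chs x xc))); apply: chs; lia.
apply: wp_seq; apply: wp_loc => s10 R10 M10 t10 _.
have e10 r : r \in [:: 3; 4; 11; 105; 106] -> forall q, rg s10 q r = rg s3 q r.
  by rewrite !inE => rin q; move: rin; do ![case/orP=> [/eqP->|]]; try move/eqP->; symb R10; rewrite e9.
have k190 q : rg s10 q 190 = src (base + q).
  by symb R10; rewrite (e9 5) // (e3 5) // h5 divn2 /src addKn.
have c3 : reg s10 3 0 by move=> q; rewrite e10 // e3.
have c4 : reg s10 4 1 by move=> q; rewrite e10 // e3.
have c11 q : rg s10 q 11 = base + q by rewrite e10 // e3.
apply: wp_seq; apply: wp_wr => [|s11 R11 hit11 miss11 t11 _].
  by split=> [q qp _|_ q q' _ _ _ _]; rewrite !c11; [lia | exact: addnI].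
(* All scratch lies in the chunk's own cells, whose contents were saved in register 106; writing
   them back restores the initial memory before the sources are read. *)
have M11 : mm s11 = M.
  apply: functional_extensionality => a; case: (boolP (base <= a < base + p)) => ac.
    have aE : a = base + (a - base) by lia.
    have ap : a - base < p by lia.
    by rewrite aE -{1}c11 hit11 ?act1 // (e10 106) // k106.
  have na q : q < p -> a <> base + q by lia.
  rewrite miss11 => [|q qp _]; last by rewrite c11; exact: na.
  rewrite M10 os9 => [|q qp]; last by rewrite /slot mul1n; exact: na.
  rewrite M8 M7 miss6 => [|q qp]; last first.
    rewrite act5 // => /andP[_ bk]; rewrite R5 e4 // k105 // => E.
    by have := H_le (base + q); rewrite -/(key q) -E; lia.
  rewrite miss5 => [|q qp _]; last by rewrite e4 // e3 // h11; exact: na.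
  rewrite M4 os3 => [|q qp]; last by rewrite /slot mul1n; exact: na.
  by rewrite M2 M1.
apply: wp_seq; apply: wp_rd => [|s12 R12 r191 M12 t12 _].
  by split=> // q qp _; rewrite R11 k190; apply: src_lt; lia.
have {}r191 q : q < p -> rg s12 q 191 = M (src (base + q)).
  by move=> qp; rewrite r191 act1 ?R11 ?k190 ?M11 // => q'; rewrite R11.
have act12 q : q < p -> active s12 3 169 q = ~~ used (base + q).
  move=> qp; rewrite /active !R12 // !R11 c3; have -> : rg s10 q 169 = rg s8 q 169.
    by symb R10; rewrite fr9.
  by rewrite k169 //; case: (used _).
have c12 q : rg s12 q 11 = base + q by rewrite R12 // R11.
apply: wp_seq; apply: wp_wr => [|s13 R13 hit13 miss13 t13 _].
  by split=> [q qp _|_ q q' _ _ _ _]; rewrite !c12; [lia | exact: addnI].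
have act13 q : q < p -> active s13 3 162 q = (nx q == 0).
  move=> qp; rewrite /active !R13 !R12 // !R11 c3; have -> : rg s10 q 162 = rg s8 q 162.
    by symb R10; rewrite fr9.
  by rewrite k162 //; case: eqP.
have c105 q : q < p -> rg s13 q 105 = key q by move=> qp; rewrite R13 R12 // R11 e10 // k105.
apply: wp_wr => [|s14 R14 hit14 miss14 t14 _].
  split=> [q qp _|_ q q' qp qp']; first by rewrite c105 // key_lt.
  by rewrite !act13 // !c105 // => l l'; exact: last_inj.
split; last first.
  move: t14 t13 t12 t11 t10 t9 t8 t7 t6 t5 t4 t3 t2 t1.
  by rewrite /shuffle_cost /cost_local /=; lia.
(* A description determines the memory, so the result need not be compared with the swaps one by
   one. *)
suff d14 : described H base M src p (mm s14).
  exact: (described_unique d14 (shuffle_described M H_le sources_src (leqnn p))).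
move=> y; split.
  move=> j jc Hj la; have jE : base + (j - base) = j by lia.
  have jp : j - base < p by lia.
  have kj : key (j - base) = y by rewrite /key jE.
  rewrite -kj -c105 // hit14 //; first by rewrite R13 R12 // R11 e10 // k106 // jE.
  by rewrite act13 //; apply/(lastP _ jp) => i ic; rewrite kj; apply: la; lia.
move=> no; rewrite miss14 => [|q qp _]; last first.
  by rewrite c105 // => E; apply: (no (base + q)); [lia | rewrite -/(key q)].
have nu : used y = false.
  apply/negbTE/hasPn => q; rewrite mem_iota => /andP[_ qp]; apply/eqP => E.
  by apply: (no (base + q)); [lia | ].
case: ifP => yc.
  have yE : y = base + (y - base) by lia.
  have yp : y - base < p by lia.
  have E := r191 _ yp; rewrite -yE in E.
  by rewrite -E {1}yE -c12 hit13 // act12 // -yE nu.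
rewrite miss13 ?M12 ?M11 // => q qp _; rewrite c12; lia.
Qed.
End ShuffleChunk.

(** ** The permutation program *)

Lemma out_weaken P p G (E : config p -> bool) T T' c v : T <= T' -> out P G E T c v -> out P G E T' c v.
Proof.
move=> le o; elim: o T' le => {T c v} [T c fin Gc T' _|T c f Gc _ IH [//|T'] le].
  exact: out_fin.
by apply: out_draw => // d; exact: IH.
Qed.

Section Draws.
Variables (P : program) (p N : nat) (excl : bool) (w : nat).
Let G := good P N excl w (p := p).

(** A draw-free stretch of code is followed by the iterates of [dstep], so the value is passed back
    unchanged. *)
Lemma out_leads E t0 c0 t1 c1 T v :
  (forall traj, (forall t, t0 <= t -> nodraw P (traj t) -> traj t.+1 = dstep P (traj t)) ->
     leads P N excl w traj t0 t0 c0 t1 c1) ->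
  out P G E T c1 v -> out P G E (t1 - t0 + T) c0 v.
Proof.
move=> le o; pose traj t := iter (t - t0) (dstep P (p := p)) c0.
have [||tt t1E gd] := le traj _ (leqnn _).
- by move=> t tt _; rewrite /traj subSn.
- by rewrite /traj subnn.
apply: out_iter => [u ut|]; last by rewrite -[iter _ _ _]/(traj t1) t1E.
by move: (gd (t0 + u)); rewrite /traj addKn => h; apply: h; lia.
Qed.

Lemma out_jump E l i s l' T v : code_at P l [:: i] -> low p w (rg s) (mm s) ->
  quiet i -> (forall q, q < p -> exec_instr i (mm s) 0 (Proc l (rg s q) (tm s)) =
                Proc l' (rg s q) (tm s).+1) ->
  out P G E T (cfg p l' (tick s 1)) v -> out P G E T.+1 (cfg p l s) v.
Proof.
move=> code lo qu ex o; rewrite -[T.+1]add1n -{1}(subSnn (tm s)).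
apply: (out_leads _ o) => traj fol; rewrite /cfg /= addn1.
(* A jump changes no data, so the trivial typing with exponent 0 is enough; it only needs [w >= 1],
   which holds as some word is below [w]. *)
have w0 : 0.+2 ^ 0 <= w by case: lo => _ /(_ 0); lia.
apply: (leads_quiet N excl w0 (isT : subty 0 None None) fol (ins := fun=> i)) => //.
by move=> q _; have := code 0 _ erefl; rewrite addn0.
Qed.

(** All processors draw in the same step. The bounds are private values, and the value before the
    step is the average over the drawn functions, which is where probability enters. *)
Lemma out_draw_step E l r b s T phi : code_at P l [:: Draw r b] ->
  low p w (rg s) (mm s) ->
  (forall g, (forall q, q < p -> g q <= rg s q b) ->
     out P G E T (cfg p l.+1 (St (fun q => upd (rg s q) r (g q)) (mm s) (tm s).+1 (lg s))) (phi g)) ->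
  out P G E T.+1 (cfg p l s) (average p (fun q => rg s q b) phi).
Proof.
move=> code lo o; have cur (q : 'I_p) : current P (cfg p l s) q = Some (Draw r b).
  by rewrite /current /=; have := code 0 _ erefl; rewrite addn0.
have bE (q : 'I_p) : draw_bound P (cfg p l s) q = rg s q b by rewrite /draw_bound cur.
rewrite -(average_draws phi bE); apply: (out_draw (f := fun d => phi (extend d))).
  apply: (good_noaccess N excl _ (ins := fun=> Draw r b)) => // q _.
  by have := code 0 _ erefl; rewrite addn0.
move=> d; have <- : cfg p l.+1 (St (fun q => upd (rg s q) r (extend d q)) (mm s) (tm s).+1 (lg s)) = step d.
  rewrite /step; congr Config; apply: functional_extensionality.
    by move=> q; rewrite cur /= extendE.
  move=> a; rewrite /writes (eq_pmap (f2 := fun=> None)) => [|q]; last by rewrite cur.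
  by elim: (enum _).
apply: o => q qp; rewrite -[q]/(val (Ordinal qp)) extendE.
by rewrite -ltnS -bE ltn_ord.
Qed.
End Draws.

Definition draw_head : cmd := Loc (rcons chunk_head (LOp Mul 156 12 11)).

Definition draw_tail : cmd := Seq shuffle_chunk (Loc chunk_tail).

Definition loop_at : nat := size (compile 0 preamble).

Definition draw_at : nat := loop_at + 2 + size (compile (loop_at + 2) draw_head).

Definition back_at : nat := draw_at + 1 + size (compile (draw_at + 1) draw_tail).

(** The structured language has no draws, so the main loop is assembled by hand around its single
    [Draw], and is followed by direct steps of the machine. *)
Definition permuting : program :=
  compile 0 preamble ++ [:: JumpLt 9 2 (loop_at + 2); JumpEq 0 0 (back_at + 1)] ++
  compile (loop_at + 2) draw_head ++ [:: Draw 101 156] ++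
  compile (draw_at + 1) draw_tail ++ [:: JumpEq 0 0 loop_at].

(* For the typing of private cells, a draw behaves like a copy of its bound. *)
Definition undrawn : cmd :=
  Seq preamble (Seq draw_head (Seq (Loc [:: LOp Defs.Sub 101 156 3]) draw_tail)).

(** Array entries are arbitrary words, so shared cells carry no bound. What is read back from
    scratch regains a type by a minimum with a private bound. *)
Definition perm_types : seq (option nat) := infer 200 None undrawn.

Lemma perm_well_typed : well_typed undrawn 60 perm_types None.
Proof. by vm_compute. Qed.

Lemma draw_type : nth (Some 1) perm_types 101 = nth (Some 1) perm_types 156.
Proof. by vm_compute. Qed.

Section Permuting.
Variables (n p w : nat) (E : config p -> bool) (psi : memory -> rat).
Hypothesis np : 0 < p <= n.
Hypothesis E_psi : forall c : config p, (E c)%:R%R = psi (shared c).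
Hypothesis w_large : exists2 e0, n.+2 ^ e0 <= w & well_typed undrawn e0 perm_types None.
Let G := good permuting n false w (p := p).
Let ty r := nth (Some 1) perm_types r.

Definition loop_cost : nat := shuffle_cost n + 60.

Definition in_words (s : state) : Prop := bounded p n w ty None s.

Lemma out_command c l s s' T v : ev p n false c s s' ->
  code_at permuting l (compile l c) -> (forall e0, well_typed undrawn e0 perm_types None -> wt e0 ty None c) ->
  in_words s -> out permuting G E T (cfg p (l + size (compile l c)) s') v ->
  out permuting G E (tm s' - tm s + T) (cfg p l s) v.
Proof.
move=> e code wtc bs o; case: w_large => e0 wl wt0.
apply: (out_leads _ o) => traj fol.
exact: (sound wl (ty_words_seq wt0) (tym_words_seq wt0) fol e code (wtc e0 wt0) bs).
Qed.

Lemma command_in_words c s s' : ev p n false c s s' ->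
  (forall e0, well_typed undrawn e0 perm_types None -> wt e0 ty None c) -> in_words s -> in_words s'.
Proof. by move=> e wtc bs; case: w_large => e0 wl wt0; exact: (ev_bounded wl e (wtc e0 wt0) bs). Qed.

Lemma in_words_low s : in_words s -> low p w (rg s) (mm s).
Proof.
by move=> bs; case: w_large => e0 wl wt0; exact: (bounded_low wl (ty_words_seq wt0) (tym_words_seq wt0) bs).
Qed.

Lemma permuting_code :
  [/\ code_at permuting 0 (compile 0 preamble),
      code_at permuting loop_at [:: JumpLt 9 2 (loop_at + 2)] /\
      code_at permuting loop_at.+1 [:: JumpEq 0 0 (back_at + 1)],
      code_at permuting (loop_at + 2) (compile (loop_at + 2) draw_head),
      code_at permuting draw_at [:: Draw 101 156]
    & code_at permuting (draw_at + 1) (compile (draw_at + 1) draw_tail) /\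
      code_at permuting back_at [:: JumpEq 0 0 loop_at]].
Proof.
have c0 : code_at permuting 0 permuting by [].
have [h0 c1] := code_at_cat c0; rewrite add0n -/loop_at in c1.
have [h1 c2] := code_at_cat c1; have [h2 c3] := code_at_cat c2.
have [h3 c4] := code_at_cat c3; have [h4 h5] := code_at_cat c4.
have [j1 j2] := @code_at_cat permuting loop_at [:: JumpLt 9 2 (loop_at + 2)] _ h1.
by split=> //; split=> //; rewrite -addn1.
Qed.

Lemma out_stop m s : env n p (bits n) s -> reg s 9 n -> in_words s ->
  out permuting G E (loop_cost * m + 4) (cfg p loop_at s) (psi (mm s)).
Proof.
have [_ [codeT codeF] _ _ _] := permuting_code.
move=> ge h9 bs; have lo := in_words_low bs; case: (ge) => _ [_ h2 _ _ _] _.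
have fin : finished permuting (cfg p (back_at + 1) (tick (tick s 1) 1)).
  apply/forallP => q; rewrite /current.
  by have -> : onth permuting (pc (procs (cfg p (back_at + 1) (tick (tick s 1) 1)) q)) = None by vm_compute.
rewrite addn4 -addn2 !addn2.
apply: (out_jump codeT lo isT (l' := loop_at.+1)) => [q _|]; first by rewrite /= h9 h2 ltnn.
apply: (out_jump codeF (s := tick s 1) lo isT (l' := back_at + 1)) => [q _|]; first by rewrite /= eqxx.
have -> : psi (mm s) = (E (cfg p (back_at + 1) (tick (tick s 1) 1)))%:R%R by rewrite E_psi.
apply: out_fin => //.
have no (q : 'I_p) : shared_access permuting (cfg p (back_at + 1) (tick (tick s 1) 1)) q = None.
  by rewrite /shared_access; move: (forallP fin q); case: current.
by split=> [//|q a|]; [rewrite no | exact: gcfg_words].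
Qed.

(** At the head of the loop the value is the expectation of [psi] over the swaps still to come. A
    chunk averages over its draws at once and, by [expected_chunk], leaves it unchanged. *)
Lemma out_loop m D s : (n - D + p.-1) %/ p <= m -> D <= n -> env n p (bits n) s -> reg s 9 D ->
  in_words s -> out permuting G E (loop_cost * m + 4) (cfg p loop_at s) (expected psi (n - D) D (mm s)).
Proof.
have [code0 [codeT codeF] codeH codeD [codeB codeJ]] := permuting_code.
elim: m D s => [|m IH] D s Dm Dn ge h9 bs; case: (ltnP D n) => Dn'; first last.
- by have DE : D = n by [lia]; subst D; rewrite subnn; exact: out_stop.
- have lo := in_words_low bs; case: (ge) => h0 [h1 h2 h3 h4 h5] [h7 h8].
  set base := minn D (n - p); set M := mm s; set D' := maxn D (base + p).
  have [s2 e2 [R2 M2 t2]] : wp p n false draw_head (fun s2 =>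
      [/\ forall q r, rg s2 q r = den (sym (rcons chunk_head (LOp Mul 156 12 11)) r) (rg s q),
          mm s2 = M & tm s2 = tm s + 10]) (tick s 1).
    by apply: wp_loc => s2 R2 M2 t2 _; split=> //; rewrite t2 /= -addnA.
  have h10 q : rg s2 q 10 = base by symb R2; rewrite /= h9 h2 h1.
  have h11 q : rg s2 q 11 = base + q by symb R2; rewrite /= h9 h2 h1 h0.
  have h12 q : rg s2 q 12 = (D <= base + q).
    by symb R2; rewrite /= h9 h2 h1 h0 h4 /base; case: leqP; lia.
  have h156 q : rg s2 q 156 = if D <= base + q then base + q else 0.
    have -> : rg s2 q 156 = rg s2 q 12 * rg s2 q 11 by do !symb R2.
    by rewrite h11 h12; case: leqP; rewrite ?mul1n ?mul0n.
  have ge2 : env n p (bits n) s2.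
    split; [|split|split] => q; symb R2; [exact: h0|exact: h1|exact: h2|exact: h3|exact: h4|exact: h5|exact: h7|exact: h8].
  have bs1 : in_words (tick s 1) by [].
  have wtH e0 : well_typed undrawn e0 perm_types None -> wt e0 ty None draw_head.
    by case/and3P=> /and3P[_ h _] _ _; exact: h.
  have wtB e0 : well_typed undrawn e0 perm_types None -> wt e0 ty None draw_tail.
    by case/and3P=> /and4P[_ _ _ h] _ _; exact: h.
  have bs2 := command_in_words e2 wtH bs1.
  have bp : base + p <= n by rewrite /base; lia.
  have -> : expected psi (n - D) D M = average p (fun q => rg s2 q 156)
      (fun g => expected psi (n - D') D' (shuffle (targets D base g) base p M)).
    rewrite -(@expected_chunk psi n D base p M) //; last by rewrite /base; lia.
    by congr average; apply: functional_extensionality => q; rewrite h156.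
  pose T := shuffle_cost n + 20 + (loop_cost * m + 4).
  have o2 : out permuting G E T.+1 (cfg p draw_at s2) (average p (fun q => rg s2 q 156)
      (fun g => expected psi (n - D') D' (shuffle (targets D base g) base p M))).
    apply: (out_draw_step codeD (in_words_low bs2)) => g g_le.
    set s3 := St _ _ _ _.
    have r3 r : r != 101 -> forall q, rg s3 q r = rg s2 q r by move=> rn q; rewrite /= upd_other.
    have ge3 : env n p (bits n) s3.
      by case: ge2 => ? [? ? ? ? ?] [? ?]; split; [|split|split] => q; rewrite r3.
    have bs3 : in_words s3.
      case: bs2 => bR bM; split=> // q qp; apply: bounded_upd; first exact: bR.
      rewrite /ty draw_type.
      exact: leq_ltn_trans (g_le q qp) (bR q qp 156).
    have [s5 e5 [M5 ge5 h9' t5]] : wp p n false draw_tail (fun s5 =>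
        [/\ mm s5 = shuffle (targets D base g) base p M, env n p (bits n) s5, reg s5 9 D'
          & tm s5 <= tm s3 + shuffle_cost n + 5]) s3.
      have h10' : reg s3 10 base by move=> q; rewrite r3.
      have h11' q : rg s3 q 11 = base + q by rewrite r3.
      have h12' q : rg s3 q 12 = (D <= base + q) by rewrite r3.
      have h101 q : q < p -> rg s3 q 101 = g q by rewrite /= upd_same.
      have gP q : q < p -> g q <= if D <= base + q then base + q else 0.
        by move=> qp; rewrite -h156; exact: g_le.
      apply: wp_seq; apply: (wp_frame (wp_shuffle_chunk np ge3 h10' h11' h12' h101 gP)).
      move=> s4 fr4 _ [M4 t4]; apply: wp_loc => s5 R5 M5 t5 _.
      have ge4 : env n p (bits n) s4 by apply: (env_same ge3 fr4).
      case: (ge4) => g0 [g1 g2 g3 g4 g5] [g7 g8]; split.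
      - by rewrite M5 M4 /= M2.
      - split; [|split|split] => q; symb R5; [exact: g0|exact: g1|exact: g2|exact: g3|exact: g4|exact: g5|exact: g7|exact: g8].
      - move=> q; symb R5; rewrite fr4 // r3 // h10 g1 g2 /D' /base; lia.
      - by move: t4; rewrite t5 /cost_local /=; lia.
    have bs5 := command_in_words e5 wtB bs3.
    have Dm' : (n - D' + p.-1) %/ p <= m.
      rewrite /D' /base; case: (leqP D (n - p)) => Dp.
        have -> : maxn D (D + p) = D + p by lia.
        have DE : n - D + p.-1 = 1 * p + (n - (D + p) + p.-1) by lia.
        by move: Dm; rewrite DE divnMDl; lia.
      have -> : maxn D (n - p + p) = n by lia.
      by rewrite subnn divn_small //; lia.
    have o6 := IH D' (tick s5 1) Dm' _ ge5 h9' bs5.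
    rewrite -M5; apply: (@out_weaken _ _ _ _ (tm s5 - tm s3 + (loop_cost * m + 4).+1)).
      by rewrite /T; lia.
    rewrite -[draw_at.+1]addn1; apply: (out_command e5 codeB wtB bs3); rewrite -/back_at.
    apply: (out_jump codeJ (in_words_low bs5) isT (l' := loop_at)) => [q _|]; first by rewrite /= eqxx.
    by apply: o6; rewrite /D'; lia.
  apply: (@out_weaken _ _ _ _ (tm s2 - tm (tick s 1) + T.+1).+1).
    by rewrite t2 /= /T /loop_cost; lia.
  apply: (out_jump codeT lo isT (l' := loop_at + 2)) => [q _|]; first by rewrite /= h9 h2 Dn'.
  exact: (out_command e2 codeH wtH bs1 o2).
- by have DE : D = n by [lia]; subst D; rewrite subnn; exact: out_stop.
- have : p %/ p <= (n - D + p.-1) %/ p by apply: leq_div2r; lia.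
  have p0 : 0 < p by case/andP: np.
  by rewrite divnn p0 /= => h; exfalso; move: (leq_trans h Dm).
Qed.

Definition perm_cost (m : nat) : nat := shuffle_cost m + 30.

Lemma out_permuting M : (forall a, M a < w) ->
  out permuting G E (chunked_time perm_cost n p) (init p n M) (expected psi n 0 M).
Proof.
move=> Mw; have [s e [ge h9 M1 _ t1]] := @wp_preamble n p n false np M.
have [code0 _ _ _ _] := permuting_code.
have bs0 : in_words (start_state n p M).
  case: w_large => e0 wl wt0.
  by apply: (start_bounded wt0 np wl Mw).
have wtP e0 : well_typed undrawn e0 perm_types None -> wt e0 ty None preamble.
  by case/and3P=> /andP[h _] _ _; exact: h.
have bs := command_in_words e wtP bs0.
have o := out_loop (m := chunks n p) (D := 0) _ (leq0n n) ge h9 bs.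
apply: (@out_weaken _ _ _ _ (tm s - tm (start_state n p M) + (loop_cost * chunks n p + 4))).
  rewrite /chunked_time /perm_cost -addnA subn0 -/(loop_cost); apply: leq_trans (leq_add t1 (leqnn _)) _.
  by rewrite /loop_cost; lia.
apply: (out_command e code0 wtP bs0).
by move: o; rewrite subn0 M1; apply.
Qed.
End Permuting.

Lemma perm_cost_poly : exists A, forall n, perm_cost n + 30 <= A * bits n ^ 2.
Proof.
exists 600 => n; rewrite /perm_cost /shuffle_cost; have := bits_gt0 n; set L := bits n => L0.
by have -> : L ^ 2 = L * L by []; nia.
Qed.

Lemma perm_words : exists e, forall n w, n.+2 ^ e <= w ->
  exists2 e0, n.+2 ^ e0 <= w & well_typed undrawn e0 perm_types None.
Proof. by exists 60 => n w h; exists 60; [exact: h | exact: perm_well_typed]. Qed.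

Lemma array_memory_bounded n (A : 'I_n -> nat) : exists w, forall a, array_memory A a < w.
Proof.
exists (\max_i A i).+1 => a; rewrite ltnS /array_memory.
by case: insubP => [i _ _|_] //; exact: leq_bigmax.
Qed.

Lemma perm_theorem : exists P : program, permutes_uniformly P /\ sync_strict_pip_whp arrays P.
Proof.
exists permuting.
have [e0 words] := perm_words.
split.
- move=> n p np A; have [w1 Aw] := array_memory_bounded A.
  pose w := maxn w1 (n.+2 ^ e0).
  have wl := words n w (leq_maxr _ _).
  have Mw a : array_memory A a < w by apply: leq_trans (Aw a) (leq_maxl _ _).
  have run B := @out_permuting n p w (fun c => [forall i : 'I_n, shared c i == B i])
    (fun M => ([forall i : 'I_n, M i == B i])%:R%R) np (fun=> erefl) wl _ Mw.
  exists (chunked_time perm_cost n p); split; first exact: out_halts (run A).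
  move=> B; rewrite (out_prob (run B) (leqnn _)) expected_uniform; congr (_ / _)%R.
  rewrite -sum1dep_card GRing.natr_sum [RHS]big_mkcond /=; apply: eq_bigr => s _.
  have -> : [forall i : 'I_n, (array_memory A \o perm_nat s) i == B i] = [forall i, A (s i) == B i].
    by apply: eq_forallb => i; rewrite /= perm_nat_ord /array_memory valK.
  by case: ifP.
have [A AE] := perm_cost_poly.
have runs n p w : 0 < p <= n -> n.+2 ^ e0 <= w ->
    forall (x : arbitrary arrays n) (r : random arrays n), (forall a, input x r a < w) ->
  exists E v, out permuting (good permuting (cells arrays n) false w) E
    (chunked_time perm_cost n p) (start p x r) v.
  move=> np wl x r xw; exists (fun=> true).
  by eexists; apply: (out_permuting (psi := fun=> 1%R) np _ (words n w wl) xw).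
have regs : all (registers_below 200) permuting by vm_compute.
apply: (assemble_pip regs runs _ _ (C := 50 + 2 * A * 3 ^ 2) (e := 2)).
- by move=> n x r; exact: array_memory_bounded.
- by move=> n; rewrite card_unit.
- by rewrite addn_gt0.
- by move=> n p n1 np; exact: (chunked_time_le (e := 2) isT (AE n) n1 np).
Qed.

Theorem corollary20 :
  (exists P : program,
     [/\ deterministic P, erew random_list P, contracts_lists P
       & sync_strict_pip_whp random_list P]) /\
  (exists P : program,
     [/\ deterministic P, erew random_leaves P, contracts_trees P
       & sync_strict_pip_whp random_leaves P]) /\
  (exists P : program,
     permutes_uniformly P /\ sync_strict_pip_whp arrays P).
Proof. by split; [exact: list_theorem | split; [exact: tree_theorem | exact: perm_theorem]]. Qed.
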